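(* Let $q\ge1$ and $p$ be integers with $\gcd(p,q)=1$. Then for every positive integer $k\notin\{1,2,3,5,7,11\}$, $k\Delta'(p,q)$ has a unimodular triangulation with standard boundary (with respect to $\Lambda_{p,q}$).
   Context: Let $p'=(-p)\bmod q$, $\Lambda_{p,q}=q\mathbb{Z}\times q\mathbb{Z}\times\mathbb{Z}+\mathbb{Z}(p',1,0)$, and $\Delta'(p,q)=\operatorname{conv}\{(0,0,0),(q,0,0),(0,0,1),(0,q,1)\}$, an empty lattice tetrahedron with respect to $\Lambda_{p,q}$ (every empty lattice tetrahedron in $\mathbb{Z}^3$ is lattice-equivalent to one of these). Triangulations have vertices in the lattice; a tetrahedron is unimodular if its vertices form an affine basis of the lattice. A triangulation of $k\Delta$ ($\Delta$ an empty lattice tetrahedron) has standard boundary if every edge contained in the boundary of $k\Delta$ is parallel to an edge of $\Delta$. *)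

(* Defs.v *)
From HB Require Import structures.
From mathcomp Require Import all_boot all_order all_algebra.
From mathcomp Require Import reals.
Unset Printing Implicit Defensive.
Import Order.TTheory GRing.Theory Num.Theory.
Local Open Scope ring_scope.

Notation ipt := 'rV[int]_3.

Definition mkpt (a b c : int) : ipt := \row_(i < 3) [:: a; b; c]`_i.

Definition pprime (p q : int) : int := ((- p) %% q)%Z.

Definition in_Lambda (p q : int) (v : ipt) : Prop :=
  exists x y z t : int,
    v = mkpt (q * x + t * pprime p q) (q * y + t) z.

Definition Delta' (p q : int) : 'I_4 -> ipt :=
  fun i => [:: mkpt 0 0 0; mkpt q 0 0; mkpt 0 0 1; mkpt 0 q 1]`_i.

Definition kDelta' (p q : int) (k : nat) : 'I_4 -> ipt :=
  fun i => (k%:Z) *: Delta' p q i.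

Definition tetra := {ffun 'I_4 -> ipt}.

Definition toR (R : realType) (v : ipt) : 'rV[R]_3 := map_mx intr v.

Definition conv (R : realType) (s : seq 'rV[R]_3) (x : 'rV[R]_3) : Prop :=
  exists l : 'I_(size s) -> R,
    (forall i, 0 <= l i) /\ \sum_i l i = 1 /\ x = \sum_i l i *: s`_i.

Definition face (R : realType) (v : 'I_4 -> ipt) (S : {set 'I_4}) :=
  conv R [seq toR R (v i) | i in S].

Definition polytope (R : realType) (v : 'I_4 -> ipt) := face R v setT.

Definition aff_indep (v : 'I_4 -> ipt) : Prop :=
  forall c : 'I_4 -> int, \sum_i c i = 0 -> \sum_i c i *: v i = 0 ->
    forall i, c i = 0.

Definition unimodular (L : ipt -> Prop) (T : tetra) : Prop :=
  (forall i, L (T i)) /\ aff_indep T /\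
  (forall w, L w -> exists c : 'I_4 -> int,
       \sum_i c i = 1 /\ w = \sum_i c i *: T i).

Definition triangulation (R : realType) (L : ipt -> Prop)
    (P : 'I_4 -> ipt) (ts : seq tetra) : Prop :=
  (forall T, T \in ts -> (forall i, L (T i)) /\ aff_indep T) /\
  (forall x, polytope R P x <-> exists2 T, T \in ts & polytope R T x) /\
  (forall T1 T2, T1 \in ts -> T2 \in ts ->
     exists S1 S2 : {set 'I_4},
       (forall x, (polytope R T1 x /\ polytope R T2 x) <-> face R T1 S1 x) /\
       (forall x, (polytope R T1 x /\ polytope R T2 x) <-> face R T2 S2 x)).

Definition interior3 (R : realType) (A : 'rV[R]_3 -> Prop) (x : 'rV[R]_3) :=
  exists2 e : R, 0 < e &
    forall y : 'rV[R]_3, (forall i, `|y 0 i - x 0 i| < e) -> A y.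

Definition boundary3 (R : realType) (A : 'rV[R]_3 -> Prop) (x : 'rV[R]_3) :=
  A x /\ ~ interior3 R A x.

Definition standard_boundary (R : realType) (D P : 'I_4 -> ipt)
    (ts : seq tetra) : Prop :=
  forall T, T \in ts -> forall i j : 'I_4, i != j ->
    (forall x, conv R [:: toR R (T i); toR R (T j)] x ->
               boundary3 R (polytope R P) x) ->
    exists a b : 'I_4, a != b /\
      exists lam : R, toR R (T j) - toR R (T i) = lam *: (toR R (D b) - toR R (D a)).

(* Main.v *)
(* Write D for Delta'(p, q) and fix k >= 4. The section of k D at an integer height z is
   the rectangle [0, (k - z) q] x [0, z q], and the lattice in it is the same planar lattice
   at every height. Any set of pairwise non-crossing primitive planar segments containing
   the boundary of a rectangle extends to a unimodular triangulation of it (take a maximal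
   non-crossing set). So one prescribes in each section some chains of edges, completes them
   to a triangulation, and fills the slab between two consecutive sections with tetrahedra
   joining an edge to an edge of width one across a chain, or a triangle to a vertex; such
   tetrahedra are unimodular. In an ordinary section the chains are the vertical lines
   x = a q and, for each b, the graph through the points (a q, b q) and, over the abscissas
   not divisible by q, through the lattice points with 0 < y < q; between two such sections
   the tetrahedra are selected by staircases, which make the weights of a point in the slab
   unique and show that the slab is covered. The directions turn by 90 degrees between the
   bottom and the top of k D, and the two families meet in the section z = 2, whose
   rectangle contains the point (q, q) in its interior because k >= 4: there the chains
   form a pinwheel around (q, q), which the quarter turn carries to a pinwheel, so that it
   can be joined to both families.

   Triangulations are handled by barycentric weights: simplices meet face to face exactly
   when any two weight vectors representing one point give the same weight to each vertex,
   that is, when they give the same sum to every function on the vertices. *)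

Require Import Defs.
From HB Require Import structures.
From mathcomp Require Import classical_sets.
From mathcomp Require Import all_boot all_order all_algebra.
From mathcomp Require Import reals boolp.
From mathcomp Require Import ring lra zify.
Set Implicit Arguments.
Unset Strict Implicit.
Unset Printing Implicit Defensive.
Import Order.TTheory GRing.Theory Num.Theory.
Local Open Scope ring_scope.

Notation pt2 := (int * int)%type.

Lemma seq_argmin (R : realFieldType) (T : eqType) (s : seq T) (P : T -> Prop)
    (f : T -> R) :
  (exists2 x, x \in s & P x) ->
  exists x, [/\ x \in s, P x & forall y, y \in s -> P y -> f x <= f y].
Proof.
elim: s => [|a s IH] [x]; first by rewrite in_nil.
move=> xs Px.
have [[b bs Pb]|nb] := pselect (exists2 x, x \in s & P x).
  have [c [cs Pc cmin]] := IH (ex_intro2 _ _ b bs Pb).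
  have [[Pa fac]|na] := pselect (P a /\ f a <= f c).
    exists a; split => //; first by rewrite inE eqxx.
    move=> y; rewrite inE => /orP[/eqP->//|ys Py].
    exact: le_trans fac (cmin _ ys Py).
  exists c; split => //; first by rewrite inE cs orbT.
  move=> y; rewrite inE => /orP[/eqP->|ys] Py; last exact: cmin.
  have [//|fca] := leP (f c) (f a).
  by case: na; split=> //; apply: ltW.
move: xs; rewrite inE => /orP[/eqP xa|xs]; last by case: nb; exists x.
exists a; split; first by rewrite inE eqxx.
  by rewrite -xa.
move=> y; rewrite inE => /orP[/eqP->//|ys Py].
by case: nb; exists y.
Qed.

Section Planar.
Variable R : realType.
Implicit Types (a b c d v w p r : pt2) (x y s t : R).

Definition rx (v : pt2) : R := (v.1)%:~R.
Definition ry (v : pt2) : R := (v.2)%:~R.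

Lemma rxy_inj (u v : pt2) : rx u = rx v -> ry u = ry v -> u = v.
Proof.
case: u v => [u1 u2] [v1 v2]; rewrite /rx /ry /= => /eqP.
by rewrite eqr_int => /eqP-> /eqP; rewrite eqr_int => /eqP->.
Qed.

Definition mx s a b := (1 - s) * rx a + s * rx b.
Definition my s a b := (1 - s) * ry a + s * ry b.

Definition compat a b c d := forall s t : R, 0 <= s -> s <= 1 -> 0 <= t -> t <= 1 ->
  mx s a b = mx t c d -> my s a b = my t c d ->
  forall g : pt2 -> R, (1 - s) * g a + s * g b = (1 - t) * g c + t * g d.

Definition ind (u v : pt2) : R := if v == u then 1 else 0.

Record maximal (V : pt2 -> Prop) (E : pt2 -> pt2 -> Prop) : Prop := Maximal {
  max_V : forall a b, E a b -> V a /\ V b;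
  max_refl : forall a, V a -> E a a;
  max_sym : forall a b, E a b -> E b a;
  max_compat : forall a b c d, E a b -> E c d -> compat a b c d;
  max_max : forall a b, V a -> V b ->
    (forall c d, E c d -> compat a b c d) -> E a b;
  max_fin : exists es : seq (pt2 * pt2), forall a b, E a b -> (a, b) \in es }.

Section Maximal.
Variables (V : pt2 -> Prop) (E : pt2 -> pt2 -> Prop).
Hypothesis M : maximal V E.
Let EV := max_V M.
Let Erefl := max_refl M.
Let Esym := max_sym M.
Let Ec := max_compat M.
Let Emax := max_max M.

Definition on x y := exists a b s, [/\ E a b, 0 <= s, s <= 1, x = mx s a b & y = my s a b].

Lemma on_vertex v : V v -> on (rx v) (ry v).
Proof.
move=> Vv; exists v, v, 0; split; rewrite ?ler01 //; first exact: Erefl.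
  by rewrite /mx; ring.
by rewrite /my; ring.
Qed.

Lemma edge_vertex (u : pt2) a b s : V u -> E a b -> 0 <= s -> s <= 1 ->
  rx u = mx s a b -> ry u = my s a b ->
  [\/ u = a /\ s = 0, u = b /\ s = 1 | u = a /\ u = b].
Proof.
move=> Vu Eab s0 s1 ex ey.
have := @Ec _ _ _ _ (Erefl Vu) Eab 0 s (lexx _) ler01 s0 s1.
have -> : mx 0 u u = rx u by rewrite /mx; ring.
have -> : my 0 u u = ry u by rewrite /my; ring.
move=> /(_ ex ey (ind u)); rewrite /ind eqxx.
have [->|na] := eqVneq a u; have [->|nb] := eqVneq b u => H.
- by constructor 3.
- by constructor 1; split=> //; lra.
- by constructor 2; split=> //; lra.
- by exfalso; lra.
Qed.

Lemma edge_relint a b p r s t : E a b -> E p r -> 0 <= s -> s <= 1 ->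
  0 < t -> t < 1 -> p != r -> mx s a b = mx t p r -> my s a b = my t p r ->
  (a = p /\ b = r) \/ (a = r /\ b = p).
Proof.
move=> Eab Epr s0 s1 t0 t1 npr ex ey.
have H := @Ec _ _ _ _ Eab Epr s t s0 s1 (ltW t0) (ltW t1) ex ey.
have := H (ind p); have := H (ind r); rewrite /ind !eqxx eq_sym.
rewrite (negbTE npr) [r == p]eq_sym (negbTE npr).
have [->|nar] := eqVneq a r; have [->|nbr] := eqVneq b r;
 rewrite ?[r == p]eq_sym ?(negbTE npr).
- by move=> *; exfalso; lra.
- by have [->|nbp] := eqVneq b p => *; [right | exfalso; lra].
- by have [->|nbp] := eqVneq a p => *; [left | exfalso; lra].
- by move=> *; exfalso; lra.
Qed.

Definition free x0 y0 x1 y1 := forall t, 0 < t -> t < 1 ->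
  ~ on ((1 - t) * x0 + t * x1) ((1 - t) * y0 + t * y1).

Lemma visible_edge (u v : pt2) : V u -> V v -> free (rx u) (ry u) (rx v) (ry v) -> E u v.
Proof.
move=> Vu Vv fr; apply: Emax => // c d Ecd s t s0 s1 t0 t1 ex ey g.
have [s00|sn0] := eqVneq s 0.
  subst s; have ex' : mx 0 u u = mx t c d by rewrite -ex /mx; ring.
  have ey' : my 0 u u = my t c d by rewrite -ey /my; ring.
  by rewrite -(Ec (Erefl Vu) Ecd _ _ t0 t1 ex' ey' g) //; ring.
have [s11|sn1] := eqVneq s 1.
  subst s; have ex' : mx 0 v v = mx t c d by rewrite -ex /mx; ring.
  have ey' : my 0 v v = my t c d by rewrite -ey /my; ring.
  by rewrite -(Ec (Erefl Vv) Ecd _ _ t0 t1 ex' ey' g) //; ring.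
case: (fr s); first by rewrite lt_neqAle eq_sym sn0.
  by rewrite lt_neqAle sn1.
by exists c, d, t; split.
Qed.

Section Angle.
Variables (p r : pt2) (tau o1 o2 y1 y2 : R).
Hypothesis Epr : E p r.
Hypothesis npr : p != r.
Hypotheses (tau0 : 0 < tau) (tau1 : tau < 1).
Hypotheses (ey1 : y1 = mx tau p r) (ey2 : y2 = my tau p r).
Hypothesis frO : free o1 o2 y1 y2.
Let D := (y1 - o1) * (ry p - o2) - (y2 - o2) * (rx p - o1).
Hypothesis D0 : D != 0.

Let P1 al be := o1 + al * (y1 - o1) + be * (rx p - o1).
Let P2 al be := o2 + al * (y2 - o2) + be * (ry p - o2).

Lemma angle_inj al be al' be' : P1 al be = P1 al' be' -> P2 al be = P2 al' be' ->
  al = al' /\ be = be'.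
Proof.
rewrite /P1 /P2 => e1 e2.
have h1 : D * (al - al') = 0.
  rewrite /D; transitivity ((ry p - o2) * ((al - al') * (y1 - o1) + (be - be') * (rx p - o1))
   - (rx p - o1) * ((al - al') * (y2 - o2) + (be - be') * (ry p - o2))); first by ring.
  have -> : (al - al') * (y1 - o1) + (be - be') * (rx p - o1) = 0 by lra.
  have -> : (al - al') * (y2 - o2) + (be - be') * (ry p - o2) = 0 by lra.
  by ring.
have h2 : D * (be - be') = 0.
  rewrite /D; transitivity ((y1 - o1) * ((al - al') * (y2 - o2) + (be - be') * (ry p - o2))
   - (y2 - o2) * ((al - al') * (y1 - o1) + (be - be') * (rx p - o1))); first by ring.
  have -> : (al - al') * (y1 - o1) + (be - be') * (rx p - o1) = 0 by lra.
  have -> : (al - al') * (y2 - o2) + (be - be') * (ry p - o2) = 0 by lra.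
  by ring.
move/eqP: h1; rewrite mulf_eq0 (negbTE D0) /= subr_eq0 => /eqP->.
by move/eqP: h2; rewrite mulf_eq0 (negbTE D0) /= subr_eq0 => /eqP->.
Qed.

Lemma angle_coord z1 z2 : exists al be, z1 = P1 al be /\ z2 = P2 al be.
Proof.
exists (((z1 - o1) * (ry p - o2) - (z2 - o2) * (rx p - o1)) / D).
exists (((y1 - o1) * (z2 - o2) - (y2 - o2) * (z1 - o1)) / D).
by rewrite /P1 /P2; split; move: D0; rewrite /D => H; field.
Qed.

Lemma angle_line s al be : mx s p r = P1 al be -> my s p r = P2 al be -> al + be = 1.
Proof.
move=> e1 e2.
have N : (y1 - rx p) * (my s p r - ry p) - (y2 - ry p) * (mx s p r - rx p) = 0.
  by rewrite ey1 ey2 /mx /my; ring.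
have : D * (al + be - 1) = 0.
  by rewrite -N e1 e2 /P1 /P2 /D; ring.
move/eqP; rewrite mulf_eq0 (negbTE D0) /= subr_eq0 => /eqP; exact.
Qed.

Lemma angle_relint a b s s' al al' be' : E a b -> 0 <= s -> s <= 1 ->
  0 < al -> al <= 1 -> mx s a b = P1 al (1 - al) -> my s a b = P2 al (1 - al) ->
  mx s' a b = P1 al' be' -> my s' a b = P2 al' be' -> al' + be' = 1.
Proof.
move=> Eab s0 s1 a0 a1 e1 e2 e1' e2'.
have t0 : 0 < al * tau by apply: mulr_gt0.
have t1 : al * tau < 1 by apply: le_lt_trans tau1; rewrite ger_pMl.
have f1 : mx s a b = mx (al * tau) p r by rewrite e1 /P1 ey1 /mx; ring.
have f2 : my s a b = my (al * tau) p r by rewrite e2 /P2 ey2 /my; ring.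
have [[ea eb]|[ea eb]] := edge_relint Eab Epr s0 s1 t0 t1 npr f1 f2; subst a b.
  exact: angle_line e1' e2'.
by apply: (@angle_line (1 - s')); [rewrite -e1' /mx | rewrite -e2' /my]; ring.
Qed.

Section Core.
Variables (v1 v2 : R).
Hypotheses (v10 : 0 <= v1) (v20 : 0 < v2) (v121 : v1 + v2 <= 1).
Hypothesis Hmin : forall (u : pt2) al be, V u -> rx u = P1 al be -> ry u = P2 al be ->
  0 < be -> al + be <= 1 -> al * v2 - be * v1 <= 0.

Lemma angle_core a b s al be al' be' : E a b -> 0 <= s -> s <= 1 ->
  mx s a b = P1 al be -> my s a b = P2 al be -> 0 < be -> al + be < 1 ->
  0 <= al * v2 - be * v1 -> rx a = P1 al' be' -> ry a = P2 al' be' ->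
  0 < al' * v2 - be' * v1 -> False.
Proof.
move=> Eab s0 s1 e1 e2 be0 ab1 k0 ea1 ea2 k1.
pose pt u := (al + u * (al' - al), be + u * (be' - be)).
have emix u : mx (s * (1 - u)) a b = P1 (pt u).1 (pt u).2 /\
              my (s * (1 - u)) a b = P2 (pt u).1 (pt u).2.
  split.
    transitivity ((1 - u) * mx s a b + u * rx a); first by rewrite /mx; ring.
    by rewrite e1 ea1 /P1 /pt /=; ring.
  transitivity ((1 - u) * my s a b + u * ry a); first by rewrite /my; ring.
  by rewrite e2 ea2 /P2 /pt /=; ring.
have su u : 0 <= u -> u <= 1 -> 0 <= s * (1 - u) /\ s * (1 - u) <= 1.
  move=> u0 u1; split; first by apply: mulr_ge0 => //; lra.
  by apply: mulr_ile1 => //; lra.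
have kpos u : 0 < u -> u <= 1 -> 0 < (pt u).1 * v2 - (pt u).2 * v1.
  move=> u0 u1; rewrite /pt /=.
  have -> : (al + u * (al' - al)) * v2 - (be + u * (be' - be)) * v1 =
   (1 - u) * (al * v2 - be * v1) + u * (al' * v2 - be' * v1) by ring.
  by apply: ltr_wpDl; [apply: mulr_ge0 => //; lra | apply: mulr_gt0].
have alpos u : 0 < u -> u <= 1 -> 0 <= (pt u).2 -> 0 < (pt u).1.
  move=> u0 u1 b0; have := kpos u u0 u1.
  have : 0 <= (pt u).2 * v1 by apply: mulr_ge0.
  move=> h1 h2; have : 0 < (pt u).1 * v2 by lra.
  by rewrite pmulr_lgt0.
have bad1 u : 0 < u -> u <= 1 -> (pt u).2 = 0 -> (pt u).1 < 1 -> False.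
  move=> u0 u1 b0 a1; have a0 := alpos u u0 u1 (eq_ind_r (fun x => 0 <= x) (lexx _) b0).
  have [h0 h1] := su u (ltW u0) u1; have [f1 f2] := emix u.
  apply: (frO a0 a1); exists a, b, (s * (1 - u)); split=> //.
    by rewrite f1 b0 /P1; ring.
  by rewrite f2 b0 /P2; ring.
have bad2 u : 0 < u -> u <= 1 -> 0 <= (pt u).2 -> (pt u).1 + (pt u).2 = 1 -> False.
  move=> u0 u1 b0 a1; have a0 := alpos u u0 u1 b0.
  have [h0 h1] := su u (ltW u0) u1; have [f1 f2] := emix u.
  have a2 : (pt u).1 <= 1 by lra.
  have eb : (pt u).2 = 1 - (pt u).1 by lra.
  rewrite eb in f1 f2.
  have := angle_relint Eab h0 h1 a0 a2 f1 f2 e1 e2; lra.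
have [b0'|b0'] := leP be' 0.
  pose t1 := be / (be - be').
  have dpos : 0 < be - be' by lra.
  have t10 : 0 < t1 by apply: divr_gt0.
  have t11 : t1 <= 1 by rewrite ler_pdivrMr //; lra.
  have eb : (pt t1).2 = 0 by rewrite /pt /t1 /=; field; lra.
  have [h|h] := ltP ((pt t1).1) 1; first exact: bad1 t10 t11 eb h.
  (* the segment leaves through the line f before or at the line oy *)
  have den : 0 < (pt t1).1 + (pt t1).2 - (al + be) by lra.
  pose t2 := t1 * ((1 - (al + be)) / ((pt t1).1 + (pt t1).2 - (al + be))).
  have q0 : 0 < (1 - (al + be)) / ((pt t1).1 + (pt t1).2 - (al + be)).
    by apply: divr_gt0 => //; lra.
  have q1 : (1 - (al + be)) / ((pt t1).1 + (pt t1).2 - (al + be)) <= 1.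
    by rewrite ler_pdivrMr //; lra.
  have t20 : 0 < t2 by apply: mulr_gt0.
  have t21 : t2 <= t1 by rewrite /t2 ger_pMr.
  apply: (bad2 t2) => //; first by lra.
    rewrite /pt /=.
    have -> : be + t2 * (be' - be) = (t1 - t2) * (be - be') + (pt t1).2 by rewrite /pt /=; ring.
    by rewrite eb addr0; apply: mulr_ge0; lra.
  have -> : (pt t2).1 + (pt t2).2 = al + be + ((1 - (al + be)) / ((pt t1).1 + (pt t1).2 - (al + be))) * ((pt t1).1 + (pt t1).2 - (al + be)).
    by rewrite /t2 /pt /=; ring.
  by rewrite divfK ?lt0r_neq0 //; ring.
have [h|h] := leP (al' + be') 1.
  have [Va _] := EV Eab.
  have := Hmin Va ea1 ea2 b0' h; lra.
pose t2 := (1 - (al + be)) / (al' + be' - (al + be)).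
have den : 0 < al' + be' - (al + be) by lra.
have t20 : 0 < t2 by apply: divr_gt0 => //; lra.
have t21 : t2 <= 1 by rewrite ler_pdivrMr //; lra.
apply: (bad2 t2) => //.
  rewrite /pt /=.
  have -> : be + t2 * (be' - be) = (1 - t2) * be + t2 * be' by ring.
  by apply: addr_ge0; apply: mulr_ge0; lra.
by rewrite /pt /t2 /=; field; lra.
Qed.

End Core.
End Angle.
End Maximal.
End Planar.

Section Angle2.
Variable R : realType.
Implicit Types (p r : pt2) (x y s t tau : R).
Variables (V : pt2 -> Prop) (E : pt2 -> pt2 -> Prop).
Hypothesis M : maximal R V E.
Local Notation on := (@on R E).
Local Notation free := (@free R E).
Local Notation rx := (@rx R).
Local Notation ry := (@ry R).

Lemma max_Vfin : exists vs : seq pt2, forall v, V v -> v \in vs.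
Proof.
have [es H] := max_fin M; exists (map fst es) => v Vv.
by apply/mapP; exists (v, v) => //; apply: H; apply: (max_refl M).
Qed.

(* Among the vertices in the triangle o, y, p the one seen from o under the
   smallest angle with oy is visible from o: an edge blocking it would have to
   end inside the empty sector or cross oy or the edge carrying y. *)
Lemma angle_visible p r tau o1 o2 y1 y2 :
  E p r -> p != r -> 0 < tau -> tau < 1 ->
  y1 = mx tau p r -> y2 = my tau p r -> free o1 o2 y1 y2 ->
  (y1 - o1) * (ry p - o2) - (y2 - o2) * (rx p - o1) != 0 ->
  exists (v : pt2) (v1 v2 : R), [/\ [/\ V v, 0 <= v1, 0 < v2 & v1 + v2 <= 1],
    rx v = o1 + v1 * (y1 - o1) + v2 * (rx p - o1),
    ry v = o2 + v1 * (y2 - o2) + v2 * (ry p - o2),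
    (forall (u : pt2) al be, V u -> rx u = o1 + al * (y1 - o1) + be * (rx p - o1) ->
       ry u = o2 + al * (y2 - o2) + be * (ry p - o2) -> 0 < be -> al + be <= 1 ->
       [/\ 0 <= al * v2 - be * v1 -> v2 <= be & al * v2 - be * v1 <= 0]) &
    [/\ forall al be, 0 < be -> al + be < 1 -> 0 < al * v2 - be * v1 ->
        ~ on (o1 + al * (y1 - o1) + be * (rx p - o1))
             (o2 + al * (y2 - o2) + be * (ry p - o2))
      & (free o1 o2 (rx v) (ry v)) \/
        (exists b s, [/\ E v b, 0 <= s, s <= 1, o1 = mx s v b & o2 = my s v b])]].
Proof.
move=> Epr npr tau0 tau1 ey1 ey2 fr D0.
have [vs Hvs] := max_Vfin.
have coord := @angle_coord R p o1 o2 y1 y2 D0.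
have inj := @angle_inj R p o1 o2 y1 y2 D0.
pose P1 al be := o1 + al * (y1 - o1) + be * (rx p - o1).
pose P2 al be := o2 + al * (y2 - o2) + be * (ry p - o2).
pose C (u : pt2) := V u /\ exists al be, [/\ rx u = P1 al be, ry u = P2 al be,
    0 < be, 0 <= al & al + be <= 1].
pose al (u : pt2) := (((rx u - o1) * (ry p - o2) - (ry u - o2) * (rx p - o1)) /
    ((y1 - o1) * (ry p - o2) - (y2 - o2) * (rx p - o1))) : R.
pose be (u : pt2) := (((y1 - o1) * (ry u - o2) - (y2 - o2) * (rx u - o1)) /
    ((y1 - o1) * (ry p - o2) - (y2 - o2) * (rx p - o1))) : R.
have alE (u : pt2) a b : rx u = P1 a b -> ry u = P2 a b -> al u = a.
  by move=> e1 e2; rewrite /al e1 e2 /P1 /P2; field.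
have beE (u : pt2) a b : rx u = P1 a b -> ry u = P2 a b -> be u = b.
  by move=> e1 e2; rewrite /be e1 e2 /P1 /P2; field.
have Vp : V p by have [] := max_V M Epr.
have Cp : C p.
  by split=> //; exists 0, 1; split; rewrite ?lexx ?ltr01 ?add0r ?lexx // /P1 /P2; ring.
have [v0 [_ Cv0 min0]] := seq_argmin (fun u => - (al u / be u)) (ex_intro2 _ _ p (Hvs _ Vp) Cp).
pose C' u := C u /\ al u / be u = al v0 / be v0.
have [v [_ [Cv ev] minv]] := seq_argmin (P := C') be
   (ex_intro2 _ _ v0 (Hvs _ (proj1 Cv0)) (conj Cv0 erefl)).
have [Vv [v1 [v2 [ev1 ev2 v20 v10 v12]]]] := Cv.
have aev := alE _ _ _ ev1 ev2; have bev := beE _ _ _ ev1 ev2.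
have Hmin (u : pt2) a b : V u -> rx u = P1 a b -> ry u = P2 a b -> 0 < b -> a + b <= 1 ->
    [/\ 0 <= a * v2 - b * v1 -> v2 <= b & a * v2 - b * v1 <= 0].
  move=> Vu e1 e2 b0 ab1.
  have ea := alE _ _ _ e1 e2; have eb := beE _ _ _ e1 e2.
  have [a0|a0] := ltP a 0.
    have h1 : a * v2 < 0 by rewrite pmulr_llt0.
    have h2 : 0 <= b * v1 by apply: mulr_ge0 => //; apply: ltW.
    by split; move: h1 h2; clear; lra.
  have Cu : C u by split => //; exists a, b; split.
  have := min0 _ (Hvs _ Vu) Cu; rewrite -ev lerN2 ea eb aev bev ler_pdivrMr //.
  have -> : v1 / v2 * b = b * v1 / v2 by ring.
  rewrite ler_pdivlMr // => h; split; last by move: h; clear; lra.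
  move=> h'; have ee : a * v2 = b * v1 by move: h h'; clear; lra.
  have := minv _ (Hvs _ Vu); rewrite /C' -ev ea eb aev bev; apply; split => //.
  apply/eqP; rewrite eqr_div ?lt0r_neq0 //; apply/eqP; rewrite ee; ring.
have Hmin' (u : pt2) a b : V u -> rx u = P1 a b -> ry u = P2 a b -> 0 < b -> a + b <= 1 ->
    a * v2 - b * v1 <= 0 by move=> Vu e1 e2 b0 ab; have [] := Hmin u a b Vu e1 e2 b0 ab.
have core := @angle_core R V E M p r tau o1 o2 y1 y2 Epr npr tau0 tau1 ey1 ey2 fr D0
  v1 v2 v10 v20 Hmin'.
exists v, v1, v2; split => //; split.
  move=> a b b0 ab1 k0 [c [d [s [Ecd s0 s1 e1 e2]]]].
  have [a1 [b1 [ec1 ec2]]] := coord (rx c) (ry c).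
  have [a2 [b2 [ed1 ed2]]] := coord (rx d) (ry d).
  have [k1|k1] := ltP 0 (a1 * v2 - b1 * v1).
    by apply: (core _ _ _ _ _ _ _ Ecd s0 s1 (esym e1) (esym e2) b0 ab1 (ltW k0) ec1 ec2 k1).
  have [k2|k2] := ltP 0 (a2 * v2 - b2 * v1).
    apply: (core d c (1 - s) a b a2 b2 (max_sym M Ecd)) => //; [by rewrite subr_ge0|by rewrite gerBl| | | exact: ltW].
      by rewrite e1 /mx; ring.
    by rewrite e2 /my; ring.
  have [e3 e4] : a = (1 - s) * a1 + s * a2 /\ b = (1 - s) * b1 + s * b2.
    by apply: inj; rewrite ?e1 ?e2 /mx /my ?ec1 ?ec2 ?ed1 ?ed2; ring.
  have : a * v2 - b * v1 = (1 - s) * (a1 * v2 - b1 * v1) + s * (a2 * v2 - b2 * v1).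
    by rewrite e3 e4; ring.
  have : (1 - s) * (a1 * v2 - b1 * v1) <= 0 by apply: mulr_ge0_le0; rewrite ?subr_ge0.
  have : s * (a2 * v2 - b2 * v1) <= 0 by apply: mulr_ge0_le0.
  by move: k0; clear; lra.
have [nf|f] := pselect (exists b s, [/\ E v b, 0 <= s, s <= 1, o1 = mx s v b & o2 = my s v b]);
  first by right.
left=> t t0 t1 [c [d [s [Ecd s0 s1 e1 e2]]]].
have [a1 [b1 [ec1 ec2]]] := coord (rx c) (ry c).
have [a2 [b2 [ed1 ed2]]] := coord (rx d) (ry d).
have g1 : mx s c d = P1 (t * v1) (t * v2) by rewrite -e1 ev1 /P1; ring.
have g2 : my s c d = P2 (t * v1) (t * v2) by rewrite -e2 ev2 /P2; ring.
have b0 : 0 < t * v2 by apply: mulr_gt0.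
have ab1 : t * v1 + t * v2 < 1.
  by rewrite -mulrDr; apply: le_lt_trans t1; rewrite ger_pMr.
have k0 : 0 <= t * v1 * v2 - t * v2 * v1 by rewrite subr_ge0 mulrAC.
have [k1|k1] := ltP 0 (a1 * v2 - b1 * v1).
  by apply: (core _ _ _ _ _ _ _ Ecd s0 s1 g1 g2 b0 ab1 k0 ec1 ec2 k1).
have [k2|k2] := ltP 0 (a2 * v2 - b2 * v1).
  apply: (core d c (1 - s) (t * v1) (t * v2) a2 b2 (max_sym M Ecd) _ _ _ _ b0 ab1 k0) => //; [by rewrite subr_ge0|by rewrite gerBl| | ].
    by transitivity (mx s c d); [rewrite /mx; ring | exact: g1].
  by transitivity (my s c d); [rewrite /my; ring | exact: g2].
have [e3 e4] : t * v1 = (1 - s) * a1 + s * a2 /\ t * v2 = (1 - s) * b1 + s * b2.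
  apply: inj.
    by transitivity (mx s c d); [rewrite g1 | rewrite /mx ec1 ed1 /P1; ring].
  by transitivity (my s c d); [rewrite g2 | rewrite /my ec2 ed2 /P2; ring].
have kk : (1 - s) * (a1 * v2 - b1 * v1) + s * (a2 * v2 - b2 * v1) = 0.
  transitivity (((1 - s) * a1 + s * a2) * v2 - ((1 - s) * b1 + s * b2) * v1); first by ring.
  by rewrite -e3 -e4; ring.
have vtx (u : pt2) a b : V u -> rx u = P1 a b -> ry u = P2 a b -> a * v2 - b * v1 = 0 ->
   0 < b -> a + b <= 1 -> v2 <= b.
  by move=> Vu f1 f2 f3 f4 f5; have [] := Hmin _ _ _ Vu f1 f2 f4 f5; rewrite f3 lexx => /(_ isT).
have [Vc Vd] := max_V M Ecd.
have lin a b : a * v2 - b * v1 = 0 -> a = (b / v2) * v1.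
  by move=> h; apply: (mulIf (lt0r_neq0 v20)); rewrite mulrAC divfK ?lt0r_neq0 //; lra.
have far a b : a * v2 - b * v1 = 0 -> b < v2 -> a + b <= 1 /\ (0 < b \/ b <= 0).
  move=> /lin ea bv; split; last by case: (ltP 0 b); [left|right].
  have -> : a + b = b / v2 * (v1 + v2) by rewrite ea mulrDr divfK ?lt0r_neq0.
  have h : b / v2 < 1 by rewrite ltr_pdivrMr // mul1r.
  have [h'|h'] := leP 0 (b / v2); first by apply: mulr_ile1 => //; [move: v10 v20; clear; lra|exact: ltW].
  have : b / v2 * (v1 + v2) <= 0 by apply: mulr_le0_ge0; [exact: ltW|move: v10 v20; clear; lra].
  by clear; lra.
have tv : t * v2 < v2 by rewrite gtr_pMl.
(* o and v lie on the edge d' c' on both sides of the hit *)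
have fin c' d' s' a1' b1' a2' b2' : E c' d' -> 0 <= s' -> s' <= 1 ->
   rx c' = P1 a1' b1' -> ry c' = P2 a1' b1' -> rx d' = P1 a2' b2' -> ry d' = P2 a2' b2' ->
   t * v2 = (1 - s') * b1' + s' * b2' ->
   a1' * v2 - b1' * v1 = 0 -> a2' * v2 - b2' * v1 = 0 -> b1' <= 0 -> v2 <= b2' -> False.
  move=> Ecd' s0' s1' h1 h2 h3 h4 h5 l1 l2 hb1 hb2.
  have dd : 0 < b2' - b1' by move: hb1 hb2 v20; clear; lra.
  pose s2 := (v2 - b1') / (b2' - b1').
  have s20 : 0 <= s2 by apply: divr_ge0; move: hb1 hb2 v20; clear; lra.
  have s21 : s2 <= 1 by rewrite ler_pdivrMr //; move: hb1 hb2 v20; clear; lra.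
  have eb : v2 = (1 - s2) * b1' + s2 * b2' by rewrite /s2; move: (lt0r_neq0 dd); clear => h; field.
  have ea : v1 = (1 - s2) * a1' + s2 * a2'.
    rewrite (lin _ _ l1) (lin _ _ l2); transitivity (((1 - s2) * b1' + s2 * b2') / v2 * v1).
      by rewrite -eb divff ?lt0r_neq0 // mul1r.
    by ring.
  have f1 : rx v = mx s2 c' d' by rewrite ev1 /mx h1 h3 ea {1}eb /P1; ring.
  have f2 : ry v = my s2 c' d' by rewrite ev2 /my h2 h4 ea {1}eb /P2; ring.
  pose s3 := - b1' / (b2' - b1').
  have s30 : 0 <= s3 by apply: divr_ge0; move: hb1 hb2 v20; clear; lra.
  have s31 : s3 <= 1 by rewrite ler_pdivrMr //; move: hb1 hb2 v20; clear; lra.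
  have eb3 : 0 = (1 - s3) * b1' + s3 * b2' by rewrite /s3; move: (lt0r_neq0 dd); clear => h; field.
  have ea3 : 0 = (1 - s3) * a1' + s3 * a2'.
    rewrite (lin _ _ l1) (lin _ _ l2); transitivity (((1 - s3) * b1' + s3 * b2') / v2 * v1).
      by rewrite -eb3; ring.
    by ring.
  have g3 : o1 = mx s3 c' d'.
    rewrite /mx h1 h3 /P1; transitivity (o1 + 0 * (y1 - o1) + 0 * (rx p - o1)); first by ring.
    by rewrite {1}ea3 eb3; ring.
  have g4 : o2 = my s3 c' d'.
    rewrite /my h2 h4 /P2; transitivity (o2 + 0 * (y2 - o2) + 0 * (ry p - o2)); first by ring.
    by rewrite {1}ea3 eb3; ring.
  have [[ec s2e]|[ed s2e]|[ec ed]] := edge_vertex M Vv Ecd' s20 s21 f1 f2.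
  - by move: eb hb1 v20; rewrite s2e; clear; lra.
  - subst d'; apply: f; exists c', (1 - s3); split; [exact: (max_sym M)|by rewrite subr_ge0|by rewrite gerBl| | ].
      by rewrite g3 /mx; ring.
    by rewrite g4 /my; ring.
  - rewrite -ec in h1 h2; rewrite -ed in h3 h4.
    by have [_ ebb] := inj _ _ _ _ (etrans (esym h1) h3) (etrans (esym h2) h4); move: ebb hb1 hb2 v20; clear; lra.
have k10 : a1 * v2 - b1 * v1 = 0.
  have [//|n0] := eqVneq (a1 * v2 - b1 * v1) 0.
  have l1 : a1 * v2 - b1 * v1 < 0 by rewrite lt_neqAle n0.
  have s1' : s = 1.
    apply/eqP; rewrite eq_le s1 /= leNgt; apply/negP => s1'.
    have : (1 - s) * (a1 * v2 - b1 * v1) < 0 by rewrite pmulr_rlt0 // subr_gt0.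
    have : s * (a2 * v2 - b2 * v1) <= 0 by apply: mulr_ge0_le0.
    by move: kk; clear; lra.
  move: kk e4; rewrite s1' => kk e4.
  have l2 : a2 * v2 - b2 * v1 = 0 by move: kk; clear; lra.
  have e4' : b2 = t * v2 by move: e4; clear; lra.
  have bl : b2 < v2 by rewrite e4'.
  have bp : 0 < b2 by rewrite e4'.
  have [l3 _] := far _ _ l2 bl.
  by have := vtx _ _ _ Vd ed1 ed2 l2 bp l3; move: bl; clear; lra.
have k20 : a2 * v2 - b2 * v1 = 0.
  have [s00|sn] := eqVneq s 0.
    move: e4; rewrite s00 => e4.
    have e4' : b1 = t * v2 by move: e4; clear; lra.
    have bl : b1 < v2 by rewrite e4'.
    have bp : 0 < b1 by rewrite e4'.
    have [l3 _] := far _ _ k10 bl.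
    by have := vtx _ _ _ Vc ec1 ec2 k10 bp l3; move: bl; clear; lra.
  by move: kk; rewrite k10 mulr0 add0r => /eqP; rewrite mulf_eq0 (negbTE sn) /= => /eqP.
have near c' a1' b1' : V c' -> rx c' = P1 a1' b1' -> ry c' = P2 a1' b1' ->
   a1' * v2 - b1' * v1 = 0 -> b1' < v2 -> b1' <= 0.
  move=> Vc' h1 h2 h3 h4; rewrite leNgt; apply/negP => h5.
  by have [l3 _] := far _ _ h3 h4; have := vtx _ _ _ Vc' h1 h2 h3 h5 l3; move: h4; clear; lra.
have [lb1|lb1] := ltP b1 v2; have [lb2|lb2] := ltP b2 v2.
- have := near _ _ _ Vc ec1 ec2 k10 lb1; have := near _ _ _ Vd ed1 ed2 k20 lb2 => h1 h2.
  have : (1 - s) * b1 <= 0 by apply: mulr_ge0_le0; rewrite ?subr_ge0.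
  have : s * b2 <= 0 by apply: mulr_ge0_le0.
  by move: e4 b0; clear; lra.
- have h1 := near _ _ _ Vc ec1 ec2 k10 lb1.
  exact: (fin c d s _ _ _ _ Ecd s0 s1 ec1 ec2 ed1 ed2 e4 k10 k20 h1 lb2).
- have h1 := near _ _ _ Vd ed1 ed2 k20 lb2.
  apply: (fin d c (1 - s) _ _ _ _ (max_sym M Ecd) _ _ ed1 ed2 ec1 ec2 _ k20 k10 h1 lb1); rewrite ?subr_ge0 ?gerBl //; move: e4; clear; lra.
have : 0 <= (1 - s) * (b1 - v2) by apply: mulr_ge0; rewrite subr_ge0.
have : 0 <= s * (b2 - v2) by apply: mulr_ge0; rewrite ?subr_ge0.
by move: e4 tv; clear; lra.
Qed.

End Angle2.

Section Hit.
Variable R : realType.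
Implicit Types (p r : pt2) (x y s t tau : R).
Local Notation rx := (@rx R).
Local Notation ry := (@ry R).

Definition at_ (o z t : R) := o + t * (z - o).

Lemma segment_first_hit (o1 o2 z1 z2 : R) p r :
  (o1 != z1) || (o2 != z2) ->
  let H t := exists s, [/\ 0 <= s, s <= 1, at_ o1 z1 t = mx s p r & at_ o2 z2 t = my s p r] in
  [\/ forall t, 0 < t -> t <= 1 -> ~ H t,
      exists t, [/\ 0 < t, t <= 1, H t & forall t', 0 < t' -> t' < t -> ~ H t'] |
      H 0 /\ exists t, [/\ 0 < t, t <= 1 & H t] ].
Proof.
move=> noz H.
have [[t1 [t10 t11 Ht1]]|nH] := pselect (exists t, [/\ 0 < t, t <= 1 & H t]); last first.
  by constructor 1 => t t0 tle Ht; apply: nH; exists t.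
have [H0|nH0] := pselect (H 0); first by constructor 3; split => //; exists t1.
constructor 2.
have [s1 [s10 s11 e1 e2]] := Ht1.
pose dd := (z1 - o1) ^+ 2 + (z2 - o2) ^+ 2.
have dd0 : dd != 0.
  rewrite /dd paddr_eq0 ?sqr_ge0 // !sqrf_eq0 !subr_eq0 negb_and.
  by rewrite [z1 == _]eq_sym [z2 == _]eq_sym.
pose D := (z1 - o1) * (ry r - ry p) - (z2 - o2) * (rx r - rx p).
have [D0|D0] := eqVneq D 0; last first.
  exists t1; split=> // t' t'0 t't [s [s0 sl f1 f2]].
  have : (t1 - t') * D = 0.
    rewrite /D; transitivity ((at_ o1 z1 t1 - at_ o1 z1 t') * (ry r - ry p)
       - (at_ o2 z2 t1 - at_ o2 z2 t') * (rx r - rx p)).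
      by rewrite /at_; ring.
    by rewrite e1 e2 f1 f2 /mx /my; ring.
  move/eqP; rewrite mulf_eq0 (negbTE D0) orbF subr_eq0 => /eqP tt.
  by move: t't; rewrite tt ltxx.
pose ka := ((rx r - rx p) * (z1 - o1) + (ry r - ry p) * (z2 - o2)) / dd.
have k1 : rx r - rx p = ka * (z1 - o1).
  apply: (mulIf dd0); rewrite mulrAC /ka divfK //.
  transitivity (((rx r - rx p) * (z1 - o1) + (ry r - ry p) * (z2 - o2)) * (z1 - o1) - D * (z2 - o2)).
    by rewrite /D /dd; ring.
  by rewrite D0 mul0r subr0.
have k2 : ry r - ry p = ka * (z2 - o2).
  apply: (mulIf dd0); rewrite mulrAC /ka divfK //.
  transitivity (((rx r - rx p) * (z1 - o1) + (ry r - ry p) * (z2 - o2)) * (z2 - o2) + D * (z1 - o1)).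
    by rewrite /D /dd; ring.
  by rewrite D0 mul0r addr0.
have Hs s : 0 <= s -> s <= 1 -> H (t1 + ka * (s - s1)).
  move=> s0 sl; exists s; split => //.
    transitivity (at_ o1 z1 t1 + (s - s1) * (ka * (z1 - o1))); first by rewrite /at_; ring.
    by rewrite e1 -k1 /mx; ring.
  transitivity (at_ o2 z2 t1 + (s - s1) * (ka * (z2 - o2))); first by rewrite /at_; ring.
  by rewrite e2 -k2 /my; ring.
have Hs' t : H t -> exists s, [/\ 0 <= s, s <= 1 & t = t1 + ka * (s - s1)].
  move=> [s [s0 sl f1 f2]]; exists s; split => //.
  have h1 : (t - t1 - ka * (s - s1)) * (z1 - o1) = 0.
    transitivity (at_ o1 z1 t - at_ o1 z1 t1 - (s - s1) * (ka * (z1 - o1))); first by rewrite /at_; ring.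
    by rewrite f1 e1 -k1 /mx; ring.
  have h2 : (t - t1 - ka * (s - s1)) * (z2 - o2) = 0.
    transitivity (at_ o2 z2 t - at_ o2 z2 t1 - (s - s1) * (ka * (z2 - o2))); first by rewrite /at_; ring.
    by rewrite f2 e2 -k2 /my; ring.
  have : (t - t1 - ka * (s - s1)) * dd = 0.
    transitivity ((t - t1 - ka * (s - s1)) * (z1 - o1) * (z1 - o1) +
      (t - t1 - ka * (s - s1)) * (z2 - o2) * (z2 - o2)); first by rewrite /dd; ring.
    by rewrite h1 h2 !mul0r addr0.
  move/eqP; rewrite mulf_eq0 (negbTE dd0) orbF subr_eq0 => /eqP; clear; lra.
have pos s : 0 <= s -> s <= 1 -> 0 < t1 + ka * (s - s1).
  move=> s0 sl; rewrite ltNge; apply/negP => h.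
  have kn : ka * (s1 - s) >= t1 by move: h; clear; lra.
  have kp : 0 < ka * (s1 - s) by apply: lt_le_trans kn.
  apply: nH0.
  have := Hs (s1 - (s1 - s) * (t1 / (ka * (s1 - s)))).
  have q0 : 0 <= t1 / (ka * (s1 - s)) by apply: divr_ge0; apply: ltW.
  have q1 : t1 / (ka * (s1 - s)) <= 1 by rewrite ler_pdivrMr // mul1r.
  set q := t1 / _ in q0 q1 *.
  have -> : t1 + ka * (s1 - (s1 - s) * q - s1) = t1 - q * (ka * (s1 - s)) by ring.
  rewrite {3}/q divfK ?lt0r_neq0 // subrr.
  have -> : s1 - (s1 - s) * q = (1 - q) * s1 + q * s by ring.
  apply.
    by apply: addr_ge0; apply: mulr_ge0; rewrite ?subr_ge0.
  have : (1 - q) * s1 <= (1 - q) * 1 by apply: ler_wpM2l; rewrite ?subr_ge0.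
  have : q * s <= q * 1 by apply: ler_wpM2l.
  by clear; lra.
have [k0|k0] := leP 0 ka.
  exists (t1 + ka * (0 - s1)); split.
  - by apply: pos; rewrite ?ler01.
  - have : 0 <= ka * s1 by apply: mulr_ge0.
    by move: t11; clear; lra.
  - by apply: Hs; rewrite ?ler01.
  move=> t' t'0 lt' /Hs' [s [s0 sl et]].
  have : 0 <= ka * s by apply: mulr_ge0.
  by move: lt'; rewrite et; clear; lra.
exists (t1 + ka * (1 - s1)); split.
- by apply: pos; rewrite ?ler01.
- have : ka * (1 - s1) <= 0 by apply: mulr_le0_ge0; [apply: ltW|rewrite subr_ge0].
  by move: t11; clear; lra.
- by apply: Hs; rewrite ?ler01.
move=> t' t'0 lt' /Hs' [s [s0 sl et]].
have : ka * (1 - s) <= 0 by apply: mulr_le0_ge0; [apply: ltW|rewrite subr_ge0].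
by move: lt'; rewrite et; clear; lra.
Qed.

Variables (V : pt2 -> Prop) (E : pt2 -> pt2 -> Prop).
Hypothesis M : maximal R V E.
Local Notation on := (@on R E).
Local Notation free := (@free R E).

Lemma first_hit (o1 o2 z1 z2 : R) : (o1 != z1) || (o2 != z2) -> on z1 z2 ->
  (exists t, [/\ 0 < t, t <= 1, on (at_ o1 z1 t) (at_ o2 z2 t) &
       free o1 o2 (at_ o1 z1 t) (at_ o2 z2 t)]) \/
  (exists a b s t s', [/\ E a b, [/\ 0 <= s, s <= 1, o1 = mx s a b & o2 = my s a b] &
     [/\ 0 < t, 0 <= s', s' <= 1, at_ o1 z1 t = mx s' a b & at_ o2 z2 t = my s' a b]]).
Proof.
move=> noz onz; have [es Hes] := max_fin M.
pose H (l : seq (pt2 * pt2)) t := exists a b s, [/\ (a, b) \in l, E a b,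
   0 <= s /\ s <= 1, at_ o1 z1 t = mx s a b & at_ o2 z2 t = my s a b].
pose third := (exists a b s t s', [/\ E a b, [/\ 0 <= s, s <= 1, o1 = mx s a b & o2 = my s a b] &
     [/\ 0 < t, 0 <= s', s' <= 1, at_ o1 z1 t = mx s' a b & at_ o2 z2 t = my s' a b]]).
suff main l : [\/ forall t, 0 < t -> t <= 1 -> ~ H l t,
    exists t, [/\ 0 < t, t <= 1, H l t & forall t', 0 < t' -> t' < t -> ~ H l t'] | third].
  have [n|[t [t0 t1 [a [b [s [_ Eab [s0 s1] e1 e2]]]] fr]]|] := main es; last by right.
    have [a [b [s [Eab s0 s1 e1 e2]]]] := onz.
    case: (n 1 ltr01 (lexx _)); exists a, b, s; split=> //; first exact: Hes.
      by rewrite -e1 /at_; ring.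
    by rewrite -e2 /at_; ring.
  left; exists t; split => //; first by exists a, b, s.
  move=> u u0 u1 [a' [b' [s' [Eab' s0' s1' e1' e2']]]].
  have := fr (u * t); apply; first exact: mulr_gt0.
    by rewrite gtr_pMl.
  exists a', b', s'; split=> //; first exact: Hes.
    by rewrite -e1' /at_; ring.
  by rewrite -e2' /at_; ring.
elim: l => [|[a b] l IH]; first by constructor 1 => t _ _ [a [b [s []]]]; rewrite in_nil.
case: IH => [n|[t [t0 t1 Ht fr]]|]; last by constructor 3.
all: have [Eab|nE] := pselect (E a b).
- have [n'|[t [t0 t1 [s [s0 s1 e1 e2]] fr]]|[[s [s0 s1 e1 e2]] [t [t0 t1 [s' [s0' s1' e1' e2']]]]]] :=
    @segment_first_hit o1 o2 z1 z2 a b noz.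
  + constructor 1 => t t0 t1 [c [d [s [cd Ecd [s0 s1] e1 e2]]]].
    move: cd; rewrite inE => /orP[/eqP[ec ed]|cd]; last by apply: (n t) => //; exists c, d, s.
    by apply: (n' t) => //; exists s; rewrite -ec -ed.
  + constructor 2; exists t; split => //.
      by exists a, b, s; rewrite inE eqxx; split.
    move=> t' t'0 t't [c [d [s' [cd Ecd [s'0 s'1] f1 f2]]]].
    move: cd; rewrite inE => /orP[/eqP[ec ed]|cd].
      by apply: (fr t') => //; exists s'; rewrite -ec -ed.
    apply: (n t') => //; last by exists c, d, s'.
    by apply: ltW; apply: lt_le_trans t't t1.
  + constructor 3; exists a, b, s, t, s'; split=> //; split=> //; move: e1 e2; rewrite /at_.
      by move=> <- _; ring.
    by move=> _ <-; ring.
- constructor 1 => t t0 t1 [c [d [s [cd Ecd [s0 s1] e1 e2]]]].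
  move: cd; rewrite inE => /orP[/eqP[ec ed]|cd]; last by apply: (n t) => //; exists c, d, s.
  by apply: nE; rewrite -ec -ed.
- have [n'|[u [u0 u1 [s [s0 s1 e1 e2]] fr']]|[[s [s0 s1 e1 e2]] [u [u0 u1 [s' [s0' s1' e1' e2']]]]]] :=
    @segment_first_hit o1 o2 z1 z2 a b noz.
  + constructor 2; exists t; split => //.
      by have [c [d [s [cd ? ? ? ?]]]] := Ht; exists c, d, s; rewrite inE cd orbT; split.
    move=> t' t'0 t't [c [d [s' [cd Ecd [s'0 s'1] f1 f2]]]].
    move: cd; rewrite inE => /orP[/eqP[ec ed]|cd].
      apply: (n' t') => //; last by exists s'; rewrite -ec -ed.
      by apply: ltW; apply: lt_le_trans t't t1.
    by apply: (fr t') => //; exists c, d, s'.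
  + constructor 2; have [tu|ut] := leP t u.
      exists t; split => //.
        by have [c [d [s'' [cd ? ? ? ?]]]] := Ht; exists c, d, s''; rewrite inE cd orbT; split.
      move=> t' t'0 t't [c [d [s' [cd Ecd [s'0 s'1] f1 f2]]]].
      move: cd; rewrite inE => /orP[/eqP[ec ed]|cd].
        apply: (fr' t') => //; last by exists s'; rewrite -ec -ed.
        exact: lt_le_trans t't tu.
      by apply: (fr t') => //; exists c, d, s'.
    exists u; split => //; first by exists a, b, s; rewrite inE eqxx; split.
    move=> t' t'0 t't [c [d [s' [cd Ecd [s'0 s'1] f1 f2]]]].
    move: cd; rewrite inE => /orP[/eqP[ec ed]|cd].
      by apply: (fr' t') => //; exists s'; rewrite -ec -ed.
    apply: (fr t') => //; last by exists c, d, s'.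
    exact: lt_trans t't ut.
  + constructor 3; exists a, b, s, u, s'; split=> //; split=> //; move: e1 e2; rewrite /at_.
      by move=> <- _; ring.
    by move=> _ <-; ring.
constructor 2; exists t; split => //.
  by have [c [d [s [cd ? ? ? ?]]]] := Ht; exists c, d, s; rewrite inE cd orbT; split.
move=> t' t'0 t't [c [d [s' [cd Ecd [s'0 s'1] f1 f2]]]].
move: cd; rewrite inE => /orP[/eqP[ec ed]|cd]; first by apply: nE; rewrite -ec -ed.
by apply: (fr t') => //; exists c, d, s'.
Qed.

Lemma free_sym x0 y0 x1 y1 : free x0 y0 x1 y1 -> free x1 y1 x0 y0.
Proof.
move=> H t t0 t1.
have -> : (1 - t) * x1 + t * x0 = (1 - (1 - t)) * x0 + (1 - t) * x1 by ring.
have -> : (1 - t) * y1 + t * y0 = (1 - (1 - t)) * y0 + (1 - t) * y1 by ring.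
by apply: H; rewrite ?subr_gt0 // gtrBl.
Qed.

Lemma seen_noncollinear p r tau (o1 o2 : R) :
  E p r -> 0 < tau -> tau < 1 ->
  free o1 o2 (mx tau p r) (my tau p r) ->
  (mx tau p r - o1) * (ry p - o2) - (my tau p r - o2) * (rx p - o1) = 0 ->
  (o1 != mx tau p r) || (o2 != my tau p r) -> p != r ->
  exists s, [/\ 0 <= s, s <= 1, o1 = mx s p r & o2 = my s p r].
Proof.
move=> Epr t0 t1 fr D0 noy npr.
have [Vp Vr] := max_V M Epr.
pose c1 := rx r - rx p; pose c2 := ry r - ry p.
pose dd := c1 ^+ 2 + c2 ^+ 2.
have dd0 : dd != 0.
  rewrite /dd paddr_eq0 ?sqr_ge0 // !sqrf_eq0 !subr_eq0; apply/negP => /andP[/eqP h1 /eqP h2].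
  by case/eqP: npr; apply: (@rxy_inj R).
have cr : (o1 - rx p) * c2 - (o2 - ry p) * c1 = 0.
  apply: (mulfI (lt0r_neq0 t0)); rewrite mulr0 -[RHS]D0 /mx /my /c1 /c2; ring.
pose s := ((o1 - rx p) * c1 + (o2 - ry p) * c2) / dd.
have e1 : o1 = mx s p r.
  have : o1 - rx p = s * c1.
    apply: (mulIf dd0); rewrite mulrAC /s divfK //.
    transitivity (((o1 - rx p) * c1 + (o2 - ry p) * c2) * c1 + ((o1 - rx p) * c2 - (o2 - ry p) * c1) * c2).
      by rewrite /dd; ring.
    by rewrite cr; ring.
  by rewrite /mx /c1 => h; transitivity (rx p + (o1 - rx p)); [ring | rewrite h; ring].
have e2 : o2 = my s p r.
  have : o2 - ry p = s * c2.
    apply: (mulIf dd0); rewrite mulrAC /s divfK //.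
    transitivity (((o1 - rx p) * c1 + (o2 - ry p) * c2) * c2 - ((o1 - rx p) * c2 - (o2 - ry p) * c1) * c1).
      by rewrite /dd; ring.
    by rewrite cr; ring.
  by rewrite /my /c2 => h; transitivity (ry p + (o2 - ry p)); [ring | rewrite h; ring].
have [s0|s0] := ltP s 0.
  have st : 0 < tau - s by rewrite subr_gt0; apply: lt_trans t0.
  case: (fr (- s / (tau - s))).
  - by apply: divr_gt0 => //; rewrite oppr_gt0.
  - by rewrite ltr_pdivrMr // mul1r; move: t0; clear; lra.
  have := on_vertex M Vp.
  have -> : (1 - (- s / (tau - s))) * o1 + - s / (tau - s) * mx tau p r = rx p.
    by rewrite e1 /mx; move: (lt0r_neq0 st); clear => h; field.
  have -> // : (1 - (- s / (tau - s))) * o2 + - s / (tau - s) * my tau p r = ry p.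
  by rewrite e2 /my; move: (lt0r_neq0 st); clear => h; field.
have [s1|s1] := ltP 1 s; last by exists s.
have st : 0 < s - tau by rewrite subr_gt0; apply: lt_trans s1.
case: (fr ((s - 1) / (s - tau))).
- by apply: divr_gt0 => //; rewrite subr_gt0.
- by rewrite ltr_pdivrMr // mul1r; move: t1; clear; lra.
have := on_vertex M Vr.
have -> : (1 - ((s - 1) / (s - tau))) * o1 + (s - 1) / (s - tau) * mx tau p r = rx r.
  by rewrite e1 /mx; move: (lt0r_neq0 st); clear => h; field.
have -> // : (1 - ((s - 1) / (s - tau))) * o2 + (s - 1) / (s - tau) * my tau p r = ry r.
by rewrite e2 /my; move: (lt0r_neq0 st); clear => h; field.
Qed.

Lemma see_vertex (x y : R) v0 : V v0 -> ~ on x y -> exists v, V v /\ free x y (rx v) (ry v).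
Proof.
move=> V0 nxy.
have nxv : (x != rx v0) || (y != ry v0).
  rewrite -negb_and; apply/negP => /andP[/eqP ex /eqP ey].
  by apply: nxy; rewrite ex ey; apply: (on_vertex M).
have [[t [t0 t1 [p [r [tau [Epr tau0 tau1 e1 e2]]]] fr]]|] := first_hit nxv (on_vertex M V0);
  last by move=> [a [b [s [_ [_ [Eab [s0 s1 e1 e2] _]]]]]]; case: nxy; exists a, b, s.
have [Vp Vr] := max_V M Epr.
rewrite e1 e2 in fr.
have [tt|tn0] := eqVneq tau 0.
  exists p; split => //; move: fr; rewrite tt /mx /my.
  by rewrite !(subr0, mul1r, mul0r, addr0).
have [tt|tn1] := eqVneq tau 1.
  exists r; split => //; move: fr; rewrite tt /mx /my.
  by rewrite !(subrr, mul1r, mul0r, add0r).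
have [pr|npr] := eqVneq p r.
  exists p; split => //; move: fr; rewrite -pr /mx /my.
  by rewrite -!mulrDl !subrK !mul1r.
have tau0' : 0 < tau by rewrite lt_neqAle eq_sym tn0.
have tau1' : tau < 1 by rewrite lt_neqAle tn1.
have nxm : (x != mx tau p r) || (y != my tau p r).
  rewrite -negb_and; apply/negP => /andP[/eqP ex /eqP ey].
  by apply: nxy; exists p, r, tau.
have D0 : (mx tau p r - x) * (ry p - y) - (my tau p r - y) * (rx p - x) != 0.
  apply/eqP => D0.
  have [s [s0 s1 f1 f2]] := seen_noncollinear Epr tau0' tau1' fr D0 nxm npr.
  by apply: nxy; exists p, r, s.
have [v [v1 [v2 [[Vv _ _ _] _ _ _ [_ [f|[b [s [Evb s0 s1 f1 f2]]]]]]]]] :=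
  angle_visible M Epr npr tau0' tau1' erefl erefl fr D0.
  by exists v.
by case: nxy; exists v, b, s.
Qed.

Lemma exit1 (x m d : R) : 0 < x -> x < m -> d != 0 -> exists T, [/\ 0 < T,
   (x + T * d == 0) || (x + T * d == m) &
   forall t, 0 <= t -> t <= T -> 0 <= x + t * d /\ x + t * d <= m].
Proof.
move=> x0 xm d0; have [dp|dn] := ltP 0 d.
  exists ((m - x) / d); split.
  - by apply: divr_gt0 => //; rewrite subr_gt0.
  - by rewrite divfK // addrC subrK eqxx orbT.
  move=> t t0; rewrite ler_pdivlMr // => tT; split; last by move: tT; clear; lra.
  by apply: addr_ge0; [apply: ltW | apply: mulr_ge0 => //; apply: ltW].
have dn' : d < 0 by rewrite lt_neqAle d0.
exists (x / - d); split.
- by apply: divr_gt0 => //; rewrite oppr_gt0.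
- by rewrite invrN mulrN mulNr divfK // subrr eqxx.
move=> t t0; rewrite ler_pdivlMr ?oppr_gt0 // mulrN => tT; split; first by move: tT; clear; lra.
have : t * d <= 0 by apply: mulr_ge0_le0.
by move: xm; clear; lra.
Qed.

Lemma exit2 (x y m n d e : R) : 0 < x -> x < m -> 0 < y -> y < n -> (d != 0) || (e != 0) ->
  exists T, [/\ 0 < T, 0 <= x + T * d, x + T * d <= m,
    0 <= y + T * e /\ y + T * e <= n &
   [|| x + T * d == 0, x + T * d == m, y + T * e == 0 | y + T * e == n]].
Proof.
move=> x0 xm y0 yn.
have [-> /= e0|d0 _] := eqVneq d 0.
  have [T [T0 h1 h2]] := exit1 y0 yn e0; exists T.
  have [h3 h4] := h2 T (ltW T0) (lexx _).
  by rewrite mulr0 addr0 h1 !orbT (ltW x0) (ltW xm); split.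
have [->|e0] := eqVneq e 0.
  have [T [T0 h1 h2]] := exit1 x0 xm d0; exists T.
  have [h3 h4] := h2 T (ltW T0) (lexx _).
  by rewrite mulr0 addr0 orbA h1 (ltW y0) (ltW yn); split.
have [T [T0 h1 h2]] := exit1 x0 xm d0; have [T' [T0' h1' h2']] := exit1 y0 yn e0.
have [TT|TT] := leP T T'.
  have [h3 h4] := h2 T (ltW T0) (lexx _); have [h5 h6] := h2' T (ltW T0) TT.
  by exists T; rewrite orbA h1.
have [h3 h4] := h2 T' (ltW T0') (ltW TT); have [h5 h6] := h2' T' (ltW T0') (lexx _).
by exists T'; rewrite h1' !orbT.
Qed.

End Hit.

Section Cover.
Variable R : realType.
Local Notation rx := (@rx R).
Local Notation ry := (@ry R).

Definition in_tri (a b c : pt2) (x y : R) := exists l1 l2 l3 : R,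
  [/\ [/\ 0 <= l1, 0 <= l2 & 0 <= l3], l1 + l2 + l3 = 1,
      x = l1 * rx a + l2 * rx b + l3 * rx c & y = l1 * ry a + l2 * ry b + l3 * ry c].

Definition det2 (a b c : pt2) : R :=
  (rx b - rx a) * (ry c - ry a) - (ry b - ry a) * (rx c - rx a).

Variables (V : pt2 -> Prop) (E : pt2 -> pt2 -> Prop).

Definition empty_tri a b c :=
  forall u, V u -> in_tri a b c (rx u) (ry u) -> [\/ u = a, u = b | u = c].

Hypothesis M : maximal R V E.
Local Notation on := (@on R E).
Local Notation free := (@free R E).

Lemma edge_on (a b : pt2) t : E a b -> 0 <= t -> t <= 1 -> on (mx t a b) (my t a b).
Proof. by move=> Eab t0 t1; exists a, b, t. Qed.

(* One side of the construction: v and w are the vertices next to the ray gy on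
   either side of it, in coordinates based at g with axes gy and gp. *)
Lemma wedge_side (g p : pt2) (y1 y2 v1 v2 W1 W2 : R) (v w u : pt2) (a b : R) :
  (forall u al be, V u -> rx u = rx g + al * (y1 - rx g) + be * (rx p - rx g) ->
       ry u = ry g + al * (y2 - ry g) + be * (ry p - ry g) -> 0 < be -> al + be <= 1 ->
       [/\ 0 <= al * v2 - be * v1 -> v2 <= be & al * v2 - be * v1 <= 0]) ->
  rx v = rx g + v1 * (y1 - rx g) + v2 * (rx p - rx g) ->
  ry v = ry g + v1 * (y2 - ry g) + v2 * (ry p - ry g) ->
  rx w = rx g + W1 * (y1 - rx g) + W2 * (rx p - rx g) ->
  ry w = ry g + W1 * (y2 - ry g) + W2 * (ry p - ry g) ->
  0 <= v1 -> 0 < v2 -> v1 + v2 <= 1 -> 0 < W1 -> W2 < 0 -> W1 + W2 <= 1 ->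
  V u -> 0 <= a -> 0 <= b -> a + b <= 1 ->
  rx u = rx g + a * (rx v - rx g) + b * (rx w - rx g) ->
  ry u = ry g + a * (ry v - ry g) + b * (ry w - ry g) ->
  0 < a * v2 + b * W2 -> u = v.
Proof.
move=> Hmin ev1 ev2 ew1 ew2 v10 v20 v12 W10 W20 W12 Vu a0 b0 ab eu1 eu2 pos.
have h1 : rx u = rx g + (a * v1 + b * W1) * (y1 - rx g) + (a * v2 + b * W2) * (rx p - rx g).
  by rewrite eu1 ev1 ew1; ring.
have h2 : ry u = ry g + (a * v1 + b * W1) * (y2 - ry g) + (a * v2 + b * W2) * (ry p - ry g).
  by rewrite eu2 ev2 ew2; ring.
have h3 : a * v1 + b * W1 + (a * v2 + b * W2) <= 1.
  have : a * (v1 + v2) <= a * 1 by apply: ler_wpM2l.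
  have : b * (W1 + W2) <= b * 1 by apply: ler_wpM2l.
  by move: ab; clear; lra.
have [h4 h5] := Hmin _ _ _ Vu h1 h2 pos h3.
have kpos : 0 < W1 * v2 - W2 * v1.
  have : 0 < W1 * v2 by apply: mulr_gt0.
  have : W2 * v1 <= 0 by apply: mulr_le0_ge0 => //; apply: ltW.
  by clear; lra.
have kE : (a * v1 + b * W1) * v2 - (a * v2 + b * W2) * v1 = b * (W1 * v2 - W2 * v1) by ring.
have b00 : b = 0.
  apply/eqP; rewrite eq_le b0 andbT leNgt; apply/negP => bp.
  have : 0 < b * (W1 * v2 - W2 * v1) by apply: mulr_gt0.
  by rewrite -kE; move: h5; clear; lra.
subst b; move: h4; rewrite kE mul0r lexx mul0r addr0 => /(_ isT).
move=> h4; have a1 : a = 1.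
  apply/eqP; rewrite eq_le; apply/andP; split; first by rewrite addr0 in ab.
  by move: h4; rewrite -[X in X <= _]mul1r ler_pM2r.
by apply: (@rxy_inj R); rewrite ?eu1 ?eu2 a1; ring.
Qed.

Lemma cover_off (m n : R) (x y : R) v0 :
  V v0 -> (forall v, V v -> [/\ 0 <= rx v, rx v <= m, 0 <= ry v & ry v <= n]) ->
  (forall x y, 0 <= x -> x <= m -> 0 <= y -> y <= n ->
     [|| x == 0, x == m, y == 0 | y == n] -> on x y) ->
  0 <= x -> x <= m -> 0 <= y -> y <= n -> ~ on x y ->
  exists a b c, [/\ [/\ V a, V b & V c], [/\ E a b, E b c & E a c], empty_tri a b c, det2 a b c != 0 &
     in_tri a b c x y].
Proof.
move=> Vv0 Vbox bd x0 xm y0 yn nxy.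
have [x0' xm' y0' yn'] : [/\ 0 < x, x < m, 0 < y & y < n].
  have nb : ~~ [|| x == 0, x == m, y == 0 | y == n] by apply/negP => /(bd _ _ x0 xm y0 yn).
  move: nb; rewrite !negb_or => /and4P[h1 h2 h3 h4].
  by split; rewrite lt_neqAle ?h1 ?h2 ?h3 ?h4 ?x0 ?xm ?y0 ?yn // eq_sym ?h1 ?h3.
have [g [Vg frg]] := see_vertex M Vv0 nxy.
have ong := on_vertex M Vg.
have d0 : (x - rx g != 0) || (y - ry g != 0).
  rewrite -negb_and !subr_eq0; apply/negP => /andP[/eqP ex /eqP ey].
  by apply: nxy; rewrite ex ey.
have [T [T0 z10 z1m [z20 z2n] zb]] := exit2 x0' xm' y0' yn' d0.
have onz := bd _ _ z10 z1m z20 z2n zb.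
set z1 := x + T * (x - rx g) in z10 z1m zb onz; set z2 := y + T * (y - ry g) in z20 z2n zb onz.
have nxz : (x != z1) || (y != z2).
  rewrite /z1 /z2 eq_sym [y == _]eq_sym -![_ + T * _ == _]subr_eq0 ![_ + _ - _]addrAC !subrr !add0r.
  by rewrite !mulf_eq0 (negbTE (lt0r_neq0 T0)).
have [[t [t0 t1 [p [r [tau [Epr tau0 tau1 ey1 ey2]]]] frx]]|] := first_hit M nxz onz;
  last by move=> [a [b [s [_ [_ [Eab [s0 s1 e1 e2] _]]]]]]; case: nxy; exists a, b, s.
have [Vp Vr] := max_V M Epr.
set Y1 := at_ x z1 t in ey1 frx; set Y2 := at_ y z2 t in ey2 frx.
pose ka := t * T.
have ka0 : 0 < ka by apply: mulr_gt0.
have eY1 : Y1 = rx g + (1 + ka) * (x - rx g) by rewrite /Y1 /at_ /z1 /ka; ring.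
have eY2 : Y2 = ry g + (1 + ka) * (y - ry g) by rewrite /Y2 /at_ /z2 /ka; ring.
have k10 : 0 < 1 + ka by apply: addr_gt0.
pose xi := (1 + ka)^-1.
have xi0 : 0 < xi by rewrite invr_gt0.
have xi1 : xi < 1 by rewrite invf_lt1 // ltrDl.
have ex1 : x = rx g + xi * (Y1 - rx g).
  by rewrite eY1 /xi; move: (lt0r_neq0 k10); clear => h; field.
have ex2 : y = ry g + xi * (Y2 - ry g).
  by rewrite eY2 /xi; move: (lt0r_neq0 k10); clear => h; field.
have frY : free (rx g) (ry g) Y1 Y2.
  move=> s s0 s1.
  have [sx|sx|sx] := ltgtP s xi.
  - have := free_sym frg (t := s / xi); rewrite ltr_pdivrMr // mul1r divr_gt0 // => /(_ isT sx).
    have -> : (1 - s / xi) * rx g + s / xi * x = (1 - s) * rx g + s * Y1.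
      by rewrite ex1; move: (lt0r_neq0 xi0); clear => h; field.
    have -> // : (1 - s / xi) * ry g + s / xi * y = (1 - s) * ry g + s * Y2.
    by rewrite ex2; move: (lt0r_neq0 xi0); clear => h; field.
  - have xi2 : 0 < 1 - xi by rewrite subr_gt0.
    have := frx ((s - xi) / (1 - xi)).
    rewrite ltr_pdivrMr // mul1r ltrD2r s1 divr_gt0 ?subr_gt0 // => /(_ isT isT).
    have -> : (1 - (s - xi) / (1 - xi)) * x + (s - xi) / (1 - xi) * Y1 = (1 - s) * rx g + s * Y1.
      by rewrite ex1; move: (lt0r_neq0 xi2); clear => h; field.
    have -> // : (1 - (s - xi) / (1 - xi)) * y + (s - xi) / (1 - xi) * Y2 = (1 - s) * ry g + s * Y2.
    by rewrite ex2; move: (lt0r_neq0 xi2); clear => h; field.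
  - rewrite sx; have -> : (1 - xi) * rx g + xi * Y1 = x by rewrite ex1; ring.
    by have -> : (1 - xi) * ry g + xi * Y2 = y by [rewrite ex2; ring].
have xon (u : pt2) : E g u -> rx u = Y1 -> ry u = Y2 -> False.
  move=> Egu e1 e2; apply: nxy; exists g, u, xi; split=> //; [exact: ltW|exact: ltW| | ].
    by rewrite {1}ex1 /mx e1; ring.
  by rewrite {1}ex2 /my e2; ring.
have vY (u : pt2) : V u -> rx u = Y1 -> ry u = Y2 -> False.
  move=> Vu e1 e2; apply: (xon u) => //; apply: (visible_edge M) => //.
  by rewrite e1 e2.
have tn0 : tau != 0.
  apply/eqP => tt; apply: (vY p) => //; rewrite ?ey1 ?ey2 tt /mx /my;
  by rewrite !(subr0, mul1r, mul0r, addr0).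
have tn1 : tau != 1.
  apply/eqP => tt; apply: (vY r) => //; rewrite ?ey1 ?ey2 tt /mx /my;
  by rewrite !(subrr, mul1r, mul0r, add0r).
have npr : p != r.
  apply/eqP => pr; apply: (vY p) => //; rewrite ?ey1 ?ey2 -pr /mx /my;
  by rewrite -!mulrDl !subrK !mul1r.
have tau0' : 0 < tau by rewrite lt_neqAle eq_sym tn0.
have tau1' : tau < 1 by rewrite lt_neqAle tn1.
have ngY : (rx g != Y1) || (ry g != Y2).
  rewrite -negb_and; apply/negP => /andP[/eqP e1 /eqP e2].
  exact: (vY g).
have D0 : (Y1 - rx g) * (ry p - ry g) - (Y2 - ry g) * (rx p - rx g) != 0.
  apply/eqP => D0.
  have h := @seen_noncollinear R V E M p r tau (rx g) (ry g) Epr tau0' tau1'.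
  rewrite -ey1 -ey2 in h.
  have [s [s0 s1 f1 f2]] := h frY D0 ngY npr.
  apply: nxy; exists p, r, ((1 - xi) * s + xi * tau); split=> //.
  - by apply: addr_ge0; apply: mulr_ge0 => //; rewrite ?subr_ge0; apply: ltW.
  - have : (1 - xi) * s <= (1 - xi) * 1 by apply: ler_wpM2l => //; rewrite subr_ge0 ltW.
    have : xi * tau <= xi * 1 by apply: ler_wpM2l => //; apply: ltW.
    by clear; lra.
  - by rewrite {1}ex1 f1 ey1 /mx; ring.
  - by rewrite {1}ex2 f2 ey2 /my; ring.
have tau0n : tau != 0 := tn0.
have tau1n : 1 - tau != 0 by rewrite subr_eq0 eq_sym.
have ptau : 0 < 1 - tau by rewrite subr_gt0.
have er1 : rx r - rx g = (Y1 - rx g) / tau - (1 - tau) / tau * (rx p - rx g).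
  by rewrite ey1 /mx; move: tau0n; clear => h; field.
have er2 : ry r - ry g = (Y2 - ry g) / tau - (1 - tau) / tau * (ry p - ry g).
  by rewrite ey2 /my; move: tau0n; clear => h; field.
have ep1 : rx p - rx g = (Y1 - rx g) / (1 - tau) - tau / (1 - tau) * (rx r - rx g).
  by rewrite ey1 /mx; move: tau1n; clear => h; field.
have ep2 : ry p - ry g = (Y2 - ry g) / (1 - tau) - tau / (1 - tau) * (ry r - ry g).
  by rewrite ey2 /my; move: tau1n; clear => h; field.
have D0' : (Y1 - rx g) * (ry r - ry g) - (Y2 - ry g) * (rx r - rx g) != 0.
  have -> : (Y1 - rx g) * (ry r - ry g) - (Y2 - ry g) * (rx r - rx g) =
   - ((1 - tau) / tau) * ((Y1 - rx g) * (ry p - ry g) - (Y2 - ry g) * (rx p - rx g)).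
    by rewrite er1 er2; ring.
  by rewrite mulf_neq0 // oppr_eq0 mulf_neq0 // invr_eq0.
have eq1 : Y1 = mx (1 - tau) r p by rewrite ey1 /mx; ring.
have eq2 : Y2 = my (1 - tau) r p by rewrite ey2 /my; ring.
have ptau' : 1 - tau < 1 by rewrite gtrBl.
have [v [v1 [v2 [[Vv v10 v20 v12] ev1 ev2 vmin [vS vF]]]]] :=
  angle_visible M Epr npr tau0' tau1' ey1 ey2 frY D0.
have nrp : r != p by rewrite eq_sym.
have [w [w1 [w2 [[Vw w10 w20 w12] ew1 ew2 wmin [wS wF]]]]] :=
  angle_visible M (max_sym M Epr) nrp ptau ptau' eq1 eq2 frY D0'.
have eY1' := ey1; have eY2' := ey2.
clear frx ey1 ey2 eq1 eq2 bd onz zb z10 z1m z20 z2n nxz eY1 eY2.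
have inj := @angle_inj R p (rx g) (ry g) Y1 Y2 D0.
have inj' := @angle_inj R r (rx g) (ry g) Y1 Y2 D0'.
have Egu (u : pt2) : V u -> u <> g -> (free (rx g) (ry g) (rx u) (ry u) \/
        (exists b s, [/\ E u b, 0 <= s, s <= 1, rx g = mx s u b & ry g = my s u b])) -> E g u.
  move=> Vu ug [fr|[b [s [Eub s0 s1 e1 e2]]]]; first by apply: (visible_edge M).
  case: (edge_vertex M Vg Eub s0 s1 e1 e2) => [[gu _]|[gb _]|[gu _]].
  - by case: ug.
  - by rewrite gb; apply: (max_sym M).
  - by case: ug.
have vg : v <> g.
  move=> vg; have [] := inj v1 v2 0 0; rewrite -?ev1 -?ev2 ?vg; [ring|ring|].
  by move=> _ h; move: v20; rewrite h ltxx.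
have wg : w <> g.
  move=> wg; have [] := inj' w1 w2 0 0; rewrite -?ew1 -?ew2 ?wg; [ring|ring|].
  by move=> _ h; move: w20; rewrite h ltxx.
have Egv : E g v := Egu v Vv vg vF.
have Egw : E g w := Egu w Vw wg wF.
pose W1 := w1 + w2 / tau; pose W2 := - (w2 * (1 - tau) / tau).
have fW1 : rx w = rx g + W1 * (Y1 - rx g) + W2 * (rx p - rx g) by rewrite ew1 er1 /W1 /W2; ring.
have fW2 : ry w = ry g + W1 * (Y2 - ry g) + W2 * (ry p - ry g) by rewrite ew2 er2 /W1 /W2; ring.
pose V1 := v1 + v2 / (1 - tau); pose V2 := - (v2 * tau / (1 - tau)).
have fV1 : rx v = rx g + V1 * (Y1 - rx g) + V2 * (rx r - rx g) by rewrite ev1 ep1 /V1 /V2; ring.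
have fV2 : ry v = ry g + V1 * (Y2 - ry g) + V2 * (ry r - ry g) by rewrite ev2 ep2 /V1 /V2; ring.
have W10 : 0 < W1 by apply: ltr_wpDl => //; apply: divr_gt0.
have V10 : 0 < V1 by apply: ltr_wpDl => //; apply: divr_gt0.
have W20 : W2 < 0 by rewrite oppr_lt0; apply: divr_gt0 => //; apply: mulr_gt0.
have V20 : V2 < 0 by rewrite oppr_lt0; apply: divr_gt0 => //; apply: mulr_gt0.
have W12 : W1 + W2 = w1 + w2 by rewrite /W1 /W2; move: tau0n; clear => h; field.
have V12 : V1 + V2 = v1 + v2 by rewrite /V1 /V2; move: tau1n; clear => h; field.
have bet : forall a b, a * V2 + b * w2 = - (a * v2 + b * W2) * (tau / (1 - tau)).
  by move=> a b; rewrite /V2 /W2; move: tau0n tau1n; clear => h h'; field; rewrite h h'.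
have q0 : 0 < tau / (1 - tau) by apply: divr_gt0.
have onray c : 0 < c -> c < 1 -> ~ on (rx g + c * (Y1 - rx g)) (ry g + c * (Y2 - ry g)).
  move=> c0 c1 h; apply: (frY c c0 c1).
  have -> : (1 - c) * rx g + c * Y1 = rx g + c * (Y1 - rx g) by ring.
  by have -> : (1 - c) * ry g + c * Y2 = ry g + c * (Y2 - ry g) by ring.
have empty : empty_tri g v w.
  move=> u Vu [l1 [l2 [l3 [[l10 l20 l30] ls eu1 eu2]]]].
  have eu1' : rx u = rx g + l2 * (rx v - rx g) + l3 * (rx w - rx g).
    by rewrite eu1 (_ : l1 = 1 - l2 - l3); [ring | move: ls; clear; lra].
  have eu2' : ry u = ry g + l2 * (ry v - ry g) + l3 * (ry w - ry g).
    by rewrite eu2 (_ : l1 = 1 - l2 - l3); [ring | move: ls; clear; lra].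
  have lle : l2 + l3 <= 1 by move: ls l10; clear; lra.
  have [bn|bp|b0] := ltgtP (l2 * v2 + l3 * W2) 0.
  - constructor 3.
    apply: (@wedge_side g r Y1 Y2 w1 w2 V1 V2 w v u l3 l2 wmin ew1 ew2 fV1 fV2 w10 w20 w12
      V10 V20 _ Vu l30 l20) => //.
    + by rewrite V12.
    + by rewrite addrC.
    + by rewrite eu1'; ring.
    + by rewrite eu2'; ring.
    + by rewrite addrC bet mulr_gt0 // oppr_gt0.
  - constructor 2.
    apply: (@wedge_side g p Y1 Y2 v1 v2 W1 W2 v w u l2 l3 vmin ev1 ev2 fW1 fW2 v10 v20 v12
      W10 W20 _ Vu l20 l30) => //.
    by rewrite W12.
  pose c := l2 * v1 + l3 * W1.
  have g1 : rx u = rx g + c * (Y1 - rx g).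
    transitivity (rx g + c * (Y1 - rx g) + (l2 * v2 + l3 * W2) * (rx p - rx g)).
      by rewrite eu1' ev1 fW1 /c; ring.
    by rewrite b0 mul0r addr0.
  have g2 : ry u = ry g + c * (Y2 - ry g).
    transitivity (ry g + c * (Y2 - ry g) + (l2 * v2 + l3 * W2) * (ry p - ry g)).
      by rewrite eu2' ev2 fW2 /c; ring.
    by rewrite b0 mul0r addr0.
  have c1 : c <= 1.
    have : l2 * (v1 + v2) <= l2 * 1 by apply: ler_wpM2l.
    have : l3 * (W1 + W2) <= l3 * 1 by apply: ler_wpM2l => //; rewrite W12.
    by move: b0 lle; rewrite /c; clear; lra.
  have c0 : 0 <= c by apply: addr_ge0; apply: mulr_ge0 => //; apply: ltW.
  have [c00|cn0] := eqVneq c 0.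
    by constructor 1; apply: (@rxy_inj R); rewrite ?g1 ?g2 c00; ring.
  have [c11|cn1] := eqVneq c 1.
    by case: (vY u) => //; rewrite ?g1 ?g2 c11; ring.
  case: (onray c); first by rewrite lt_neqAle eq_sym cn0.
    by rewrite lt_neqAle cn1.
  by rewrite -g1 -g2; apply: (on_vertex M).
have Evw : E v w.
  have [/andP[/eqP sv /eqP sw]|nvw] := boolP ((v1 + v2 == 1) && (w1 + w2 == 1)).
    have s0 : 0 <= v1 * tau by apply: mulr_ge0 => //; apply: ltW.
    have v1le : v1 <= 1 by move: v12 v20; clear; lra.
    have s1 : v1 * tau < 1 by apply: le_lt_trans tau1'; rewrite ler_piMl // ltW.
    have r0 : 0 <= w1 * (1 - tau) by apply: mulr_ge0 => //; apply: ltW.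
    have w1le : w1 <= 1 by move: w12 w20; clear; lra.
    have r1 : w1 * (1 - tau) < 1 by apply: le_lt_trans ptau'; rewrite ler_piMl // ltW.
    have ev2' : v2 = 1 - v1 by move: sv; clear; lra.
    have ew2' : w2 = 1 - w1 by move: sw; clear; lra.
    have a1 : rx v = mx (v1 * tau) p r by rewrite ev1 ev2' eY1' /mx; ring.
    have a2 : ry v = my (v1 * tau) p r by rewrite ev2 ev2' eY2' /my; ring.
    have b1 : rx w = mx (w1 * (1 - tau)) r p by rewrite ew1 ew2' eY1' /mx; ring.
    have b2 : ry w = my (w1 * (1 - tau)) r p by rewrite ew2 ew2' eY2' /my; ring.
    have vp : v = p.
      case: (edge_vertex M Vv Epr s0 (ltW s1) a1 a2) => [[//]|[_ h]|[//]].
      by move: s1; rewrite h ltxx.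
    have wr : w = r.
      case: (edge_vertex M Vw (max_sym M Epr) r0 (ltW r1) b1 b2) => [[//]|[_ h]|[//]].
      by move: r1; rewrite h ltxx.
    by rewrite vp wr.
  apply: (visible_edge M) => // t' t'0 t'1.
  have -> : (1 - t') * rx v + t' * rx w = rx g + ((1 - t') * v1 + t' * W1) * (Y1 - rx g)
     + ((1 - t') * v2 + t' * W2) * (rx p - rx g) by rewrite ev1 fW1; ring.
  have -> : (1 - t') * ry v + t' * ry w = ry g + ((1 - t') * v1 + t' * W1) * (Y2 - ry g)
     + ((1 - t') * v2 + t' * W2) * (ry p - ry g) by rewrite ev2 fW2; ring.
  have t'p : 0 < 1 - t' by rewrite subr_gt0.
  have sum1 : (1 - t') * (v1 + v2) + t' * (w1 + w2) < 1.
    have h1 : (1 - t') * (v1 + v2) <= (1 - t') * 1 by apply: ler_wpM2l => //; apply: ltW.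
    have h2 : t' * (w1 + w2) <= t' * 1 by apply: ler_wpM2l => //; apply: ltW.
    move: nvw; rewrite negb_and => /orP[h|h].
      have : (1 - t') * (v1 + v2) < (1 - t') * 1 by rewrite ltr_pM2l // lt_neqAle h.
      by move: h2; clear; lra.
    have : t' * (w1 + w2) < t' * 1 by rewrite ltr_pM2l // lt_neqAle h.
    by move: h1; clear; lra.
  have [bn|bp|b0] := ltgtP ((1 - t') * v2 + t' * W2) 0.
  - have h := wS (t' * w1 + (1 - t') * V1) (t' * w2 + (1 - t') * V2).
    have hb : t' * w2 + (1 - t') * V2 = - ((1 - t') * v2 + t' * W2) * (tau / (1 - tau)).
      by rewrite addrC bet.
    move: h; rewrite {1}hb mulr_gt0 ?oppr_gt0 // => /(_ isT).
    have -> : t' * w1 + (1 - t') * V1 + (t' * w2 + (1 - t') * V2) =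
      (1 - t') * (v1 + v2) + t' * (w1 + w2) by rewrite -V12; ring.
    rewrite sum1 => /(_ isT).
    have -> : (t' * w1 + (1 - t') * V1) * w2 - (t' * w2 + (1 - t') * V2) * w1 =
      (1 - t') * (V1 * w2 - V2 * w1) by ring.
    have kp : 0 < V1 * w2 - V2 * w1.
      have : 0 < V1 * w2 by apply: mulr_gt0.
      have : V2 * w1 <= 0 by apply: mulr_le0_ge0 => //; apply: ltW.
      by clear; lra.
    rewrite mulr_gt0 // => /(_ isT).
    have -> : rx g + (t' * w1 + (1 - t') * V1) * (Y1 - rx g) + (t' * w2 + (1 - t') * V2) * (rx r - rx g)
      = rx g + ((1 - t') * v1 + t' * W1) * (Y1 - rx g) + ((1 - t') * v2 + t' * W2) * (rx p - rx g).
      transitivity ((1 - t') * rx v + t' * rx w); first by rewrite fV1 ew1; ring.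
      by rewrite ev1 fW1; ring.
    have -> // : ry g + (t' * w1 + (1 - t') * V1) * (Y2 - ry g) + (t' * w2 + (1 - t') * V2) * (ry r - ry g)
      = ry g + ((1 - t') * v1 + t' * W1) * (Y2 - ry g) + ((1 - t') * v2 + t' * W2) * (ry p - ry g).
    transitivity ((1 - t') * ry v + t' * ry w); first by rewrite fV2 ew2; ring.
    by rewrite ev2 fW2; ring.
  - apply: vS => //.
      have -> : (1 - t') * v1 + t' * W1 + ((1 - t') * v2 + t' * W2) =
       (1 - t') * (v1 + v2) + t' * (w1 + w2) by rewrite -W12; ring.
      exact: sum1.
    have -> : ((1 - t') * v1 + t' * W1) * v2 - ((1 - t') * v2 + t' * W2) * v1 =
      t' * (W1 * v2 - W2 * v1) by ring.
    apply: mulr_gt0 => //.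
    have : 0 < W1 * v2 by apply: mulr_gt0.
    have : W2 * v1 <= 0 by apply: mulr_le0_ge0 => //; apply: ltW.
    by clear; lra.
  have -> : rx g + ((1 - t') * v1 + t' * W1) * (Y1 - rx g) + ((1 - t') * v2 + t' * W2) * (rx p - rx g)
     = rx g + ((1 - t') * v1 + t' * W1) * (Y1 - rx g) by rewrite b0 mul0r addr0.
  have -> : ry g + ((1 - t') * v1 + t' * W1) * (Y2 - ry g) + ((1 - t') * v2 + t' * W2) * (ry p - ry g)
     = ry g + ((1 - t') * v1 + t' * W1) * (Y2 - ry g) by rewrite b0 mul0r addr0.
  apply: onray.
    have : 0 <= (1 - t') * v1 by apply: mulr_ge0 => //; apply: ltW.
    have : 0 < t' * W1 by apply: mulr_gt0.
    by clear; lra.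
  have : (1 - t') * v1 + t' * W1 = (1 - t') * (v1 + v2) + t' * (w1 + w2).
    by rewrite -W12; move: b0; clear; lra.
  by move=> ->.
exists g, v, w; split=> //.
- have -> : det2 g v w = (v1 * W2 - v2 * W1) *
     ((Y1 - rx g) * (ry p - ry g) - (Y2 - ry g) * (rx p - rx g)).
    by rewrite /det2 ev1 ev2 fW1 fW2; ring.
  rewrite mulf_neq0 // lt_eqF //.
  have : v1 * W2 <= 0 by apply: mulr_ge0_le0 => //; apply: ltW.
  have : 0 < v2 * W1 by apply: mulr_gt0.
  by clear; lra.
have vW : 0 < v2 - W2 by move: v20 W20; clear; lra.
pose la := v2 / (v2 - W2); pose k0 := (1 - la) * v1 + la * W1.
have la0 : 0 < la by apply: divr_gt0.
have la1 : la < 1 by rewrite ltr_pdivrMr // mul1r; move: W20; clear; lra.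
have lb : (1 - la) * v2 + la * W2 = 0 by rewrite /la; move: (lt0r_neq0 vW); clear => h; field.
have k00 : 0 < k0.
  have : 0 <= (1 - la) * v1 by apply: mulr_ge0 => //; rewrite subr_ge0 ltW.
  have : 0 < la * W1 by apply: mulr_gt0.
  by rewrite /k0; clear; lra.
have m1 : (1 - la) * rx v + la * rx w = rx g + k0 * (Y1 - rx g).
  transitivity (rx g + k0 * (Y1 - rx g) + ((1 - la) * v2 + la * W2) * (rx p - rx g)).
    by rewrite ev1 fW1 /k0; ring.
  by rewrite lb mul0r addr0.
have m2 : (1 - la) * ry v + la * ry w = ry g + k0 * (Y2 - ry g).
  transitivity (ry g + k0 * (Y2 - ry g) + ((1 - la) * v2 + la * W2) * (ry p - ry g)).
    by rewrite ev2 fW2 /k0; ring.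
  by rewrite lb mul0r addr0.
have xk : xi <= k0.
  rewrite leNgt; apply/negP => kx.
  apply: (onray k0 k00); first exact: lt_trans kx xi1.
  by rewrite -m1 -m2; apply: (edge_on Evw); apply: ltW.
exists (1 - xi / k0), (xi / k0 * (1 - la)), (xi / k0 * la).
have xk0 : 0 <= xi / k0 by apply: divr_ge0; apply: ltW.
have xk1 : xi / k0 <= 1 by rewrite ler_pdivrMr // mul1r.
split.
- split; first by rewrite subr_ge0.
    by apply: mulr_ge0 => //; rewrite subr_ge0 ltW.
  by apply: mulr_ge0 => //; apply: ltW.
- by ring.
- transitivity ((1 - xi / k0) * rx g + xi / k0 * ((1 - la) * rx v + la * rx w)); last by ring.
  by rewrite m1 {1}ex1; move: (lt0r_neq0 k00); clear => h; field.
- transitivity ((1 - xi / k0) * ry g + xi / k0 * ((1 - la) * ry v + la * ry w)); last by ring.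
  by rewrite m2 {1}ex2; move: (lt0r_neq0 k00); clear => h; field.
Qed.

End Cover.

Section Simplices.
Variable R : realType.
Local Notation rx := (@rx R).
Local Notation ry := (@ry R).

Lemma bary_coord a b c (x y : R) : det2 R a b c != 0 -> exists l1 l2 l3 : R,
  [/\ l1 + l2 + l3 = 1, x = l1 * rx a + l2 * rx b + l3 * rx c
   & y = l1 * ry a + l2 * ry b + l3 * ry c].
Proof.
move=> D0.
pose l2 := ((x - rx a) * (ry c - ry a) - (y - ry a) * (rx c - rx a)) / det2 R a b c.
pose l3 := ((rx b - rx a) * (y - ry a) - (ry b - ry a) * (x - rx a)) / det2 R a b c.
exists (1 - l2 - l3), l2, l3; split; first by ring.
  by rewrite /l2 /l3; move: D0; rewrite /det2; clear => h; field.
by rewrite /l2 /l3; move: D0; rewrite /det2; clear => h; field.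
Qed.

Lemma bary_uniq a b c (l1 l2 l3 m1 m2 m3 : R) : det2 R a b c != 0 ->
  l1 + l2 + l3 = m1 + m2 + m3 ->
  l1 * rx a + l2 * rx b + l3 * rx c = m1 * rx a + m2 * rx b + m3 * rx c ->
  l1 * ry a + l2 * ry b + l3 * ry c = m1 * ry a + m2 * ry b + m3 * ry c ->
  [/\ l1 = m1, l2 = m2 & l3 = m3].
Proof.
move=> D0 es ex ey.
have e1 : l1 = m1 + m2 + m3 - l2 - l3 by move: es; clear; lra.
have fx : (l2 - m2) * (rx b - rx a) + (l3 - m3) * (rx c - rx a) = 0.
  transitivity (l1 * rx a + l2 * rx b + l3 * rx c - (m1 * rx a + m2 * rx b + m3 * rx c)).
    by rewrite e1; ring.
  by rewrite ex subrr.
have fy : (l2 - m2) * (ry b - ry a) + (l3 - m3) * (ry c - ry a) = 0.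
  transitivity (l1 * ry a + l2 * ry b + l3 * ry c - (m1 * ry a + m2 * ry b + m3 * ry c)).
    by rewrite e1; ring.
  by rewrite ey subrr.
have e2 : l2 = m2.
  apply/eqP; rewrite -subr_eq0 -(mulIr_eq0 _ (mulIf D0)); apply/eqP.
  transitivity (((l2 - m2) * (rx b - rx a) + (l3 - m3) * (rx c - rx a)) * (ry c - ry a)
    - ((l2 - m2) * (ry b - ry a) + (l3 - m3) * (ry c - ry a)) * (rx c - rx a)).
    by rewrite /det2; ring.
  by rewrite fx fy !mul0r subrr.
have e3 : l3 = m3.
  apply/eqP; rewrite -subr_eq0 -(mulIr_eq0 _ (mulIf D0)); apply/eqP.
  transitivity (((l2 - m2) * (ry b - ry a) + (l3 - m3) * (ry c - ry a)) * (rx b - rx a)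
    - ((l2 - m2) * (rx b - rx a) + (l3 - m3) * (rx c - rx a)) * (ry b - ry a)).
    by rewrite /det2; ring.
  by rewrite fx fy !mul0r subrr.
by split=> //; rewrite e1 e2 e3; ring.
Qed.

Lemma det2_perm a b c : det2 R b c a = det2 R a b c.
Proof. by rewrite /det2; ring. Qed.

Lemma det2_neq a b c : det2 R a b c != 0 -> [/\ a != b, b != c & a != c].
Proof.
move=> D0; split; apply/negP => /eqP h; case/eqP: D0; rewrite h /det2; ring.
Qed.

Lemma exit_one (l p : R) : 0 < l -> exists u, [/\ 0 < u, u <= 1,
   forall u', 0 <= u' -> u' <= u -> 0 <= (1 - u') * l + u' * p &
   (u = 1 /\ 0 <= p) \/ (1 - u) * l + u * p = 0].
Proof.
move=> l0; have [p0|p0] := leP 0 p.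
  exists 1; split; [exact: ltr01|exact: lexx| |by left].
  move=> u' u0 u1; apply: addr_ge0; apply: mulr_ge0 => //; last exact: ltW.
  by rewrite subr_ge0.
have lp : 0 < l - p by move: l0 p0; clear; lra.
exists (l / (l - p)); split.
- exact: divr_gt0.
- by rewrite ler_pdivrMr // mul1r; move: p0; clear; lra.
- by move=> u' u0; rewrite ler_pdivlMr // => h; move: h; clear; lra.
- by right; move: (lt0r_neq0 lp); clear => h; field.
Qed.

Lemma exit_three (l1 l2 l3 p1 p2 p3 : R) : 0 < l1 -> 0 < l2 -> 0 < l3 ->
  ~ [/\ 0 <= p1, 0 <= p2 & 0 <= p3] -> exists u, [/\ 0 < u, u < 1,
   [/\ 0 <= (1 - u) * l1 + u * p1, 0 <= (1 - u) * l2 + u * p2 & 0 <= (1 - u) * l3 + u * p3] &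
   [\/ (1 - u) * l1 + u * p1 = 0, (1 - u) * l2 + u * p2 = 0 | (1 - u) * l3 + u * p3 = 0]].
Proof.
move=> l10 l20 l30 np.
have [u1 [a1 b1 c1 d1]] := exit_one p1 l10.
have [u2 [a2 b2 c2 d2]] := exit_one p2 l20.
have [u3 [a3 b3 c3 d3]] := exit_one p3 l30.
have fin u : 0 < u -> u <= 1 -> u <= u1 -> u <= u2 -> u <= u3 ->
  [\/ (1 - u) * l1 + u * p1 = 0, (1 - u) * l2 + u * p2 = 0 | (1 - u) * l3 + u * p3 = 0] ->
  exists u, [/\ 0 < u, u < 1,
   [/\ 0 <= (1 - u) * l1 + u * p1, 0 <= (1 - u) * l2 + u * p2 & 0 <= (1 - u) * l3 + u * p3] &
   [\/ (1 - u) * l1 + u * p1 = 0, (1 - u) * l2 + u * p2 = 0 | (1 - u) * l3 + u * p3 = 0]].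
  move=> u0 ule h1 h2 h3 h; exists u; split=> //.
    rewrite lt_neqAle ule andbT; apply/eqP => uu; subst u.
    have := c1 1 ler01 h1; have := c2 1 ler01 h2; have := c3 1 ler01 h3.
    by rewrite !(subrr, mul0r, add0r, mul1r) => *; apply: np.
  by split; [apply: c1|apply: c2|apply: c3] => //; apply: ltW.
have [u12|u21] := leP u1 u2; have [u13|u31] := leP u1 u3; have [u23|u32] := leP u2 u3.
- case: d1 => [[e1 q1]|e1]; last by apply: (fin u1) => //; constructor 1.
  case: d2 => [[e2 q2]|e2]; last by apply: (fin u2) => //; [rewrite e1|constructor 2].
  case: d3 => [[e3 q3]|e3]; last by apply: (fin u3) => //; [rewrite e1|rewrite e2|constructor 3].
  by case: np.
- case: d1 => [[e1 q1]|e1]; last by apply: (fin u1) => //; constructor 1.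
  case: d3 => [[e3 q3]|e3]; last by apply: (fin u3) => //; [rewrite e1|exact: ltW|constructor 3].
  by move: u32 b2; rewrite e3; clear; lra.
- by move: u12 u31 u23; clear; lra.
- case: d3 => [[e3 q3]|e3]; last by apply: (fin u3) => //; [exact: ltW|exact: ltW|constructor 3].
  by move: u32 b2; rewrite e3; clear; lra.
- case: d2 => [[e2 q2]|e2]; last by apply: (fin u2) => //; [exact: ltW|constructor 2].
  by move: u21 b1; rewrite e2; clear; lra.
- by move: u13 u21 u32; clear; lra.
- case: d2 => [[e2 q2]|e2]; last by apply: (fin u2) => //; [exact: ltW|constructor 2].
  by move: u21 b1; rewrite e2; clear; lra.
- case: d3 => [[e3 q3]|e3]; last by apply: (fin u3) => //; [exact: ltW|exact: ltW|constructor 3].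
  by move: u32 b2; rewrite e3; clear; lra.
Qed.

Variables (V : pt2 -> Prop) (E : pt2 -> pt2 -> Prop).
Hypothesis M : maximal R V E.
Local Notation on := (@on R E).

Definition good a b c := [/\ [/\ V a, V b & V c], [/\ E a b, E b c & E a c],
  empty_tri R V a b c & det2 R a b c != 0].

Lemma good_perm a b c : good a b c -> good b c a.
Proof.
move=> [[Va Vb Vc] [Eab Ebc Eac] emp D0]; split=> //.
- by split=> //; apply: (max_sym M).
- move=> u Vu [l1 [l2 [l3 [[h1 h2 h3] hs e1 e2]]]].
  have : in_tri a b c (rx u) (ry u).
    exists l3, l1, l2; split=> //; first by rewrite -hs; ring.
      by rewrite e1; ring.
    by rewrite e2; ring.
  by case/(emp _ Vu) => ->; [constructor 3|constructor 1|constructor 2].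
- by rewrite det2_perm.
Qed.

Lemma edge_mix a b (l m : R) : 0 <= l -> 0 <= m -> l + m = 1 -> E a b ->
  on (l * rx a + m * rx b) (l * ry a + m * ry b).
Proof.
move=> l0 m0 s Eab; have el : l = 1 - m by move: s; clear; lra.
by exists a, b, m; split=> //; [by rewrite -subr_ge0 -el|by rewrite el|by rewrite el].
Qed.

Lemma exit_side a b c p r (s u l1 l2 l3 p1 p2 p3 r1 r2 r3 : R) : good a b c -> E p r ->
  0 <= s -> s <= 1 -> 0 < u -> u < 1 -> 0 < l3 ->
  rx p = p1 * rx a + p2 * rx b + p3 * rx c -> ry p = p1 * ry a + p2 * ry b + p3 * ry c ->
  rx r = r1 * rx a + r2 * rx b + r3 * rx c -> ry r = r1 * ry a + r2 * ry b + r3 * ry c ->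
  p1 + p2 + p3 = 1 -> r1 + r2 + r3 = 1 ->
  l1 = (1 - s) * p1 + s * r1 -> l2 = (1 - s) * p2 + s * r2 -> l3 = (1 - s) * p3 + s * r3 ->
  0 <= (1 - u) * l1 + u * p1 -> 0 <= (1 - u) * l2 + u * p2 -> (1 - u) * l3 + u * p3 = 0 ->
  False.
Proof.
move=> [[Va Vb Vc] [Eab Ebc Eac] emp D0] Epr s0 s1 u0 u1 l30 ep1 ep2 er1 er2 ps rs e1 e2 e3 A0 B0 C0.
have [nab nbc nac] := det2_neq D0.
have pE (q1 q2 q3 : R) (q v : pt2) (m1 m2 m3 : R) : rx q = q1 * rx a + q2 * rx b + q3 * rx c ->
   ry q = q1 * ry a + q2 * ry b + q3 * ry c -> q1 + q2 + q3 = 1 -> q = v ->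
   m1 + m2 + m3 = 1 -> rx v = m1 * rx a + m2 * rx b + m3 * rx c ->
   ry v = m1 * ry a + m2 * ry b + m3 * ry c -> q3 = m3.
  move=> h1 h2 hs hq ms g1 g2.
  have [_ _ //] := @bary_uniq a b c q1 q2 q3 m1 m2 m3 D0 (etrans hs (esym ms))
     (etrans (esym h1) (etrans (congr1 rx hq) g1)) (etrans (esym h2) (etrans (congr1 ry hq) g2)).
have a3 q1 q2 q3 (q : pt2) : rx q = q1 * rx a + q2 * rx b + q3 * rx c ->
   ry q = q1 * ry a + q2 * ry b + q3 * ry c -> q1 + q2 + q3 = 1 -> q = a -> q3 = 0.
  by move=> h1 h2 hs hq; apply: (pE q1 q2 q3 q a 1 0 0 h1 h2 hs hq); ring.
have b3 q1 q2 q3 (q : pt2) : rx q = q1 * rx a + q2 * rx b + q3 * rx c ->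
   ry q = q1 * ry a + q2 * ry b + q3 * ry c -> q1 + q2 + q3 = 1 -> q = b -> q3 = 0.
  by move=> h1 h2 hs hq; apply: (pE q1 q2 q3 q b 0 1 0 h1 h2 hs hq); ring.
have both : p3 = 0 -> r3 = 0 -> False.
  by move=> h1 h2; move: l30; rewrite e3 h1 h2 !mulr0 addr0 ltxx.
pose k := s * (1 - u).
have k0 : 0 <= k by apply: mulr_ge0 => //; rewrite subr_ge0 ltW.
have k1 : k < 1.
  apply: le_lt_trans (_ : 1 - u < 1); last by rewrite gtrBl.
  by rewrite ler_piMl // subr_ge0 ltW.
set A := (1 - u) * l1 + u * p1 in A0; set B := (1 - u) * l2 + u * p2 in B0.
have AB : A + B = 1.
  transitivity (A + B + ((1 - u) * l3 + u * p3)); first by rewrite C0 addr0.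
  transitivity ((1 - u) * ((1 - s) * (p1 + p2 + p3) + s * (r1 + r2 + r3)) + u * (p1 + p2 + p3)).
    by rewrite /A /B e1 e2 e3; ring.
  by rewrite ps rs; ring.
have AE : A = 1 - B by rewrite -AB addrK.
have m1 : mx k p r = mx B a b.
  transitivity (A * rx a + B * rx b + ((1 - u) * l3 + u * p3) * rx c).
    by rewrite /mx ep1 er1 /k /A /B e1 e2 e3; ring.
  by rewrite C0 mul0r addr0 /mx -AE.
have m2 : my k p r = my B a b.
  transitivity (A * ry a + B * ry b + ((1 - u) * l3 + u * p3) * ry c).
    by rewrite /my ep2 er2 /k /A /B e1 e2 e3; ring.
  by rewrite C0 mul0r addr0 /my -AE.
have k00 : k = 0 -> False.
  move=> /eqP; rewrite mulf_eq0 => /orP[/eqP ss|]; last by rewrite subr_eq0 eq_sym lt_eqF.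
  have h : l3 = p3 by rewrite e3 ss subr0 mul1r mul0r addr0.
  move: C0; rewrite -h -mulrDl subrK mul1r => h'.
  by move: l30; rewrite h' ltxx.
have vert (v : pt2) : V v -> rx v = mx B a b -> ry v = my B a b ->
   (forall q1 q2 q3 (q : pt2), rx q = q1 * rx a + q2 * rx b + q3 * rx c ->
   ry q = q1 * ry a + q2 * ry b + q3 * ry c -> q1 + q2 + q3 = 1 -> q = v -> q3 = 0) -> False.
  move=> Vv g1 g2 g3.
  have [[_ h]|[_ h]|[h1 h2]] := edge_vertex M Vv Epr k0 (ltW k1) (etrans g1 (esym m1)) (etrans g2 (esym m2)).
  - exact: k00.
  - by move: k1; rewrite h ltxx.
  - apply: both; [exact: (g3 _ _ _ _ ep1 ep2 ps (esym h1))|exact: (g3 _ _ _ _ er1 er2 rs (esym h2))].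
have [B00|Bn0] := eqVneq B 0.
  by apply: (vert a) => //; rewrite B00 /mx /my; ring.
have [B11|Bn1] := eqVneq B 1.
  by apply: (vert b) => //; rewrite B11 /mx /my; ring.
have B0' : 0 < B by rewrite lt_neqAle eq_sym Bn0.
have B1' : B < 1 by rewrite lt_neqAle Bn1 -subr_ge0 -AE.
have [[h1 h2]|[h1 h2]] := edge_relint M Epr Eab k0 (ltW k1) B0' B1' nab m1 m2.
  apply: both; [exact: (a3 _ _ _ _ ep1 ep2 ps h1)|exact: (b3 _ _ _ _ er1 er2 rs h2)].
apply: both; [exact: (b3 _ _ _ _ ep1 ep2 ps h1)|exact: (a3 _ _ _ _ er1 er2 rs h2)].
Qed.

Lemma interior_edge_end a b c p r (s l1 l2 l3 : R) : good a b c -> 0 < l1 -> 0 < l2 -> 0 < l3 ->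
  l1 + l2 + l3 = 1 -> E p r -> 0 <= s -> s <= 1 ->
  l1 * rx a + l2 * rx b + l3 * rx c = mx s p r ->
  l1 * ry a + l2 * ry b + l3 * ry c = my s p r -> [\/ p = a, p = b | p = c].
Proof.
move=> G l10 l20 l30 ls Epr s0 s1 e1 e2.
have [[Va Vb Vc] [Eab Ebc Eac] emp D0] := G.
have [Vp Vr] := max_V M Epr.
have [p1 [p2 [p3 [ps ep1 ep2]]]] := bary_coord (rx p) (ry p) D0.
have [r1 [r2 [r3 [rs er1 er2]]]] := bary_coord (rx r) (ry r) D0.
have [f1 f2 f3] : [/\ l1 = (1 - s) * p1 + s * r1, l2 = (1 - s) * p2 + s * r2 &
   l3 = (1 - s) * p3 + s * r3].
  apply: (bary_uniq D0).
  - rewrite ls; transitivity ((1 - s) * (p1 + p2 + p3) + s * (r1 + r2 + r3)); last by ring.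
    by rewrite ps rs; ring.
  - by rewrite e1 /mx ep1 er1; ring.
  - by rewrite e2 /my ep2 er2; ring.
have [pp|np] := pselect [/\ 0 <= p1, 0 <= p2 & 0 <= p3].
  by apply: (emp _ Vp); exists p1, p2, p3.
exfalso; have [u [u0 u1 [h1 h2 h3] [hz|hz|hz]]] := exit_three l10 l20 l30 np.
- have G' := good_perm G.
  apply: (@exit_side b c a p r s u l2 l3 l1 p2 p3 p1 r2 r3 r1 G' Epr s0 s1 u0 u1 l10) => //.
  + by rewrite ep1; ring.
  + by rewrite ep2; ring.
  + by rewrite er1; ring.
  + by rewrite er2; ring.
  + by rewrite -ps; ring.
  + by rewrite -rs; ring.
- have G' := good_perm (good_perm G).
  apply: (@exit_side c a b p r s u l3 l1 l2 p3 p1 p2 r3 r1 r2 G' Epr s0 s1 u0 u1 l20) => //.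
  + by rewrite ep1; ring.
  + by rewrite ep2; ring.
  + by rewrite er1; ring.
  + by rewrite er2; ring.
  + by rewrite -ps; ring.
  + by rewrite -rs; ring.
- exact: (@exit_side a b c p r s u l1 l2 l3 p1 p2 p3 r1 r2 r3 G Epr s0 s1 u0 u1 l30).
Qed.

Definition eq_ind (v w : pt2) : R := if w == v then 1 else 0.

Lemma among_three a b c w (h : pt2 -> R) : a != b -> b != c -> a != c ->
  [\/ w = a, w = b | w = c] ->
  h w = eq_ind a w * h a + eq_ind b w * h b + eq_ind c w * h c.
Proof.
move=> nab nbc nac; rewrite /eq_ind; case=> ->; rewrite eqxx ?[b == a]eq_sym ?[c == a]eq_sym
 ?[c == b]eq_sym ?(negbTE nab) ?(negbTE nbc) ?(negbTE nac); ring.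
Qed.

Lemma interior_free a b c (l1 l2 l3 : R) : good a b c -> 0 < l1 -> 0 < l2 -> 0 < l3 ->
  l1 + l2 + l3 = 1 ->
  ~ on (l1 * rx a + l2 * rx b + l3 * rx c) (l1 * ry a + l2 * ry b + l3 * ry c).
Proof.
move=> G l10 l20 l30 ls [p [r [s [Epr s0 s1 e1 e2]]]].
have hp := interior_edge_end G l10 l20 l30 ls Epr s0 s1 e1 e2.
have hr : [\/ r = a, r = b | r = c].
  apply: (interior_edge_end G l10 l20 l30 ls (max_sym M Epr) (s := 1 - s)).
  - by rewrite subr_ge0.
  - by rewrite gerBl.
  - by rewrite e1 /mx; ring.
  - by rewrite e2 /my; ring.
have [_ _ _ D0] := G; have [nab nbc nac] := det2_neq D0.
have [f1 f2 f3] : [/\ l1 = (1 - s) * eq_ind a p + s * eq_ind a r,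
   l2 = (1 - s) * eq_ind b p + s * eq_ind b r & l3 = (1 - s) * eq_ind c p + s * eq_ind c r].
  have H (h : pt2 -> R) := among_three h nab nbc nac hp.
  have H' (h : pt2 -> R) := among_three h nab nbc nac hr.
  apply: (bary_uniq D0).
  - have S1 := H (fun=> 1); have S2 := H' (fun=> 1); rewrite !mulr1 in S1 S2.
    transitivity ((1 - s) * (eq_ind a p + eq_ind b p + eq_ind c p) +
      s * (eq_ind a r + eq_ind b r + eq_ind c r)); last by ring.
    by rewrite -S1 -S2 ls; ring.
  - by rewrite e1 /mx (H rx) (H' rx); ring.
  - by rewrite e2 /my (H ry) (H' ry); ring.
move: f1 f2 f3 l10 l20 l30; rewrite /eq_ind.
by case: hp => ->; case: hr => ->; rewrite ?eqxx ?[b == a]eq_sym ?[c == a]eq_sym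
 ?[c == b]eq_sym ?(negbTE nab) ?(negbTE nbc) ?(negbTE nac) => -> -> ->; rewrite ?mulr0 ?addr0 ltxx.
Qed.

Lemma interior_interior a b c d e f (l1 l2 l3 m1 m2 m3 : R) : good a b c -> good d e f ->
  0 < l1 -> 0 < l2 -> 0 < l3 -> l1 + l2 + l3 = 1 ->
  0 < m1 -> 0 < m2 -> 0 < m3 -> m1 + m2 + m3 = 1 ->
  l1 * rx a + l2 * rx b + l3 * rx c = m1 * rx d + m2 * rx e + m3 * rx f ->
  l1 * ry a + l2 * ry b + l3 * ry c = m1 * ry d + m2 * ry e + m3 * ry f ->
  forall g : pt2 -> R, l1 * g a + l2 * g b + l3 * g c = m1 * g d + m2 * g e + m3 * g f.
Proof.
move=> G G' l10 l20 l30 ls m10 m20 m30 ms ex ey.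
have [[Va Vb Vc] [Eab Ebc Eac] emp D0] := G.
have [[Vd Ve Vf] _ _ _] := G'.
have [nab nbc nac] := det2_neq D0.
have key v (n1 n2 n3 : R) : V v -> 0 <= n1 -> 0 <= n2 -> 0 <= n3 -> n1 + n2 + n3 = 1 ->
   rx v = n1 * rx d + n2 * rx e + n3 * rx f -> ry v = n1 * ry d + n2 * ry e + n3 * ry f ->
   [\/ v = a, v = b | v = c].
  move=> Vv n10 n20 n30 ns ev1 ev2.
  have [p1 [p2 [p3 [ps ep1 ep2]]]] := bary_coord (rx v) (ry v) D0.
  have [pp|np] := pselect [/\ 0 <= p1, 0 <= p2 & 0 <= p3].
    by apply: (emp _ Vv); exists p1, p2, p3.
  exfalso; have [u [u0 u1 [h1 h2 h3] hz]] := exit_three l10 l20 l30 np.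
  have u1' : 0 < 1 - u by rewrite subr_gt0.
  have pos m' n' : 0 < m' -> 0 <= n' -> 0 < (1 - u) * m' + u * n'.
    by move=> mm nn; apply: ltr_wpDr; [apply: mulr_ge0 => //; apply: ltW|apply: mulr_gt0].
  apply: (interior_free G' (pos m1 n1 m10 n10) (pos m2 n2 m20 n20) (pos m3 n3 m30 n30)).
    transitivity ((1 - u) * (m1 + m2 + m3) + u * (n1 + n2 + n3)); first by ring.
    by rewrite ms ns; ring.
  have hs : (1 - u) * l1 + u * p1 + ((1 - u) * l2 + u * p2) + ((1 - u) * l3 + u * p3) = 1.
    transitivity ((1 - u) * (l1 + l2 + l3) + u * (p1 + p2 + p3)); first by ring.
    by rewrite ls ps; ring.
  have -> : ((1 - u) * m1 + u * n1) * rx d + ((1 - u) * m2 + u * n2) * rx e +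
    ((1 - u) * m3 + u * n3) * rx f = ((1 - u) * l1 + u * p1) * rx a + ((1 - u) * l2 + u * p2) * rx b
      + ((1 - u) * l3 + u * p3) * rx c.
    transitivity ((1 - u) * (l1 * rx a + l2 * rx b + l3 * rx c) + u * rx v); last by rewrite ep1; ring.
    by rewrite ex ev1; ring.
  have -> : ((1 - u) * m1 + u * n1) * ry d + ((1 - u) * m2 + u * n2) * ry e +
    ((1 - u) * m3 + u * n3) * ry f = ((1 - u) * l1 + u * p1) * ry a + ((1 - u) * l2 + u * p2) * ry b
      + ((1 - u) * l3 + u * p3) * ry c.
    transitivity ((1 - u) * (l1 * ry a + l2 * ry b + l3 * ry c) + u * ry v); last by rewrite ep2; ring.
    by rewrite ey ev2; ring.
  move: hs; case: hz => z; rewrite z ?mul0r ?add0r ?addr0 => hs; exact: edge_mix.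
have kd : [\/ d = a, d = b | d = c].
  by apply: (key d 1 0 0) => //; rewrite ?ler01 //; ring.
have ke : [\/ e = a, e = b | e = c].
  by apply: (key e 0 1 0) => //; rewrite ?ler01 //; ring.
have kf : [\/ f = a, f = b | f = c].
  by apply: (key f 0 0 1) => //; rewrite ?ler01 //; ring.
have H (h : pt2 -> R) := among_three h nab nbc nac kd.
have H' (h : pt2 -> R) := among_three h nab nbc nac ke.
have H'' (h : pt2 -> R) := among_three h nab nbc nac kf.
have [f1 f2 f3] : [/\ l1 = m1 * eq_ind a d + m2 * eq_ind a e + m3 * eq_ind a f,
   l2 = m1 * eq_ind b d + m2 * eq_ind b e + m3 * eq_ind b f &
   l3 = m1 * eq_ind c d + m2 * eq_ind c e + m3 * eq_ind c f].
  apply: (bary_uniq D0).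
  - have S1 := H (fun=> 1); have S2 := H' (fun=> 1); have S3 := H'' (fun=> 1).
    rewrite !mulr1 in S1 S2 S3.
    transitivity (m1 * (eq_ind a d + eq_ind b d + eq_ind c d) +
      m2 * (eq_ind a e + eq_ind b e + eq_ind c e) +
      m3 * (eq_ind a f + eq_ind b f + eq_ind c f)); last by ring.
    by rewrite -S1 -S2 -S3 ls !mulr1 ms.
  - by rewrite ex (H rx) (H' rx) (H'' rx); ring.
  - by rewrite ey (H ry) (H' ry) (H'' ry); ring.
by move=> g; rewrite f1 f2 f3 (H g) (H' g) (H'' g); ring.
Qed.

End Simplices.

Record lattice (q : int) (L : int -> int -> Prop) : Prop := Lattice {
  lat_q : 0 < q;
  lat_B : forall a b c d, L a b -> L c d -> L (a - c) (b - d);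
  lat_x : L q 0;
  lat_y : L 0 q;
  lat_x0 : forall a, L a 0 -> exists i, a = i * q;
  lat_y0 : forall b, L 0 b -> exists i, b = i * q;
  lat_exy : forall a, exists b, L a b;
  lat_exx : forall b, exists a, L a b }.

Definition sub2 (b a : pt2) : pt2 := (b.1 - a.1, b.2 - a.2).

Definition basis2 (L : int -> int -> Prop) (u v : pt2) :=
  u.1 * v.2 - u.2 * v.1 != 0 /\
  forall x y, L x y -> exists i j : int, x = i * u.1 + j * v.1 /\ y = i * u.2 + j * v.2.

Definition Vbox (L : int -> int -> Prop) (m n : int) (v : pt2) :=
  [/\ L v.1 v.2, 0 <= v.1, v.1 <= m, 0 <= v.2 & v.2 <= n].

Definition tri L (E : pt2 -> pt2 -> Prop) a b c :=
  [/\ E a b, E b c, E a c & basis2 L (sub2 b a) (sub2 c a)].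

Inductive spx (L : int -> int -> Prop) (E : pt2 -> pt2 -> Prop) : seq pt2 -> Prop :=
| Spx1 a : E a a -> spx L E [:: a]
| Spx2 a b : E a b -> spx L E [:: a; b]
| Spx3 a b c : tri L E a b c -> spx L E [:: a; b; c].

Section Weights.
Variable R : realType.
Local Notation rx := (@rx R).
Local Notation ry := (@ry R).

Definition wsum (P : Type) (s : seq P) (l : seq R) (g : P -> R) : R :=
  \sum_(i <- zip s l) i.2 * g i.1.

Lemma wsum_nil P l (g : P -> R) : wsum [::] l g = 0.
Proof. by rewrite /wsum; case: l => [|x l]; rewrite big_nil. Qed.

Lemma wsum_cons P a s x l (g : P -> R) : wsum (a :: s) (x :: l) g = x * g a + wsum s l g.
Proof. by rewrite /wsum /= big_cons. Qed.

Definition wsumE := (wsum_cons, wsum_nil).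

Definition wt (P : Type) (s : seq P) (l : seq R) :=
  [/\ size l = size s, forall x, x \in l -> 0 <= x & wsum s l (fun=> 1) = 1].

Definition FF2 (K : seq pt2 -> Prop) := forall s t l m, K s -> K t -> wt s l -> wt t m ->
  wsum s l rx = wsum t m rx -> wsum s l ry = wsum t m ry ->
  forall g, wsum s l g = wsum t m g.

Record plane (L : int -> int -> Prop) (m n : int) (E : pt2 -> pt2 -> Prop) : Prop := Plane {
  pl_V : forall a b, E a b -> Vbox L m n a /\ Vbox L m n b;
  pl_refl : forall a, Vbox L m n a -> E a a;
  pl_sym : forall a b, E a b -> E b a;
  pl_FF : FF2 (spx L E);
  pl_cov : forall x y : R, 0 <= x -> x <= m%:~R -> 0 <= y -> y <= n%:~R ->
    exists a b c, tri L E a b c /\ in_tri a b c x y }.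

Lemma wt1 (P : Type) (a : P) l : wt [:: a] l -> forall g, wsum [:: a] l g = g a.
Proof.
case: l => [|x [|? ?]] [] // _ _; rewrite !wsumE mulr1 addr0 => -> g.
by rewrite !wsumE mul1r addr0.
Qed.

Lemma wt2 (P : Type) (a b : P) l : wt [:: a; b] l -> exists s, [/\ 0 <= s, s <= 1 &
  forall g, wsum [:: a; b] l g = (1 - s) * g a + s * g b].
Proof.
case: l => [|x [|y [|? ?]]] [] // _ l0; rewrite !wsumE !mulr1 addr0 => e.
have x0 : 0 <= x by apply: l0; rewrite !inE eqxx.
have y0 : 0 <= y by apply: l0; rewrite !inE eqxx orbT.
exists y; split=> //; first by move: e x0; clear; lra.
have -> : 1 - y = x by move: e; clear; lra.
by move=> g; rewrite !wsumE addr0.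
Qed.

Lemma wt3 (P : Type) (a b c : P) l : wt [:: a; b; c] l -> exists l1 l2 l3,
  [/\ [/\ 0 <= l1, 0 <= l2 & 0 <= l3], l1 + l2 + l3 = 1 &
  forall g, wsum [:: a; b; c] l g = l1 * g a + l2 * g b + l3 * g c].
Proof.
case: l => [|x [|y [|z [|? ?]]]] [] // _ l0; rewrite !wsumE !mulr1 addr0 => e.
exists x, y, z; split.
- by split; apply: l0; rewrite !inE eqxx ?orbT.
- by rewrite -e addrA.
- by move=> g; rewrite !wsumE addr0 addrA.
Qed.

Lemma floor_frac (x : R) : exists (i : int) (f : R), [/\ x = i%:~R + f, 0 <= f & f < 1].
Proof.
exists (Num.floor x), (x - (Num.floor x)%:~R); split; first by ring.
  by rewrite subr_ge0 floor_le.
by have := floorD1_gt x; rewrite rmorphD /= rmorph1; clear; lra.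
Qed.

Lemma det2E a b c : det2 R a b c =
  ((sub2 b a).1 * (sub2 c a).2 - (sub2 b a).2 * (sub2 c a).1)%:~R.
Proof. by rewrite /det2 /rx /ry /sub2 /= !(rmorphB, rmorphM). Qed.

Lemma empty_basis q L m n a b c : lattice q L -> Vbox L m n a -> Vbox L m n b -> Vbox L m n c ->
  empty_tri R (Vbox L m n) a b c -> det2 R a b c != 0 -> basis2 L (sub2 b a) (sub2 c a).
Proof.
move=> Lq Va Vb Vc emp D0; split; first by move: D0; rewrite det2E intr_eq0.
move=> x y Lxy.
have L0 : L 0 0 by have := lat_B Lq Lxy Lxy; rewrite !subrr.
have LN u v : L u v -> L (- u) (- v) by move=> h; have := lat_B Lq L0 h; rewrite !sub0r.
have LD u v u' v' : L u v -> L u' v' -> L (u + u') (v + v').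
  by move=> h h'; have := lat_B Lq h (LN _ _ h'); rewrite !opprK.
have Lmn u v (i : nat) : L u v -> L (u *+ i) (v *+ i).
  by move=> h; elim: i => [|i IH]; rewrite ?mulr0n // !mulrS; apply: LD.
have LM u v (i : int) : L u v -> L (i * u) (i * v).
  move=> h; case: i => i; first by have := Lmn _ _ i h; rewrite !pmulrn !mulrzz ![_ * Posz i]mulrC.
  by have := LN _ _ (Lmn _ _ i.+1 h); rewrite !pmulrn !mulrzz NegzE !mulNr ![_ * Posz i.+1]mulrC.
have [La _ _ _ _] := Va; have [Lb _ _ _ _] := Vb; have [Lc _ _ _ _] := Vc.
have Lu : L (sub2 b a).1 (sub2 b a).2 by apply: (lat_B Lq).
have Lv : L (sub2 c a).1 (sub2 c a).2 by apply: (lat_B Lq).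
set u := sub2 b a in Lu *; set v := sub2 c a in Lv *.
have [l1 [l2 [l3 [ls e1 e2]]]] := bary_coord (rx a + x%:~R) (ry a + y%:~R) D0.
have [i [f [ei f0 f1]]] := floor_frac l2; have [j [h [ej h0 h1]]] := floor_frac l3.
have rxu : rx b - rx a = u.1%:~R by rewrite /rx /u /= rmorphB.
have ryu : ry b - ry a = u.2%:~R by rewrite /ry /u /= rmorphB.
have rxv : rx c - rx a = v.1%:~R by rewrite /rx /v /= rmorphB.
have ryv : ry c - ry a = v.2%:~R by rewrite /ry /v /= rmorphB.
clearbody u v.
have l1E : l1 = 1 - l2 - l3 by move: ls; clear; lra.
have ex : x%:~R = l2 * u.1%:~R + l3 * v.1%:~R :> R.
  by rewrite -rxu -rxv; transitivity (rx a + x%:~R - rx a); [ring|rewrite e1 l1E; ring].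
have ey : y%:~R = l2 * u.2%:~R + l3 * v.2%:~R :> R.
  by rewrite -ryu -ryv; transitivity (ry a + y%:~R - ry a); [ring|rewrite e2 l1E; ring].
pose w : pt2 := (x - i * u.1 - j * v.1, y - i * u.2 - j * v.2).
have Lw : L w.1 w.2.
  by apply: (lat_B Lq); [apply: (lat_B Lq) => //|]; apply: LM.
have ew1 : w.1%:~R = f * u.1%:~R + h * v.1%:~R :> R.
  by rewrite /w /= !rmorphB !rmorphM /= ex ei ej; ring.
have ew2 : w.2%:~R = f * u.2%:~R + h * v.2%:~R :> R.
  by rewrite /w /= !rmorphB !rmorphM /= ey ei ej; ring.
suff [f00 h00] : f = 0 /\ h = 0.
  exists i, j; move: ew1 ew2; rewrite f00 h00 !mul0r addr0 => /eqP; rewrite intr_eq0 => /eqP w1.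
  move=> /eqP; rewrite intr_eq0 => /eqP w2.
  by move: w1 w2; rewrite /w /=; clear; split; lia.
clearbody w.
have inV (z : pt2) (m1 m2 m3 : R) : L z.1 z.2 -> 0 <= m1 -> 0 <= m2 -> 0 <= m3 -> m1 + m2 + m3 = 1 ->
   rx z = m1 * rx a + m2 * rx b + m3 * rx c -> ry z = m1 * ry a + m2 * ry b + m3 * ry c ->
   [\/ m2 = 0 /\ m3 = 0, m2 = 1 /\ m3 = 0 | m2 = 0 /\ m3 = 1].
  move=> Lz m10 m20 m30 ms ez1 ez2.
  have bd (g : pt2 -> R) (B C : R) : (B <= g a) -> (B <= g b) -> (B <= g c) ->
     (g a <= C) -> (g b <= C) -> (g c <= C) -> B <= m1 * g a + m2 * g b + m3 * g c /\
     m1 * g a + m2 * g b + m3 * g c <= C.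
    move=> h2 h3 h4 h5 h6 h7; have es g' : m1 * g' + m2 * g' + m3 * g' = g' by rewrite -!mulrDl ms mul1r.
    by split; [rewrite -(es B)|rewrite -(es C)]; do 2?apply: lerD; apply: ler_wpM2l.
  have Vz : Vbox L m n z.
    have [_ a1 a2 a3 a4] := Va; have [_ b1 b2 b3 b4] := Vb; have [_ c1 c2 c3 c4] := Vc.
    have [g1 g2] : 0 <= rx z /\ rx z <= m%:~R.
      by rewrite ez1; apply: bd; rewrite /rx ?ler0z ?ler_int.
    have [g3 g4] : 0 <= ry z /\ ry z <= n%:~R.
      by rewrite ez2; apply: bd; rewrite /ry ?ler0z ?ler_int.
    by split=> //; move: g1 g2 g3 g4; rewrite /rx /ry ?ler0z ?ler_int.
  have hz : in_tri a b c (rx z) (ry z) by exists m1, m2, m3.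
  have uq (k1 k2 k3 : R) : k1 + k2 + k3 = 1 -> rx z = k1 * rx a + k2 * rx b + k3 * rx c ->
     ry z = k1 * ry a + k2 * ry b + k3 * ry c -> m2 = k2 /\ m3 = k3.
    move=> ks k1e k2e.
    have [_ -> ->] := bary_uniq D0 (etrans ms (esym ks)) (etrans (esym ez1) k1e) (etrans (esym ez2) k2e).
    by [].
  case: (emp _ Vz hz) => ez.
  - by constructor 1; apply: (uq 1); rewrite ?ez; ring.
  - by constructor 2; apply: (uq 0); rewrite ?ez; ring.
  - by constructor 3; apply: (uq 0); rewrite ?ez; ring.
have [fh|fh] := leP (f + h) 1.
  have La' : L (a.1 + w.1) (a.2 + w.2) by apply: LD.
  have z0 : 0 <= 1 - f - h by move: fh; clear; lra.
  have zs : 1 - f - h + f + h = 1 by ring.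
  have z1 : rx (a.1 + w.1, a.2 + w.2) = (1 - f - h) * rx a + f * rx b + h * rx c.
    by rewrite {1}/rx /= rmorphD /= ew1 -rxu -rxv /rx; ring.
  have z2 : ry (a.1 + w.1, a.2 + w.2) = (1 - f - h) * ry a + f * ry b + h * ry c.
    by rewrite {1}/ry /= rmorphD /= ew2 -ryu -ryv /ry; ring.
  have [//|[e _]|[_ e]] := inV (_, _) _ _ _ La' z0 f0 h0 zs z1 z2.
    by move: f1; rewrite e ltxx.
  by move: h1; rewrite e ltxx.
have Lb' : L (a.1 + (u.1 + v.1 - w.1)) (a.2 + (u.2 + v.2 - w.2)).
  by apply: (LD _ _ _ _ La); apply: (lat_B Lq) => //; apply: LD.
have z0 : 0 <= f + h - 1 by move: fh; clear; lra.
have f0' : 0 <= 1 - f by move: f1; clear; lra.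
have h0' : 0 <= 1 - h by move: h1; clear; lra.
have zs : f + h - 1 + (1 - f) + (1 - h) = 1 by ring.
have z1 : rx (a.1 + (u.1 + v.1 - w.1), a.2 + (u.2 + v.2 - w.2)) =
    (f + h - 1) * rx a + (1 - f) * rx b + (1 - h) * rx c.
  by rewrite {1}/rx /= !(rmorphD, rmorphN) /= ew1 -rxu -rxv /rx; ring.
have z2 : ry (a.1 + (u.1 + v.1 - w.1), a.2 + (u.2 + v.2 - w.2)) =
    (f + h - 1) * ry a + (1 - f) * ry b + (1 - h) * ry c.
  by rewrite {1}/ry /= !(rmorphD, rmorphN) /= ew2 -ryu -ryv /ry; ring.
have [[e _]|[_ e]|[e _]] := inV (_, _) _ _ _ Lb' z0 f0' h0' zs z1 z2; exfalso.
- by move: f1 e; clear; lra.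
- by move: h1 e; clear; lra.
- by move: f1 e; clear; lra.
Qed.

Lemma basis_empty q L m n a b c : lattice q L ->
  Vbox L m n a -> basis2 L (sub2 b a) (sub2 c a) ->
  empty_tri R (Vbox L m n) a b c /\ det2 R a b c != 0.
Proof.
move=> Lq Va [D0 bas]; have D0' : det2 R a b c != 0 by rewrite det2E intr_eq0.
split=> // u Vu [l1 [l2 [l3 [[l10 l20 l30] ls e1 e2]]]].
have [La _ _ _ _] := Va; have [Lu _ _ _ _] := Vu.
have [i [j [ei ej]]] := bas _ _ (lat_B Lq Lu La).
have [h1 h2 h3] : [/\ l1 = 1 - i%:~R - j%:~R, l2 = i%:~R & l3 = j%:~R].
  apply: (bary_uniq D0'); first by rewrite ls; ring.
    rewrite -e1; have -> : rx u = rx a + (u.1 - a.1)%:~R by rewrite /rx rmorphB /=; ring.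
    by rewrite ei rmorphD !rmorphM /= !rmorphB /= /rx; ring.
  rewrite -e2; have -> : ry u = ry a + (u.2 - a.2)%:~R by rewrite /ry rmorphB /=; ring.
  by rewrite ej rmorphD !rmorphM /= !rmorphB /= /ry; ring.
have i0 : 0 <= i by rewrite -(ler0z R) -h2.
have j0 : 0 <= j by rewrite -(ler0z R) -h3.
have ij : i + j <= 1.
  by rewrite -(ler_int R) rmorphD /= -h2 -h3; move: ls l10; clear; lra.
have hij : [\/ i = 0 /\ j = 0, i = 1 /\ j = 0 | i = 0 /\ j = 1].
  have [i00|i1] : i = 0 \/ i = 1 by move: i0 j0 ij; clear; lia.
    have [j00|j1] : j = 0 \/ j = 1 by move: i0 j0 ij; clear; lia.
      by constructor 1.
    by constructor 3.
  by constructor 2; split=> //; move: i1 i0 j0 ij; clear; lia.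
by case: hij => [[i' j']|[i' j']|[i' j']]; [constructor 1|constructor 2|constructor 3];
 apply: (@rxy_inj R); rewrite ?e1 ?e2 h1 h2 h3 i' j' ?mulr1z; ring.
Qed.

End Weights.

Section Completion.
Variable R : realType.
Local Notation rx := (@rx R).
Local Notation ry := (@ry R).

Lemma tri_far a b c (x y d1 d2 : R) : det2 R a b c != 0 -> ~ in_tri a b c x y ->
  exists2 del : R, 0 < del & forall t : R, 0 <= t -> t < del -> ~ in_tri a b c (x + t * d1) (y + t * d2).
Proof.
move=> D0 nin.
have [l1 [l2 [l3 [ls e1 e2]]]] := bary_coord x y D0.
have [m1 [m2 [m3 [ms f1 f2]]]] := bary_coord (x + d1) (y + d2) D0.
have uq (t n1 n2 n3 : R) : n1 + n2 + n3 = 1 -> x + t * d1 = n1 * rx a + n2 * rx b + n3 * rx c ->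
   y + t * d2 = n1 * ry a + n2 * ry b + n3 * ry c ->
   [/\ n1 = l1 + t * (m1 - l1), n2 = l2 + t * (m2 - l2) & n3 = l3 + t * (m3 - l3)].
  move=> ns g1 g2; apply: (bary_uniq D0).
  - transitivity ((1 - t) * (l1 + l2 + l3) + t * (m1 + m2 + m3)); last by ring.
    by rewrite ns ls ms; ring.
  - rewrite -g1; transitivity ((1 - t) * x + t * (x + d1)); first by ring.
    by rewrite {1}e1 f1; ring.
  - rewrite -g2; transitivity ((1 - t) * y + t * (y + d2)); first by ring.
    by rewrite {1}e2 f2; ring.
have neg (l m : R) : l < 0 -> exists2 del : R, 0 < del & forall t : R, 0 <= t -> t < del -> l + t * (m - l) < 0.
  move=> l0; have pos : 0 < `|m - l| + 1 by apply: ltr_wpDl.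
  exists (- l / (`|m - l| + 1)); first by apply: divr_gt0 => //; rewrite oppr_gt0.
  move=> t t0; rewrite ltr_pdivlMr // => h.
  have : t * (m - l) <= t * `|m - l| by apply: ler_wpM2l => //; apply: ler_norm.
  by move: h t0; clear; lra.
have [h1|h1] := leP 0 l1; last first.
  have [del d0 H] := neg l1 m1 h1; exists del => // t t0 td [n1 [n2 [n3 [[n10 n20 n30] ns g1 g2]]]].
  have [u1 _ _] := uq _ _ _ _ ns g1 g2.
  by have := H t t0 td; rewrite -u1 ltNge n10.
have [h2|h2] := leP 0 l2; last first.
  have [del d0 H] := neg l2 m2 h2; exists del => // t t0 td [n1 [n2 [n3 [[n10 n20 n30] ns g1 g2]]]].
  have [_ u1 _] := uq _ _ _ _ ns g1 g2.
  by have := H t t0 td; rewrite -u1 ltNge n20.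
have [h3|h3] := leP 0 l3; last first.
  have [del d0 H] := neg l3 m3 h3; exists del => // t t0 td [n1 [n2 [n3 [[n10 n20 n30] ns g1 g2]]]].
  have [_ _ u1] := uq _ _ _ _ ns g1 g2.
  by have := H t t0 td; rewrite -u1 ltNge n30.
by case: nin; exists l1, l2, l3.
Qed.

Lemma cover_closed (G : pt2 -> pt2 -> pt2 -> Prop) (vs : seq pt2) (x y d1 d2 del : R) :
  (forall a b c, G a b c -> [/\ det2 R a b c != 0, a \in vs, b \in vs & c \in vs]) ->
  0 < del -> (forall t, 0 < t -> t < del ->
    exists a b c, G a b c /\ in_tri a b c (x + t * d1) (y + t * d2)) ->
  exists a b c, G a b c /\ in_tri a b c x y.
Proof.
move=> HG del0 H; apply: contrapT => nex.
pose ts := [seq (p, c) | p <- [seq (a, b) | a <- vs, b <- vs], c <- vs].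
have [e e0 He] : exists2 e : R, 0 < e & forall p, p \in ts -> G p.1.1 p.1.2 p.2 ->
    forall t, 0 <= t -> t < e -> ~ in_tri p.1.1 p.1.2 p.2 (x + t * d1) (y + t * d2).
  elim: ts => [|p ts [e e0 IH]]; first by exists 1.
  have [Gp|nG] := pselect (G p.1.1 p.1.2 p.2); last first.
    by exists e => // q; rewrite inE => /orP[/eqP->//|qs]; apply: IH.
  have [D0 _ _ _] := HG _ _ _ Gp.
  have nin : ~ in_tri p.1.1 p.1.2 p.2 x y by move=> h; apply: nex; exists p.1.1, p.1.2, p.2.
  have [e' e0' He'] := tri_far d1 d2 D0 nin.
  exists (Num.min e e'); first by rewrite lt_min e0.
  move=> q; rewrite inE => /orP[/eqP-> _|qs Gq] t t0; rewrite lt_min => /andP[te te'].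
    exact: He'.
  exact: IH.
pose t := Num.min e del / 2.
have m0 : 0 < Num.min e del by rewrite lt_min e0.
have t0 : 0 < t by apply: divr_gt0.
have tm : t < Num.min e del by rewrite /t; move: m0; set u := Num.min _ _; clearbody u; clear; lra.
move: tm; rewrite lt_min => /andP[te td].
have [a [b [c [Gabc hin]]]] := H t t0 td.
have [_ a_ b_ c_] := HG _ _ _ Gabc.
apply: (He ((a, b), c) _ Gabc t (ltW t0) te) => //.
apply/allpairsP; exists ((a, b), c); split => //.
by apply/allpairsP; exists (a, b).
Qed.

Lemma at_frac (x z u t : R) : t != 0 -> (1 - u / t) * x + u / t * at_ x z t = x + u * (z - x).
Proof. by move=> t0; rewrite /at_; field. Qed.

Lemma box_convex (x z t c : R) : 0 <= x -> x <= c -> 0 <= z -> z <= c -> 0 <= t -> t <= 1 ->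
  0 <= x + t * (z - x) /\ x + t * (z - x) <= c.
Proof.
move=> x0 xc z0 zc t0 t1.
have -> : x + t * (z - x) = (1 - t) * x + t * z by ring.
have t1' : 0 <= 1 - t by rewrite subr_ge0.
split; first by apply: addr_ge0; apply: mulr_ge0.
have : (1 - t) * x <= (1 - t) * c by apply: ler_wpM2l.
have : t * z <= t * c by apply: ler_wpM2l.
by clear; lra.
Qed.

Variables (q : int) (L : int -> int -> Prop) (m n : int) (E : pt2 -> pt2 -> Prop).
Hypothesis Lq : lattice q L.
Local Notation V := (Vbox L m n).
Hypothesis M : maximal R V E.
Local Notation on := (@on R E).

Lemma tri_good a b c : tri L E a b c -> good R V E a b c.
Proof.
move=> [Eab Ebc Eac bas].
have [Va Vb] := max_V M Eab; have [_ Vc] := max_V M Ebc.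
by have [emp D0] := basis_empty R Lq Va bas.
Qed.

Lemma good_tri a b c : good R V E a b c -> tri L E a b c.
Proof.
by move=> [[Va Vb Vc] [Eab Ebc Eac] emp D0]; split=> //; apply: (empty_basis Lq Va Vb Vc emp D0).
Qed.

Lemma spx_cases s l : spx L E s -> wt s l ->
  (exists a b (t : R), [/\ E a b, 0 <= t, t <= 1 &
     forall g, wsum s l g = (1 - t) * g a + t * g b]) \/
  (exists a b c (l1 l2 l3 : R), [/\ good R V E a b c, [/\ 0 < l1, 0 < l2 & 0 < l3],
     l1 + l2 + l3 = 1 & forall g, wsum s l g = l1 * g a + l2 * g b + l3 * g c]).
Proof.
case=> [a Ea|a b Eab|a b c T] wl.
- left; exists a, a, 0; split; rewrite ?ler01 // => g.
  by rewrite (wt1 wl); ring.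
- by left; have [t [t0 t1 H]] := wt2 wl; exists a, b, t.
have [l1 [l2 [l3 [[l10 l20 l30] ls H]]]] := wt3 wl.
have [Eab Ebc Eac _] := T.
have [e1|n1] := eqVneq l1 0.
  left; exists b, c, l3; split=> //; first by rewrite -ls e1 add0r lerDr.
  have -> : 1 - l3 = l2 by rewrite -ls e1 add0r addrK.
  by move=> g; rewrite H e1; ring.
have [e2|n2] := eqVneq l2 0.
  left; exists a, c, l3; split=> //; first by rewrite -ls e2 addr0 lerDr.
  have -> : 1 - l3 = l1 by rewrite -ls e2 addr0 addrK.
  by move=> g; rewrite H e2; ring.
have [e3|n3] := eqVneq l3 0.
  left; exists a, b, l2; split=> //; first by rewrite -ls e3 addr0 lerDr.
  have -> : 1 - l2 = l1 by rewrite -ls e3 addr0 addrK.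
  by move=> g; rewrite H e3; ring.
right; exists a, b, c, l1, l2, l3; split=> //; first exact: tri_good.
by split; rewrite lt_neqAle eq_sym ?n1 ?n2 ?n3.
Qed.

Lemma max_FF : FF2 R (spx L E).
Proof.
move=> s t l k Ks Kt ws wtk ex ey g.
have [[a [b [u [Eab u0 u1 H]]]]|[a [b [c [l1 [l2 [l3 [G [l10 l20 l30] ls H]]]]]]]] := spx_cases Ks ws;
have [[a' [b' [u' [Eab' u0' u1' H']]]]|[a' [b' [c' [l1' [l2' [l3' [G' [l10' l20' l30'] ls' H']]]]]]]] :=
  spx_cases Kt wtk.
- rewrite H H'; move: ex ey; rewrite !H !H' => ex ey.
  exact: (max_compat M Eab Eab' u0 u1 u0' u1' ex ey).
- case: (interior_free M G' l10' l20' l30' ls').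
  by exists a, b, u; split=> //; rewrite -H' ?H /mx /my ?[RHS]H // -?ex -?ey H.
- case: (interior_free M G l10 l20 l30 ls).
  by exists a', b', u'; split=> //; rewrite -H ?ex ?ey H'.
- rewrite H H'; apply: (interior_interior M G G') => //.
    by rewrite -H -H'.
  by rewrite -H -H'.
Qed.

Hypotheses (m0 : 0 < m) (n0 : 0 < n).
Hypotheses (V00 : V (0, 0)) (Vm0 : V (m, 0)) (V0n : V (0, n)).
Hypothesis bd : forall x y : R, 0 <= x -> x <= m%:~R -> 0 <= y -> y <= n%:~R ->
  [|| x == 0, x == m%:~R, y == 0 | y == n%:~R] -> on x y.

Lemma Vbox_real v : V v -> [/\ 0 <= rx v, rx v <= m%:~R, 0 <= ry v & ry v <= n%:~R].
Proof. by move=> [_ h1 h2 h3 h4]; rewrite /rx /ry !ler0z !ler_int. Qed.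

Local Notation covered := (fun x y => exists a b c, good R V E a b c /\ in_tri a b c x y).

Lemma good_fin : exists vs : seq pt2, forall a b c, good R V E a b c ->
  [/\ det2 R a b c != 0, a \in vs, b \in vs & c \in vs].
Proof.
have [vs H] := max_Vfin M; exists vs => a b c [[Va Vb Vc] _ _ D0].
by split=> //; apply: H.
Qed.

Lemma covered_off (x y : R) : 0 <= x -> x <= m%:~R -> 0 <= y -> y <= n%:~R -> ~ on x y -> covered x y.
Proof.
move=> x0 xm y0 yn nxy.
have [a [b [c [h1 h2 h3 h4 h5]]]] := cover_off M V00 Vbox_real bd x0 xm y0 yn nxy.
by exists a, b, c.
Qed.

Lemma covered_nonvertex (x y : R) : 0 <= x -> x <= m%:~R -> 0 <= y -> y <= n%:~R ->
  (forall v, V v -> ~ (rx v = x /\ ry v = y)) -> covered x y.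
Proof.
move=> x0 xm y0 yn nv.
have [onxy|/(covered_off x0 xm y0 yn)//] := pselect (on x y).
have [a [b [s [Eab s0 s1 e1 e2]]]] := onxy.
have [Va Vb] := max_V M Eab.
have sn0 : s != 0.
  by apply/eqP => ss; apply: (nv a) => //; rewrite e1 e2 ss /mx /my; split; ring.
have sn1 : s != 1.
  by apply/eqP => ss; apply: (nv b) => //; rewrite e1 e2 ss /mx /my; split; ring.
have nab : a != b.
  by apply/eqP => ab; apply: (nv a) => //; rewrite e1 e2 -ab /mx /my; split; ring.
have s0' : 0 < s by rewrite lt_neqAle eq_sym sn0.
have s1' : s < 1 by rewrite lt_neqAle sn1.
have mR : (0 : R) < m%:~R by rewrite ltr0z.
have nR : (0 : R) < n%:~R by rewrite ltr0z.
have [c [Vc D0]] : exists c, V c /\ det2 R a b c != 0.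
  have [h1|h1] := eqVneq (det2 R a b (0, 0)) 0; last by exists (0, 0).
  have [h2|h2] := eqVneq (det2 R a b (m, 0)) 0; last by exists (m, 0).
  exists (0, n); split=> //; apply/eqP => h3; case/eqP: nab.
  move: h1 h2 h3; rewrite /det2 /rx /ry /= !mulr0z => h1 h2 h3.
  have k1 : m%:~R * ((b.2)%:~R - (a.2)%:~R) = 0 :> R by have := congr2 (fun u v => u - v) h1 h2; rewrite /= [X in _ = X]subrr => <-; ring.
  have k2 : n%:~R * ((b.1)%:~R - (a.1)%:~R) = 0 :> R by have := congr2 (fun u v => u - v) h3 h1; rewrite /= [X in _ = X]subrr => <-; ring.
  move/eqP: k1; rewrite mulf_eq0 (negbTE (lt0r_neq0 mR)) /= subr_eq0 => /eqP k1.
  move/eqP: k2; rewrite mulf_eq0 (negbTE (lt0r_neq0 nR)) /= subr_eq0 => /eqP k2.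
  exact: (@rxy_inj R).
have [c10 c1m c20 c2n] := Vbox_real Vc.
have nxc : (x != rx c) || (y != ry c).
  by rewrite -negb_and; apply/negP => /andP[/eqP ex /eqP ey]; apply: (nv c).
have [[t [t0 t1 ont fr]]|] := first_hit M nxc (on_vertex M Vc).
  have [vs Hvs] := good_fin.
  apply: (cover_closed Hvs t0 (d1 := rx c - x) (d2 := ry c - y)) => u u0 ut.
  have u1 : u <= 1 by apply: ltW; apply: lt_le_trans ut t1.
  have [b1 b2] := box_convex x0 xm c10 c1m (ltW u0) u1.
  have [b3 b4] := box_convex y0 yn c20 c2n (ltW u0) u1.
  apply: covered_off => // onu; apply: (fr (u / t)).
  - exact: divr_gt0.
  - by rewrite ltr_pdivrMr // mul1r.
  by rewrite !at_frac ?lt0r_neq0.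
move=> [p [r [s' [t [s'' [Epr [s0'' s1'' f1 f2] [t0 s0''' s1''' g1 g2]]]]]]]; exfalso.
have lin z1 z2 w : (z1 = mx w a b /\ z2 = my w a b) ->
   (rx b - rx a) * (z2 - ry a) - (ry b - ry a) * (z1 - rx a) = 0.
  by move=> [-> ->]; rewrite /mx /my; ring.
have [w [hw1 hw2]] : exists w, at_ x (rx c) t = mx w a b /\ at_ y (ry c) t = my w a b.
  have [[pa rb]|[pb ra]] := edge_relint M Epr Eab s0'' s1'' s0' s1' nab (etrans (esym f1) e1) (etrans (esym f2) e2).
    by exists s''; rewrite g1 g2 pa rb.
  by exists (1 - s''); rewrite g1 g2 pb ra /mx /my; split; ring.
have l1 := lin _ _ _ (conj hw1 hw2); have l2 := lin _ _ _ (conj e1 e2).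
case/eqP: D0; apply: (mulfI (lt0r_neq0 t0)); rewrite mulr0 /det2.
rewrite -[RHS]subr0 -{1}l1 -{1}(mulr0 (1 - t)) -{1}l2 /at_.
by ring.
Qed.

Lemma covered_all (x y : R) : 0 <= x -> x <= m%:~R -> 0 <= y -> y <= n%:~R -> covered x y.
Proof.
move=> x0 xm y0 yn.
have [[v [Vv [ex ey]]]|nv] := pselect (exists v, V v /\ (rx v = x /\ ry v = y)); last first.
  by apply: covered_nonvertex => // v Vv h; apply: nv; exists v.
have [vs Hvs] := good_fin.
have nint (w : pt2) (t : R) : 0 < t -> t < 1 -> rx w <> rx v + t.
  move=> t0 t1; rewrite /rx => h.
  have : ((w.1 - v.1)%:~R : R) = t by rewrite rmorphB /= h; ring.
  move=> h'; move: t0 t1; rewrite -h' ltr0z -[1]/(1%:~R) ltr_int.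
  by clear; lia.
have nint' (w : pt2) (t : R) : 0 < t -> t < 1 -> rx w <> rx v - t.
  move=> t0 t1; rewrite /rx => h.
  have : ((v.1 - w.1)%:~R : R) = t by rewrite rmorphB /= h; ring.
  move=> h'; move: t0 t1; rewrite -h' ltr0z -[1]/(1%:~R) ltr_int.
  by clear; lia.
have [_ v0 vm _ _] := Vv.
have [vm'|vm'] := ltP v.1 m.
  apply: (cover_closed Hvs ltr01 (d1 := 1) (d2 := 0)) => t t0 t1.
  rewrite mulr1 mulr0 addr0; apply: covered_nonvertex => //.
  - by apply: addr_ge0 => //; apply: ltW.
  - have : rx v + 1 <= m%:~R by rewrite /rx -[1]/(1%:~R) -rmorphD /= ler_int; move: vm'; clear; lia.
    by rewrite ex; apply: le_trans; rewrite lerD2l ltW.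
  - by move=> w Vw [h _]; apply: (nint w t) => //; rewrite h ex.
apply: (cover_closed Hvs ltr01 (d1 := -1) (d2 := 0)) => t t0 t1.
rewrite mulrN1 mulr0 addr0; apply: covered_nonvertex => //.
- have : 1 <= rx v by rewrite /rx -[1]/(1%:~R) ler_int; move: vm' m0; clear; lia.
  by rewrite ex subr_ge0; apply: le_trans; apply: ltW.
- by apply: le_trans xm; rewrite gerBl ltW.
- by move=> w Vw [h _]; apply: (nint' w t) => //; rewrite h ex.
Qed.

Lemma max_plane : plane R L m n E.
Proof.
split.
- by move=> a b /(max_V M).
- exact: (max_refl M).
- exact: (max_sym M).
- exact: max_FF.
move=> x y x0 xm y0 yn; have [a [b [c [G h]]]] := covered_all x0 xm y0 yn.
by exists a, b, c; split=> //; apply: good_tri.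
Qed.

End Completion.

Section Existence.
Variable R : realType.
Local Notation rx := (@rx R).
Local Notation ry := (@ry R).
Local Notation mx := (@mx R).
Local Notation my := (@my R).
Local Notation compat := (@compat R).

Lemma compat_sym a b c d : compat a b c d -> compat c d a b.
Proof. by move=> H s t s0 s1 t0 t1 ex ey g; rewrite (H t s). Qed.

Lemma compat_swap a b c d : compat a b c d -> compat b a c d.
Proof.
move=> H s t s0 s1 t0 t1 ex ey g.
have := H (1 - s) t; rewrite subr_ge0 s1 gerBl s0 t0 t1 => /(_ isT isT isT isT).
have -> : mx (1 - s) a b = mx s b a by rewrite /mx; ring.
have -> : my (1 - s) a b = my s b a by rewrite /my; ring.
by move=> /(_ ex ey g) <-; ring.
Qed.

Lemma mix_inj a b (s t : R) : mx s a b = mx t a b -> my s a b = my t a b -> s = t \/ a = b.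
Proof.
move=> ex ey; have [->|nst] := eqVneq s t; first by left.
have st : s - t != 0 by rewrite subr_eq0.
right; apply: (@rxy_inj R); apply: (mulfI st).
  have := congr2 (fun u v => u - v) ex ey; move: ex; rewrite /mx; clear => h _.
  by have := congr1 (fun u => u - ((1 - t) * rx a + t * rx b) ) h; rewrite subrr => h';
   apply/eqP; rewrite -subr_eq0; apply/eqP; rewrite -[RHS]oppr0 -h'; ring.
move: ey; rewrite /my; clear => h.
by have := congr1 (fun u => u - ((1 - t) * ry a + t * ry b) ) h; rewrite subrr => h';
   apply/eqP; rewrite -subr_eq0; apply/eqP; rewrite -[RHS]oppr0 -h'; ring.
Qed.

Lemma compat_self a b : compat a b a b.
Proof.
move=> s t s0 s1 t0 t1 ex ey g; have [->//|->] := mix_inj ex ey; ring.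
Qed.

Lemma vertex_value a b v (s : R) (g : pt2 -> R) : v = a \/ v = b ->
  rx v = mx s a b -> ry v = my s a b -> (1 - s) * g a + s * g b = g v.
Proof.
case=> -> ex ey.
  have [] := @mix_inj a b 0 s; rewrite -?ex -?ey /mx /my; [ring|ring| |].
    by move=> <-; ring.
  by move=> <-; ring.
have [] := @mix_inj a b 1 s; rewrite -?ex -?ey /mx /my; [ring|ring| |].
  by move=> <-; ring.
by move=> <-; ring.
Qed.

Variables (q : int) (L : int -> int -> Prop) (m n : int).
Hypothesis Lq : lattice q L.
Local Notation V := (Vbox L m n).

Definition prim a b := forall u (s : R), V u -> 0 <= s -> s <= 1 ->
  rx u = mx s a b -> ry u = my s a b -> u = a \/ u = b.

Definition meets a b c d := forall s t : R, 0 <= s -> s <= 1 -> 0 <= t -> t <= 1 ->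
  mx s a b = mx t c d -> my s a b = my t c d ->
  [\/ exists v, [/\ V v, rx v = mx s a b & ry v = my s a b], a = c /\ b = d | a = d /\ b = c].

Lemma meets_sym a b c d : meets a b c d -> meets c d a b.
Proof.
move=> H s t s0 s1 t0 t1 ex ey.
have [[v [Vv h1 h2]]|[h1 h2]|[h1 h2]] := H t s t0 t1 s0 s1 (esym ex) (esym ey).
- by constructor 1; exists v; rewrite ex ey.
- by constructor 2.
- by constructor 3.
Qed.

Lemma prim_compat a b c d : prim a b -> prim c d -> meets a b c d -> compat a b c d.
Proof.
move=> pab pcd H s t s0 s1 t0 t1 ex ey g.
have [[v [Vv h1 h2]]|[h1 h2]|[h1 h2]] := H s t s0 s1 t0 t1 ex ey.
- rewrite (vertex_value g (pab v s Vv s0 s1 h1 h2) h1 h2).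
  rewrite ex in h1; rewrite ey in h2.
  by rewrite (vertex_value g (pcd v t Vv t0 t1 h1 h2) h1 h2).
- by subst c d; apply: compat_self.
- by subst c d; apply: (compat_swap (@compat_self b a)).
Qed.

Lemma exists_maximal (E0 : pt2 -> pt2 -> Prop) :
  (forall a b, E0 a b -> V a /\ V b) -> (forall a, V a -> E0 a a) ->
  (forall a b c d, E0 a b -> E0 c d -> compat a b c d) ->
  exists E, maximal R V E /\ forall a b, E0 a b -> E a b.
Proof.
move=> EV Er Ec.
pose N := `|m|%N; pose N' := `|n|%N.
pose G : finType := ('I_N.+1 * 'I_N'.+1)%type.
pose io (p : G) : pt2 := ((p.1 : nat)%:Z, (p.2 : nat)%:Z).
have ioS v : V v -> exists p, io p = v.
  case: v => v1 v2 [_ /= h1 h2 h3 h4].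
  have k1 : (`|v1| < N.+1)%N by move: h1 h2; rewrite /N; clear; lia.
  have k2 : (`|v2| < N'.+1)%N by move: h3 h4; rewrite /N'; clear; lia.
  by exists (Ordinal k1, Ordinal k2); rewrite /io /=; congr pair; rewrite gez0_abs.
pose P (S : {set G * G}) := [forall e in S, `[< V (io e.1) /\ V (io e.2) >]] &&
   [forall e in S, [forall f in S, `[< compat (io e.1) (io e.2) (io f.1) (io f.2) >]]].
pose S0 := [set e : G * G | `[< E0 (io e.1) (io e.2) >]].
have P0 : P S0.
  apply/andP; split.
    by apply/forall_inP => e; rewrite inE => /asboolP h; apply/asboolP; apply: EV.
  apply/forall_inP => e; rewrite inE => /asboolP h; apply/forall_inP => f.
  by rewrite inE => /asboolP h'; apply/asboolP; apply: Ec.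
have [S Smax S0S] := maxset_exists P0.
have /andP[/forall_inP PV /forall_inP PC] := maxsetp Smax.
pose E a b := exists p q', [/\ io p = a, io q' = b & (p, q') \in S].
have E0E a b : E0 a b -> E a b.
  move=> Eab; have [/ioS[p ep] /ioS[q' eq']] := EV _ _ Eab.
  exists p, q'; split=> //; apply: (subsetP S0S); rewrite inE; apply/asboolP.
  by rewrite /= ep eq'.
have Emax a b : V a -> V b -> (forall c d, E c d -> compat a b c d) -> E a b.
  move=> Va Vb H; have [p ep] := ioS a Va; have [q' eq'] := ioS b Vb.
  exists p, q'; split=> //.
  suff <- : (p, q') |: S = S by rewrite setU11.
  apply: (maxsetsup Smax); last exact: subsetUr.
  have comp f : f \in S -> compat a b (io f.1) (io f.2).
    by move=> fS; apply: H; exists f.1, f.2; rewrite -surjective_pairing.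
  apply/andP; split.
    apply/forall_inP => e; rewrite in_setU1 => /orP[/eqP->/=|/PV//].
    by apply/asboolP; rewrite ep eq'.
  apply/forall_inP => e; rewrite in_setU1 => /orP[/eqP->/=|eS]; apply/forall_inP => f;
    rewrite in_setU1 => /orP[/eqP->/=|fS]; apply/asboolP; rewrite ?ep ?eq'.
  - exact: compat_self.
  - exact: comp.
  - by apply: compat_sym; apply: comp.
  - by have /forall_inP/(_ f fS)/asboolP := PC e eS.
have Ecomp a b c d : E a b -> E c d -> compat a b c d.
  move=> [p [q' [<- <- pS]]] [p' [q'' [<- <- pS']]].
  by have /forall_inP/(_ _ pS')/asboolP := PC _ pS.
have EVS a b : E a b -> V a /\ V b.
  by move=> [p [q' [<- <- pS]]]; have /asboolP := PV _ pS.
exists E; split=> //; split=> //.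
- by move=> a Va; apply: E0E; apply: Er.
- move=> a b Eab; have [Va Vb] := EVS _ _ Eab; apply: Emax => // c d Ecd.
  by apply: compat_swap; apply: Ecomp.
- exists [seq (io e.1, io e.2) | e : G * G in S] => a b [p [q' [<- <- pS]]].
  by apply/mapP; exists (p, q') => //; rewrite mem_enum.
Qed.

Theorem planar_completion (E1 : pt2 -> pt2 -> Prop) :
  0 < m -> 0 < n -> V (0, 0) -> V (m, 0) -> V (0, n) ->
  (forall a b, E1 a b -> [/\ V a, V b & prim a b]) ->
  (forall a b c d, E1 a b -> E1 c d -> meets a b c d) ->
  (forall x y : R, 0 <= x -> x <= m%:~R -> 0 <= y -> y <= n%:~R ->
    [|| x == 0, x == m%:~R, y == 0 | y == n%:~R] -> on E1 x y) ->
  exists E, plane R L m n E /\ forall a b, E1 a b -> E a b.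
Proof.
move=> m0 n0 V00 Vm0 V0n EV Em bd.
pose E0 a b := E1 a b \/ (a = b /\ V a).
have p0 a : V a -> prim a a.
  move=> Va u s Vu s0 s1 ex ey; left; apply: (@rxy_inj R); rewrite ?ex ?ey /mx /my; ring.
have mm u (t : R) : mx t u u = rx u /\ my t u u = ry u by rewrite /mx /my; split; ring.
have [E [M E0E]] : exists E, maximal R V E /\ forall a b, E0 a b -> E a b.
  apply: exists_maximal.
  - by move=> a b [/EV[]|[<-]].
  - by move=> a Va; right.
  move=> a b c d [h|[<- Va]] [h'|[<- Vc]].
  - by apply: prim_compat; [have [] := EV _ _ h|have [] := EV _ _ h'|exact: Em].
  - apply: prim_compat; [by have [] := EV _ _ h|exact: p0|].
    by move=> s t s0 s1 t0 t1 ex ey; constructor 1; exists c; have [h1 h2] := mm c t; rewrite ex ey h1 h2.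
  - apply: prim_compat; [exact: p0|by have [] := EV _ _ h'|].
    by move=> s t s0 s1 t0 t1 ex ey; constructor 1; exists a; have [h1 h2] := mm a s; rewrite h1 h2.
  - apply: prim_compat; [exact: p0|exact: p0|].
    by move=> s t s0 s1 t0 t1 ex ey; constructor 1; exists a; have [h1 h2] := mm a s; rewrite h1 h2.
exists E; split; last by move=> a b h; apply: E0E; left.
apply: (max_plane Lq M) => // x y x0 xm y0 yn h.
have [a [b [s [h1 h2 h3 h4 h5]]]] := bd x y x0 xm y0 yn h.
by exists a, b, s; split=> //; apply: E0E; left.
Qed.

End Existence.

(** * Piecewise linear functions *)

Section Lipschitz.
Variable R : realType.

Definition lip (f : R -> R) := exists2 C, 0 <= C & forall x y, `|f x - f y| <= C * `|x - y|.

Lemma lip_ivt (f : R -> R) : lip f -> 0 < f 0 -> f 1 < 0 ->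
  exists t, [/\ 0 < t, t < 1 & f t = 0].
Proof.
move=> [C C0 Cf] f0 f1.
pose S := [set t : R | 0 <= t /\ t <= 1 /\ 0 <= f t]%classic.
have S0 : S 0 by split; [exact: lexx|split; [exact: ler01|exact: ltW]].
have Sub : has_sup S.
  by split; [exists 0|exists 1 => t [_ []]].
pose s := sup S.
have s0 : 0 <= s by apply: (ub_le_sup (proj2 Sub)).
have s1 : s <= 1 by apply: ge_sup; [exists 0|move=> t [_ []]].
have C1 : 0 < C + 1 by apply: ltr_wpDl.
have near t : `|t - s| * (C + 1) < `|f s| -> 0 < `|f s| -> `|f t - f s| < `|f s|.
  move=> h _; apply: le_lt_trans (Cf t s) _; apply: le_lt_trans h.
  by rewrite mulrC; apply: ler_wpM2l => //; rewrite lerDl.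
have fs : f s = 0.
  apply/eqP; apply: contrapT => /negP fs.
  have fp : 0 < `|f s| by rewrite normr_gt0.
  have ep : 0 < `|f s| / (C + 1) by apply: divr_gt0.
  have [neg|pos] : f s < 0 \/ 0 < f s by case: (ltgtP (f s) 0) fs => //; [left|right].
    have [t [t0 [t1 ft]] st] := sup_adherent ep Sub.
    have ts : t <= s by apply: (ub_le_sup (proj2 Sub)); split.
    have := near t; rewrite -ltr_pdivlMr // ler0_norm ?subr_le0 // opprB.
    have -> : s - t < `|f s| / (C + 1) by move: st; rewrite -/s; clear; lra.
    move=> /(_ isT fp); rewrite (ltr0_norm neg) => h.
    have : f t - f s <= `|f t - f s| by apply: ler_norm.
    by move: h ft; clear; lra.
  have [ss|ss] := leP 1 s.
    by move: f1; rewrite (_ : 1 = s) ?ltNge ?(ltW pos) //; apply/eqP; rewrite eq_le ss s1.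
  pose u := Num.min (`|f s| / (C + 1)) (1 - s) / 2.
  have m0 : 0 < Num.min (`|f s| / (C + 1)) (1 - s) by rewrite lt_min ep subr_gt0.
  have u0 : 0 < u by apply: divr_gt0.
  have um : u < Num.min (`|f s| / (C + 1)) (1 - s).
    by rewrite /u; move: m0; set v := Num.min _ _; clearbody v; clear; lra.
  move: um; rewrite lt_min => /andP[u1 u2].
  have Su : S (s + u).
    split; first by apply: addr_ge0 => //; apply: ltW.
    split; first by move: u2; clear; lra.
    have := near (s + u); rewrite -ltr_pdivlMr // addrAC subrr add0r (gtr0_norm u0) u1.
    move=> /(_ isT fp); rewrite (gtr0_norm pos) => h.
    have : - (f (s + u) - f s) <= `|f (s + u) - f s| by rewrite -normrN; apply: ler_norm.
    by move: h; clear; lra.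
  have : s + u <= s by apply: (ub_le_sup (proj2 Sub)).
  by move: u0; clear; lra.
exists s; split=> //.
  by rewrite lt_neqAle s0 andbT; apply/eqP => e; move: fs f0; rewrite -e => ->; rewrite ltxx.
by rewrite lt_neqAle s1 andbT; apply/eqP => e; move: fs f1; rewrite e => ->; rewrite ltxx.
Qed.

Lemma lip_const c : lip (fun=> c).
Proof. by exists 0 => // x y; rewrite subrr normr0 mul0r. Qed.

Lemma lip_affine a b : lip (fun t => a + t * b).
Proof.
exists `|b| => // x y; rewrite (_ : a + x * b - (a + y * b) = b * (x - y)); last by ring.
by rewrite normrM.
Qed.

Lemma lipD f g : lip f -> lip g -> lip (fun t => f t + g t).
Proof.
move=> [C C0 Cf] [D D0 Dg]; exists (C + D) => [|x y]; first exact: addr_ge0.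
rewrite (_ : f x + g x - (f y + g y) = (f x - f y) + (g x - g y)); last by ring.
by apply: le_trans (ler_normD _ _) _; rewrite mulrDl lerD.
Qed.

Lemma lipM c f : lip f -> lip (fun t => c * f t).
Proof.
move=> [C C0 Cf]; exists (`|c| * C) => [|x y]; first by apply: mulr_ge0.
by rewrite -mulrBr normrM -mulrA ler_wpM2l.
Qed.

Lemma lipN f : lip f -> lip (fun t => - f t).
Proof.
by move=> [C C0 Cf]; exists C => // x y; rewrite -opprD normrN.
Qed.

Lemma lipB f g : lip f -> lip g -> lip (fun t => f t - g t).
Proof. by move=> hf hg; apply: lipD => //; apply: lipN. Qed.

Lemma norm_max (a b c d e : R) : `|a - c| <= e -> `|b - d| <= e -> `|Num.max a b - Num.max c d| <= e.
Proof.
rewrite !ler_norml => /andP[h1 h2] /andP[h3 h4].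
have [ab|ab] := leP a b; have [cd|cd] := leP c d; apply/andP; split;
 move: h1 h2 h3 h4 ab cd; clear; lra.
Qed.

Lemma lip_max f g : lip f -> lip g -> lip (fun t => Num.max (f t) (g t)).
Proof.
move=> [C C0 Cf] [D D0 Dg]; exists (C + D) => [|x y]; first exact: addr_ge0.
apply: norm_max; [apply: le_trans (Cf x y) _|apply: le_trans (Dg x y) _]; rewrite mulrDl ?lerDl ?lerDr;
 exact: mulr_ge0.
Qed.

Lemma minNmax (a b : R) : Num.min a b = - Num.max (- a) (- b).
Proof. by rewrite oppr_max !opprK. Qed.

Lemma lip_min f g : lip f -> lip g -> lip (fun t => Num.min (f t) (g t)).
Proof.
move=> hf hg; have [C C0 CC] := lipN (lip_max (lipN hf) (lipN hg)).
by exists C => // x y; rewrite !minNmax.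
Qed.

Lemma lip_norm f : lip f -> lip (fun t => `|f t|).
Proof.
move=> [C C0 Cf]; exists C => // x y; apply: le_trans (Cf x y); exact: ler_dist_dist.
Qed.

Lemma lip_comp f g : lip f -> lip g -> lip (fun t => f (g t)).
Proof.
move=> [C C0 Cf] [D D0 Dg]; exists (C * D) => [|x y]; first exact: mulr_ge0.
by apply: le_trans (Cf _ _) _; rewrite -mulrA ler_wpM2l.
Qed.

Lemma lip_sum N (f : 'I_N -> R -> R) : (forall i, lip (f i)) -> lip (fun t => \sum_i f i t).
Proof.
elim: N f => [|N IH] f H.
  by have [C C0 CC] := lip_const 0; exists C => // x y; rewrite !big_ord0; apply: (CC x y).
have [C C0 CC] := lipD (H ord0) (IH _ (fun i => H (lift ord0 i))).
by exists C => // x y; rewrite !big_ord_recl.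
Qed.

(* The piecewise linear function with value phi t at t = 0, ..., N. *)
Definition hat (y : R) : R := Num.max 0 (1 - `|y|).
Definition pl (phi : int -> int) (N : nat) (y : R) : R :=
  \sum_(i < N.+1) (phi i%:Z)%:~R * hat (y - i%:R).

Lemma hat_ge0 y : 0 <= hat y.
Proof. by rewrite /hat le_max lexx. Qed.

Lemma lip_hat : lip hat.
Proof.
apply: lip_max; first exact: lip_const.
apply: lipB; first exact: lip_const.
by apply: (@lip_norm (fun y => y)); exists 1 => // x y; rewrite mul1r.
Qed.

Lemma lip_pl phi N : lip (pl phi N).
Proof.
apply: lip_sum => i; apply: lipM; apply: lip_comp lip_hat _.
by exists 1 => // x y; rewrite mul1r opprB addrA subrK.
Qed.

Lemma hat_zero y : 1 <= `|y| -> hat y = 0.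
Proof. by move=> h; rewrite /hat; apply/max_idPl; rewrite subr_le0. Qed.

Lemma plE phi N (t : int) y : 0 <= t -> t + 1 <= N%:Z -> t%:~R <= y -> y <= t%:~R + 1 ->
  pl phi N y = (t%:~R + 1 - y) * (phi t)%:~R + (y - t%:~R) * (phi (t + 1))%:~R.
Proof.
case: t => // t _ tN ty yt; rewrite -pmulrn in ty yt *.
have t1 : (t < N.+1)%N by move: tN; clear; lia.
have t2 : (t.+1 < N.+1)%N by move: tN; clear; lia.
have tS : (t.+1)%:R = t%:R + 1 :> R by rewrite -addn1 natrD.
rewrite /pl (bigD1 (Ordinal t1)) //= (bigD1 (Ordinal t2)) /=; last first.
  by rewrite -val_eqE /=; clear; lia.
rewrite big1 ?addr0.
  have -> : hat (y - t%:R) = t%:R + 1 - y.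
    rewrite /hat ger0_norm ?subr_ge0 // (_ : 1 - (y - t%:R) = t%:R + 1 - y); last by ring.
    by apply/max_idPr; rewrite subr_ge0.
  have -> : hat (y - t.+1%:R) = y - t%:R.
    rewrite /hat ler0_norm ?tS; last by rewrite subr_le0.
    rewrite opprB (_ : 1 - (t%:R + 1 - y) = y - t%:R); last by ring.
    by apply/max_idPr; rewrite subr_ge0.
  have -> : (t%:Z + 1)%R = t.+1 by rewrite intS addrC.
  by ring.
move=> i /andP[]; rewrite -!val_eqE /= => it it'; rewrite hat_zero ?mulr0 //.
have [ilt|tlt] := ltnP i t.
  have : (i.+1)%:R <= t%:R :> R by rewrite ler_nat.
  rewrite -addn1 natrD => h; rewrite ger0_norm; move: h ty; clear; lra.
have tlt' : (t.+2 <= i)%N by move: it it' tlt; clear; lia.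
have : (t.+2)%:R <= i%:R :> R by rewrite ler_nat.
rewrite -addn2 natrD => h; rewrite ler0_norm; move: h yt; clear; lra.
Qed.

Lemma pl_le phi psi N y : (forall t : int, 0 <= t -> t <= N%:Z -> phi t <= psi t) ->
  pl phi N y <= pl psi N y.
Proof.
move=> H; apply: ler_sum => i _; apply: ler_wpM2r; first exact: hat_ge0.
by rewrite ler_int; apply: H => //; have := ltn_ord i; clear; lia.
Qed.

Lemma unit_cell (a b : int) (y : R) : a < b -> a%:~R <= y -> y <= b%:~R ->
  exists t : int, [/\ a <= t, t + 1 <= b, t%:~R <= y & y <= t%:~R + 1].
Proof.
move=> ab ay yb; have [y1|y1] := eqVneq y b%:~R.
  exists (b - 1); rewrite rmorphB /= y1; split; try by move: ab; clear; lia.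
    by rewrite gerBl ler01.
  by rewrite subrK.
exists (Num.floor y); split.
- by rewrite floor_ge_int.
- have : Num.floor y < b by rewrite floor_lt_int lt_neqAle y1.
  by clear; lia.
- exact: floor_le.
- by have := floorD1_gt y; rewrite rmorphD /= => /ltW.
Qed.

Lemma pl_int phi N (t : int) : 0 <= t -> t <= N%:Z -> pl phi N t%:~R = (phi t)%:~R.
Proof.
move=> t0 tN; have [tN'|tN'] := ltP t N%:Z.
  rewrite (@plE phi N t) ?lexx //; first by ring.
    by move: tN'; clear; lia.
  by rewrite lerDl.
have [t1|t1] := ltP 0 t; last first.
  have [t00 N0] : t = 0 /\ N = 0%N by move: t0 tN t1 tN'; clear; lia.
  rewrite t00 N0 /pl big_ord1 /= /hat subrr normr0 subr0 (max_idPr _) ?ler01 //; ring.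
have := @plE phi N (t - 1) t%:~R; rewrite subrK rmorphB /= => -> //.
- by ring.
- by move: t1; clear; lia.
- by rewrite gerBl.
- by rewrite subrK.
Qed.

Lemma pl_bounds phi N y (lo hi : int) : 0 <= y -> y <= N%:R ->
  (forall t : int, 0 <= t -> t <= N%:Z -> lo <= phi t /\ phi t <= hi) ->
  lo%:~R <= pl phi N y /\ pl phi N y <= hi%:~R.
Proof.
move=> y0 yN H; case: N yN H => [|N] yN H.
  have -> : y = (0 : int)%:~R by apply/eqP; rewrite eq_le y0 yN.
  by rewrite pl_int // !ler_int; apply: H.
have yN' : y <= (N.+1 : int)%:~R by rewrite -pmulrn.
have [t [t0 tN ty yt]] := @unit_cell 0 (N.+1 : int) y isT y0 yN'.
rewrite (plE _ t0 tN ty yt).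
have [h1 h2] : lo <= phi t /\ phi t <= hi by apply: H; move: t0 tN; clear; lia.
have [h3 h4] : lo <= phi (t + 1) /\ phi (t + 1) <= hi by apply: H; move: t0 tN; clear; lia.
have a0 : 0 <= t%:~R + 1 - y by rewrite subr_ge0.
have b0 : 0 <= y - t%:~R by rewrite subr_ge0.
have e c : c = (t%:~R + 1 - y) * c + (y - t%:~R) * c by ring.
by split; [rewrite [X in X <= _]e|rewrite [X in _ <= X]e]; apply: lerD; apply: ler_wpM2l; rewrite ?ler_int.
Qed.

End Lipschitz.

Section Side.
Variable R : realType.
Local Notation rx := (@rx R).
Local Notation ry := (@ry R).

Definition lip2 (h : R -> R -> R) := forall a b c d, lip (fun t => h (a + t * b) (c + t * d)).

Lemma lip2_x : lip2 (fun x _ => x).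
Proof. by move=> a b c d; apply: lip_affine. Qed.
Lemma lip2_y : lip2 (fun _ y => y).
Proof. by move=> a b c d; apply: lip_affine. Qed.
Lemma lip2_const k : lip2 (fun _ _ => k).
Proof. by move=> a b c d; apply: lip_const. Qed.
Lemma lip2B f g : lip2 f -> lip2 g -> lip2 (fun x y => f x y - g x y).
Proof. by move=> hf hg a b c d; apply: lipB; [apply: hf|apply: hg]. Qed.
Lemma lip2_min f g : lip2 f -> lip2 g -> lip2 (fun x y => Num.min (f x y) (g x y)).
Proof. by move=> hf hg a b c d; apply: lip_min; [apply: hf|apply: hg]. Qed.
Lemma lip2_pl phi N f : lip2 f -> lip2 (fun x y => pl phi N (f x y)).
Proof. by move=> hf a b c d; apply: lip_comp; [apply: lip_pl|apply: hf]. Qed.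

Variables (L : int -> int -> Prop) (m n : int) (E : pt2 -> pt2 -> Prop).
Hypothesis PL : plane R L m n E.

Lemma tri_neq a b c : tri L E a b c -> [/\ a != b, b != c & a != c].
Proof.
move=> [_ _ _ [D0 _]]; apply: (@det2_neq R); by rewrite det2E intr_eq0.
Qed.

Lemma plane_interior a b c (l1 l2 l3 : R) : tri L E a b c -> 0 < l1 -> 0 < l2 -> 0 < l3 ->
  l1 + l2 + l3 = 1 ->
  ~ on E (l1 * rx a + l2 * rx b + l3 * rx c) (l1 * ry a + l2 * ry b + l3 * ry c).
Proof.
move=> T l10 l20 l30 ls [p [r [s [Epr s0 s1 ex ey]]]].
have [nab nbc nac] := tri_neq T.
have w1 : wt [:: a; b; c] [:: l1; l2; l3].
  split=> //; last by rewrite !wsumE !mulr1 addr0 addrA ls.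
  by move=> x; rewrite !inE => /or3P[] /eqP->; apply: ltW.
have w2 : wt [:: p; r] [:: 1 - s; s].
  split=> //; last by rewrite !wsumE; ring.
  by move=> x; rewrite !inE => /orP[] /eqP->//; rewrite subr_ge0.
have H := pl_FF PL (Spx3 T) (Spx2 L Epr) w1 w2.
have {}H : forall g : pt2 -> R, l1 * g a + l2 * g b + l3 * g c = (1 - s) * g p + s * g r.
  move=> g; have := H _ _ g; rewrite !wsumE !addr0 !addrA; apply.
    by rewrite ex.
  by rewrite ey.
have in2 v (l : R) : 0 < l -> l = (1 - s) * eq_ind R v p + s * eq_ind R v r -> v = p \/ v = r.
  rewrite /eq_ind => l0; have [->|np] := eqVneq p v; first by left.
  have [->|nr] := eqVneq r v; first by right.
  by rewrite !mulr0 addr0 => l00; rewrite l00 ltxx in l0.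
have ha : a = p \/ a = r.
  apply: (in2 _ l1) => //; rewrite -H /eq_ind eqxx [b == a]eq_sym [c == a]eq_sym.
  by rewrite (negbTE nab) (negbTE nac); ring.
have hb : b = p \/ b = r.
  apply: (in2 _ l2) => //; rewrite -H /eq_ind eqxx [c == b]eq_sym.
  by rewrite (negbTE nab) (negbTE nbc); ring.
have hc : c = p \/ c = r.
  apply: (in2 _ l3) => //; rewrite -H /eq_ind eqxx.
  by rewrite (negbTE nbc) (negbTE nac); ring.
by case: ha hb hc nab nbc nac => -> [] -> [] ->; rewrite ?eqxx.
Qed.

(* The intermediate value theorem along a segment inside the triangle. *)
Lemma triangle_side a b c (h : R -> R -> R) (x y z1 z2 : R) : tri L E a b c -> lip2 h ->
  (forall u v, 0 <= u -> u <= m%:~R -> 0 <= v -> v <= n%:~R -> h u v = 0 -> on E u v) ->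
  in_tri a b c x y -> 0 < h x y -> in_tri a b c z1 z2 -> 0 <= h z1 z2.
Proof.
move=> T hlip hz [l1 [l2 [l3 [[l10 l20 l30] ls ex ey]]]] hxy.
move=> [k1 [k2 [k3 [[k10 k20 k30] ks e1 e2]]]].
rewrite leNgt; apply/negP => hzn.
have [Eab Ebc _ _] := T.
have [Va Vb] := pl_V PL Eab; have [_ Vc] := pl_V PL Ebc.
pose g1 := (rx a + rx b + rx c) / 3; pose g2 := (ry a + ry b + ry c) / 3.
have mixed (m1 m2 m3 t : R) : 0 <= m1 -> 0 <= m2 -> 0 <= m3 -> m1 + m2 + m3 = 1 ->
   0 <= t -> t < 1 ->
   h (g1 + t * (m1 * rx a + m2 * rx b + m3 * rx c - g1))
     (g2 + t * (m1 * ry a + m2 * ry b + m3 * ry c - g2)) = 0 -> False.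
  move=> m10 m20 m30 ms t0 t1 h0.
  pose n1 := (1 - t) / 3 + t * m1; pose n2 := (1 - t) / 3 + t * m2; pose n3 := (1 - t) / 3 + t * m3.
  have t3 : 0 < (1 - t) / 3 by apply: divr_gt0 => //; rewrite subr_gt0.
  have n10 : 0 < n1 by apply: ltr_wpDr => //; apply: mulr_ge0.
  have n20 : 0 < n2 by apply: ltr_wpDr => //; apply: mulr_ge0.
  have n30 : 0 < n3 by apply: ltr_wpDr => //; apply: mulr_ge0.
  have ns : n1 + n2 + n3 = 1.
    transitivity ((1 - t) + t * (m1 + m2 + m3)); first by rewrite /n1 /n2 /n3; field.
    by rewrite ms; ring.
  apply: (plane_interior T n10 n20 n30 ns).
  have -> : n1 * rx a + n2 * rx b + n3 * rx c = g1 + t * (m1 * rx a + m2 * rx b + m3 * rx c - g1).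
    by rewrite /n1 /n2 /n3 /g1; field.
  have -> : n1 * ry a + n2 * ry b + n3 * ry c = g2 + t * (m1 * ry a + m2 * ry b + m3 * ry c - g2).
    by rewrite /n1 /n2 /n3 /g2; field.
  have bd (B : R) (A1 A2 A3 : R) : 0 <= A1 -> A1 <= B -> 0 <= A2 -> A2 <= B -> 0 <= A3 -> A3 <= B ->
     0 <= n1 * A1 + n2 * A2 + n3 * A3 /\ n1 * A1 + n2 * A2 + n3 * A3 <= B.
    move=> a0 aB b0 bB c0 cB; split; first by do 2?apply: addr_ge0; apply: mulr_ge0 => //; apply: ltW.
    have -> : B = n1 * B + n2 * B + n3 * B by rewrite -!mulrDl ns mul1r.
    by do 2?apply: lerD; apply: ler_wpM2l => //; apply: ltW.
  have e1' : n1 * rx a + n2 * rx b + n3 * rx c = g1 + t * (m1 * rx a + m2 * rx b + m3 * rx c - g1).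
    by rewrite /n1 /n2 /n3 /g1; field.
  have e2' : n1 * ry a + n2 * ry b + n3 * ry c = g2 + t * (m1 * ry a + m2 * ry b + m3 * ry c - g2).
    by rewrite /n1 /n2 /n3 /g2; field.
  have [_ a1 a2 a3 a4] := Va; have [_ b1 b2 b3 b4] := Vb; have [_ c1 c2 c3 c4] := Vc.
  have [u1 u2] : 0 <= n1 * rx a + n2 * rx b + n3 * rx c /\ n1 * rx a + n2 * rx b + n3 * rx c <= m%:~R.
    by apply: bd; rewrite /rx ?ler0z ?ler_int.
  have [u3 u4] : 0 <= n1 * ry a + n2 * ry b + n3 * ry c /\ n1 * ry a + n2 * ry b + n3 * ry c <= n%:~R.
    by apply: bd; rewrite /ry ?ler0z ?ler_int.
  by apply: hz => //; rewrite -?e1' -?e2'.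
have [gn|gp|g0] := ltgtP (h g1 g2) 0.
- have lipf := lipN (hlip g1 (x - g1) g2 (y - g2)).
  have [] := lip_ivt lipf; rewrite ?mul0r ?addr0 ?mul1r ?[_ + (_ - _)]addrC ?subrK ?oppr_gt0 ?oppr_lt0 //.
  move=> t [t0 t1 /eqP]; rewrite oppr_eq0 => /eqP ht.
  by apply: (mixed l1 l2 l3 t) => //; [apply: ltW|rewrite -ex -ey].
- have lipf := hlip g1 (z1 - g1) g2 (z2 - g2).
  have [] := lip_ivt lipf; rewrite ?mul0r ?addr0 ?mul1r ?[_ + (_ - _)]addrC ?subrK //.
  move=> t [t0 t1 ht].
  by apply: (mixed k1 k2 k3 t) => //; [apply: ltW|rewrite -e1 -e2].
by apply: (mixed l1 l2 l3 0) => //; rewrite !mul0r !addr0.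
Qed.

End Side.

Notation pt3 := (int * int * int)%type.

Definition lift3 (z : int) (s : seq pt2) : seq pt3 := [seq (v, z) | v <- s].

Definition zsum (P : Type) (s : seq P) (c : seq int) (g : P -> int) : int :=
  \sum_(i <- zip s c) i.2 * g i.1.

Lemma zsum_cons P (a : P) s x c g : zsum (a :: s) (x :: c) g = x * g a + zsum s c g.
Proof. by rewrite /zsum /= big_cons. Qed.

Lemma zsum_nil P c (g : P -> int) : zsum [::] c g = 0.
Proof. by rewrite /zsum; case: c => [|x c]; rewrite big_nil. Qed.

Definition zsumE := (zsum_cons, zsum_nil).

Definition uni3 (L : int -> int -> Prop) (T : seq pt3) :=
  (forall c, size c = size T -> zsum T c (fun=> 1) = 0 -> zsum T c (fun v => v.1.1) = 0 ->
     zsum T c (fun v => v.1.2) = 0 -> zsum T c (fun v => v.2) = 0 -> forall x, x \in c -> x = 0) /\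
  (forall x y z, L x y -> exists c, [/\ size c = size T, zsum T c (fun=> 1) = 1,
     zsum T c (fun v => v.1.1) = x, zsum T c (fun v => v.1.2) = y & zsum T c (fun v => v.2) = z]).

(* The directions of the edges of Delta', up to sign and degenerate vectors. *)
Definition stdir (q : int) (v w : pt3) := exists (e : pt3) (s : int),
  [/\ e \in [:: (q, 0, 0); (0, q, 0); (0, 0, 1); (0, q, 1); (- q, 0, 1); (- q, q, 1)],
      w.1.1 - v.1.1 = s * e.1.1, w.1.2 - v.1.2 = s * e.1.2 & w.2 - v.2 = s * e.2].

Definition same_facet (q A B : int) (v w : pt3) :=
  [\/ v.1.1 = 0 /\ w.1.1 = 0, v.1.2 = 0 /\ w.1.2 = 0,
      v.1.1 = (A - v.2) * q /\ w.1.1 = (A - w.2) * q |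
      v.1.2 = (B + v.2) * q /\ w.1.2 = (B + w.2) * q].

Section Half.
Variable R : realType.
Local Notation rx := (@rx R).
Local Notation ry := (@ry R).
Local Notation wt := (@wt R).
Local Notation wsum := (@wsum R).

Definition tx (v : pt3) : R := (v.1.1)%:~R.
Definition ty (v : pt3) : R := (v.1.2)%:~R.
Definition tz (v : pt3) : R := (v.2)%:~R.

Definition FF3 (K : seq pt3 -> Prop) := forall S T l m, K S -> K T -> wt S l -> wt T m ->
  wsum S l tx = wsum T m tx -> wsum S l ty = wsum T m ty -> wsum S l tz = wsum T m tz ->
  forall g, wsum S l g = wsum T m g.

Definition covers (K : seq pt3 -> Prop) (x y z : R) := exists T l,
  [/\ K T, wt T l, wsum T l tx = x, wsum T l ty = y & wsum T l tz = z].

(* A triangulation of the part of a dilated tetrahedron above (or below) a horizontal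
   section of size A q x B q, with trace E on that section. *)
Record half (q : int) (L : int -> int -> Prop) (A B : int) (E : pt2 -> pt2 -> Prop)
    (P : seq pt3 -> Prop) : Prop := Half {
  hf_size : forall T, P T -> size T = 4;
  hf_in : forall T v, P T -> v \in T -> [/\ L v.1.1 v.1.2, 0 <= v.2 /\ v.2 <= A,
     0 <= v.1.1 /\ v.1.1 <= (A - v.2) * q & 0 <= v.1.2 /\ v.1.2 <= (B + v.2) * q];
  hf_uni : forall T, P T -> uni3 L T;
  hf_cov : forall x y z : R, 0 <= z -> z < A%:~R -> 0 <= x -> x <= (A%:~R - z) * q%:~R ->
     0 <= y -> y <= (B%:~R + z) * q%:~R -> covers P x y z;
  hf_top : 0 < A -> forall y : R, 0 <= y -> y <= (A + B)%:~R * q%:~R -> covers P 0 y A%:~R;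
  hf_FF : FF3 P;
  hf_trace : forall T l, P T -> wt T l -> wsum T l tz = 0 ->
     exists s m, [/\ spx L E s, wt s m & forall g : pt3 -> R, wsum T l g = wsum s m (fun v => g (v, 0))];
  hf_std : forall T v w, P T -> v \in T -> w \in T -> same_facet q A B v w -> stdir q v w }.

Record slab (q : int) (L : int -> int -> Prop) (A B : int) (E E' : pt2 -> pt2 -> Prop)
    (M : seq pt2 -> seq pt2 -> Prop) : Prop := Slab {
  sl_low : forall s t, M s t -> spx L E s;
  sl_high : forall s t, M s t -> spx L E' t;
  sl_size : forall s t, M s t -> (size s + size t = 4)%N;
  sl_low_in : forall s t v, M s t -> v \in s ->
     [/\ L v.1 v.2, 0 <= v.1 /\ v.1 <= A * q & 0 <= v.2 /\ v.2 <= B * q];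
  sl_high_in : forall s t v, M s t -> v \in t ->
     [/\ L v.1 v.2, 0 <= v.1 /\ v.1 <= (A - 1) * q & 0 <= v.2 /\ v.2 <= (B + 1) * q];
  sl_edges : forall a b c d, M [:: a; b] [:: c; d] -> basis2 L (sub2 b a) (sub2 d c);
  sl_uniq : forall s t s' t' l k l' k' (u : R), M s t -> M s' t' -> wt s l -> wt t k ->
     wt s' l' -> wt t' k' -> 0 < u -> u < 1 ->
     (1 - u) * wsum s l rx + u * wsum t k rx = (1 - u) * wsum s' l' rx + u * wsum t' k' rx ->
     (1 - u) * wsum s l ry + u * wsum t k ry = (1 - u) * wsum s' l' ry + u * wsum t' k' ry ->
     wsum s l rx = wsum s' l' rx /\ wsum s l ry = wsum s' l' ry;
  sl_cov : forall x y u : R, 0 <= u -> u < 1 -> 0 <= x -> x <= (A%:~R - u) * q%:~R ->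
     0 <= y -> y <= (B%:~R + u) * q%:~R ->
     exists s t l k, [/\ M s t, wt s l, wt t k,
       x = (1 - u) * wsum s l rx + u * wsum t k rx & y = (1 - u) * wsum s l ry + u * wsum t k ry];
  sl_top : A = 1 -> forall y : R, 0 <= y -> y <= (A + B)%:~R * q%:~R ->
     exists s t k, [/\ M s t, wt t k, wsum t k rx = 0 & wsum t k ry = y];
  sl_std : forall s t v w, M s t -> v \in s -> w \in t ->
     [/\ v.1 = 0 -> w.1 = 0 -> w.2 = v.2 \/ w.2 = v.2 + q,
         v.2 = 0 -> w.2 = 0 -> w.1 = v.1 \/ w.1 = v.1 - q,
         v.1 = A * q -> w.1 = (A - 1) * q -> w.2 = v.2 \/ w.2 = v.2 + q &
         v.2 = B * q -> w.2 = (B + 1) * q -> w.1 = v.1 \/ w.1 = v.1 - q] }.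

Lemma wsum_cat P (s t : seq P) l k g : size l = size s ->
  wsum (s ++ t) (l ++ k) g = wsum s l g + wsum t k g.
Proof. by move=> e; rewrite /wsum zip_cat // big_cat. Qed.

Lemma wsum_map P Q (f : P -> Q) s l g : wsum (map f s) l g = wsum s l (fun v => g (f v)).
Proof.
elim: s l => [|a s IH] [|x l]; rewrite /= ?wsumE //.
by rewrite /wsum !big_nil.
by rewrite IH.
Qed.

Lemma wsum_scale P (s : seq P) l (c : R) g : wsum s (map ( *%R c) l) g = c * wsum s l g.
Proof.
elim: s l => [|a s IH] [|x l]; rewrite /= ?wsumE ?mulr0 //.
  by rewrite /wsum !big_nil mulr0.
by rewrite IH mulrDr mulrA.
Qed.

Lemma wsum_ge0 P (s : seq P) l g : (forall x, x \in l -> 0 <= x) -> (forall v, 0 <= g v) ->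
  0 <= wsum s l g.
Proof.
move=> l0 g0; elim: s l l0 => [|a s IH] [|x l] l0; rewrite ?wsumE //.
  by rewrite /wsum big_nil.
apply: addr_ge0; first by apply: mulr_ge0 => //; apply: l0; rewrite inE eqxx.
by apply: IH => y yl; apply: l0; rewrite inE yl orbT.
Qed.

Lemma wsum_zero P (s : seq P) l g : size l = size s -> (forall x, x \in l -> 0 <= x) ->
  wsum s l (fun=> 1) = 0 -> wsum s l g = 0.
Proof.
elim: s l => [|a s IH] [|x l] //; first by move=> *; rewrite wsumE.
move=> [e] l0; rewrite !wsumE mulr1 => h.
have x0 : 0 <= x by apply: l0; rewrite inE eqxx.
have l0' : forall y, y \in l -> 0 <= y by move=> y yl; apply: l0; rewrite inE yl orbT.
have w0 : 0 <= wsum s l (fun=> 1) by apply: wsum_ge0.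
have [x00 w00] : x = 0 /\ wsum s l (fun=> 1) = 0.
  by split; apply/eqP; rewrite eq_le ?x0 ?w0 ?andbT -?h ?lerDl ?lerDr.
by rewrite x00 mul0r add0r; apply: IH.
Qed.

Lemma wsum_const P (s : seq P) l (c : R) : wsum s l (fun=> c) = c * wsum s l (fun=> 1).
Proof.
elim: s l => [|a s IH] [|x l]; rewrite ?wsumE ?mulr0 //.
  by rewrite /wsum !big_nil mulr0.
by rewrite IH mulr1 mulrDr [c * x]mulrC.
Qed.

Lemma wsumD P (s : seq P) l g h : wsum s l (fun v => g v + h v) = wsum s l g + wsum s l h.
Proof.
elim: s l => [|a s IH] [|x l]; rewrite ?wsumE ?addr0 //.
  by rewrite /wsum !big_nil addr0.
by rewrite IH mulrDr addrACA.
Qed.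

Lemma wsum_ext P (s : seq P) l g h : g =1 h -> wsum s l g = wsum s l h.
Proof. by move=> e; apply: eq_bigr => i _; rewrite e. Qed.

Lemma wt_exists P (a : P) s : exists l, wt (a :: s) l.
Proof.
exists (1 :: nseq (size s) 0); split; first by rewrite /= size_nseq.
  by move=> x; rewrite inE => /orP[/eqP->//|/nseqP[->]].
rewrite wsumE mulr1 (_ : wsum s _ _ = 0) ?addr0 //.
by elim: s => [|b s IH]; rewrite /= ?wsumE // mul0r add0r.
Qed.

Lemma wt_scale P (s : seq P) l (c : R) : size l = size s -> (forall x, x \in l -> 0 <= x) ->
  0 < c -> wsum s l (fun=> 1) = c -> exists m, wt s m /\ forall g, wsum s l g = c * wsum s m g.
Proof.
move=> e l0 c0 ec; exists (map ( *%R c^-1) l); split; first split.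
- by rewrite size_map.
- by move=> x /mapP[y yl ->]; apply: mulr_ge0; [rewrite invr_ge0 ltW|apply: l0].
- by rewrite wsum_scale ec mulVf // lt0r_neq0.
by move=> g; rewrite wsum_scale mulrA divff ?mul1r // lt0r_neq0.
Qed.

Lemma slab_split a s b t l : wt (lift3 0 (a :: s) ++ lift3 1 (b :: t)) l ->
  exists u m k, [/\ 0 <= u, u <= 1, wt (a :: s) m, wt (b :: t) k &
   forall g : pt3 -> R, wsum (lift3 0 (a :: s) ++ lift3 1 (b :: t)) l g =
     (1 - u) * wsum (a :: s) m (fun v => g (v, 0)) + u * wsum (b :: t) k (fun v => g (v, 1))].
Proof.
move=> [sl l0 ls].
set l1 := take (size (a :: s)) l; set l2 := drop (size (a :: s)) l.
have el : l = l1 ++ l2 by rewrite cat_take_drop.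
have sl' : size l = (size (a :: s) + size (b :: t))%N by rewrite sl size_cat !size_map.
have s1 : size l1 = size (a :: s) by rewrite size_takel // sl' leq_addr.
have s2 : size l2 = size (b :: t) by rewrite size_drop sl' addKn.
have l10 x : x \in l1 -> 0 <= x by move=> h; apply: l0; rewrite el mem_cat h.
have l20 x : x \in l2 -> 0 <= x by move=> h; apply: l0; rewrite el mem_cat h orbT.
have W g : wsum (lift3 0 (a :: s) ++ lift3 1 (b :: t)) l g =
   wsum (a :: s) l1 (fun v => g (v, 0)) + wsum (b :: t) l2 (fun v => g (v, 1)).
  by rewrite {1}el wsum_cat ?size_map // !wsum_map.
clearbody l1 l2.
set u := wsum (b :: t) l2 (fun=> 1).
have u0 : 0 <= u by apply: wsum_ge0.
have eu : wsum (a :: s) l1 (fun=> 1) = 1 - u.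
  by apply/eqP; rewrite -subr_eq opprK; apply/eqP; have := W (fun=> 1); rewrite ls => <-.
have u1 : u <= 1.
  have : 0 <= wsum (a :: s) l1 (fun=> 1) by apply: wsum_ge0.
  by rewrite eu subr_ge0.
have [m [wm Hm]] : exists m, wt (a :: s) m /\ forall g, wsum (a :: s) l1 g = (1 - u) * wsum (a :: s) m g.
  have [e|n] := eqVneq (1 - u) 0; last by apply: wt_scale => //; rewrite lt_neqAle eq_sym n subr_ge0.
  have [m wm] := wt_exists a s; exists m; split=> // g.
  by rewrite e mul0r; apply: wsum_zero => //; rewrite eu.
have [k [wk Hk]] : exists k, wt (b :: t) k /\ forall g, wsum (b :: t) l2 g = u * wsum (b :: t) k g.
  have [e|n] := eqVneq u 0; last by apply: wt_scale => //; rewrite lt_neqAle eq_sym n.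
  have [k wk] := wt_exists b t; exists k; split=> // g.
  by rewrite e mul0r; apply: wsum_zero.
by exists u, m, k; split=> // g; rewrite W Hm Hk.
Qed.

Lemma slab_join s t m k (u : R) : 0 <= u -> u <= 1 -> wt s m -> wt t k ->
  exists l, wt (lift3 0 s ++ lift3 1 t) l /\
   forall g : pt3 -> R, wsum (lift3 0 s ++ lift3 1 t) l g =
     (1 - u) * wsum s m (fun v => g (v, 0)) + u * wsum t k (fun v => g (v, 1)).
Proof.
move=> u0 u1 [sm m0 ms] [sk k0 ks].
have W g : wsum (lift3 0 s ++ lift3 1 t) (map ( *%R (1 - u)) m ++ map ( *%R u) k) g =
     (1 - u) * wsum s m (fun v => g (v, 0)) + u * wsum t k (fun v => g (v, 1)).
  by rewrite wsum_cat ?size_map // !wsum_map !wsum_scale.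
exists (map ( *%R (1 - u)) m ++ map ( *%R u) k); split=> //; split.
- by rewrite !size_cat !size_map sm sk.
- move=> x; rewrite mem_cat => /orP[] /mapP[y yl ->]; apply: mulr_ge0 => //.
  + by rewrite subr_ge0.
  + exact: m0.
  + exact: k0.
- by rewrite W ms ks; ring.
Qed.

End Half.

Lemma mulr_eq0l (D x : int) : D != 0 -> D * x = 0 -> x = 0.
Proof. by move=> D0 /eqP; rewrite mulf_eq0 (negbTE D0) => /eqP. Qed.

Lemma lat_scale q L a b (i : int) : lattice q L -> L a b -> L (i * a) (i * b).
Proof.
move=> Lq Lab; have L0 : L 0 0 by have := lat_B Lq Lab Lab; rewrite !subrr.
have LN u v : L u v -> L (- u) (- v) by move=> h; have := lat_B Lq L0 h; rewrite !sub0r.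
have Lmn (j : nat) : L (a *+ j) (b *+ j).
  elim: j => [|j IH]; rewrite ?mulr0n // !mulrS.
  by have := lat_B Lq Lab (LN _ _ IH); rewrite !opprK.
case: i => i; first by have := Lmn i; rewrite !pmulrn !mulrzz ![_ * Posz i]mulrC.
by have := LN _ _ (Lmn i.+1); rewrite !pmulrn !mulrzz NegzE !mulNr ![_ * Posz i.+1]mulrC.
Qed.

Lemma lat_D q L a b c d : lattice q L -> L a b -> L c d -> L (a + c) (b + d).
Proof.
move=> Lq Lab Lcd; have := lat_scale (-1) Lq Lcd; rewrite !mulN1r => h.
by have := lat_B Lq Lab h; rewrite !opprK.
Qed.

Lemma basis2_free L (u v : pt2) (i j : int) : basis2 L u v ->
  i * u.1 + j * v.1 = 0 -> i * u.2 + j * v.2 = 0 -> i = 0 /\ j = 0.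
Proof.
move=> [D0 _] e1 e2; split; apply: (mulr_eq0l D0).
  transitivity ((i * u.1 + j * v.1) * v.2 - (i * u.2 + j * v.2) * v.1); first by ring.
  by rewrite e1 e2 !mul0r.
transitivity ((i * u.2 + j * v.2) * u.1 - (i * u.1 + j * v.1) * u.2); first by ring.
by rewrite e1 e2 !mul0r.
Qed.

Section Uni.
Variables (q : int) (L : int -> int -> Prop).
Hypothesis Lq : lattice q L.

Lemma uni3_31 a b c d : L a.1 a.2 -> L d.1 d.2 -> basis2 L (sub2 b a) (sub2 c a) ->
  uni3 L (lift3 0 [:: a; b; c] ++ lift3 1 [:: d]).
Proof.
move=> La Ld bas; split.
  case=> [|c1 [|c2 [|c3 [|c4 [|? ?]]]]] // _; rewrite !zsumE /= => e1 e2 e3 e4.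
  have c40 : c4 = 0 by move: e4; clear; lia.
  subst c4.
  have c1E : c1 = - c2 - c3 by move: e1; clear; lia.
  have [] := basis2_free (i := c2) (j := c3) bas.
  - by transitivity (c1 * a.1 + (c2 * b.1 + (c3 * c.1 + (0 * d.1 + 0)))) => //; rewrite c1E /sub2 /=; ring.
  - by transitivity (c1 * a.2 + (c2 * b.2 + (c3 * c.2 + (0 * d.2 + 0)))) => //; rewrite c1E /sub2 /=; ring.
  move=> c20 c30 x; subst c2 c3; rewrite !inE c1E => /or4P[] /eqP->//.
move=> x y z Lxy.
have [_ bb] := bas.
have Lw : L (x - (z * d.1 + (1 - z) * a.1)) (y - (z * d.2 + (1 - z) * a.2)).
  by apply: (lat_B Lq Lxy); apply: (lat_D Lq); apply: (lat_scale _ Lq).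
have [i [j [ei ej]]] := bb _ _ Lw.
exists [:: 1 - z - i - j; i; j; z]; split=> //; rewrite !zsumE /=; [ring| | |ring].
  transitivity (i * (sub2 b a).1 + j * (sub2 c a).1 + (z * d.1 + (1 - z) * a.1)); last by rewrite -ei subrK.
  by rewrite /sub2 /=; ring.
transitivity (i * (sub2 b a).2 + j * (sub2 c a).2 + (z * d.2 + (1 - z) * a.2)); last by rewrite -ej subrK.
by rewrite /sub2 /=; ring.
Qed.

Lemma uni3_13 a b c d : L a.1 a.2 -> L b.1 b.2 -> basis2 L (sub2 c b) (sub2 d b) ->
  uni3 L (lift3 0 [:: a] ++ lift3 1 [:: b; c; d]).
Proof.
move=> La Lb bas; split.
  case=> [|c1 [|c2 [|c3 [|c4 [|? ?]]]]] // _; rewrite !zsumE /= => e1 e2 e3 e4.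
  have c10 : c1 = 0 by move: e1 e4; clear; lia.
  subst c1.
  have c2E : c2 = - c3 - c4 by move: e1; clear; lia.
  have [] := basis2_free (i := c3) (j := c4) bas.
  - by transitivity (0 * a.1 + (c2 * b.1 + (c3 * c.1 + (c4 * d.1 + 0)))) => //; rewrite c2E /sub2 /=; ring.
  - by transitivity (0 * a.2 + (c2 * b.2 + (c3 * c.2 + (c4 * d.2 + 0)))) => //; rewrite c2E /sub2 /=; ring.
  move=> c30 c40 x; subst c3 c4; rewrite !inE c2E => /or4P[] /eqP->//.
move=> x y z Lxy.
have [_ bb] := bas.
have Lw : L (x - ((1 - z) * a.1 + z * b.1)) (y - ((1 - z) * a.2 + z * b.2)).
  by apply: (lat_B Lq Lxy); apply: (lat_D Lq); apply: (lat_scale _ Lq).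
have [i [j [ei ej]]] := bb _ _ Lw.
exists [:: 1 - z; z - i - j; i; j]; split=> //; rewrite !zsumE /=; [ring| | |ring].
  transitivity (i * (sub2 c b).1 + j * (sub2 d b).1 + ((1 - z) * a.1 + z * b.1)); last by rewrite -ei subrK.
  by rewrite /sub2 /=; ring.
transitivity (i * (sub2 c b).2 + j * (sub2 d b).2 + ((1 - z) * a.2 + z * b.2)); last by rewrite -ej subrK.
by rewrite /sub2 /=; ring.
Qed.

Lemma uni3_22 a b c d : L a.1 a.2 -> L c.1 c.2 -> basis2 L (sub2 b a) (sub2 d c) ->
  uni3 L (lift3 0 [:: a; b] ++ lift3 1 [:: c; d]).
Proof.
move=> La Lc bas; split.
  case=> [|c1 [|c2 [|c3 [|c4 [|? ?]]]]] // _; rewrite !zsumE /= => e1 e2 e3 e4.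
  have c1E : c1 = - c2 by move: e1 e4; clear; lia.
  have c3E : c3 = - c4 by move: e4; clear; lia.
  have [] := basis2_free (i := c2) (j := c4) bas.
  - by transitivity (c1 * a.1 + (c2 * b.1 + (c3 * c.1 + (c4 * d.1 + 0)))) => //; rewrite c1E c3E /sub2 /=; ring.
  - by transitivity (c1 * a.2 + (c2 * b.2 + (c3 * c.2 + (c4 * d.2 + 0)))) => //; rewrite c1E c3E /sub2 /=; ring.
  move=> c20 c40 x; subst c2 c4; rewrite !inE c1E c3E => /or4P[] /eqP->//.
move=> x y z Lxy.
have [_ bb] := bas.
have Lw : L (x - ((1 - z) * a.1 + z * c.1)) (y - ((1 - z) * a.2 + z * c.2)).
  by apply: (lat_B Lq Lxy); apply: (lat_D Lq); apply: (lat_scale _ Lq).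
have [i [j [ei ej]]] := bb _ _ Lw.
exists [:: 1 - z - i; i; z - j; j]; split=> //; rewrite !zsumE /=; [ring| | |ring].
  transitivity (i * (sub2 b a).1 + j * (sub2 d c).1 + ((1 - z) * a.1 + z * c.1)); last by rewrite -ei subrK.
  by rewrite /sub2 /=; ring.
transitivity (i * (sub2 b a).2 + j * (sub2 d c).2 + ((1 - z) * a.2 + z * c.2)); last by rewrite -ej subrK.
by rewrite /sub2 /=; ring.
Qed.

Lemma zsum_map P Q (f : P -> Q) s c g : zsum (map f s) c g = zsum s c (fun v => g (f v)).
Proof.
elim: s c => [|a s IH] [|x c]; rewrite /= ?zsumE //.
by rewrite /zsum !big_nil.
by rewrite IH.
Qed.

Lemma zsumD P (s : seq P) c g h : zsum s c (fun v => g v + h v) = zsum s c g + zsum s c h.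
Proof.
elim: s c => [|a s IH] [|x c]; rewrite ?zsumE ?addr0 //.
  by rewrite /zsum !big_nil addr0.
by rewrite IH mulrDr addrACA.
Qed.

Lemma zsumZ P (s : seq P) c k g : zsum s c (fun v => k * g v) = k * zsum s c g.
Proof.
elim: s c => [|a s IH] [|x c]; rewrite ?zsumE ?mulr0 //.
  by rewrite /zsum !big_nil mulr0.
by rewrite IH mulrDr mulrCA.
Qed.

Definition up (z : int) (v : pt3) : pt3 := (v.1, v.2 + z).

Lemma uni3_up z T : uni3 L T -> uni3 L (map (up z) T).
Proof.
move=> [ind gen].
have upz c : zsum (map (up z) T) c (fun v => v.2) = zsum T c (fun v => v.2) + z * zsum T c (fun=> 1).
  by rewrite zsum_map /up /= zsumD -zsumZ; congr (_ + _); apply: eq_bigr => i _; rewrite mulr1.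
split; rewrite ?size_map.
  move=> c sc; rewrite upz !zsum_map /= => e1 e2 e3; rewrite e1 mulr0 addr0; exact: ind.
move=> x y w Lxy; have [c [sc e1 e2 e3 e4]] := gen x y (w - z) Lxy.
exists c; split=> //; rewrite ?upz ?zsum_map //.
by rewrite e4 e1 mulr1 subrK.
Qed.

End Uni.

Lemma stdir_sym q v w : stdir q v w -> stdir q w v.
Proof.
move=> [e [s [ie h1 h2 h3]]]; exists e, (- s); split=> //; rewrite mulNr.
- by rewrite -h1 opprB.
- by rewrite -h2 opprB.
- by rewrite -h3 opprB.
Qed.

Section Edges.
Variable R : realType.
Local Notation rx := (@rx R).
Local Notation ry := (@ry R).
Local Notation wsum := (@wsum R).
Local Notation wt := (@wt R).
Variables (q : int) (L : int -> int -> Prop) (m n : int) (E : pt2 -> pt2 -> Prop).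
Hypothesis Lq : lattice q L.
Hypothesis PL : plane R L m n E.

Lemma spx_edge s v w : spx L E s -> v \in s -> w \in s -> E v w.
Proof.
have rf a b : E a b -> E a a /\ E b b.
  by move=> /(pl_V PL)[Va Vb]; split; apply: (pl_refl PL).
case=> [a Ea|a b Eab|a b c [Eab Ebc Eac _]]; rewrite !inE.
- by move=> /eqP-> /eqP->.
- have [Ea Eb] := rf _ _ Eab.
  by move=> /orP[] /eqP-> /orP[] /eqP-> //; apply: (pl_sym PL).
have [Ea Eb] := rf _ _ Eab; have [_ Ec] := rf _ _ Ebc.
by move=> /or3P[] /eqP-> /or3P[] /eqP-> //; apply: (pl_sym PL).
Qed.

Lemma edge_prim u v w (s : R) : E v w -> Vbox L m n u -> 0 < s -> s < 1 ->
  rx u = mx s v w -> ry u = my s v w -> u = v /\ u = w.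
Proof.
move=> Evw Vu s0 s1 ex ey.
have w1 : wt [:: u] [:: 1].
  split=> //; last by rewrite !wsumE; ring.
  by move=> x; rewrite !inE => /eqP->.
have w2 : wt [:: v; w] [:: 1 - s; s].
  split=> //; last by rewrite !wsumE; ring.
  by move=> x; rewrite !inE => /orP[] /eqP->; rewrite ?subr_ge0 ltW.
have H := pl_FF PL (Spx1 L (pl_refl PL Vu)) (Spx2 L Evw) w1 w2.
have {}H g : g u = (1 - s) * g v + s * g w.
  by have := H _ _ g; rewrite !wsumE !addr0 !mul1r; apply.
have := H (eq_ind R u); rewrite /eq_ind eqxx.
have [->|vu] := eqVneq v u; have [->|wu] := eqVneq w u => // h; exfalso.
- by move: h s0; clear -PL Lq; lra.
- by move: h s1; clear -PL Lq; lra.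
- by move: h; clear -PL Lq; lra.
Qed.

Lemma edge_vertical v w : E v w -> v.1 = w.1 -> exists2 s : int, w.2 - v.2 = s * q & s \in [:: -1; 0; 1].
Proof.
move=> Evw e1; have [Vv Vw] := pl_V PL Evw.
have [Lv v1 v2 v3 v4] := Vv; have [Lw w1 w2 w3 w4] := Vw.
have q0 := lat_q Lq.
have := lat_B Lq Lw Lv; rewrite e1 subrr => /(lat_y0 Lq)[i ei].
exists i => //.
have key (e : int) : e = 1 \/ e = -1 -> 1 < e * i -> False.
  move=> ee hi.
  pose u : pt2 := (v.1, v.2 + e * q).
  have i0 : (0 : R) < (e * i)%:~R by rewrite ltr0z; move: hi; clear -PL Lq; lia.
  have ei2 : w.2 = v.2 + (e * i) * (e * q).
    have -> : (e * i) * (e * q) = (e * e) * (i * q) by ring.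
    by rewrite -ei; case: ee => ->; ring.
  have hq : 0 <= (e * i - 1) * q by apply: mulr_ge0; [move: hi; clear -PL Lq; lia|exact: ltW].
  have Vu : Vbox L m n u.
    split=> //=.
    - have := lat_D Lq Lv (lat_scale e Lq (lat_y Lq)); rewrite mulr0 addr0; exact.
    - case: ee => ee; first by rewrite ee mul1r; apply: addr_ge0 => //; apply: ltW.
      move: w3; rewrite ei2; move: hq; rewrite ee; set k := _ * i.
      have -> : v.2 + k * (-1 * q) = v.2 - q - (k - 1) * q by ring.
      by clear -PL Lq; lia.
    - case: ee => ee; last by rewrite ee mulN1r; move: v4 q0; clear -PL Lq; lia.
      move: w4; rewrite ei2; move: hq; rewrite ee; set k := _ * i.
      have -> : v.2 + k * (1 * q) = v.2 + q + (k - 1) * q by ring.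
      by rewrite mul1r; clear -PL Lq; lia.
  have s0 : 0 < ((e * i)%:~R)^-1 :> R by rewrite invr_gt0.
  have s1 : ((e * i)%:~R)^-1 < 1 :> R by rewrite invf_lt1 // -[1]/(1%:~R) ltr_int.
  have [] := @edge_prim u v w ((e * i)%:~R)^-1 Evw Vu s0 s1.
  - by rewrite /mx /rx /u /= -e1; ring.
  - rewrite /my /ry /u /= ei2 !rmorphD [X in _ + _ * (_ + X)]rmorphM /=.
    by move: (lt0r_neq0 i0); set k := (e * i)%:~R; clear -PL Lq; move=> h; field; move: h; rewrite /k rmorphM /= mulf_eq0 negb_or andbC.
  move=> uv _; have : e * q = 0 by move: (congr1 snd uv); rewrite /u /=; clear -PL Lq; lia.
  by move: q0; case: ee => ->; clear -PL Lq; lia.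
have [h1|h1] := ltP 1 i; first by case: (key 1) => //; [left|rewrite mul1r].
have [h2|h2] := ltP 1 (- i); first by case: (key (-1)) => //; [right|rewrite mulN1r].
by rewrite !inE; move: h1 h2; clear -PL Lq; lia.
Qed.
End Edges.

Lemma lattice_flip q L : lattice q L -> lattice q (fun x y => L y x).
Proof.
by case=> *; split=> // a b c d h1 h2; auto.
Qed.

Definition flip (v : pt2) : pt2 := (v.2, v.1).

Lemma basis2_flip L u v : basis2 L u v -> basis2 (fun x y => L y x) (flip u) (flip v).
Proof.
move=> [D0 H]; split=> [|x y /H[i [j [e1 e2]]]]; last by exists i, j.
rewrite /flip /= (_ : _ - _ = - (u.1 * v.2 - u.2 * v.1)) ?oppr_eq0 //; ring.
Qed.

Section Flip.
Variable R : realType.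
Local Notation rx := (@rx R).
Local Notation ry := (@ry R).
Local Notation wsum := (@wsum R).
Local Notation wt := (@wt R).

Lemma wt_map P Q (f : P -> Q) s l : wt s l -> wt (map f s) l.
Proof. by move=> [h1 h2 h3]; split=> //; rewrite ?size_map ?wsum_map. Qed.

Lemma flipK : cancel flip flip. Proof. by case. Qed.

Lemma spx_flip L E s : spx L E s -> spx (fun x y => L y x) (fun a b => E (flip a) (flip b)) (map flip s).
Proof.
have fl v : flip (flip v) = v by case: v.
case=> [a Ea|a b Eab|a b c [Eab Ebc Eac bas]] /=; constructor; rewrite ?fl //.
split; rewrite ?fl //; exact: (basis2_flip bas).
Qed.

Lemma plane_flip L m n E : plane R L m n E -> plane R (fun x y => L y x) n m (fun a b => E (flip a) (flip b)).
Proof.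
have fl v : flip (flip v) = v by case: v.
have fls (s : seq pt2) : map flip (map flip s) = s by rewrite mapK.
move=> PL; split.
- by move=> a b /(pl_V PL)[[? ? ? ? ?] [? ? ? ? ?]].
- by move=> a [h1 h2 h3 h4 h5]; apply: (pl_refl PL).
- by move=> a b /(pl_sym PL).
- have sp s : spx (fun x y => L y x) (fun a b => E (flip a) (flip b)) s -> spx L E (map flip s).
    move=> /spx_flip; suff -> : (fun a b => E (flip (flip a)) (flip (flip b))) = E by [].
    by apply: funext => a; apply: funext => b; rewrite !fl.
  move=> s t l m' Ks Kt ws wt' e1 e2 g.
  have H := pl_FF PL (sp _ Ks) (sp _ Kt) (wt_map flip ws) (wt_map flip wt').
  have K r k : wsum r k (fun v => g (flip (flip v))) = wsum r k g by apply: wsum_ext => v; rewrite /= fl.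
  by have := H _ _ (fun v => g (flip v)); rewrite !wsum_map !K; apply.
move=> x y x0 xn y0 ym; have [a [b [c [[Eab Ebc Eac bas] [l1 [l2 [l3 [h1 h2 h3 h4]]]]]]]] := pl_cov PL y0 ym x0 xn.
exists (flip a), (flip b), (flip c); split; last by exists l1, l2, l3.
by split; rewrite ?fl //; exact: (basis2_flip bas).
Qed.

Variables (q : int) (L : int -> int -> Prop).
Hypothesis Lq : lattice q L.

Lemma edge_horizontal m n E v w : plane R L m n E -> E v w -> v.2 = w.2 ->
  exists2 s : int, w.1 - v.1 = s * q & s \in [:: -1; 0; 1].
Proof.
move=> PL Evw e2.
by apply: (@edge_vertical R q _ _ _ _ (lattice_flip Lq) (plane_flip PL) (flip v) (flip w)) => //; case: v w Evw e2 => ? ? [].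
Qed.

Lemma half_nil A B E : 0 <= A -> A <= 0 -> half R q L A B E (fun=> False).
Proof.
move=> A0 A0'; have {A0 A0'}-> : A = 0 by apply/eqP; rewrite eq_le A0 A0'.
split=> //.
- by move=> x y z /le_lt_trans h /h; rewrite ltxx.
Qed.

Lemma edge_std A B m n E s v w z : plane R L m n E -> spx L E s -> v \in s -> w \in s ->
  same_facet q A B (v, z) (w, z) -> stdir q (v, z) (w, z).
Proof.
move=> PL Es vs ws sf; have Evw := spx_edge PL Es vs ws.
have [e|e] : v.1 = w.1 \/ v.2 = w.2.
  by case: sf => /= -[-> ->]; [left|right|left|right].
  have [i ei _] := edge_vertical Lq PL Evw e.
  by exists (0, q, 0), i; rewrite /= ei e !subrr !mulr0 !inE eqxx ?orbT.
have [i ei _] := edge_horizontal PL Evw e.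
by exists (q, 0, 0), i; rewrite /= ei e !subrr !mulr0 !inE eqxx ?orbT.
Qed.

End Flip.

Section Glue.
Variable R : realType.
Local Notation rx := (@rx R).
Local Notation ry := (@ry R).
Local Notation wsum := (@wsum R).
Local Notation wt := (@wt R).
Variables (q : int) (L : int -> int -> Prop).
Hypothesis Lq : lattice q L.

Definition stack (M : seq pt2 -> seq pt2 -> Prop) (P : seq pt3 -> Prop) (T : seq pt3) :=
  (exists s t, M s t /\ T = lift3 0 s ++ lift3 1 t) \/ (exists T', P T' /\ T = map (up 1) T').

Variables (A B m n m' n' : int) (E E' : pt2 -> pt2 -> Prop).
Variables (M : seq pt2 -> seq pt2 -> Prop) (P : seq pt3 -> Prop).
Hypotheses (A1 : 1 <= A) (PE : plane R L m n E) (PE' : plane R L m' n' E').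
Hypotheses (SM : slab R q L A B E E' M) (HP : half R q L (A - 1) (B + 1) E' P).

Lemma slab_cons s t : M s t -> exists a s' b t', s = a :: s' /\ t = b :: t'.
Proof.
move=> Mst; have := sl_low SM Mst; have := sl_high SM Mst; clear -Mst.
by case=> [b _|b b' _|b b' b'' _]; case=> [a _|a a' _|a a' a'' _];
 do 4 eexists; split; reflexivity.
Qed.

Lemma slab_wsum s t l : M s t -> wt (lift3 0 s ++ lift3 1 t) l ->
  exists u k k', [/\ 0 <= u, u <= 1, wt s k, wt t k' &
   forall g : pt3 -> R, wsum (lift3 0 s ++ lift3 1 t) l g =
     (1 - u) * wsum s k (fun v => g (v, 0)) + u * wsum t k' (fun v => g (v, 1))].
Proof.
by move=> /slab_cons[a [s' [b [t' [-> ->]]]]]; apply: slab_split.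
Qed.

Lemma slab_tz (u : R) s t k k' : wt s k -> wt t k' ->
  (1 - u) * wsum s k (fun v => tz R (v, 0)) + u * wsum t k' (fun v => tz R (v, 1)) = u.
Proof.
move=> [_ _ e1] [_ _ e2].
rewrite (_ : wsum s k _ = wsum s k (fun=> 0)) // (_ : wsum t k' _ = wsum t k' (fun=> 1)) //.
by rewrite e2 wsum_const mul0r mulr0 add0r mulr1.
Qed.

Lemma up_wsum T l g : wsum (map (up 1) T) l g = wsum T l (fun v => g (up 1 v)).
Proof. exact: wsum_map. Qed.

Lemma up_wt T l : wt (map (up 1) T) l -> wt T l.
Proof. by move=> [h1 h2]; rewrite wsum_map => h3; split=> //; rewrite h1 size_map. Qed.

Lemma up_tz T l : wt T l -> wsum T l (fun v => tz R (up 1 v)) = wsum T l (tz R) + 1.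
Proof.
move=> [_ _ e]; rewrite -[X in _ + X]e -wsumD; apply: wsum_ext => v.
by rewrite /tz /up /= rmorphD.
Qed.

Lemma wsum_ge0' T l (g : pt3 -> R) : wt T l -> (forall v, v \in T -> 0 <= g v) -> 0 <= wsum T l g.
Proof.
move=> [e l0 _]; elim: T l e l0 => [|a T IH] [|x l] // e l0 g0; rewrite ?wsumE //.
apply: addr_ge0.
  by apply: mulr_ge0; [apply: l0|apply: g0]; rewrite inE eqxx.
case: e => e; apply: IH => // [y yl|v vT]; [apply: l0|apply: g0]; by rewrite inE ?yl ?vT orbT.
Qed.

Lemma half_tz L0 A0 B0 E0 P0 T l : half R q L0 A0 B0 E0 P0 -> P0 T -> wt T l -> 0 <= wsum T l (tz R).
Proof.
move=> HP0 PT wT; apply: wsum_ge0' => // v vT; have [_ [h _] _ _] := hf_in HP0 PT vT.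
by rewrite /tz ler0z.
Qed.

Lemma slab_FF s t l s' t' l' : M s t -> M s' t' ->
  wt (lift3 0 s ++ lift3 1 t) l -> wt (lift3 0 s' ++ lift3 1 t') l' ->
  wsum (lift3 0 s ++ lift3 1 t) l (tx R) = wsum (lift3 0 s' ++ lift3 1 t') l' (tx R) ->
  wsum (lift3 0 s ++ lift3 1 t) l (ty R) = wsum (lift3 0 s' ++ lift3 1 t') l' (ty R) ->
  wsum (lift3 0 s ++ lift3 1 t) l (tz R) = wsum (lift3 0 s' ++ lift3 1 t') l' (tz R) ->
  forall g, wsum (lift3 0 s ++ lift3 1 t) l g = wsum (lift3 0 s' ++ lift3 1 t') l' g.
Proof.
move=> M1 M2 W1 W2.
have [u [k1 [k2 [u0 u1 wk1 wk2 H]]]] := slab_wsum M1 W1.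
have [u' [k1' [k2' [_ _ wk1' wk2' H']]]] := slab_wsum M2 W2.
rewrite !H !H' !slab_tz // => ex ey eu; subst u' => g; rewrite H H'.
have Ex : (1 - u) * wsum s k1 rx + u * wsum t k2 rx = (1 - u) * wsum s' k1' rx + u * wsum t' k2' rx by exact: ex.
have Ey : (1 - u) * wsum s k1 ry + u * wsum t k2 ry = (1 - u) * wsum s' k1' ry + u * wsum t' k2' ry by exact: ey.
have [z0|n0] := eqVneq u 0.
  move: Ex Ey; rewrite z0 subr0 !mul1r !mul0r !addr0 => Ex Ey.
  exact: (pl_FF PE (sl_low SM M1) (sl_low SM M2)).
have [z1|n1] := eqVneq u 1.
  move: Ex Ey; rewrite z1 subrr !mul1r !mul0r !add0r => Ex Ey.
  exact: (pl_FF PE' (sl_high SM M1) (sl_high SM M2)).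
have up : 0 < u by rewrite lt_neqAle eq_sym n0.
have ul : u < 1 by rewrite lt_neqAle n1.
have [fx fy] := sl_uniq SM M1 M2 wk1 wk2 wk1' wk2' up ul Ex Ey.
congr (_ * _ + _ * _); first exact: (pl_FF PE (sl_low SM M1) (sl_low SM M2)).
apply: (pl_FF PE' (sl_high SM M1) (sl_high SM M2)) => //; apply: (mulfI n0).
  by apply: (addrI ((1 - u) * wsum s k1 rx)); rewrite Ex fx.
by apply: (addrI ((1 - u) * wsum s k1 ry)); rewrite Ey fy.
Qed.

Lemma slab_half_FF s t l T l' : M s t -> P T ->
  wt (lift3 0 s ++ lift3 1 t) l -> wt T l' ->
  wsum (lift3 0 s ++ lift3 1 t) l (tx R) = wsum (map (up 1) T) l' (tx R) ->
  wsum (lift3 0 s ++ lift3 1 t) l (ty R) = wsum (map (up 1) T) l' (ty R) ->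
  wsum (lift3 0 s ++ lift3 1 t) l (tz R) = wsum (map (up 1) T) l' (tz R) ->
  forall g, wsum (lift3 0 s ++ lift3 1 t) l g = wsum (map (up 1) T) l' g.
Proof.
move=> M1 PT W1 W2.
have [u [k1 [k2 [u0 u1 wk1 wk2 H]]]] := slab_wsum M1 W1.
rewrite !H !up_wsum slab_tz // up_tz // => ex ey eu g; rewrite H up_wsum.
have z0 := half_tz HP PT W2.
have eu1 : u = 1 by apply/eqP; rewrite eq_le u1 eu lerDr.
have ez : wsum T l' (tz R) = 0 by apply: (addIr 1); rewrite -eu add0r.
have [s' [m1 [Es' wm1 Hs]]] := hf_trace HP PT W2 ez.
move: ex ey; rewrite eu1 subrr !mul1r !mul0r !add0r !Hs => ex ey.
by apply: (pl_FF PE' (sl_high SM M1) Es' wk2 wm1 ex ey).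
Qed.

Lemma half_glue : half R q L A B E (stack M P).
Proof.
have q0 := lat_q Lq.
split.
- move=> T [[s [t [Mst ->]]]|[T' [PT ->]]].
    by rewrite size_cat !size_map (sl_size SM Mst).
  by rewrite size_map (hf_size HP PT).
- move=> T v [[s [t [Mst ->]]]|[T' [PT ->]]].
    rewrite mem_cat => /orP[] /mapP[w ws ->] /=.
      have [h1 h2 h3] := sl_low_in SM Mst ws; rewrite subr0 addr0; split=> //.
      by split=> //; apply: le_trans A1.
    by have [h1 h2 h3] := sl_high_in SM Mst ws; split.
  move=> /mapP[w wT ->]; have [h1 h2 h3 h4] := hf_in HP PT wT.
  rewrite /up /=; split=> //.
  + by case: h2 => h21 h22; rewrite -lerBrDr addr_ge0.
  + by move: h3; rewrite opprD addrA addrAC.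
  + by move: h4; rewrite -addrA [1 + _]addrC.
- move=> T [[s [t [Mst ->]]]|[T' [PT ->]]]; last exact: uni3_up (hf_uni HP PT).
  have := sl_size SM Mst; have Hl := sl_low SM Mst; have Hh := sl_high SM Mst; move: Mst.
  have Lof s1 t1 v : M s1 t1 -> (v \in s1) || (v \in t1) -> L v.1 v.2.
    by move=> Mst /orP[/(sl_low_in SM Mst)[]|/(sl_high_in SM Mst)[]].
  case: Hl => [a _|a a' _|a a' a'' [_ _ _ bas]]; case: Hh => [b _|b b' _|b b' b'' [_ _ _ bas']] Mst //= _.
  + by apply: (uni3_13 Lq) bas'; apply: (Lof _ _ _ Mst); rewrite !inE eqxx ?orbT.
  + by apply: (uni3_22 Lq) (sl_edges SM Mst); apply: (Lof _ _ _ Mst); rewrite !inE eqxx ?orbT.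
  + by apply: (uni3_31 Lq) bas; apply: (Lof _ _ _ Mst); rewrite !inE eqxx ?orbT.
- move=> x y z z0 zA x0 xA y0 yB; have [z1|z1] := ltP z 1.
    have [s [t [l [k [Mst ws wt' ex ey]]]]] := sl_cov SM z0 z1 x0 xA y0 yB.
    have [r [wr H]] := slab_join z0 (ltW z1) ws wt'.
    exists (lift3 0 s ++ lift3 1 t), r; split=> //; first by left; exists s, t.
    + by rewrite H ex.
    + by rewrite H ey.
    + by rewrite H slab_tz.
  have [] := @hf_cov _ _ _ _ _ _ _ HP x y (z - 1); rewrite ?subr_ge0 //.
  + by rewrite rmorphB /= ltrD2r.
  + by rewrite rmorphB /= opprB addrA subrK.
  + by rewrite rmorphD /= (_ : B%:~R + 1 + (z - 1) = B%:~R + z) //; clear -z; ring.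
  move=> T [l [PT wT e1 e2 e3]]; exists (map (up 1) T), l; split.
  + by right; exists T.
  + exact: wt_map.
  + by rewrite up_wsum.
  + by rewrite up_wsum.
  + by rewrite up_wsum up_tz // e3 subrK.
- move=> A0 y y0 yAB; have [eA|nA] := eqVneq A 1.
    have [s [t [k [Mst wk e1 e2]]]] := sl_top SM eA y0 yAB.
    have [l wl] : exists l, wt s l.
      by have [a [s' [_ [_ [-> _]]]]] := slab_cons Mst; apply: wt_exists.
    have [r [wr H]] := slab_join ler01 (lexx 1) wl wk.
    exists (lift3 0 s ++ lift3 1 t), r; split=> //; first by left; exists s, t.
    + by rewrite H subrr mul0r add0r mul1r e1.
    + by rewrite H subrr mul0r add0r mul1r e2.
    + by rewrite H slab_tz // eA.
  have A2 : 0 < A - 1 by move: A1 nA; clear; lia.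
  have [|T [l [PT wT e1 e2 e3]]] := hf_top HP A2 y0.
    by rewrite (_ : A - 1 + (B + 1) = A + B) //; ring.
  exists (map (up 1) T), l; split; first by right; exists T.
  + exact: wt_map.
  + by rewrite up_wsum.
  + by rewrite up_wsum.
  + by rewrite up_wsum up_tz // e3 rmorphB /= subrK.
- move=> S T l l' [[s [t [Mst ->]]]|[S' [PS ->]]] [[s' [t' [Mst' ->]]]|[T' [PT ->]]] W1 W2 ex ey ez g.
  + exact: slab_FF.
  + by apply: slab_half_FF => //; apply: up_wt.
  + by symmetry; apply: slab_half_FF => //; apply: up_wt.
  have W1' := up_wt W1; have W2' := up_wt W2.
  move: ex ey ez; rewrite !up_wsum !up_tz // => ex ey /addIr ez.
  exact: (hf_FF HP PS PT).
- move=> T l [[s [t [Mst ->]]]|[T' [PT ->]]] wT.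
    have [u [k1 [k2 [u0 u1 wk1 wk2 H]]]] := slab_wsum Mst wT.
    rewrite H slab_tz // => eu; exists s, k1; split=> //; first exact: (sl_low SM Mst).
    by move=> g; rewrite H eu subr0 mul1r mul0r addr0.
  have wT' := up_wt wT; rewrite up_wsum up_tz // => e; by have := ltr_wpDl (half_tz HP PT wT') ltr01; rewrite e ltxx.
move=> T v w [[s [t [Mst ->]]]|[T' [PT ->]]].
  have mix a b : a \in s -> b \in t -> same_facet q A B (a, 0) (b, 1) -> stdir q (a, 0) (b, 1).
    move=> ha hb; have [f1 f2 f3 f4] := sl_std SM Mst ha hb.
    rewrite /same_facet /= subr0 addr0; case=> -[ea eb].
    + have [e|e] := f1 ea eb; [exists (0, 0, 1), 1|exists (0, q, 1), 1]; rewrite /= e ea eb !mul1r; split; rewrite ?inE ?eqxx ?orbT //; ring.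
    + have [e|e] := f2 ea eb; [exists (0, 0, 1), 1|exists (- q, 0, 1), 1]; rewrite /= e ea eb !mul1r; split; rewrite ?inE ?eqxx ?orbT //; ring.
    + have [e|e] := f3 ea eb; [exists (- q, 0, 1), 1|exists (- q, q, 1), 1]; rewrite /= e ea eb !mul1r; split; rewrite ?inE ?eqxx ?orbT //; ring.
    + have [e|e] := f4 ea eb; [exists (0, q, 1), 1|exists (- q, q, 1), 1]; rewrite /= e ea eb !mul1r; split; rewrite ?inE ?eqxx ?orbT //; ring.
  have sfC a b : same_facet q A B a b -> same_facet q A B b a.
    by case=> -[? ?]; [constructor 1|constructor 2|constructor 3|constructor 4].
  rewrite !mem_cat => /orP[] /mapP[a ha ->] /orP[] /mapP[b hb ->] sf.
  + exact: (edge_std Lq PE (sl_low SM Mst) ha hb sf).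
  + exact: mix.
  + by apply: stdir_sym; apply: mix => //; apply: sfC.
  + exact: (edge_std Lq PE' (sl_high SM Mst) ha hb sf).
move=> /mapP[a ha ->] /mapP[b hb ->] sf.
suff [e [i [he h1 h2 h3]]] : stdir q a b.
  by exists e, i; split=> //; rewrite -h3 /up /= opprD addrACA subrr addr0.
apply: (hf_std HP PT ha hb); move: sf; rewrite /same_facet /up /=.
have eA x : A - (x + 1) = A - 1 - x by ring.
have eB x : B + (x + 1) = B + 1 + x by ring.
by rewrite !eA !eB.
Qed.

End Glue.

Lemma lat_yq q L (i : int) : lattice q L -> L 0 (i * q).
Proof. by move=> Lq; have := lat_scale i Lq (lat_y Lq); rewrite mulr0. Qed.

Lemma lat_xq q L (i : int) : lattice q L -> L (i * q) 0.
Proof. by move=> Lq; have := lat_scale i Lq (lat_x Lq); rewrite mulr0. Qed.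

Lemma lat_grid q L (i j : int) : lattice q L -> L (i * q) (j * q).
Proof. by move=> Lq; have := lat_D Lq (lat_xq i Lq) (lat_yq j Lq); rewrite addr0 add0r. Qed.

Lemma lat_ymult q L (i y : int) : lattice q L -> L (i * q) y -> exists j, y = j * q.
Proof.
move=> Lq h; have := lat_B Lq h (lat_xq i Lq); rewrite subrr subr0; exact: lat_y0 Lq _.
Qed.

Lemma lat_xmult q L (j x : int) : lattice q L -> L x (j * q) -> exists i, x = i * q.
Proof. by move=> Lq h; apply: (lat_ymult (lattice_flip Lq) h). Qed.

(** * Non-crossing segments *)

Section Meets.
Variable R : realType.
Local Notation rx := (@rx R).
Local Notation ry := (@ry R).
Local Notation mx := (@mx R).
Local Notation my := (@my R).

Lemma unit_int (s : R) (i j : int) : 0 <= s -> s <= 1 -> i%:~R + s = j%:~R -> s = 0 \/ s = 1.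
Proof.
move=> s0 s1 e; have es : s = (j - i)%:~R by rewrite rmorphB /= -e; clear; ring.
move: s0 s1; rewrite es ler0z -[1]/(1%:~R) ler_int => h0 h1.
have [->|->] : j - i = 0 \/ j - i = 1 by move: h0 h1; clear; lia.
  by left.
by right.
Qed.

Variables (q : int) (L : int -> int -> Prop) (m n : int).
Hypothesis Lq : lattice q L.
Local Notation V := (Vbox L m n).
Local Notation meets := (@meets R L m n).
Local Notation prim := (@prim R L m n).

Lemma mx_step v w (s : R) : w.1 = v.1 + 1 -> mx s v w = (v.1)%:~R + s.
Proof. by move=> e; rewrite /mx /rx e rmorphD /=; ring. Qed.

Lemma step_prim v w : w.1 = v.1 + 1 -> prim v w.
Proof.
move=> e u s Vu s0 s1 ex ey; rewrite mx_step // in ex.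
have [z|z] := unit_int s0 s1 (esym ex); [left|right]; apply: (@rxy_inj R); rewrite ?ex ?ey /my z.
- by rewrite addr0.
- ring.
- by rewrite /rx e rmorphD.
- ring.
Qed.

Lemma step_int v w (s : R) (i : int) : V v -> V w -> w.1 = v.1 + 1 -> 0 <= s -> s <= 1 ->
  mx s v w = i%:~R -> exists u, [/\ V u, rx u = mx s v w & ry u = my s v w].
Proof.
move=> Vv Vw e s0 s1; rewrite mx_step // => ei.
have [z|z] := unit_int s0 s1 ei; [exists v|exists w]; split=> //; rewrite ?z /my.
- by rewrite addr0.
- ring.
- by rewrite /rx e rmorphD.
- ring.
Qed.

Lemma meets_xx v w v' w' : V v -> V w -> V v' -> V w' -> w.1 = v.1 + 1 -> w'.1 = v'.1 + 1 ->
  (v.1 = v'.1 -> (v.2 <= v'.2 /\ w.2 <= w'.2) \/ (v'.2 <= v.2 /\ w'.2 <= w.2)) ->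
  meets v w v' w'.
Proof.
move=> Vv Vw Vv' Vw' e e' H s t s0 s1 t0 t1 ex ey.
have intx i : mx s v w = i%:~R -> exists u, [/\ V u, rx u = mx s v w & ry u = my s v w].
  by move=> h; apply: (step_int Vv Vw e s0 s1 h).
have ex' := ex; rewrite !mx_step // in ex'.
have [z|sn0] := eqVneq s 0.
  by constructor 1; apply: (intx v.1); rewrite mx_step // z addr0.
have [z|sn1] := eqVneq s 1.
  by constructor 1; apply: (intx (v.1 + 1)); rewrite mx_step // z rmorphD.
have sp : 0 < s by rewrite lt_neqAle eq_sym sn0.
have sl : s < 1 by rewrite lt_neqAle sn1.
have ev : v.1 = v'.1.
  have d1 : (v.1 - v'.1)%:~R < 1%:~R :> R.
    by rewrite rmorphB /=; move: ex' t1 sp; rewrite -[1%:~R]/(1 : R); clear -Lq; lra.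
  have d2 : (-1)%:~R < (v.1 - v'.1)%:~R :> R.
    by rewrite rmorphB rmorphN /=; move: ex' t0 sl; rewrite -[1%:~R]/(1 : R); clear -Lq; lra.
  by move: d1 d2; rewrite !ltr_int; clear -Lq; lia.
have est : s = t by move: ex'; rewrite ev => /addrI.
subst t; move: ey; rewrite /my /ry => ey.
have sl' : 0 < 1 - s by rewrite subr_gt0.
suff [h1 h2] : v.2 = v'.2 /\ w.2 = w'.2.
  constructor 2; split; rewrite [LHS]surjective_pairing [RHS]surjective_pairing ?ev ?h1 ?h2 //.
  by rewrite e e' ev.
have key (x y z r : int) : x <= y -> z <= r -> (1 - s) * x%:~R + s * z%:~R = (1 - s) * y%:~R + s * r%:~R ->
  x = y /\ z = r.
  move=> h1 h2 h3.
  have a1 : 0 <= (1 - s) * (y%:~R - x%:~R) by apply: mulr_ge0; rewrite ?subr_ge0 ?ler_int // ltW.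
  have a2 : 0 <= s * (r%:~R - z%:~R) by apply: mulr_ge0; rewrite ?subr_ge0 ?ler_int // ltW.
  have b1 : (1 - s) * (y%:~R - x%:~R) = 0 by move: a1 a2 h3; clear -Lq; lra.
  have b2 : s * (r%:~R - z%:~R) = 0 by move: a1 a2 h3; clear -Lq; lra.
  move/eqP: b1; rewrite mulf_eq0 (negbTE (lt0r_neq0 sl')) /= subr_eq0 eqr_int => /eqP->.
  by move/eqP: b2; rewrite mulf_eq0 (negbTE sn0) /= subr_eq0 eqr_int => /eqP->.
have [[h1 h2]|[h1 h2]] := H ev; first exact: key.
by have [<- <-] := key _ _ _ _ h1 h2 (esym ey).
Qed.

Definition vert (a b : int) (v w : pt2) := v = (a * q, b * q) /\ w = (a * q, (b + 1) * q).
Definition hori (a b : int) (v w : pt2) := v = (a * q, b * q) /\ w = ((a + 1) * q, b * q).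

Lemma mx_vert a b v w (s : R) : vert a b v w ->
  mx s v w = (a * q)%:~R /\ my s v w = (b%:~R + s) * q%:~R.
Proof.
move=> [-> ->]; rewrite /mx /my /rx /ry /= !rmorphM !rmorphD /=; split; ring.
Qed.

Lemma mx_hori a b v w (s : R) : hori a b v w ->
  mx s v w = (a%:~R + s) * q%:~R /\ my s v w = (b * q)%:~R.
Proof.
move=> [-> ->]; rewrite /mx /my /rx /ry /= !rmorphM !rmorphD /=; split; ring.
Qed.

Lemma meets_xv v w v' w' a b : V v -> V w -> w.1 = v.1 + 1 -> vert a b v' w' -> meets v w v' w'.
Proof.
move=> Vv Vw e vv s t s0 s1 t0 t1 ex ey; constructor 1.
by apply: (step_int Vv Vw e s0 s1 (i := a * q)); rewrite ex; have [] := mx_vert t vv.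
Qed.

Lemma meets_xh v w v' w' a b : V v -> V w -> w.1 = v.1 + 1 -> hori a b v' w' ->
  (v.2 <= b * q /\ w.2 <= b * q) \/ (b * q <= v.2 /\ b * q <= w.2) -> meets v w v' w'.
Proof.
move=> Vv Vw e vv H s t s0 s1 t0 t1 ex ey.
have [e1 e2] := mx_hori t vv.
have intx i : mx s v w = i%:~R -> exists u, [/\ V u, rx u = mx s v w & ry u = my s v w].
  by move=> h; apply: (step_int Vv Vw e s0 s1 h).
have [z|sn0] := eqVneq s 0.
  by constructor 1; apply: (intx v.1); rewrite mx_step // z addr0.
have [z|sn1] := eqVneq s 1.
  by constructor 1; apply: (intx (v.1 + 1)); rewrite mx_step // z rmorphD.
have sp : 0 < s by rewrite lt_neqAle eq_sym sn0.
have sl : s < 1 by rewrite lt_neqAle sn1.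
have sl' : 0 < 1 - s by rewrite subr_gt0.
have [h1 h2] : v.2 = b * q /\ w.2 = b * q.
  have ey' : (1 - s) * (v.2)%:~R + s * (w.2)%:~R = (b * q)%:~R by rewrite -e2 -ey.
  have key (x z y : R) : 0 <= x -> 0 <= z -> (1 - s) * x + s * z = 0 -> x = 0 /\ z = 0.
    move=> x0 z0 h3.
    have a1 : 0 <= (1 - s) * x by apply: mulr_ge0 => //; apply: ltW.
    have a2 : 0 <= s * z by apply: mulr_ge0.
    have b1 : (1 - s) * x = 0 by move: a1 a2 h3; clear -Lq; lra.
    have b2 : s * z = 0 by move: a1 a2 h3; clear -Lq; lra.
    move/eqP: b1; rewrite mulf_eq0 (negbTE (lt0r_neq0 sl')) /= => /eqP->.
    by move/eqP: b2; rewrite mulf_eq0 (negbTE sn0) /= => /eqP->.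
  have [[h1 h2]|[h1 h2]] := H.
    have [] := key ((b * q)%:~R - (v.2)%:~R) ((b * q)%:~R - (w.2)%:~R); rewrite ?subr_ge0 ?ler_int //.
      by move: ey'; clear -Lq; lra.
    by move=> /eqP; rewrite subr_eq0 eqr_int => /eqP<- /eqP; rewrite subr_eq0 eqr_int => /eqP<-.
  have [] := key ((v.2)%:~R - (b * q)%:~R) ((w.2)%:~R - (b * q)%:~R); rewrite ?subr_ge0 ?ler_int //.
    by move: ey'; clear -Lq; lra.
  by move=> /eqP; rewrite subr_eq0 eqr_int => /eqP<- /eqP; rewrite subr_eq0 eqr_int => /eqP<-.
have q0 := lat_q Lq.
have [Lv _ _ _ _] := Vv; have [Lw _ _ _ _] := Vw; rewrite h1 in Lv; rewrite h2 in Lw.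
have [i ei] := lat_xmult Lq Lv; have [j ej] := lat_xmult Lq Lw.
have q1 : q = 1.
  have : (j - i) * q = 1 by rewrite mulrBl -ej -ei e; ring.
  move: q0; clear -Lq => q0 h; apply/eqP; rewrite eq_le.
  have : 0 < (j - i) by rewrite -(pmulr_lgt0 _ q0) h.
  have : (j - i) * q = 1 by [].
  by clear -Lq q0; nia.
have ex' := ex; rewrite mx_step // e1 in ex'.
rewrite q1 mulr1 in ex'.
have ea : v.1 = a.
  have d1 : (v.1 - a)%:~R < 1%:~R :> R.
    by rewrite rmorphB /=; move: ex' t1 sp; rewrite -[1%:~R]/(1 : R); clear -Lq; lra.
  have d2 : (-1)%:~R < (v.1 - a)%:~R :> R.
    by rewrite rmorphB rmorphN /=; move: ex' t0 sl; rewrite -[1%:~R]/(1 : R); clear -Lq; lra.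
  by move: d1 d2; rewrite !ltr_int; clear -Lq; lia.
constructor 2; case: vv => -> ->.
rewrite [v]surjective_pairing [w]surjective_pairing /= h1 h2 e ea q1 !mulr1; split=> //.
Qed.

Lemma meets_vv v w v' w' a b a' b' : V v -> V w -> vert a b v w -> vert a' b' v' w' -> meets v w v' w'.
Proof.
move=> Vv Vw vv vv' s t s0 s1 t0 t1.
have q0 : q%:~R != 0 :> R by rewrite intr_eq0 lt0r_neq0 // (lat_q Lq).
have [e1 e2] := mx_vert s vv; have [e1' e2'] := mx_vert t vv'.
move=> ex ey.
have eb : b%:~R + s = b'%:~R + t by apply: (mulIf q0); rewrite -e2 ey.
have ea : a = a'.
  by apply: (mulIf (lt0r_neq0 (lat_q Lq))); apply: (@intr_inj R); rewrite -e1 ex.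
have [ebb|nb] := eqVneq b b'.
  by constructor 2; case: vv vv' => -> -> [-> ->]; rewrite ea ebb.
constructor 1.
have [z|z] : s = 0 \/ s = 1.
  apply: contrapT => /not_orP[n0 n1].
  have sp : 0 < s by rewrite lt_neqAle eq_sym s0 andbT; apply/eqP.
  have sl : s < 1 by rewrite lt_neqAle s1 andbT; apply/eqP.
  case/eqP: nb.
  have d1 : (b - b')%:~R < 1%:~R :> R.
    by rewrite rmorphB /=; move: eb t1 sp; rewrite -[1%:~R]/(1 : R); clear -Lq; lra.
  have d2 : (-1)%:~R < (b - b')%:~R :> R.
    by rewrite rmorphB rmorphN /=; move: eb t0 sl; rewrite -[1%:~R]/(1 : R); clear -Lq; lra.
  by move: d1 d2; rewrite !ltr_int; clear -Lq; lia.
- by exists v; split=> //; rewrite /mx /my z; ring.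
- by exists w; split=> //; rewrite /mx /my z; ring.
Qed.

Lemma meets_vh v w v' w' a b a' b' : V (a * q, b' * q) -> vert a b v w -> hori a' b' v' w' -> meets v w v' w'.
Proof.
move=> Vab vv vv' s t s0 s1 t0 t1 ex ey; constructor 1; exists (a * q, b' * q); split=> //.
  by have [-> _] := mx_vert s vv.
by rewrite ey; have [_ ->] := mx_hori t vv'.
Qed.

Lemma vert_prim a b v w : vert a b v w -> prim v w.
Proof.
move=> vv u s [Lu _ _ _ _] s0 s1; have [e1 e2] := mx_vert s vv; rewrite e1 e2 => ex ey.
have {}ex : u.1 = a * q by apply: (@intr_inj R).
rewrite ex in Lu; have [j ej] := lat_ymult Lq Lu.
have q0 : q%:~R != 0 :> R by rewrite intr_eq0 lt0r_neq0 // (lat_q Lq).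
have ej' : b%:~R + s = j%:~R by apply: (mulIf q0); rewrite -ey /ry ej rmorphM.
case: vv => -> ->.
have [z|z] := unit_int s0 s1 ej'; [left|right];
  rewrite [u]surjective_pairing ex ej; congr (_ , _ * q); apply: (@intr_inj R).
  by rewrite -ej' z addr0.
by rewrite -ej' z rmorphD.
Qed.

End Meets.

Section Config.
Variable R : realType.
Local Notation rx := (@rx R).
Local Notation ry := (@ry R).
Local Notation mx := (@mx R).
Local Notation my := (@my R).

Lemma meets_flip L m n a b c d :
  meets R (fun x y => L y x) n m (flip a) (flip b) (flip c) (flip d) -> meets R L m n a b c d.
Proof.
have fi : injective flip by exact: can_inj flipK.
move=> H s t s0 s1 t0 t1 ex ey.
have [[v [Vv e1 e2]]|[/fi e1 /fi e2]|[/fi e1 /fi e2]] := H s t s0 s1 t0 t1 ey ex.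
- constructor 1; exists (flip v); split=> //.
  by case: Vv => *; split.
- by constructor 2.
- by constructor 3.
Qed.

Lemma prim_flip L m n a b : prim R (fun x y => L y x) n m (flip a) (flip b) -> prim R L m n a b.
Proof.
move=> H u s Vu s0 s1 ex ey.
have Vu' : Vbox (fun x y => L y x) n m (flip u) by case: Vu => *; split.
by have [/(can_inj flipK)|/(can_inj flipK)] := H (flip u) s Vu' s0 s1 ey ex; auto.
Qed.

(* Families of lattice segments of width one, such as graphs of piecewise linear functions. *)
Definition steps L (m n : int) (X : pt2 -> pt2 -> Prop) :=
  (forall v w, X v w -> [/\ Vbox L m n v, Vbox L m n w & w.1 = v.1 + 1]) /\
  (forall v w v' w', X v w -> X v' w' -> v.1 = v'.1 ->
    (v.2 <= v'.2 /\ w.2 <= w'.2) \/ (v'.2 <= v.2 /\ w'.2 <= w.2)).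

Definition avoids (q : int) (X : pt2 -> pt2 -> Prop) (b : int) := forall v w, X v w ->
  (v.2 <= b * q /\ w.2 <= b * q) \/ (b * q <= v.2 /\ b * q <= w.2).

Variables (q : int) (L : int -> int -> Prop) (A B : int).
Hypothesis Lq : lattice q L.
Hypotheses (A1 : 1 <= A) (B1 : 1 <= B).
Local Notation m := (A * q).
Local Notation n := (B * q).
Local Notation V := (Vbox L m n).

Lemma grid_V a b : 0 <= a -> a <= A -> 0 <= b -> b <= B -> V (a * q, b * q).
Proof.
have q0 := ltW (lat_q Lq); move=> a0 aA b0 bB; split=> /=; first exact: lat_grid.
- exact: mulr_ge0.
- exact: ler_wpM2r.
- exact: mulr_ge0.
- exact: ler_wpM2r.
Qed.

Lemma grid_cell (C : int) (y : R) : 1 <= C -> 0 <= y -> y <= (C * q)%:~R ->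
  exists (b : int) (s : R), [/\ 0 <= b, b + 1 <= C, 0 <= s, s <= 1 & y = (b%:~R + s) * q%:~R].
Proof.
move=> C1 y0 yC; have q0 : 0 < q%:~R :> R by rewrite ltr0z (lat_q Lq).
have [] := @unit_cell R 0 C (y / q%:~R).
- by move: C1; clear -Lq; lia.
- by rewrite divr_ge0 // ltW.
- by rewrite ler_pdivrMr // -rmorphM.
move=> b [b0 bC h1 h2]; exists b, (y / q%:~R - b%:~R); split=> //.
- by rewrite subr_ge0.
- by rewrite lerBlDl.
- by rewrite addrC subrK mulfVK // lt0r_neq0.
Qed.

Variables (X Y : pt2 -> pt2 -> Prop) (va hb : int -> Prop).
Hypothesis SX : steps L m n X.
Hypothesis SY : steps (fun x y => L y x) n m (fun v w => Y (flip v) (flip w)).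
Hypothesis XY : forall v w v' w', X v w -> Y v' w' -> meets R L m n v w v' w'.
Hypothesis hva : forall a, va a -> [/\ 0 <= a, a <= A & avoids q (fun v w => Y (flip v) (flip w)) a].
Hypothesis hhb : forall b, hb b -> [/\ 0 <= b, b <= B & avoids q X b].
Hypotheses (va0 : va 0) (vaA : va A) (hb0 : hb 0) (hbB : hb B).

Definition frame v w :=
  (exists a b, [/\ va a, 0 <= b, b + 1 <= B & vert q a b v w]) \/
  (exists a b, [/\ hb b, 0 <= a, a + 1 <= A & hori q a b v w]).

Lemma hori_flip a b v w : hori q a b v w -> vert q b a (flip v) (flip w).
Proof. by case=> -> ->. Qed.

Lemma vert_flip a b v w : vert q a b v w -> hori q b a (flip v) (flip w).
Proof. by case=> -> ->. Qed.

Theorem config_plane : exists E, plane R L m n E /\ forall v w, X v w \/ Y v w \/ frame v w -> E v w.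
Proof.
have q0 := lat_q Lq; have [SX1 SX2] := SX; have [SY1 SY2] := SY.
have Lq' := lattice_flip Lq.
have fV v : Vbox (fun x y => L y x) n m (flip v) -> V v by case=> *; split.
have fV' v : V v -> Vbox (fun x y => L y x) n m (flip v) by case=> *; split.
have Yf v w : Y v w -> [/\ V v, V w & w.2 = v.2 + 1].
  move=> h; have [] := SY1 (flip v) (flip w); first by rewrite !flipK.
  by move=> /fV h1 /fV h2.
have vV a b v w : va a -> 0 <= b -> b + 1 <= B -> vert q a b v w -> V v /\ V w.
  move=> /hva[a0 aA _] b0 bB [-> ->]; split; apply: grid_V => //.
  - by move: bB; clear -Lq; lia.
  - by move: b0; clear -Lq; lia.
have hV a b v w : hb b -> 0 <= a -> a + 1 <= A -> hori q a b v w -> V v /\ V w.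
  move=> /hhb[b0 bB _] a0 aA [-> ->]; split; apply: grid_V => //.
  - by move: aA; clear -Lq; lia.
  - by move: a0; clear -Lq; lia.
have m0 : 0 < m by apply: mulr_gt0 => //; apply: lt_le_trans A1.
have n0 : 0 < n by apply: mulr_gt0 => //; apply: lt_le_trans B1.
have A0 : 0 <= A by apply: le_trans A1. have B0 : 0 <= B by apply: le_trans B1.
apply: (@planar_completion R q L m n Lq (fun v w => X v w \/ Y v w \/ frame v w)) => //.
- by have := grid_V (lexx 0) A0 (lexx 0) B0; rewrite !mul0r.
- by have := grid_V A0 (lexx A) (lexx 0) B0; rewrite !mul0r.
- by have := grid_V (lexx 0) A0 B0 (lexx B); rewrite !mul0r.
- move=> v w [h|[h|[[a [b [ha b0 bB vv]]]|[a [b [ha a0 aA vv]]]]]].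
  + by have [h1 h2 h3] := SX1 _ _ h; split=> //; apply: step_prim.
  + by have [h1 h2 h3] := Yf _ _ h; split=> //; apply: prim_flip; apply: step_prim.
  + by have [h1 h2] := vV _ _ _ _ ha b0 bB vv; split=> //; apply: (vert_prim Lq vv).
  + have [h1 h2] := hV _ _ _ _ ha a0 aA vv; split=> //; apply: prim_flip.
    exact: (vert_prim Lq' (hori_flip vv)).
- have mXY := XY.
  have mXX v w v' w' : X v w -> X v' w' -> meets R L m n v w v' w'.
    move=> h h'; have [h1 h2 h3] := SX1 _ _ h; have [h1' h2' h3'] := SX1 _ _ h'.
    by apply: meets_xx => //; apply: SX2.
  have mXF v w v' w' : X v w -> frame v' w' -> meets R L m n v w v' w'.
    move=> h; have [h1 h2 h3] := SX1 _ _ h; case=> [[a [b [ha b0 bB vv]]]|[a [b [ha a0 aA vv]]]].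
      exact: (meets_xv h1 h2 h3 vv).
    by apply: (meets_xh Lq h1 h2 h3 vv); have [_ _ av] := hhb ha; apply: av.
  have mYY v w v' w' : Y v w -> Y v' w' -> meets R L m n v w v' w'.
    move=> h h'; have [h1 h2 h3] := Yf _ _ h; have [h1' h2' h3'] := Yf _ _ h'.
    apply: meets_flip; apply: meets_xx; rewrite ?flipK //; [exact: fV'|exact: fV'|exact: fV'|exact: fV'|].
    by apply: SY2; rewrite !flipK.
  have mYF v w v' w' : Y v w -> frame v' w' -> meets R L m n v w v' w'.
    move=> h; have [h1 h2 h3] := Yf _ _ h; case=> [[a [b [ha b0 bB vv]]]|[a [b [ha a0 aA vv]]]]; apply: meets_flip.
      apply: (meets_xh Lq' (fV' _ h1) (fV' _ h2) h3 (vert_flip vv)).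
      by have [_ _ av] := hva ha; apply: av; rewrite !flipK.
    exact: (meets_xv (fV' _ h1) (fV' _ h2) h3 (hori_flip vv)).
  have mFF v w v' w' : frame v w -> frame v' w' -> meets R L m n v w v' w'.
    have vh a b a' b' x y x' y' : va a -> hb b' -> vert q a b x y -> hori q a' b' x' y' -> meets R L m n x y x' y'.
      move=> /hva[a0 aA _] /hhb[b0 bB _] hv hh; apply: (meets_vh (grid_V a0 aA b0 bB) hv hh).
    case=> [[a [b [ha b0 bB vv]]]|[a [b [ha a0 aA vv]]]];
    case=> [[a' [b' [ha' b0' bB' vv']]]|[a' [b' [ha' a0' aA' vv']]]].
    - by have [h1 h2] := vV _ _ _ _ ha b0 bB vv; apply: (meets_vv Lq h1 h2 vv vv').
    - exact: vh ha ha' vv vv'.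
    - by apply: meets_sym; apply: vh ha' ha vv' vv.
    have [h1 h2] := hV _ _ _ _ ha a0 aA vv; apply: meets_flip.
    exact: (meets_vv Lq' (fV' _ h1) (fV' _ h2) (hori_flip vv) (hori_flip vv')).
  move=> v w v' w' [h|[h|h]] [h'|[h'|h']]; auto; apply: meets_sym; auto.
move=> x y x0 xm y0 yn h.
have onv a : va a -> x = (a * q)%:~R -> on (fun v w => X v w \/ Y v w \/ frame v w) x y.
  move=> ha ex; have [b [s [b0 bB s0 s1 ey]]] := grid_cell B1 y0 yn.
  have vv : vert q a b (a * q, b * q) (a * q, (b + 1) * q) by [].
  exists (a * q, b * q), (a * q, (b + 1) * q), s; have [-> ->] := mx_vert s vv; split=> //.
  by right; right; left; exists a, b.
have onh b : hb b -> y = (b * q)%:~R -> on (fun v w => X v w \/ Y v w \/ frame v w) x y.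
  move=> ha ey; have [a [s [a0 aA s0 s1 ex]]] := grid_cell A1 x0 xm.
  have vv : hori q a b (a * q, b * q) ((a + 1) * q, b * q) by [].
  exists (a * q, b * q), ((a + 1) * q, b * q), s; have [-> ->] := mx_hori s vv; split=> //.
  by right; right; right; exists a, b.
case/or4P: h => /eqP h.
- by apply: (onv 0); rewrite ?mul0r.
- by apply: (onv A).
- by apply: (onh 0); rewrite ?mul0r.
- by apply: (onh B).
Qed.

End Config.

Lemma basis2_x q L (d : int) : lattice q L -> L 1 d -> basis2 L (1, d) (0, q).
Proof.
move=> Lq Ld; split=> /=; first by rewrite mul1r mulr0 subr0 lt0r_neq0 // (lat_q Lq).
move=> x y Lxy; have := lat_B Lq Lxy (lat_scale x Lq Ld); rewrite mulr1 subrr.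
by move=> /(lat_y0 Lq)[j ej]; exists x, j; rewrite mulr1 mulr0 addr0 -ej addrC subrK.
Qed.

Lemma basis2_sym L u v : basis2 L u v -> basis2 L v u.
Proof.
move=> [D0 H]; split=> [|x y /H[i [j [-> ->]]]].
  by rewrite (_ : _ - _ = - (u.1 * v.2 - u.2 * v.1)) ?oppr_eq0 //; ring.
by exists j, i; rewrite ![i * _ + _]addrC.
Qed.

(** * Staircases *)

Section Stair.
Variable R : realType.

(* (p, r) lies on the monotone staircase that is horizontal at the heights b q and climbs
   from b q to (b + 1) q at the abscissa f b. *)
Definition stair (q : int) (n : int) (f : int -> R) (p r : R) :=
  [/\ 0 <= r, r <= n%:~R * q%:~R & forall b, 0 <= b -> b < n ->
    (p < f b -> r <= b%:~R * q%:~R) /\ (f b < p -> (b%:~R + 1) * q%:~R <= r)].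

Lemma stair_mono q n f p r p' r' : 0 < q -> stair q n f p r -> stair q n f p' r' -> p < p' -> r <= r'.
Proof.
move=> q0 [r0 rn H] [r0' rn' H'] pp; have q0' : 0 < q%:~R :> R by rewrite ltr0z.
rewrite leNgt; apply/negP => rr.
pose b := Num.floor (r' / q%:~R).
have b1 : b%:~R * q%:~R <= r' by rewrite -ler_pdivlMr // floor_le.
have b2 : r' < (b%:~R + 1) * q%:~R.
  by rewrite -ltr_pdivrMr //; have := floorD1_gt (r' / q%:~R); rewrite rmorphD.
have b0 : 0 <= b by rewrite floor_ge0 divr_ge0 // ltW.
have bn : b < n.
  rewrite -(ltr_int R) -(ltr_pM2r q0'); apply: le_lt_trans b1 _.
  by apply: lt_le_trans rr _.
have [_ h1] := H' _ b0 bn; have [h2 _] := H _ b0 bn.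
have pf : p' <= f b by rewrite leNgt; apply/negP => /h1; rewrite leNgt b2.
have := h2 (lt_le_trans pp pf); rewrite leNgt; case/negP.
exact: le_lt_trans b1 rr.
Qed.

Lemma mono_uniq (u p r p' r' : R) : 0 < u -> u < 1 -> (p < p' -> r <= r') -> (p' < p -> r' <= r) ->
  (1 - u) * p + u * r = (1 - u) * p' + u * r' -> p = p' /\ r = r'.
Proof.
move=> u0 u1 h1 h2 e; have u1' : 0 < 1 - u by rewrite subr_gt0.
have key (a b c d : R) : a < b -> c <= d -> (1 - u) * a + u * c = (1 - u) * b + u * d -> False.
  move=> ab cd e'; have : (1 - u) * a + u * c < (1 - u) * b + u * d.
    by apply: ltr_leD; rewrite ?ltr_pM2l ?ler_pM2l.
  by rewrite e' ltxx.
have ep : p = p'.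
  case: (ltgtP p p') => // pp; first by case: (key _ _ _ _ pp (h1 pp) e).
  by case: (key _ _ _ _ pp (h2 pp) (esym e)).
split=> //; move: e; rewrite ep => /addrI /(mulfI (lt0r_neq0 u0)); exact.
Qed.

Lemma stair_uniq q n f (u p r p' r' : R) : 0 < q -> 0 < u -> u < 1 ->
  stair q n f p r -> stair q n f p' r' ->
  (1 - u) * p + u * r = (1 - u) * p' + u * r' -> p = p' /\ r = r'.
Proof.
by move=> q0 u0 u1 s s'; apply: mono_uniq => // h; apply: (stair_mono q0 _ _ h); eassumption.
Qed.

Lemma stair_cover (q : int) (n : nat) (f : int -> R) (al be c H : R) :
  0 < q -> 0 <= al -> 0 <= be -> 0 <= H ->
  (forall b : int, 0 <= b -> b < n%:Z -> 0 <= f b /\ f b <= H) ->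
  (forall b b' : int, 0 <= b -> b <= b' -> b' < n%:Z -> f b <= f b') ->
  0 <= c -> c <= al * H + be * (n%:R * q%:~R) ->
  exists p r, [/\ 0 <= p, p <= H, al * p + be * r = c &
    (exists j : int, [/\ 0 <= j, j <= n%:Z, r = j%:~R * q%:~R, 0 < j -> f (j - 1) <= p & j < n%:Z -> p <= f j]) \/
    (exists j : int, [/\ 0 <= j, j < n%:Z, p = f j, j%:~R * q%:~R <= r & r <= (j%:~R + 1) * q%:~R])].
Proof.
move=> q0 al0 be0; have q0' : 0 < q%:~R :> R by rewrite ltr0z.
have seg (a x y z : R) : 0 <= a -> x <= y -> a * x <= z -> z <= a * y -> exists w, [/\ x <= w, w <= y & a * w = z].
  move=> a0 xy h1 h2; have [ea|na] := eqVneq a 0.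
    by exists x; split=> //; move: h1 h2; rewrite ea !mul0r => h1 h2; apply/eqP; rewrite eq_le h1 h2.
  have a0' : 0 < a by rewrite lt_neqAle eq_sym na.
  exists (z / a); split; first by rewrite ler_pdivlMr // mulrC.
    by rewrite ler_pdivrMr // mulrC.
  by rewrite mulrC mulfVK.
elim: n H => [|n IH] H H0 fH fm c0 cH.
  have h0 : al * 0 <= c by rewrite mulr0.
  rewrite mul0r mulr0 addr0 in cH.
  have [w [w0 wH ew]] := seg al 0 H c al0 H0 h0 cH.
  exists w, 0; split=> //; first by rewrite mulr0 addr0.
  by left; exists 0; rewrite mul0r.
have nn1 : n%:Z < n.+1%:Z by rewrite ltz_nat.
have [fn0 fnH] : 0 <= f n%:Z /\ f n%:Z <= H by apply: fH.
have [c1|c1] := leP c (al * f n%:Z + be * (n%:R * q%:~R)).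
  have fH' b : 0 <= b -> b < n%:Z -> 0 <= f b /\ f b <= f n%:Z.
    move=> b0 bn; split; last by apply: fm => //; apply: ltW.
    by have [] := fH b b0 (lt_trans bn nn1).
  have fm' b b' : 0 <= b -> b <= b' -> b' < n%:Z -> f b <= f b'.
    by move=> b0 bb bn; apply: fm => //; apply: lt_trans nn1.
  have [p [r [p0 pf e cs]]] := IH (f n%:Z) fn0 fH' fm' c0 c1.
  exists p, r; split=> //; first exact: le_trans fnH.
  case: cs => [[j [j0 jn er h1 h2]]|[j [j0 jn ep h1 h2]]]; [left|right]; exists j; split=> //.
  - exact: le_trans (ltW nn1).
  - move=> _; have [->//|nj] := eqVneq j n%:Z.
    by apply: h2; rewrite lt_neqAle nj.
  - exact: lt_trans nn1.
have [c2|c2] := leP c (al * f n%:Z + be * (n.+1%:R * q%:~R)).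
  have nq : n%:R * q%:~R <= n.+1%:R * q%:~R :> R by apply: ler_wpM2r; rewrite ?ler_nat // ltW.
  have h1 : be * (n%:R * q%:~R) <= c - al * f n%:Z by rewrite lerBrDl ltW.
  have h2 : c - al * f n%:Z <= be * (n.+1%:R * q%:~R) by rewrite lerBlDl.
  have [w [w0 wH ew]] := seg be _ _ _ be0 nq h1 h2.
  exists (f n%:Z), w; split=> //; first by rewrite ew addrC subrK.
  right; exists n%:Z; split=> //.
  by move: wH; rewrite -natr1.
have h1 : al * f n%:Z <= c - be * (n.+1%:R * q%:~R) by rewrite lerBrDr ltW.
have h2 : c - be * (n.+1%:R * q%:~R) <= al * H by rewrite lerBlDr.
have [w [w0 wH ew]] := seg al _ _ _ al0 fnH h1 h2.
exists w, (n.+1%:R * q%:~R); split=> //.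
- exact: le_trans w0.
- by rewrite ew subrK.
left; exists n.+1%:Z; split=> //; last by rewrite ltxx.
by move=> _; rewrite -addn1 PoszD addrK.
Qed.

End Stair.

Section StairMore.
Variable R : realType.
Variables (q n : int) (f : int -> R).
Hypothesis q0 : 0 < q.
Hypothesis fm : forall b b' : int, 0 <= b -> b <= b' -> b' < n -> f b <= f b'.

Lemma stair_level (j : int) (p : R) : 0 <= j -> j <= n -> (0 < j -> f (j - 1) <= p) -> (j < n -> p <= f j) ->
  stair q n f p (j%:~R * q%:~R).
Proof.
have q0' : 0 < q%:~R :> R by rewrite ltr0z.
move=> j0 jn h1 h2; split.
- by apply: mulr_ge0; rewrite ?ler0z // ltW.
- by rewrite ler_pM2r // ler_int.
move=> b b0 bn; split=> h.
  rewrite ler_pM2r // ler_int leNgt; apply/negP => bj.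
  have : f b <= f (j - 1) by apply: fm => //; move: bj jn; clear -q0; lia.
  move=> h3; have := lt_le_trans h (le_trans h3 (h1 (le_lt_trans b0 bj))); by rewrite ltxx.
rewrite ler_pM2r // -[1]/(1%:~R) -rmorphD /= ler_int leNgt; apply/negP => bj.
have jn' : j < n by move: bj bn; clear -q0; lia.
have : f j <= f b by apply: fm => //; move: bj; clear -q0; lia.
by move=> h3; have := lt_le_trans h (le_trans (h2 jn') h3); rewrite ltxx.
Qed.

Lemma stair_rise (j : int) (r : R) : 0 <= j -> j < n -> j%:~R * q%:~R <= r -> r <= (j%:~R + 1) * q%:~R ->
  stair q n f (f j) r.
Proof.
have q0' : 0 < q%:~R :> R by rewrite ltr0z.
move=> j0 jn h1 h2.
have E (x : int) : x%:~R + 1 = (x + 1)%:~R :> R by rewrite rmorphD.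
split.
- by apply: le_trans h1; apply: mulr_ge0; rewrite ?ler0z // ltW.
- by apply: le_trans h2 _; rewrite E ler_pM2r // ler_int; move: jn; clear -q0; lia.
move=> b b0 bn; split=> h.
  apply: le_trans h2 _; rewrite E ler_pM2r // ler_int leNgt; apply/negP => bj.
  have bj' : b <= j by move: bj; clear -q0; lia.
  by have := lt_le_trans h (fm b0 bj' jn); rewrite ltxx.
apply: le_trans h1; rewrite E ler_pM2r // ler_int leNgt; apply/negP => bj.
have bj' : j <= b by move: bj; clear -q0; lia.
by have := lt_le_trans h (fm j0 bj' bn); rewrite ltxx.
Qed.

End StairMore.

Section StairGrid.
Variable R : realType.
Variables (q : int).
Hypothesis q0 : 0 < q.

Lemma stair_ext n (f g : int -> R) p r : (forall b, 0 <= b -> b < n -> f b = g b) ->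
  stair q n f p r -> stair q n g p r.
Proof. by move=> e [h1 h2 H]; split=> // b b0 bn; rewrite -e //; apply: H. Qed.

Lemma stair_swap (B : int) (p r : R) : 0 <= p -> p <= B%:~R * q%:~R ->
  stair q (B + 1) (fun b => b%:~R * q%:~R) p r -> stair q B (fun b => (b%:~R + 1) * q%:~R) r p.
Proof.
have E (x : int) : x%:~R + 1 = (x + 1)%:~R :> R by rewrite rmorphD.
move=> p0 pB [r0 rB H]; split=> // b b0 bB; split=> h; rewrite leNgt; apply/negP => h'.
  have [|_ /(_ h')] := H b b0; first by move: bB; clear -q0; lia.
  by rewrite leNgt h.
have b10 : 0 <= b + 1 by move: b0; clear -q0; lia.
have b1B : b + 1 < B + 1 by move: bB; clear -q0; lia.
have [+ _] := H _ b10 b1B; rewrite -E => /(_ h').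
by rewrite leNgt h.
Qed.

Lemma stair_grid n (i j : int) : 0 <= i -> i <= n + 1 ->
  stair q n (fun b => (b%:~R + 1) * q%:~R : R) (i%:~R * q%:~R) (j%:~R * q%:~R) -> i = j \/ i = j + 1.
Proof.
have q0' : 0 < q%:~R :> R by rewrite ltr0z.
have E (x : int) : x%:~R + 1 = (x + 1)%:~R :> R by rewrite rmorphD.
move=> i0 iN [j0 jn H].
have {}j0 : 0 <= j by rewrite -(ler0z R) -(pmulr_lge0 _ q0').
have {}jn : j <= n by move: jn; rewrite ler_pM2r // ler_int.
have h1 : i - 1 <= j.
  rewrite leNgt; apply/negP => h.
  have i2 : 0 <= i - 2 by move: h j0; clear -q0; lia.
  have i2n : i - 2 < n by move: iN; clear -q0; lia.
  have [_] := H _ i2 i2n; rewrite !E !ltr_pM2r // !ler_pM2r // !ltr_int !ler_int; move: h; clear -q0; lia.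
have h2 : j <= i.
  rewrite leNgt; apply/negP => h.
  have iln : i < n by move: h jn; clear -q0; lia.
  have [+ _] := H _ i0 iln; rewrite !E !ltr_pM2r // !ler_pM2r // !ltr_int !ler_int; move: h; clear -q0; lia.
by move: h1 h2; clear -q0; lia.
Qed.
End StairGrid.

Section Chains.
Variable R : realType.
Local Notation rx := (@rx R).
Local Notation ry := (@ry R).
Local Notation mx := (@mx R).
Local Notation my := (@my R).
Local Notation wsum := (@wsum R).
Local Notation wt := (@wt R).

Lemma wt_unit (P : eqType) (s : seq P) v : v \in s -> exists l, wt s l /\ forall g, wsum s l g = g v.
Proof.
have zeros g : forall s' : seq P, wsum s' (nseq (size s') 0) g = 0.
  by elim=> [|a s' IH]; rewrite /= ?wsumE // mul0r add0r.
elim: s => [|a s IH] //; rewrite inE; have [->|av] := eqVneq v a => /= h.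
  exists (1 :: nseq (size s) 0); split; last by move=> g; rewrite wsumE zeros addr0 mul1r.
  split; first by rewrite /= size_nseq.
    by move=> x; rewrite inE => /orP[/eqP->//|/nseqP[->]].
  by rewrite wsumE zeros addr0 mul1r.
have [l [[h1 h2 h3] H]] := IH h; exists (0 :: l); split; last by move=> g; rewrite wsumE mul0r add0r H.
split; first by rewrite /= h1.
  by move=> x; rewrite inE => /orP[/eqP->//|/h2].
by rewrite wsumE mul0r add0r H.
Qed.

Lemma wt_mix (a b : pt2) (s : R) : 0 <= s -> s <= 1 ->
  exists l, wt [:: a; b] l /\ forall g, wsum [:: a; b] l g = (1 - s) * g a + s * g b.
Proof.
move=> s0 s1; exists [:: 1 - s; s]; split; last by move=> g; rewrite !wsumE addr0.
split=> //; last by rewrite !wsumE; ring.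
by move=> x; rewrite !inE => /orP[] /eqP->; rewrite ?subr_ge0.
Qed.

Lemma chain_cell (phi : int -> int) N (lo hi : int) (x : R) : 0 <= lo -> lo < hi -> hi <= N%:Z ->
  lo%:~R <= x -> x <= hi%:~R -> exists t s, [/\ lo <= t, t + 1 <= hi, 0 <= s /\ s <= 1,
    x = mx s (t, phi t) (t + 1, phi (t + 1)) & pl phi N x = my s (t, phi t) (t + 1, phi (t + 1))].
Proof.
move=> lo0 lohi hN lox xhi; have [t [t0 t1 tx xt]] := unit_cell lohi lox xhi.
exists t, (x - t%:~R); split=> //.
- by rewrite subr_ge0 lerBlDl.
- by rewrite mx_step //= addrC subrK.
rewrite (plE phi (t := t)) //; first by rewrite /my /ry /=; ring.
- exact: le_trans t0.
- exact: le_trans hN.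
Qed.

Lemma chain_on (E : pt2 -> pt2 -> Prop) phi N (lo hi : int) (x : R) : 0 <= lo -> lo < hi -> hi <= N%:Z ->
  (forall t, lo <= t -> t + 1 <= hi -> E (t, phi t) (t + 1, phi (t + 1))) ->
  lo%:~R <= x -> x <= hi%:~R -> on E x (pl phi N x).
Proof.
move=> lo0 lohi hN H lox xhi; have [t [s [t0 t1 [s0 s1] e1 e2]]] := chain_cell phi lo0 lohi hN lox xhi.
by exists (t, phi t), (t + 1, phi (t + 1)), s; split=> //; apply: H.
Qed.

Lemma wt_step phi N (t : int) l : 0 <= t -> t + 1 <= N%:Z ->
  wt [:: (t, phi t); (t + 1, phi (t + 1))] l ->
  let x := wsum [:: (t, phi t); (t + 1, phi (t + 1))] l rx in
  [/\ t%:~R <= x, x <= t%:~R + 1 & wsum [:: (t, phi t); (t + 1, phi (t + 1))] l ry = pl phi N x].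
Proof.
move=> t0 tN wl; have [s [s0 s1 H]] := wt2 wl; rewrite /= !H.
have ex : (1 - s) * rx (t, phi t) + s * rx (t + 1, phi (t + 1)) = t%:~R + s.
  by rewrite /rx /= rmorphD /=; ring.
rewrite ex lerDl lerD2l; split=> //.
rewrite (plE phi (t := t)) ?lerDl ?lerD2l //.
by rewrite /ry /=; ring.
Qed.

Lemma wt_vert q (a b : int) l : wt [:: (a * q, b * q); (a * q, (b + 1) * q)] l -> 0 < q ->
  [/\ wsum [:: (a * q, b * q); (a * q, (b + 1) * q)] l rx = a%:~R * q%:~R,
      b%:~R * q%:~R <= wsum [:: (a * q, b * q); (a * q, (b + 1) * q)] l ry &
      wsum [:: (a * q, b * q); (a * q, (b + 1) * q)] l ry <= (b%:~R + 1) * q%:~R].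
Proof.
move=> wl q0; have [s [s0 s1 H]] := wt2 wl; rewrite !H /rx /ry /= !rmorphM /= rmorphD /=.
have q0' : 0 < q%:~R :> R by rewrite ltr0z.
have -> : (1 - s) * (b%:~R * q%:~R) + s * ((b%:~R + 1) * q%:~R) = (b%:~R + s) * q%:~R :> R by ring.
by rewrite !ler_pM2r // lerDl lerD2l; split=> //; ring.
Qed.

Variables (L : int -> int -> Prop) (m n : int) (E : pt2 -> pt2 -> Prop).
Hypothesis PL : plane R L m n E.

Lemma tri_zone a b c (h : R -> R -> R) (x y : R) l : tri L E a b c -> lip2 h ->
  (forall u v, 0 <= u -> u <= m%:~R -> 0 <= v -> v <= n%:~R -> h u v = 0 -> on E u v) ->
  in_tri a b c x y -> 0 < h x y -> wt [:: a; b; c] l ->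
  0 <= h (wsum [:: a; b; c] l rx) (wsum [:: a; b; c] l ry).
Proof.
move=> T hl hz it h0 wl; apply: (triangle_side PL T hl hz it h0).
have [l1 [l2 [l3 [p e H]]]] := wt3 wl.
by exists l1, l2, l3; split=> //; rewrite H.
Qed.

Lemma spx_range s l : spx L E s -> wt s l ->
  [/\ 0 <= wsum s l rx, wsum s l rx <= m%:~R, 0 <= wsum s l ry & wsum s l ry <= n%:~R].
Proof.
move=> Es wl.
have H v : v \in s -> [/\ 0 <= rx v, rx v <= m%:~R, 0 <= ry v & ry v <= n%:~R].
  move=> vs; have [[_ h1 h2 h3 h4] _] := pl_V PL (spx_edge PL Es vs vs).
  by rewrite /rx /ry !ler0z !ler_int.
have ge (g : pt2 -> R) : (forall v, v \in s -> 0 <= g v) -> 0 <= wsum s l g.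
  move: wl => [e l0 _]; move: {Es H} l e l0; elim: s => [|a s IH] [|x l] // e l0 g0; rewrite ?wsumE //.
  apply: addr_ge0.
    by apply: mulr_ge0; [apply: l0|apply: g0]; rewrite inE eqxx.
  case: e => e; apply: IH => // [y yl|v vT]; [apply: l0|apply: g0]; by rewrite inE ?yl ?vT orbT.
have le (g : pt2 -> R) c : (forall v, v \in s -> g v <= c) -> wsum s l g <= c.
  move=> hg; have : 0 <= wsum s l (fun v => c + (-1) * g v).
    by apply: ge => v vs; rewrite mulN1r subr_ge0; apply: hg.
  rewrite wsumD wsum_const; have [_ _ ->] := wl; rewrite mulr1.
  suff -> : wsum s l (fun v => -1 * g v) = - wsum s l g by rewrite subr_ge0.
  rewrite /wsum -sumrN; apply: eq_bigr => i _; ring.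
by split; [apply: ge|apply: le|apply: ge|apply: le] => v /H[].
Qed.

End Chains.

(** * Slabs between ordinary sections *)

Section XPlane.
Variable R : realType.
Variables (q : int) (L : int -> int -> Prop) (Y : int -> int).
Hypothesis Lq : lattice q L.
Hypothesis HY : forall t, [/\ L t (Y t), 0 <= Y t & Y t < q].

Definition phi (b t : int) : int := if (q %| t)%Z then b * q else Y t.

Lemma dvdzMq (a : int) : (q %| a * q)%Z. Proof. exact: dvdz_mull. Qed.

Lemma phi_grid a b : phi b (a * q) = b * q.
Proof. by rewrite /phi dvdzMq. Qed.

Lemma phi_L b t : L t (phi b t).
Proof.
rewrite /phi; case: ifP => [/dvdzP[a ->]|_]; first exact: lat_grid.
by have [] := HY t.
Qed.

Lemma phi_le b b' t : b <= b' -> phi b t <= phi b' t.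
Proof. by move=> h; rewrite /phi; case: ifP => // _; apply: ler_wpM2r => //; apply: ltW (lat_q Lq). Qed.

Lemma phi_bounds b B t : 0 <= b -> b <= B -> 1 <= B -> 0 <= phi b t /\ phi b t <= B * q.
Proof.
have q0 := lat_q Lq; move=> b0 bB B1; rewrite /phi; case: ifP => _.
  by split; [apply: mulr_ge0 => //; apply: ltW|apply: ler_wpM2r => //; apply: ltW].
have [_ h1 h2] := HY t; split=> //; apply: le_trans (ltW h2) _.
by rewrite -[X in X <= _]mul1r; apply: ler_wpM2r => //; apply: ltW.
Qed.

Record xplane (A B : int) (E : pt2 -> pt2 -> Prop) : Prop := XPlane {
  xp_pl : plane R L (A * q) (B * q) E;
  xp_ch : forall b t, 0 <= b -> b <= B -> 0 <= t -> t + 1 <= A * q -> E (t, phi b t) (t + 1, phi b (t + 1));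
  xp_vt : forall a b, 0 <= a -> a <= A -> 0 <= b -> b + 1 <= B -> E (a * q, b * q) (a * q, (b + 1) * q);
  xp_hz : forall a b, b = 0 \/ b = B -> 0 <= a -> a + 1 <= A -> E (a * q, b * q) ((a + 1) * q, b * q) }.

Lemma xplane_exists A B : 1 <= A -> 1 <= B -> exists E, xplane A B E.
Proof.
move=> A1 B1; have A0 : 0 <= A by apply: le_trans A1. have B0 : 0 <= B by apply: le_trans B1.
pose X (v w : pt2) := exists b t, [/\ 0 <= b /\ b <= B, 0 <= t /\ t + 1 <= A * q, v = (t, phi b t) & w = (t + 1, phi b (t + 1))].
have SX : steps L (A * q) (B * q) X.
  split.
    move=> v w [b [t [[b0 bB] [t0 tA] -> ->]]]; split=> //; split=> /=; try exact: phi_L;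
      try by case: (phi_bounds t b0 bB B1); try by case: (phi_bounds (t + 1) b0 bB B1).
    - by move: tA; clear; lia.
    - by move: t0; clear; lia.
  move=> v w v' w' [b [t [_ _ -> ->]]] [b' [t' [_ _ -> ->]]] /= <-.
  by case: (leP b b') => h; [left|right; have {}h := ltW h]; split; apply: phi_le.
have SY : steps (fun x y => L y x) (B * q) (A * q) (fun v w => False) by [].
pose va a : Prop := 0 <= a /\ a <= A.
pose hb b : Prop := b = 0 \/ b = B.
have XYm (v w v' w' : pt2) : X v w -> False -> meets R L (A * q) (B * q) v w v' w' by move=> _ [].
have hva a : va a -> [/\ 0 <= a, a <= A & avoids q (fun _ _ => False) a] by case=> h1 h2; split=> // ? ? [].
have hhb b : hb b -> [/\ 0 <= b, b <= B & avoids q X b].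
  move=> hb'; have [b0 bB] : 0 <= b /\ b <= B by case: hb' => ->.
  split=> // v w [b' [t [[b0' bB'] _ -> ->]]] /=.
  have [h1 h2] := phi_bounds t b0' bB' B1; have [h3 h4] := phi_bounds (t + 1) b0' bB' B1.
  by case: hb' => ->; [right; rewrite mul0r|left].
have va0 : va 0 by split. have vaA : va A by split.
have [E [PE HE]] := config_plane Lq A1 B1 SX SY XYm hva hhb va0 vaA (or_introl erefl) (or_intror erefl).
exists E; split=> //.
- by move=> b t b0 bB t0 tA; apply: HE; left; exists b, t.
- by move=> a b a0 aA b0 bB; apply: HE; right; right; left; exists a, b.
- by move=> a b hb' a0 aA; apply: HE; right; right; right; exists a, b.
Qed.

End XPlane.

Section XSlab.
Variable R : realType.
Local Notation rx := (@rx R).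
Local Notation ry := (@ry R).
Local Notation mx := (@mx R).
Local Notation my := (@my R).
Local Notation wsum := (@wsum R).
Local Notation wt := (@wt R).
Variables (q : int) (L : int -> int -> Prop) (Y : int -> int).
Hypothesis Lq : lattice q L.
Hypothesis HY : forall t, [/\ L t (Y t), 0 <= Y t & Y t < q].
Local Notation phi := (phi q Y).
Variables (A B A' : int) (E E' : pt2 -> pt2 -> Prop).
Hypotheses (A1 : 1 <= A) (B1 : 1 <= B) (A1' : 1 <= A') (AA' : A - 1 <= A') (AA : A' <= A).
Hypotheses (XE : xplane R q L Y A B E) (XE' : xplane R q L Y A' (B + 1) E').

Let N : nat := absz (A * q).
Let F (b : int) (x : R) := pl (phi b) N x.
Let Q : R := q%:~R.

Let q0 : 0 < q. Proof. exact: lat_q Lq. Qed.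
Let Q0 : 0 < Q. Proof. by rewrite ltr0z. Qed.
Let NE : N%:Z = A * q.
Proof. by rewrite /N gez0_abs // mulr_ge0 ?ltW // (lt_le_trans _ A1). Qed.

Lemma F_grid b a : 0 <= a -> a <= A -> F b (a%:~R * Q) = b%:~R * Q.
Proof.
move=> a0 aA; rewrite /F -rmorphM /= pl_int; first by rewrite phi_grid rmorphM.
  by rewrite mulr_ge0 // ltW.
by rewrite NE ler_wpM2r // ltW.
Qed.

Lemma F_le b b' x : b <= b' -> F b x <= F b' x.
Proof. by move=> h; apply: pl_le => t _ _; apply: (phi_le _ Lq). Qed.

Lemma F_bd C b x : 1 <= C -> 0 <= b -> b <= C -> 0 <= x -> x <= A%:~R * Q -> 0 <= F b x /\ F b x <= C%:~R * Q.
Proof.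
move=> C1 b0 bC x0 xA.
have xN : x <= N%:R by rewrite -[N%:R]/((N%:Z)%:~R) NE rmorphM.
have [|h1 h2] := @pl_bounds R (phi b) N x 0 (C * q) x0 xN; last by rewrite -rmorphM; split.
by move=> t _ _; apply: (phi_bounds Lq HY).
Qed.

Definition xrel (y1 y2 w1 w2 : R) :=
  [/\ stair q (A - 1) (fun a => (a%:~R + 1) * Q) y1 w1, 0 <= y2 /\ y2 <= B%:~R * Q &
   (exists a, [/\ 0 <= a, a <= A - 1, w1 = a%:~R * Q & stair q (B + 1) (F^~ y1) y2 w2]) \/
   (exists a, [/\ 0 <= a, a <= A, y1 = a%:~R * Q & stair q B (fun b => F (b + 1) w1) w2 y2])].

Lemma intS (b : int) : b%:~R + 1 = (b + 1)%:~R :> R.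
Proof. by rewrite rmorphD. Qed.

Lemma xrel_grid a a' y2 w2 : 0 <= a -> a <= A -> 0 <= a' -> a' <= A ->
  xrel (a%:~R * Q) y2 (a'%:~R * Q) w2 -> stair q B (fun b => (b%:~R + 1) * Q) w2 y2.
Proof.
move=> a0 aA a0' aA' [_ [y0 yB] [[_ [_ _ _ s]]|[_ [_ _ _ s]]]].
  apply: (stair_swap q0 y0 yB); apply: stair_ext s => b b0 bB; exact: F_grid.
by apply: stair_ext s => b b0 bB; rewrite F_grid // intS.
Qed.

Lemma xrel_uniq (u y1 y2 w1 w2 y1' y2' w1' w2' : R) : 0 < u -> u < 1 ->
  xrel y1 y2 w1 w2 -> xrel y1' y2' w1' w2' ->
  (1 - u) * y1 + u * w1 = (1 - u) * y1' + u * w1' ->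
  (1 - u) * y2 + u * w2 = (1 - u) * y2' + u * w2' -> y1 = y1' /\ y2 = y2'.
Proof.
move=> u0 u1 r r' e1 e2.
have [s1 [y20 y2B] c] := r; have [s1' [y20' y2B'] c'] := r'.
have [ey ew] := stair_uniq q0 u0 u1 s1 s1' e1; split=> //; subst y1' w1'.
have u1' : 0 < 1 - u by rewrite subr_gt0.
have ul : 1 - u < 1 by rewrite gtrBl.
have e2' : (1 - (1 - u)) * w2 + (1 - u) * y2 = (1 - (1 - u)) * w2' + (1 - u) * y2'.
  by rewrite subKr addrC e2 addrC.
have grid a a' : 0 <= a -> a <= A -> y1 = a%:~R * Q -> 0 <= a' -> a' <= A - 1 -> w1 = a'%:~R * Q -> y2 = y2'.
  move=> a0 aA ey a0' aA' ew; have {}aA' : a' <= A by apply: le_trans aA' _; rewrite gerBl.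
  rewrite ey ew in r r'; have s := xrel_grid a0 aA a0' aA' r; have s' := xrel_grid a0 aA a0' aA' r'.
  by have [_ ->] := stair_uniq q0 u1' ul s s' e2'.
case: c => -[a [a0 aA ea s]]; case: c' => -[a' [a0' aA' ea' s']].
- by have [-> _] := stair_uniq q0 u0 u1 s s' e2.
- exact: (grid a' a).
- exact: (grid a a').
- by have [_ ->] := stair_uniq q0 u1' ul s s' e2'.
Qed.

Definition xslab (s t : seq pt2) :=
  [/\ spx L E s, spx L E' t, (size s + size t = 4)%N,
   forall a b c d, s = [:: a; b] -> t = [:: c; d] -> basis2 L (sub2 b a) (sub2 d c) &
   forall l k, wt s l -> wt t k -> xrel (wsum s l rx) (wsum s l ry) (wsum t k rx) (wsum t k ry)].

Lemma xslab_vertex s t v w : xslab s t -> v \in s -> w \in t -> xrel (rx v) (ry v) (rx w) (ry w).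
Proof.
move=> [_ _ _ _ H] vs wt'; have [l [wl el]] := wt_unit R vs; have [k [wk ek]] := wt_unit R wt'.
by have := H l k wl wk; rewrite !el !ek.
Qed.

Lemma xslab_low s t v : xslab s t -> v \in s -> Vbox L (A * q) (B * q) v.
Proof. by move=> [Es _ _ _ _] vs; have [] := pl_V (xp_pl XE) (spx_edge (xp_pl XE) Es vs vs). Qed.

Lemma xslab_high s t w : xslab s t -> w \in t -> Vbox L ((A - 1) * q) ((B + 1) * q) w.
Proof.
move=> M wt'; have [Es Et _ _ _] := M.
have [[h1 h2 h3 h4 h5] _] := pl_V (xp_pl XE') (spx_edge (xp_pl XE') Et wt' wt').
split=> //.
have [v vs] : exists v, v \in s by case: Es => [a _|a b _|a b c _]; exists a; rewrite inE eqxx.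
have [[_ + _] _ _] := xslab_vertex M vs wt'.
by rewrite -rmorphM /= ler_int.
Qed.

Lemma strip_low a (x : R) : 0 <= a -> a <= A - 1 -> a%:~R * Q <= x -> x <= (a%:~R + 1) * Q ->
  stair q (A - 1) (fun a => (a%:~R + 1) * Q) x (a%:~R * Q).
Proof.
move=> a0 aA h1 h2; apply: stair_level => //.
- by move=> b b' _ bb _; rewrite ler_pM2r // lerD2r ler_int.
- by move=> _; rewrite rmorphB /= subrK.
Qed.

Lemma strip_high a (x : R) : 0 <= a -> a < A - 1 -> a%:~R * Q <= x -> x <= (a%:~R + 1) * Q ->
  stair q (A - 1) (fun a => (a%:~R + 1) * Q) ((a%:~R + 1) * Q) x.
Proof.
move=> a0 aA h1 h2; apply: (stair_rise (f := fun a => (a%:~R + 1) * Q)) => //.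
by move=> b b' _ bb _; rewrite ler_pM2r // lerD2r ler_int.
Qed.

Let A0 : 0 <= A. Proof. exact: le_trans A1. Qed.
Let B0 : 0 <= B. Proof. exact: le_trans B1. Qed.

Lemma F_mono x : forall b b' : int, 0 <= b -> b <= b' -> b' < B + 1 -> F b x <= F b' x.
Proof. by move=> *; apply: F_le. Qed.

Lemma F_mono1 x : forall b b' : int, 0 <= b -> b <= b' -> b' < B -> F (b + 1) x <= F (b' + 1) x.
Proof. by move=> *; apply: F_le; rewrite lerD2r. Qed.

Lemma cell_le a (t : int) (x : R) : t%:~R <= x -> x <= t%:~R + 1 -> a * q <= t -> t + 1 <= (a + 1) * q ->
  a%:~R * Q <= x /\ x <= (a%:~R + 1) * Q.
Proof.
move=> h1 h2 h3 h4; split.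
  by apply: le_trans h1; rewrite -rmorphM ler_int.
by apply: le_trans h2 _; rewrite intS -rmorphM intS ler_int.
Qed.

Lemma step_basis b t a c : basis2 L (sub2 (t + 1, phi b (t + 1)) (t, phi b t)) (sub2 (a * q, (c + 1) * q) (a * q, c * q)).
Proof.
have -> : sub2 (a * q, (c + 1) * q) (a * q, c * q) = (0, q) by congr pair => /=; ring.
have Lt : L (t + 1 - t) (phi b (t + 1) - phi b t).
  by apply: (lat_B Lq); apply: (phi_L Lq HY).
have e1 : t + 1 - t = 1 by ring.
by rewrite e1 in Lt; rewrite /sub2 /= e1; apply: (basis2_x Lq).
Qed.

Lemma xslab1 a b t : 0 <= a -> a <= A - 1 -> 0 <= b -> b <= B -> a * q <= t -> t + 1 <= (a + 1) * q ->
  xslab [:: (t, phi b t); (t + 1, phi b (t + 1))] [:: (a * q, b * q); (a * q, (b + 1) * q)].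
Proof.
move=> a0 aA b0 bB t0 tA.
have t0' : 0 <= t by apply: le_trans t0; apply: mulr_ge0 => //; apply: ltW.
have tA' : t + 1 <= A * q.
  by apply: le_trans tA _; rewrite ler_wpM2r ?(ltW q0) // -lerBrDr.
split=> //.
- by apply: Spx2; apply: (xp_ch XE).
- apply: Spx2; apply: (xp_vt XE') => //; first exact: le_trans AA'.
  by rewrite lerD2r.
- by move=> ? ? ? ? [<- <-] [<- <-]; apply: step_basis.
move=> l k wl wk; have := wl; have := @wt_step R (phi b) N t l t0' _ wl; rewrite NE => /(_ tA').
have [-> k1 k2] := wt_vert wk q0.
set x := wsum _ l rx; move=> [x1 x2 ->] wl'.
have [x3 x4] := cell_le x1 x2 t0 tA.
have x0 : 0 <= x by apply: le_trans x3; apply: mulr_ge0; rewrite ?ler0z // ltW.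
have xA : x <= A%:~R * Q.
  by apply: le_trans x2 _; rewrite intS -rmorphM ler_int.
split.
- exact: strip_low.
- exact: F_bd.
left; exists a; split=> //; apply: (stair_rise (f := F^~ x)) => //; first exact: F_mono.
by move: bB; clear -B1; lia.
Qed.

Lemma xslab3 a b t : 0 <= a -> a < A - 1 -> 0 <= b -> b < B -> a * q <= t -> t + 1 <= (a + 1) * q ->
  xslab [:: ((a + 1) * q, b * q); ((a + 1) * q, (b + 1) * q)]
        [:: (t, phi (b + 1) t); (t + 1, phi (b + 1) (t + 1))].
Proof.
move=> a0 aA b0 bB t0 tA.
have t0' : 0 <= t by apply: le_trans t0; apply: mulr_ge0 => //; apply: ltW.
have aA1 : a + 1 <= A - 1 by move: aA; clear -B1; lia.
have tA' : t + 1 <= A' * q.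
  by apply: le_trans tA _; rewrite ler_wpM2r ?(ltW q0) // (le_trans aA1).
have tA2 : t + 1 <= A * q by apply: le_trans tA' _; rewrite ler_wpM2r // ltW.
have b10 : 0 <= b + 1 by apply: addr_ge0.
split=> //.
- apply: Spx2; apply: (xp_vt XE) => //.
  + by apply: addr_ge0.
  + by apply: le_trans aA1 _; rewrite gerBl.
  + by move: bB; clear -B1; lia.
- by apply: Spx2; apply: (xp_ch XE') => //; rewrite lerD2r ltW.
- by move=> ? ? ? ? [<- <-] [<- <-]; apply: basis2_sym; apply: step_basis.
move=> l k wl wk; have := @wt_step R (phi (b + 1)) N t k t0' _ wk; rewrite NE => /(_ tA2).
have [-> l1 l2] := wt_vert wl q0.
set x := wsum _ k rx; set y := wsum _ l ry in l1 l2 *; move=> [x1 x2 ->].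
have [x3 x4] := cell_le x1 x2 t0 tA.
split.
- by rewrite -intS; apply: strip_high.
- split; first by apply: le_trans l1; apply: mulr_ge0; rewrite ?ler0z // ltW.
  by apply: le_trans l2 _; rewrite ler_wpM2r ?(ltW Q0) // intS ler_int; move: bB; clear -B1; lia.
right; exists (a + 1); split=> //; [exact: addr_ge0|by apply: le_trans aA1 _; rewrite gerBl|].
by apply: (stair_rise (f := fun b => F (b + 1) x)) => //; apply: F_mono1.
Qed.

Lemma wt_sing (v : pt2) k : wt [:: v] k -> wsum [:: v] k rx = rx v /\ wsum [:: v] k ry = ry v.
Proof. by move=> wk; rewrite !(wt1 wk). Qed.

Lemma xslab2 a b s : 0 <= a -> a <= A - 1 -> 0 <= b -> b <= B + 1 -> spx L E s -> size s = 3%N ->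
  (forall l, wt s l -> let x := wsum s l rx in let y := wsum s l ry in
    [/\ a%:~R * Q <= x, x <= (a%:~R + 1) * Q, 0 < b -> F (b - 1) x <= y & b < B + 1 -> y <= F b x]) ->
  xslab s [:: (a * q, b * q)].
Proof.
move=> a0 aA b0 bB Es ss H.
have Vab : Vbox L (A' * q) ((B + 1) * q) (a * q, b * q).
  split=> /=; first exact: lat_grid.
  - by apply: mulr_ge0 => //; apply: ltW.
  - by apply: ler_wpM2r; [apply: ltW|apply: le_trans AA'].
  - by apply: mulr_ge0 => //; apply: ltW.
  - by apply: ler_wpM2r => //; apply: ltW.
split=> //; first by apply: Spx1; apply: (pl_refl (xp_pl XE')).
  by rewrite ss.
move=> l k wl wk; have [h1 h2 h3 h4] := H l wl.
have [_ _ y0 yB] := spx_range (xp_pl XE) Es wl.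
have [-> ->] := wt_sing wk; rewrite /rx /ry /= !rmorphM /=.
split; first exact: strip_low.
  by rewrite -rmorphM.
left; exists a; split=> //; apply: stair_level => //; exact: F_mono.
Qed.

Lemma xslab4 a b t : 0 <= a -> a < A - 1 -> 0 <= b -> b <= B -> spx L E' t -> size t = 3%N ->
  (forall l, wt t l -> let x := wsum t l rx in let y := wsum t l ry in
    [/\ a%:~R * Q <= x, x <= (a%:~R + 1) * Q, 0 < b -> F b x <= y & b < B -> y <= F (b + 1) x]) ->
  xslab [:: ((a + 1) * q, b * q)] t.
Proof.
move=> a0 aA b0 bB Et st H.
have aA1 : a + 1 <= A - 1 by move: aA; clear -B1; lia.
have aA2 : a + 1 <= A by apply: le_trans aA1 _; rewrite gerBl.
have a10 : 0 <= a + 1 by apply: addr_ge0.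
have Vab : Vbox L (A * q) (B * q) ((a + 1) * q, b * q).
  split=> /=; first exact: lat_grid.
  - by apply: mulr_ge0 => //; apply: ltW.
  - by apply: ler_wpM2r => //; apply: ltW.
  - by apply: mulr_ge0 => //; apply: ltW.
  - by apply: ler_wpM2r => //; apply: ltW.
split=> //; first by apply: Spx1; apply: (pl_refl (xp_pl XE)).
  by rewrite /= st.
move=> l k wl wk; have [h1 h2 h3 h4] := H k wk.
have [-> ->] := wt_sing wl; rewrite /rx /ry /= !rmorphM /=.
split; first by rewrite -intS; apply: strip_high.
  by split; [apply: mulr_ge0; rewrite ?ler0z // ltW|apply: ler_wpM2r; rewrite ?ler_int // ltW].
right; exists (a + 1); split=> //; apply: stair_level => //; first exact: F_mono1.
by move=> b00; rewrite subrK; apply: h3.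
Qed.

End XSlab.

Section Zone.
Variable R : realType.
Local Notation rx := (@rx R).
Local Notation ry := (@ry R).
Local Notation wsum := (@wsum R).
Local Notation wt := (@wt R).
Variables (L : int -> int -> Prop) (m n : int) (E : pt2 -> pt2 -> Prop).
Hypothesis PL : plane R L m n E.

Lemma in_tri_wt a b c (x y : R) : in_tri a b c x y ->
  exists l, [/\ wt [:: a; b; c] l, wsum [:: a; b; c] l rx = x & wsum [:: a; b; c] l ry = y].
Proof.
move=> [l1 [l2 [l3 [[h1 h2 h3] ls -> ->]]]]; exists [:: l1; l2; l3]; split; rewrite ?wsumE ?addr0 ?addrA //.
split=> //; last by rewrite !wsumE !mulr1 addr0 addrA.
by move=> z; rewrite !inE => /or3P[] /eqP->.
Qed.

Lemma zone_cover (K : (R -> R -> R) -> Prop) (x y : R) :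
  0 <= x -> x <= m%:~R -> 0 <= y -> y <= n%:~R ->
  (forall h, K h -> [/\ lip2 h, forall u v, 0 <= u -> u <= m%:~R -> 0 <= v -> v <= n%:~R -> h u v = 0 -> on E u v
     & 0 < h x y]) ->
  exists s l, [/\ spx L E s, size s = 3%N, wt s l, wsum s l rx = x /\ wsum s l ry = y &
    forall l' h, wt s l' -> K h -> 0 <= h (wsum s l' rx) (wsum s l' ry)].
Proof.
move=> x0 xm y0 yn HK; have [a [b [c [T it]]]] := pl_cov PL x0 xm y0 yn.
have [l [wl e1 e2]] := in_tri_wt it; exists [:: a; b; c], l; split=> //; first exact: Spx3.
by move=> l' h wl' /HK[h1 h2 h3]; apply: (tri_zone PL T h1 h2 it h3 wl').
Qed.

End Zone.

Section XZone.
Variable R : realType.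
Local Notation rx := (@rx R).
Local Notation ry := (@ry R).
Local Notation wsum := (@wsum R).
Local Notation wt := (@wt R).
Variables (q : int) (L : int -> int -> Prop) (Y : int -> int).
Hypothesis Lq : lattice q L.
Variables (A B : int) (E : pt2 -> pt2 -> Prop) (N : nat).
Hypotheses (A1 : 1 <= A) (B1 : 1 <= B) (AN : A * q <= N%:Z).
Hypothesis (XE : xplane R q L Y A B E).
Local Notation F b := (pl (phi q Y b) N).
Local Notation Q := (q%:~R : R).

Lemma vert_on a (y : R) : 0 <= a -> a <= A -> 0 <= y -> y <= (B * q)%:~R -> on E (a%:~R * Q) y.
Proof.
move=> a0 aA y0 yB; have [b [s [b0 bB s0 s1 ->]]] := grid_cell Lq B1 y0 yB.
have vv : vert q a b (a * q, b * q) (a * q, (b + 1) * q) by [].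
have [e1 e2] := mx_vert s vv.
exists (a * q, b * q), (a * q, (b + 1) * q), s; rewrite e1 e2 rmorphM; split=> //.
exact: (xp_vt XE).
Qed.

Lemma strip_zone (a blo bhi : int) (clo chi : Prop) (x y : R) : 0 <= x -> x <= (A * q)%:~R -> 0 <= y -> y <= (B * q)%:~R ->
  0 <= a -> a + 1 <= A ->
  (0 < a -> a%:~R * Q < x) -> (a + 1 < A -> x < (a%:~R + 1) * Q) ->
  (clo -> [/\ 0 <= blo, blo <= B & F blo x < y]) ->
  (chi -> [/\ 0 <= bhi, bhi <= B & y < F bhi x]) ->
  exists s l, [/\ spx L E s, size s = 3%N, wt s l, wsum s l rx = x /\ wsum s l ry = y &
    forall l', wt s l' -> let x' := wsum s l' rx in let y' := wsum s l' ry in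
    [/\ a%:~R * Q <= x', x' <= (a%:~R + 1) * Q, clo -> F blo x' <= y' & chi -> y' <= F bhi x']].
Proof.
move=> x0 xA y0 yB a0 aA ha1 ha2 hlo hhi.
have q0 := lat_q Lq.
have Aq0 : 0 < A * q by apply: mulr_gt0 => //; apply: lt_le_trans A1.
pose K (h : R -> R -> R) := [\/ 0 < a /\ h = (fun x y => x - a%:~R * Q),
  a + 1 < A /\ h = (fun x y => (a%:~R + 1) * Q - x),
  clo /\ h = (fun x y => y - F blo x) | chi /\ h = (fun x y => F bhi x - y)].
have chon (b : int) (u v : R) : 0 <= b -> b <= B -> 0 <= u -> u <= (A * q)%:~R -> v = F b u -> on E u v.
  move=> b0 bB u0 uA ->; apply: (@chain_on R E (phi q Y b) N 0 (A * q)) => // t t0 tA.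
  exact: (xp_ch XE).
have [|s [l [Es ss wl exy H]]] := zone_cover (K := K) (xp_pl XE) x0 xA y0 yB.
  move=> h [] [c ->].
  - split; [exact: (lip2B (@lip2_x R) (@lip2_const R _))| |by rewrite subr_gt0; apply: ha1].
    move=> u v u0 um v0 vn /eqP; rewrite subr_eq0 => /eqP ->; apply: vert_on => //.
    by apply: le_trans aA; rewrite lerDl.
  - split; [exact: (lip2B (@lip2_const R _) (@lip2_x R))| |by rewrite subr_gt0; apply: ha2].
    move=> u v u0 um v0 vn /eqP; rewrite subr_eq0 => /eqP <-; rewrite intS; apply: vert_on => //.
    by apply: addr_ge0.
  - have [b0 bB yF] := hlo c.
    split; [exact: (lip2B (@lip2_y R) (lip2_pl _ _ (@lip2_x R)))| |by rewrite subr_gt0].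
    by move=> u v u0 um v0 vn /eqP; rewrite subr_eq0 => /eqP; apply: chon.
  - have [b0 bB yF] := hhi c.
    split; [exact: (lip2B (lip2_pl _ _ (@lip2_x R)) (@lip2_y R))| |by rewrite subr_gt0].
    by move=> u v u0 um v0 vn /eqP; rewrite subr_eq0 => /eqP/esym; apply: chon.
exists s, l; split=> // l' wl' x' y'.
have [x0' xA' _ _] := spx_range (xp_pl XE) Es wl'.
split.
- have [a00|a00] := ltP 0 a.
    by have := H l' _ wl' (Or41 _ _ _ (conj a00 erefl)); rewrite subr_ge0.
  by have -> : a = 0; [apply/eqP; rewrite eq_le a00 a0|rewrite mul0r].
- have [a00|a00] := ltP (a + 1) A.
    by have := H l' _ wl' (Or42 _ _ _ (conj a00 erefl)); rewrite subr_ge0.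
  have -> : a%:~R + 1 = A%:~R :> R; last by rewrite -rmorphM.
  by rewrite intS; congr intr; apply/eqP; rewrite eq_le a00 aA.
- by move=> c; have := H l' _ wl' (Or43 _ _ _ (conj c erefl)); rewrite subr_ge0.
- by move=> c; have := H l' _ wl' (Or44 _ _ _ (conj c erefl)); rewrite subr_ge0.
Qed.

End XZone.

Section XCover.
Variable R : realType.
Local Notation rx := (@rx R).
Local Notation ry := (@ry R).
Local Notation mx := (@mx R).
Local Notation my := (@my R).
Local Notation wsum := (@wsum R).
Local Notation wt := (@wt R).
Variables (q : int) (L : int -> int -> Prop) (Y : int -> int).
Hypothesis Lq : lattice q L.
Hypothesis HY : forall t, [/\ L t (Y t), 0 <= Y t & Y t < q].
Local Notation phi := (phi q Y).
Variables (A B A' : int) (E E' : pt2 -> pt2 -> Prop).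
Hypotheses (A1 : 1 <= A) (B1 : 1 <= B) (A1' : 1 <= A') (AA' : A - 1 <= A') (AA : A' <= A).
Hypotheses (XE : xplane R q L Y A B E) (XE' : xplane R q L Y A' (B + 1) E').
Local Notation N := (absz (A * q)).
Local Notation F b := (pl (phi b) N).
Local Notation Q := (q%:~R : R).
Local Notation M := (@xslab R q L Y A B E E').

Let q0 : 0 < q. Proof. exact: lat_q Lq. Qed.
Let Q0 : 0 < Q. Proof. by rewrite ltr0z. Qed.
Let NE : N%:Z = A * q.
Proof. by rewrite gez0_abs // mulr_ge0 ?ltW // (lt_le_trans _ A1). Qed.

Definition hit (y1 y2 w1 w2 : R) := exists s t l k, [/\ M s t, wt s l, wt t k,
  wsum s l rx = y1 /\ wsum s l ry = y2 & wsum t k rx = w1 /\ wsum t k ry = w2].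

Lemma strip_cell a (x : R) : a%:~R * Q <= x -> x <= (a%:~R + 1) * Q -> exists t, [/\ a * q <= t, t + 1 <= (a + 1) * q,
   t%:~R <= x & x <= t%:~R + 1].
Proof.
move=> h1 h2; apply: unit_cell; rewrite ?rmorphM ?rmorphD //=.
by rewrite ltr_pM2r // ltrDl.
Qed.

Lemma step_wt b (t : int) (x : R) : 0 <= t -> t + 1 <= A * q -> t%:~R <= x -> x <= t%:~R + 1 ->
  exists l, [/\ wt [:: (t, phi b t); (t + 1, phi b (t + 1))] l,
    wsum [:: (t, phi b t); (t + 1, phi b (t + 1))] l rx = x &
    wsum [:: (t, phi b t); (t + 1, phi b (t + 1))] l ry = F b x].
Proof.
move=> t0 tA tx xt.
have [||l [wl H]] := @wt_mix R (t, phi b t) (t + 1, phi b (t + 1)) (x - t%:~R).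
- by rewrite subr_ge0.
- by rewrite lerBlDl.
have ex : wsum [:: (t, phi b t); (t + 1, phi b (t + 1))] l rx = x.
  by rewrite H /rx /= rmorphD /=; ring.
exists l; split=> //.
have := @wt_step R (phi b) N t l t0 _ wl; rewrite NE => /(_ tA); rewrite ex.
by case.
Qed.

Lemma vert_wt a b (y : R) : b%:~R * Q <= y -> y <= (b%:~R + 1) * Q ->
  exists l, [/\ wt [:: (a * q, b * q); (a * q, (b + 1) * q)] l,
    wsum [:: (a * q, b * q); (a * q, (b + 1) * q)] l rx = a%:~R * Q &
    wsum [:: (a * q, b * q); (a * q, (b + 1) * q)] l ry = y].
Proof.
move=> h1 h2.
have [||l [wl H]] := @wt_mix R (a * q, b * q) (a * q, (b + 1) * q) (y / Q - b%:~R).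
- by rewrite subr_ge0 ler_pdivlMr.
- by rewrite lerBlDl ler_pdivrMr.
exists l; split=> //; rewrite H /rx /ry /= !rmorphM ?rmorphD /=; first by ring.
by transitivity (y / Q * Q); [ring|rewrite mulfVK // lt0r_neq0].
Qed.

Let strip0 a : 0 <= a -> 0 <= a * q. Proof. by move=> h; apply: mulr_ge0 => //; apply: ltW. Qed.

Lemma hit1 a b (x w2 : R) : 0 <= a -> a <= A - 1 -> 0 <= b -> b <= B ->
  a%:~R * Q <= x -> x <= (a%:~R + 1) * Q -> b%:~R * Q <= w2 -> w2 <= (b%:~R + 1) * Q ->
  hit x (F b x) (a%:~R * Q) w2.
Proof.
move=> a0 aA b0 bB x1 x2 w1 w2'.
have [t [t0 t1 tx xt]] := strip_cell x1 x2.
have t0' : 0 <= t by apply: le_trans t0; apply: strip0.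
have tA' : t + 1 <= A * q by apply: le_trans t1 _; rewrite ler_wpM2r ?(ltW q0) // -lerBrDr.
have [l [wl e1 e2]] := step_wt b t0' tA' tx xt.
have [k [wk e3 e4]] := vert_wt a w1 w2'.
exists [:: (t, phi b t); (t + 1, phi b (t + 1))], [:: (a * q, b * q); (a * q, (b + 1) * q)], l, k.
by split=> //; apply: (xslab1 Lq HY A1 B1 AA' XE XE').
Qed.

Lemma hit3 a b (x y2 : R) : 0 <= a -> a < A - 1 -> 0 <= b -> b < B ->
  a%:~R * Q <= x -> x <= (a%:~R + 1) * Q -> b%:~R * Q <= y2 -> y2 <= (b%:~R + 1) * Q ->
  hit ((a%:~R + 1) * Q) y2 x (F (b + 1) x).
Proof.
move=> a0 aA b0 bB x1 x2 w1 w2'.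
have [t [t0 t1 tx xt]] := strip_cell x1 x2.
have t0' : 0 <= t by apply: le_trans t0; apply: strip0.
have tA' : t + 1 <= A * q.
  by apply: le_trans t1 _; rewrite ler_wpM2r ?(ltW q0) // -lerBrDr ltW.
have [l [wl e1 e2]] := step_wt (b + 1) t0' tA' tx xt.
have [k [wk e3 e4]] := vert_wt (a + 1) w1 w2'.
exists [:: ((a + 1) * q, b * q); ((a + 1) * q, (b + 1) * q)], [:: (t, phi (b + 1) t); (t + 1, phi (b + 1) (t + 1))], k, l.
split=> //; first exact: (xslab3 Lq HY A1 B1 AA' AA XE XE').
by rewrite intS.
Qed.

Lemma hit2 a b (y1 y2 : R) : 0 <= y2 -> y2 <= B%:~R * Q -> 0 <= a -> a <= A - 1 -> 0 <= b -> b <= B + 1 ->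
  a%:~R * Q <= y1 -> y1 <= (a%:~R + 1) * Q ->
  (0 < b -> F (b - 1) y1 <= y2) -> (b < B + 1 -> y2 <= F b y1) ->
  hit y1 y2 (a%:~R * Q) (b%:~R * Q).
Proof.
move=> y0 yB a0 aA b0 bB x1 x2 h1 h2.
have A0 : 0 <= A by apply: le_trans A1. have B0 : 0 <= B by apply: le_trans B1.
have aA0 : a <= A by apply: le_trans aA _; rewrite gerBl.
have aA1 : a + 1 <= A by rewrite -lerBrDr.
have EB (z : int) : z%:~R + 1 = (z + 1)%:~R :> R by rewrite rmorphD.
have x0 : 0 <= y1 by apply: le_trans x1; apply: mulr_ge0; rewrite ?ler0z // ltW.
have xA : y1 <= A%:~R * Q by apply: le_trans x2 _; rewrite EB ler_pM2r // ler_int.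
have b1E : (b - 1)%:~R + 1 = b%:~R :> R by rewrite EB subrK.
have a1E : (a - 1)%:~R + 1 = a%:~R :> R by rewrite EB subrK.
have [/andP[c1 /eqP c2]|n1] := boolP ((0 < b) && (y2 == F (b - 1) y1)).
  rewrite c2; apply: hit1 => //.
  - by move: c1; clear -B1; lia.
  - by rewrite lerBlDr.
  - by rewrite ler_pM2r // ler_int gerBl.
  - by rewrite b1E.
have [/andP[c1 /eqP c2]|n2] := boolP ((b < B + 1) && (y2 == F b y1)).
  rewrite c2; apply: hit1 => //; first by move: c1; clear -B1; lia.
  by rewrite ler_pM2r // lerDl.
have h1' : 0 < b -> F (b - 1) y1 < y2.
  by move=> c; rewrite lt_neqAle h1 // andbT eq_sym; move: n1; rewrite c.
have h2' : b < B + 1 -> y2 < F b y1.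
  by move=> c; rewrite lt_neqAle h2 // andbT; move: n2; rewrite c.
have vcase c : 0 <= c -> c <= A -> y1 = c%:~R * Q -> [/\ 0 <= b - 1, b - 1 < B, (b - 1)%:~R * Q <= y2 & y2 <= b%:~R * Q].
  move=> c0 cA ey.
  have b00 : 0 < b.
    rewrite lt_neqAle b0 andbT; apply/eqP => eb.
    have Bp : 0 < B + 1 by rewrite ltr_wpDl.
    by have := h2'; rewrite -eb ey (F_grid _ _ Lq A1) // mul0r => /(_ Bp); rewrite ltNge y0.
  have b0B : b < B + 1.
    rewrite lt_neqAle bB andbT; apply/eqP => eb.
    by have := h1' b00; rewrite eb addrK ey (F_grid _ _ Lq A1) // ltNge yB.
  split.
  - by move: b00; clear -B1; lia.
  - by move: b0B; clear -B1; lia.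
  - by have := h1' b00; rewrite ey (F_grid _ _ Lq A1) // => /ltW.
  - by have := h2' b0B; rewrite ey (F_grid _ _ Lq A1) // => /ltW.
have [/andP[c1 /eqP c2]|n3] := boolP ((0 < a) && (y1 == a%:~R * Q)).
  have [v1 v2 v3 v4] := vcase a a0 aA0 c2.
  have a10 : 0 <= a - 1 by move: c1; clear -B1; lia.
  rewrite c2; have := @hit3 (a - 1) (b - 1) (a%:~R * Q) y2; rewrite a1E b1E !subrK (F_grid _ _ Lq A1) //.
  apply=> //; first by move: aA; clear -B1; lia.
  by rewrite ler_pM2r // ler_int gerBl.
have [/andP[c1 /eqP c2]|n4] := boolP ((a + 1 < A) && (y1 == (a%:~R + 1) * Q)).
  have [v1 v2 v3 v4] : [/\ 0 <= b - 1, b - 1 < B, (b - 1)%:~R * Q <= y2 & y2 <= b%:~R * Q].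
    by apply: (vcase (a + 1)) => //; [apply: addr_ge0|rewrite -EB].
  rewrite c2; have := @hit3 a (b - 1) (a%:~R * Q) y2; rewrite b1E !subrK (F_grid _ _ Lq A1) //.
  apply=> //; first by move: c1; clear -B1; lia.
  by rewrite ler_pM2r // lerDl.
have [|||||||s [l [Es ss wl [e1 e2] H]]] := @strip_zone R q L Y Lq A B E N A1 B1 _ XE a (b - 1) b (0 < b) (b < B + 1) y1 y2 x0 _ y0 _ a0 aA1.
- by rewrite NE.
- by rewrite rmorphM.
- by rewrite rmorphM.
- by move=> c; rewrite lt_neqAle x1 andbT eq_sym; move: n3; rewrite c.
- by move=> c; rewrite lt_neqAle x2 andbT; move: n4; rewrite c.
- by move=> c; split; [move: c; clear -B1; lia|rewrite lerBlDr|exact: h1'].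
- by move=> c; split; [|move: c; clear -B1; lia|exact: h2'].
have [k [wk ek]] := wt_unit R (mem_head (a * q, b * q) [::]).
exists s, [:: (a * q, b * q)], l, k; split=> //.
- exact: (xslab2 Lq AA' XE XE').
- by rewrite !ek /rx /ry /= !rmorphM.
Qed.

Lemma hit4 a b (w1 w2 : R) : 0 <= w2 -> w2 <= (B + 1)%:~R * Q -> 0 <= a -> a < A - 1 -> 0 <= b -> b <= B ->
  a%:~R * Q <= w1 -> w1 <= (a%:~R + 1) * Q ->
  (0 < b -> F b w1 <= w2) -> (b < B -> w2 <= F (b + 1) w1) ->
  hit ((a%:~R + 1) * Q) (b%:~R * Q) w1 w2.
Proof.
move=> y0 yB a0 aA b0 bB x1 x2 h1 h2.
have A0 : 0 <= A by apply: le_trans A1. have B0 : 0 <= B by apply: le_trans B1.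
have aA1 : a + 1 <= A - 1 by move: aA; clear -B1; lia.
have aA0 : a <= A by move: aA; clear -B1; lia.
have aA2 : a + 1 <= A by move: aA; clear -B1; lia.
have EB (z : int) : z%:~R + 1 = (z + 1)%:~R :> R by rewrite rmorphD.
have x0 : 0 <= w1 by apply: le_trans x1; apply: mulr_ge0; rewrite ?ler0z // ltW.
have xA : w1 <= A'%:~R * Q.
  by apply: le_trans x2 _; rewrite EB ler_pM2r // ler_int; apply: le_trans AA'.
have b1E : (b - 1)%:~R + 1 = b%:~R :> R by rewrite EB subrK.
have [/andP[c1 /eqP c2]|n1] := boolP ((0 < b) && (w2 == F b w1)).
  have := @hit3 a (b - 1) w1 (b%:~R * Q); rewrite b1E subrK c2; apply=> //.
  - by move: c1; clear -B1; lia.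
  - by move: bB; clear -B1; lia.
  - by rewrite ler_pM2r // ler_int gerBl.
have [/andP[c1 /eqP c2]|n2] := boolP ((b < B) && (w2 == F (b + 1) w1)).
  by rewrite c2; apply: hit3 => //; rewrite ler_pM2r // lerDl.
have h1' : 0 < b -> F b w1 < w2.
  by move=> c; rewrite lt_neqAle h1 // andbT eq_sym; move: n1; rewrite c.
have h2' : b < B -> w2 < F (b + 1) w1.
  by move=> c; rewrite lt_neqAle h2 // andbT; move: n2; rewrite c.
have vcase c : 0 <= c -> c <= A -> w1 = c%:~R * Q -> b%:~R * Q <= w2 /\ w2 <= (b%:~R + 1) * Q.
  move=> c0 cA ey; split.
    have [b00|b00] := ltP 0 b; first by have := h1' b00; rewrite ey (F_grid _ _ Lq A1) // => /ltW.
    by have -> : b = 0; [apply/eqP; rewrite eq_le b00|rewrite mul0r].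
  have [b00|b00] := ltP b B; first by have := h2' b00; rewrite ey (F_grid _ _ Lq A1) // -EB => /ltW.
  have -> : b = B by apply/eqP; rewrite eq_le b00 bB.
  by rewrite EB.
have [/eqP c2|n3] := boolP (w1 == a%:~R * Q).
  have [v1 v2] := vcase a a0 aA0 c2.
  rewrite c2; have := @hit1 a b ((a%:~R + 1) * Q) w2; rewrite EB (F_grid _ _ Lq A1) //; last exact: addr_ge0.
  apply=> //; first exact: ltW.
  by rewrite ler_pM2r // ler_int lerDl.
have [/eqP c2|n4] := boolP (w1 == (a%:~R + 1) * Q).
  have a10 : 0 <= a + 1 by apply: addr_ge0.
  have [v1 v2] : b%:~R * Q <= w2 /\ w2 <= (b%:~R + 1) * Q by apply: (vcase (a + 1)) => //; rewrite -EB.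
  rewrite c2; have := @hit1 (a + 1) b ((a%:~R + 1) * Q) w2; rewrite EB (F_grid _ _ Lq A1) //.
  by apply=> //; rewrite ler_pM2r // lerDl.
have [||||||||s [l [Es ss wl [e1 e2] H]]] := @strip_zone R q L Y Lq A' (B + 1) E' N A1' _ _ XE' a b (b + 1) (0 < b) (b < B) w1 w2 x0 _ y0 _ a0 (le_trans aA1 AA').
- by apply: le_trans B1 _; rewrite lerDl.
- by rewrite NE ler_wpM2r // ltW.
- by rewrite rmorphM.
- by rewrite rmorphM.
- by move=> c; rewrite lt_neqAle x1 andbT eq_sym.
- by move=> c; rewrite lt_neqAle x2 andbT.
- by move=> c; split; [|by apply: le_trans bB _; rewrite lerDl|exact: h1'].
- by move=> c; split; [exact: addr_ge0|by rewrite lerD2r|exact: h2'].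
have [k [wk ek]] := wt_unit R (mem_head ((a + 1) * q, b * q) [::]).
exists [:: ((a + 1) * q, b * q)], s, k, l; split=> //.
- exact: (xslab4 Lq B1 XE).
- by rewrite !ek /rx /ry /= !rmorphM /= -?EB.
Qed.

End XCover.

Section XHalf.
Variable R : realType.
Local Notation rx := (@rx R).
Local Notation ry := (@ry R).
Local Notation wsum := (@wsum R).
Local Notation wt := (@wt R).
Variables (q : int) (L : int -> int -> Prop) (Y : int -> int).
Hypothesis Lq : lattice q L.
Hypothesis HY : forall t, [/\ L t (Y t), 0 <= Y t & Y t < q].
Local Notation phi := (phi q Y).
Local Notation Q := (q%:~R : R).

Section Slab.
Variables (A B A' : int) (E E' : pt2 -> pt2 -> Prop).
Hypotheses (A1 : 1 <= A) (B1 : 1 <= B) (A1' : 1 <= A') (AA' : A - 1 <= A') (AA : A' <= A).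
Hypotheses (XE : xplane R q L Y A B E) (XE' : xplane R q L Y A' (B + 1) E').
Local Notation N := (absz (A * q)).
Local Notation F b := (pl (phi b) N).
Local Notation M := (@xslab R q L Y A B E E').

Let q0 : 0 < q. Proof. exact: lat_q Lq. Qed.
Let Q0 : 0 < Q. Proof. by rewrite ltr0z. Qed.
Let NE : N%:Z = A * q.
Proof. by rewrite gez0_abs // mulr_ge0 ?ltW // (lt_le_trans _ A1). Qed.

Lemma xslab_cov (x y u : R) : 0 <= u -> u <= 1 -> 0 <= x -> x <= (A%:~R - u) * Q ->
  0 <= y -> y <= (B%:~R + u) * Q ->
  exists y1 y2 w1 w2, [/\ hit q L Y A B E E' y1 y2 w1 w2,
     x = (1 - u) * y1 + u * w1 & y = (1 - u) * y2 + u * w2].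
Proof.
move=> u0 u1 x0 xA y0 yB.
have A0 : 0 <= A by apply: le_trans A1. have B0 : 0 <= B by apply: le_trans B1.
have v0 : 0 <= 1 - u by rewrite subr_ge0.
have EB (z : int) : z%:~R + 1 = (z + 1)%:~R :> R by rewrite rmorphD.
have [nA eA] : exists n : nat, n%:Z = A - 1.
  by exists (absz (A - 1)); rewrite gez0_abs // subr_ge0.
have [nB eB] : exists n : nat, n%:Z = B by exists (absz B); rewrite gez0_abs.
have nAR : nA%:R = A%:~R - 1 :> R by rewrite -[nA%:R]/((nA%:Z)%:~R) eA rmorphB.
have nBR : nB%:R = B%:~R :> R by rewrite -[nB%:R]/((nB%:Z)%:~R) eB.
have AR0 : 0 <= A%:~R * Q by apply: mulr_ge0; rewrite ?ler0z // ltW.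
have [] := @stair_cover R q nA (fun a => (a%:~R + 1) * Q) (1 - u) u x (A%:~R * Q) q0 v0 u0 AR0 _ _ x0.
- move=> b b0 bn; split; first by apply: mulr_ge0; rewrite ?EB ?ler0z ?addr_ge0 // ltW.
  by rewrite EB ler_pM2r // ler_int; move: bn; rewrite eA; clear -B1; lia.
- by move=> b b' _ bb _; rewrite ler_pM2r // lerD2r ler_int.
- by apply: le_trans xA _; rewrite nAR le_eqVlt; apply/orP; left; apply/eqP; ring.
move=> y1 [w1 [y10 y1A ex cs]].
have fin y2 w2 : (1 - u) * y2 + u * w2 = y -> hit q L Y A B E E' y1 y2 w1 w2 ->
  exists y1 y2 w1 w2, [/\ hit q L Y A B E E' y1 y2 w1 w2,
     x = (1 - u) * y1 + u * w1 & y = (1 - u) * y2 + u * w2].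
  by move=> <- h; exists y1, y2, w1, w2.
case: cs => [[a [a0 aA ew ha1 ha2]]|[a [a0 aA ey ha1 ha2]]]; rewrite eA in aA.
  rewrite eA in ha2; subst w1.
  have x1 : a%:~R * Q <= y1.
    have [/ha1|a00] := ltP 0 a; first by rewrite EB subrK.
    by have -> : a = 0; [apply/eqP; rewrite eq_le a00|rewrite mul0r].
  have x2 : y1 <= (a%:~R + 1) * Q.
    have [/ha2//|a00] := ltP a (A - 1).
    have -> : a = A - 1 by apply/eqP; rewrite eq_le a00 aA.
    by rewrite EB subrK.
  have HB0 : 0 <= B%:~R * Q by apply: mulr_ge0; rewrite ?ler0z // ltW.
  have nB1 : nB.+1%:Z = B + 1 by rewrite -addn1 PoszD eB.
  have [] := @stair_cover R q nB.+1 (fun b => F b y1) (1 - u) u y (B%:~R * Q) q0 v0 u0 HB0 _ _ y0.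
  - move=> b b0 bn; apply: (F_bd Lq HY A1 B1) => //; move: bn; rewrite nB1; clear -B1; lia.
  - by move=> b b' _ bb _; apply: pl_le => t _ _; apply: (phi_le _ Lq).
  - by apply: le_trans yB _; rewrite -natr1 nBR le_eqVlt; apply/orP; left; apply/eqP; ring.
  move=> y2 [w2 [y20 y2B e2]]; case=> -[b [b0 bB]]; rewrite nB1 in bB *.
    by move=> er h1 h2; apply: fin e2 _; rewrite er; apply: (hit2 Lq HY A1 B1 AA' AA XE XE').
  move=> er h1 h2; apply: fin e2 _; rewrite er.
  by apply: (hit1 Lq HY A1 B1 AA' XE XE') => //; move: bB; clear -B1; lia.
subst y1.
have w10 : 0 <= w1 by apply: le_trans ha1; apply: mulr_ge0; rewrite ?ler0z // ltW.
have w1A : w1 <= A%:~R * Q.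
  by apply: le_trans ha2 _; rewrite EB ler_pM2r // ler_int; move: aA; clear -B1; lia.
have B10 : 0 <= B + 1 by apply: addr_ge0.
have HB0 : 0 <= (B + 1)%:~R * Q by apply: mulr_ge0; rewrite ?ler0z // ltW.
have [] := @stair_cover R q nB (fun b => F (b + 1) w1) u (1 - u) y ((B + 1)%:~R * Q) q0 u0 v0 HB0 _ _ y0.
- by move=> b b0 bn; apply: (F_bd Lq HY A1); rewrite ?lerDr ?addr_ge0 //; move: bn; rewrite eB; clear -B1; lia.
- by move=> b b' _ bb _; apply: pl_le => t _ _; apply: (phi_le _ Lq); rewrite lerD2r.
- apply: le_trans yB _; rewrite nBR -EB le_eqVlt; apply/orP; left; apply/eqP; ring.
move=> w2 [y2 [w20 w2B e2]]; rewrite addrC in e2; case=> -[b [b0 bB]]; rewrite eB in bB *.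
  move=> er h1 h2; apply: fin e2 _; rewrite er.
  apply: (hit4 Lq HY A1 B1 A1' AA' AA XE XE') => //.
  by move=> /h1; rewrite subrK.
by move=> er h1 h2; apply: fin e2 _; rewrite er; apply: (hit3 Lq HY A1 B1 AA' AA XE XE').
Qed.

Lemma xslab_slab : slab R q L A B E E' M.
Proof.
have A0 : 0 <= A by apply: le_trans A1. have B0 : 0 <= B by apply: le_trans B1.
have EB (z : int) : z%:~R + 1 = (z + 1)%:~R :> R by rewrite rmorphD.
split.
- by move=> s t [].
- by move=> s t [].
- by move=> s t [].
- by move=> s t v Mst vs; have [h1 h2 h3 h4 h5] := xslab_low XE Mst vs.
- by move=> s t v Mst vs; have [h1 h2 h3 h4 h5] := xslab_high XE' Mst vs.
- by move=> a b c d [_ _ _ H _]; apply: H.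
- move=> s t s' t' l k l' k' u [_ _ _ _ H] [_ _ _ _ H'] wl wk wl' wk' u0 u1.
  exact: (xrel_uniq Lq A1 u0 u1 (H _ _ wl wk) (H' _ _ wl' wk')).
- move=> x y u u0 u1 x0 xA y0 yB.
  have [y1 [y2 [w1 [w2 [[s [t [l [k [Mst wl wk [<- <-] [<- <-]]]]]] ex ey]]]]] := xslab_cov u0 (ltW u1) x0 xA y0 yB.
  by exists s, t, l, k.
- move=> eA y y0 yAB.
  have B11 : 1 <= B + 1 by rewrite lerDr.
  have [|b [s [b0 bB s0 s1 ey]]] := @grid_cell R q L Lq (B + 1) y B11 y0.
    by rewrite rmorphM /= addrC -eA.
  have [||||||||s' [t [l [k [Mst wl wk _ [h1 h2]]]]]] := @hit1 R q L Y Lq HY A B A' E E' A1 B1 AA' XE XE' 0 b 0 y.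
  + by [].
  + by rewrite eA.
  + by [].
  + by rewrite -(lerD2r 1).
  + by rewrite mul0r.
  + by rewrite add0r mul1r ltW.
  + by rewrite ey ler_pM2r // lerDl.
  + by rewrite ey ler_pM2r // lerD2l.
  by exists s', t, k; split=> //; rewrite h1 mul0r.
move=> s t v w Mst vs wt'.
have [Lv v1 v2 v3 v4] := xslab_low XE Mst vs; have [Lw w1 w2 w3 w4] := xslab_high XE' Mst wt'.
have rel := xslab_vertex Mst vs wt'.
have mul0 (i : int) : i * q = 0 -> i = 0.
  by move=> /eqP; rewrite mulf_eq0 (negbTE (lt0r_neq0 q0)) orbF => /eqP.
have col a a' : 0 <= a -> a <= A -> 0 <= a' -> a' <= A -> v.1 = a * q -> w.1 = a' * q -> w.2 = v.2 \/ w.2 = v.2 + q.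
  move=> a0 aA a0' aA' ev ew; rewrite ev in Lv; rewrite ew in Lw.
  have [i ei] := lat_ymult Lq Lv; have [j ej] := lat_ymult Lq Lw.
  move: rel; rewrite /rx /ry ev ew ei ej !rmorphM /=.
  move=> /(xrel_grid Lq A1 a0 aA a0' aA')/(stair_grid q0) [||->|->].
  - by rewrite -(pmulr_lge0 _ q0) -ej.
  - by rewrite -(ler_pM2r q0) -ej.
  - by left.
  - by right; rewrite mulrDl mul1r.
have row b b' : v.2 = b * q -> w.2 = b' * q -> w.1 = v.1 \/ w.1 = v.1 - q.
  move=> ev ew; rewrite ev in Lv; rewrite ew in Lw.
  have [i ei] := lat_xmult Lq Lv; have [j ej] := lat_xmult Lq Lw.
  have [st _ _] := rel; move: st; rewrite /rx ei ej !rmorphM /=.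
  move=> /(stair_grid q0) [||->|->].
  - by rewrite -(pmulr_lge0 _ q0) -ei.
  - by rewrite subrK -(ler_pM2r q0) -ei.
  - by left.
  - by right; rewrite mulrDl mul1r addrK.
split.
- by move=> e1 e2; apply: (col 0 0); rewrite ?mul0r.
- by move=> e1 e2; apply: (row 0 0); rewrite ?mul0r.
- by move=> e1 e2; apply: (col A (A - 1)); rewrite ?subr_ge0 ?gerBl.
- by move=> e1 e2; apply: (row B (B + 1)).
Qed.

End Slab.

Theorem xplane_half A B E : 0 <= A -> 1 <= B -> (1 <= A -> xplane R q L Y A B E) ->
  exists P, half R q L A B E P.
Proof.
move=> A0; have [n en] : exists n : nat, A = n%:Z by exists (absz A); rewrite gez0_abs.
elim: n A en A0 B E => [|n IH] A en A0 B E B1 XE.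
  by exists (fun=> False); rewrite en; apply: half_nil.
have A1 : 1 <= A by rewrite en.
have enA : A - 1 = n%:Z by rewrite en -addn1 PoszD addrK.
have B1' : 1 <= B + 1 by rewrite ler_wpDl // (le_trans _ B1).
pose A' := if A == 1 then 1 else A - 1.
have [A1' AA' AA] : [/\ 1 <= A', A - 1 <= A' & A' <= A].
  by rewrite /A'; case: eqP => [->|h]; split=> //; move: A1 h; clear; lia.
have [E' XE'] := xplane_exists R Lq HY A1' B1'.
have A10 : 0 <= A - 1 by rewrite subr_ge0.
have [|P HP] := IH (A - 1) enA A10 (B + 1) E' B1'.
  by move: XE'; rewrite /A'; case: eqP => // ->.
exists (stack (@xslab R q L Y A B E E') P).
exact: (half_glue Lq A1 (xp_pl (XE A1)) (xp_pl XE') (xslab_slab A1 B1 A1' AA' AA (XE A1) XE') HP).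
Qed.

End XHalf.

(** * The pinwheel section and the slab above it *)

Section MeetsXY.
Variable R : realType.
Local Notation rx := (@rx R).
Local Notation ry := (@ry R).
Local Notation mx := (@mx R).
Local Notation my := (@my R).

Lemma mix_ge (s x y z : R) : 0 <= s -> s <= 1 -> z <= x -> z <= y -> z <= (1 - s) * x + s * y.
Proof.
move=> s0 s1 h1 h2; have : 0 <= (1 - s) * (x - z) + s * (y - z).
  by apply: addr_ge0; apply: mulr_ge0; rewrite ?subr_ge0.
by clear; lra.
Qed.

Lemma mix_le (s x y z : R) : 0 <= s -> s <= 1 -> x <= z -> y <= z -> (1 - s) * x + s * y <= z.
Proof.
move=> s0 s1 h1 h2; have : 0 <= (1 - s) * (z - x) + s * (z - y).
  by apply: addr_ge0; apply: mulr_ge0; rewrite ?subr_ge0.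
by clear; lra.
Qed.

Lemma meets_sepx L m n v w v' w' : Vbox L m n v -> Vbox L m n w -> w.1 = v.1 + 1 ->
  (w.1 <= v'.1 /\ w.1 <= w'.1) \/ (v'.1 <= v.1 /\ w'.1 <= v.1) -> meets R L m n v w v' w'.
Proof.
move=> Vv Vw e H s t s0 s1 t0 t1 ex ey; constructor 1.
have h : mx s v w = (v.1)%:~R + s by apply: mx_step.
case: H => -[h1 h2].
  apply: (step_int Vv Vw e s0 s1 (i := w.1)).
  apply/eqP; rewrite eq_le; apply/andP; split; first by rewrite h e rmorphD lerD2l.
  by rewrite ex; apply: mix_ge => //; rewrite /rx ler_int.
apply: (step_int Vv Vw e s0 s1 (i := v.1)).
apply/eqP; rewrite eq_le; apply/andP; split; last by rewrite h lerDl.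
by rewrite ex; apply: mix_le => //; rewrite /rx ler_int.
Qed.

Lemma meets_sep L m n v w v' w' : Vbox L m n v -> Vbox L m n w -> Vbox L m n v' -> Vbox L m n w' ->
  w.1 = v.1 + 1 -> w'.2 = v'.2 + 1 ->
  [\/ w.1 <= v'.1 /\ w.1 <= w'.1, v'.1 <= v.1 /\ w'.1 <= v.1,
      w'.2 <= v.2 /\ w'.2 <= w.2 | v.2 <= v'.2 /\ w.2 <= v'.2] -> meets R L m n v w v' w'.
Proof.
have fV u : Vbox L m n u -> Vbox (fun x y => L y x) n m (flip u) by case=> *; split.
move=> Vv Vw Vv' Vw' e e' [] H; [apply: meets_sepx => //; by left|apply: meets_sepx => //; by right| |].
  by apply: meets_sym; apply: meets_flip; apply: meets_sepx => //; [exact: fV|exact: fV|left].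
by apply: meets_sym; apply: meets_flip; apply: meets_sepx => //; [exact: fV|exact: fV|right].
Qed.

Lemma meets_swap L m n a b c d : meets R L m n b a c d -> meets R L m n a b c d.
Proof.
move=> H s t s0 s1 t0 t1.
have ex : mx s a b = mx (1 - s) b a by rewrite /mx; ring.
have ey : my s a b = my (1 - s) b a by rewrite /my; ring.
rewrite ex ey => h1 h2; have [] := H (1 - s) t _ _ t0 t1 h1 h2.
- by rewrite subr_ge0.
- by rewrite gerBl.
- by move=> h; constructor 1.
- by move=> h; constructor 3; case: h.
- by move=> h; constructor 2; case: h.
Qed.

Lemma meets_corner L m n p (si ta al be : int) : Vbox L m n p -> si * si = 1 -> ta * ta = 1 ->
  1 <= si * al -> 1 <= ta * be -> meets R L m n p (p.1 + si, p.2 + be) p (p.1 + al, p.2 + ta).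
Proof.
move=> Vp si1 ta1 h1 h2 s t s0 s1 t0 t1; rewrite /mx /my /rx /ry /= !rmorphD /= => ex ey.
have sR : si%:~R * si%:~R = 1 :> R by rewrite -rmorphM si1.
have tR : ta%:~R * ta%:~R = 1 :> R by rewrite -rmorphM ta1.
have e1 : s = t * (si * al)%:~R.
  have {}ex : s * si%:~R = t * al%:~R by move: ex; clear; lra.
  by rewrite rmorphM /= [_ * al%:~R]mulrC mulrA -ex -mulrA sR mulr1.
have e2 : t = s * (ta * be)%:~R.
  have {}ey : s * be%:~R = t * ta%:~R by move: ey; clear; lra.
  by rewrite rmorphM /= [_ * be%:~R]mulrC mulrA ey -mulrA tR mulr1.
have [z|sn0] := eqVneq s 0.
  constructor 1; exists p; split=> //; rewrite z /rx /ry; ring.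
have e3 : (si * al) * (ta * be) = 1.
  apply: (@intr_inj R); apply: (mulfI sn0); rewrite rmorphM [_ * (ta * be)%:~R]mulrC mulrA /= -e2 -e1 mulr1 //.
have {h1 h2} [f1 f2] : si * al = 1 /\ ta * be = 1.
  by move: h1 h2 e3; set x := si * al; set y := ta * be; clear; nia.
have -> : al = si.
  by rewrite -[LHS]mul1r -si1 -mulrA f1 mulr1.
have -> : be = ta.
  by rewrite -[LHS]mul1r -ta1 -mulrA f2 mulr1.
by constructor 2.
Qed.

End MeetsXY.

Section Special.
Variable R : realType.
Variables (q : int) (L : int -> int -> Prop) (Y X : int -> int).
Hypothesis Lq : lattice q L.
Hypothesis HY : forall t, [/\ L t (Y t), 0 <= Y t & Y t < q].
Hypothesis HX : forall t, [/\ L (X t) t, 0 <= X t & X t < q].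
Variables (A B : int).
Hypotheses (A2 : 2 <= A) (B2 : 2 <= B).

(* The four arms of a pinwheel with centre (q, q): chains joining the centre to the lattice
   points of the left, right, bottom and top side. *)
Definition Lc b t := if t <= 0 then b * q else if t < q then Y t else q.
Definition Rc b t := if t <= q then q else if t < A * q then q + Y t else b * q.
Definition Bc i s := if s <= 0 then i * q else if s < q then q + X s else q.
Definition Tc i s := if s <= q then q else if s < B * q then (if (q %| s)%Z then q else X s) else i * q.

Let q0 : 0 < q. Proof. exact: lat_q Lq. Qed.

Lemma mulq_le i j : i <= j -> i * q <= j * q.
Proof. by move=> h; apply: ler_wpM2r => //; apply: ltW. Qed.

Let Aq : 2 * q <= A * q. Proof. exact: mulq_le. Qed.
Let Bq : 2 * q <= B * q. Proof. exact: mulq_le. Qed.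

Lemma Lc0 b t : t <= 0 -> Lc b t = b * q. Proof. by rewrite /Lc => ->. Qed.

Lemma Y_pos t : (q %| t)%Z = false -> 0 < Y t.
Proof.
move=> h; have [Lt y0 _] := HY t; rewrite lt_neqAle y0 andbT; apply/eqP => e.
by rewrite -e in Lt; have [i ei] := lat_x0 Lq Lt; rewrite ei dvdz_mull in h.
Qed.

Lemma X_pos t : (q %| t)%Z = false -> 0 < X t.
Proof.
move=> h; have [Lt y0 _] := HX t; rewrite lt_neqAle y0 andbT; apply/eqP => e.
by rewrite -e in Lt; have [i ei] := lat_y0 Lq Lt; rewrite ei dvdz_mull in h.
Qed.

Lemma ndvd t : 0 < t -> t < q -> (q %| t)%Z = false.
Proof.
move=> t0 tq; apply/negbTE/negP => /dvdzP[i ei]; move: t0 tq; rewrite ei => h1 h2.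
have : 0 < i by rewrite -(pmulr_lgt0 _ q0).
have : i < 1 by rewrite -(ltr_pM2r q0) mul1r.
by clear; lia.
Qed.

Lemma Lc1 b t : 0 < t -> 1 <= Lc b t /\ Lc b t <= q.
Proof.
move=> t0; rewrite /Lc [t <= 0]leNgt t0 /=; case: ifP => [tq|_]; last by rewrite lexx; move: q0; clear; lia.
have := Y_pos (ndvd t0 tq); have [_ _] := HY t; clear; lia.
Qed.

Lemma Lcq b t : q <= t -> Lc b t = q.
Proof. by move=> h; rewrite /Lc !leNgt (lt_le_trans q0 h) /= ltNge h. Qed.

Lemma Lc_indep b b' t : 0 < t -> Lc b t = Lc b' t.
Proof. by move=> t0; rewrite /Lc [t <= 0]leNgt t0. Qed.

Lemma Rc0 b t : t <= q -> Rc b t = q. Proof. by rewrite /Rc => ->. Qed.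

Lemma Rc1 b t : t < A * q -> q <= Rc b t /\ Rc b t <= 2 * q - 1.
Proof.
move=> tA; rewrite /Rc tA; case: ifP => _; first by move: q0; clear; lia.
by have [_] := HY t; clear; lia.
Qed.

Lemma RcA b t : A * q <= t -> Rc b t = b * q.
Proof.
move=> h; rewrite /Rc; have -> : t <= q = false by apply/negbTE; rewrite -ltNge; move: h Aq q0; clear; lia.
by rewrite ltNge h.
Qed.

Lemma Rc_indep b b' t : t < A * q -> Rc b t = Rc b' t.
Proof. by rewrite /Rc => ->. Qed.

Lemma Bc0 i s : s <= 0 -> Bc i s = i * q. Proof. by rewrite /Bc => ->. Qed.

Lemma Bc1 i s : 0 < s -> q <= Bc i s /\ Bc i s <= 2 * q - 1.
Proof.
move=> t0; rewrite /Bc [s <= 0]leNgt t0 /=; case: ifP => [tq|_]; last by move: q0; clear; lia.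
by have [_] := HX s; clear; lia.
Qed.

Lemma Bcq i s : q <= s -> Bc i s = q.
Proof. by move=> h; rewrite /Bc !leNgt (lt_le_trans q0 h) /= ltNge h. Qed.

Lemma Bc_indep i i' s : 0 < s -> Bc i s = Bc i' s.
Proof. by move=> t0; rewrite /Bc [s <= 0]leNgt t0. Qed.

Lemma Tc0 i s : s <= q -> Tc i s = q. Proof. by rewrite /Tc => ->. Qed.

Lemma Tc1 i s : s < B * q -> 1 <= Tc i s /\ Tc i s <= q.
Proof.
move=> tA; rewrite /Tc tA; case: ifP => _; first by move: q0; clear; lia.
case: ifP => [_|h]; first by move: q0; clear; lia.
by have := X_pos h; have [_ _] := HX s; clear; lia.
Qed.

Lemma TcB i s : B * q <= s -> Tc i s = i * q.
Proof.
move=> h; rewrite /Tc; have -> : s <= q = false by apply/negbTE; rewrite -ltNge; move: h Bq q0; clear; lia.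
by rewrite ltNge h.
Qed.

Lemma Tc_indep i i' s : s < B * q -> Tc i s = Tc i' s.
Proof. by rewrite /Tc => ->. Qed.

Let Lqq : L q q. Proof. by have := lat_grid 1 1 Lq; rewrite !mul1r. Qed.

Lemma Lc_L b t : 0 <= t -> t <= q -> L t (Lc b t).
Proof.
move=> t0 tq; rewrite /Lc; case: ifP => h1.
  have -> : t = 0 by apply/eqP; rewrite eq_le t0 h1.
  exact: lat_yq.
case: ifP => h2; first by have [] := HY t.
by have -> : t = q by apply/eqP; rewrite eq_le tq leNgt h2.
Qed.

Lemma Rc_L b t : q <= t -> t <= A * q -> L t (Rc b t).
Proof.
move=> t0 tq; rewrite /Rc; case: ifP => h1.
  by have -> : t = q by apply/eqP; rewrite eq_le t0 h1.
case: ifP => h2; first by have [h _ _] := HY t; have := lat_D Lq (lat_y Lq) h; rewrite add0r.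
by have -> : t = A * q; [apply/eqP; rewrite eq_le tq leNgt h2|exact: lat_grid].
Qed.

Lemma Bc_L i s : 0 <= s -> s <= q -> L (Bc i s) s.
Proof.
move=> t0 tq; rewrite /Bc; case: ifP => h1.
  have -> : s = 0 by apply/eqP; rewrite eq_le t0 h1.
  exact: lat_xq.
case: ifP => h2; first by have [h _ _] := HX s; have := lat_D Lq (lat_x Lq) h; rewrite add0r.
by have -> : s = q by apply/eqP; rewrite eq_le tq leNgt h2.
Qed.

Lemma Tc_L i s : q <= s -> s <= B * q -> L (Tc i s) s.
Proof.
move=> t0 tq; rewrite /Tc; case: ifP => h1.
  by have -> : s = q by apply/eqP; rewrite eq_le t0 h1.
case: ifP => h2.
  case: ifP => [/dvdzP[j ->]|_]; last by have [] := HX s.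
  by have := lat_grid 1 j Lq; rewrite mul1r.
by have -> : s = B * q; [apply/eqP; rewrite eq_le tq leNgt h2|exact: lat_grid].
Qed.

Lemma Lc_le b b' t : b <= b' -> Lc b t <= Lc b' t.
Proof. by move=> h; rewrite /Lc; case: ifP => // _; apply: mulq_le. Qed.
Lemma Rc_le b b' t : b <= b' -> Rc b t <= Rc b' t.
Proof. by move=> h; rewrite /Rc; case: ifP => // _; case: ifP => // _; apply: mulq_le. Qed.
Lemma Bc_le b b' t : b <= b' -> Bc b t <= Bc b' t.
Proof. by move=> h; rewrite /Bc; case: ifP => // _; apply: mulq_le. Qed.
Lemma Tc_le b b' t : b <= b' -> Tc b t <= Tc b' t.
Proof. by move=> h; rewrite /Tc; case: ifP => // _; case: ifP => // _; apply: mulq_le. Qed.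

Record splane (E : pt2 -> pt2 -> Prop) : Prop := SPlane {
  sp_pl : plane R L (A * q) (B * q) E;
  sp_L : forall b t, 0 <= b -> b <= B -> 0 <= t -> t + 1 <= q -> E (t, Lc b t) (t + 1, Lc b (t + 1));
  sp_R : forall b t, 0 <= b -> b <= B -> q <= t -> t + 1 <= A * q -> E (t, Rc b t) (t + 1, Rc b (t + 1));
  sp_B : forall i s, 0 <= i -> i <= A -> 0 <= s -> s + 1 <= q -> E (Bc i s, s) (Bc i (s + 1), s + 1);
  sp_T : forall i s, 0 <= i -> i <= A -> q <= s -> s + 1 <= B * q -> E (Tc i s, s) (Tc i (s + 1), s + 1) }.

Definition armx (v w : pt2) := exists b t, [/\ 0 <= b, b <= B &
  [/\ 0 <= t, t + 1 <= q, v = (t, Lc b t) & w = (t + 1, Lc b (t + 1))] \/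
  [/\ q <= t, t + 1 <= A * q, v = (t, Rc b t) & w = (t + 1, Rc b (t + 1))]].

Definition army (v w : pt2) := exists i s, [/\ 0 <= i, i <= A &
  [/\ 0 <= s, s + 1 <= q, v = (Bc i s, s) & w = (Bc i (s + 1), s + 1)] \/
  [/\ q <= s, s + 1 <= B * q, v = (Tc i s, s) & w = (Tc i (s + 1), s + 1)]].

Let q1 : 1 <= q. Proof. by move: q0; clear; lia. Qed.

Lemma mulq_bd b C : 0 <= b -> b <= C -> 0 <= b * q /\ b * q <= C * q.
Proof. by move=> h1 h2; split; [apply: mulr_ge0 => //; apply: ltW|apply: mulq_le]. Qed.

Lemma Lc_bd b t : 0 <= b -> b <= B -> 0 <= Lc b t /\ Lc b t <= B * q.
Proof.
move=> b0 bB; have [h|h] := leP t 0; first by rewrite Lc0 //; apply: mulq_bd.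
by move: (Lc1 b h) Bq q1; clear; lia.
Qed.

Lemma Rc_bd b t : 0 <= b -> b <= B -> 0 <= Rc b t /\ Rc b t <= B * q.
Proof.
move=> b0 bB; have [h|h] := leP (A * q) t; first by rewrite RcA //; apply: mulq_bd.
by move: (Rc1 b h) Bq q1; clear; lia.
Qed.

Lemma Bc_bd b t : 0 <= b -> b <= A -> 0 <= Bc b t /\ Bc b t <= A * q.
Proof.
move=> b0 bB; have [h|h] := leP t 0; first by rewrite Bc0 //; apply: mulq_bd.
by move: (Bc1 b h) Aq q1; clear; lia.
Qed.

Lemma Tc_bd b t : 0 <= b -> b <= A -> 0 <= Tc b t /\ Tc b t <= A * q.
Proof.
move=> b0 bB; have [h|h] := leP (B * q) t; first by rewrite TcB //; apply: mulq_bd.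
by move: (Tc1 b h) Aq q1; clear; lia.
Qed.

Lemma armx_V v w : armx v w -> [/\ Vbox L (A * q) (B * q) v, Vbox L (A * q) (B * q) w & w.1 = v.1 + 1].
Proof.
move=> [b [t [b0 bB [[t0 tq -> ->]|[t0 tq -> ->]]]]].
  have [h1 h2] := Lc_bd t b0 bB; have [h3 h4] := Lc_bd (t + 1) b0 bB.
  by split=> //; split=> //=; try (apply: Lc_L); move: t0 tq Aq q1; clear; lia.
have [h1 h2] := Rc_bd t b0 bB; have [h3 h4] := Rc_bd (t + 1) b0 bB.
by split=> //; split=> //=; try (apply: Rc_L); move: t0 tq Aq q1; clear; lia.
Qed.

Lemma army_V v w : army v w -> [/\ Vbox L (A * q) (B * q) v, Vbox L (A * q) (B * q) w & w.2 = v.2 + 1].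
Proof.
move=> [b [t [b0 bB [[t0 tq -> ->]|[t0 tq -> ->]]]]].
  have [h1 h2] := Bc_bd t b0 bB; have [h3 h4] := Bc_bd (t + 1) b0 bB.
  by split=> //; split=> //=; try (apply: Bc_L); move: t0 tq Bq q1; clear; lia.
have [h1 h2] := Tc_bd t b0 bB; have [h3 h4] := Tc_bd (t + 1) b0 bB.
by split=> //; split=> //=; try (apply: Tc_L); move: t0 tq Bq q1; clear; lia.
Qed.

Lemma arm_meets v w v' w' : armx v w -> army v' w' -> meets R L (A * q) (B * q) v w v' w'.
Proof.
move=> hx hy; have [Vv Vw e] := armx_V hx; have [Vv' Vw' e'] := army_V hy.
have S := @meets_sep R _ _ _ _ _ _ _ Vv Vw Vv' Vw' e e'.
case: hx => b [t [b0 bB hx]]; case: hy => i [s [i0 iA hy]].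
have [bq0 bqB] := mulq_bd b0 bB; have [iq0 iqA] := mulq_bd i0 iA.
have bP : 0 < b -> q <= b * q.
  by move=> h; rewrite -[X in X <= _]mul1r; apply: mulq_le; move: h; clear; lia.
have iP : 0 < i -> q <= i * q.
  by move=> h; rewrite -[X in X <= _]mul1r; apply: mulq_le; move: h; clear; lia.
have bM : b < B -> b * q + q <= B * q.
  by move=> h; have : (b + 1) * q <= B * q by [apply: mulq_le; move: h; clear; lia]; clear; lia.
have iM : i < A -> i * q + q <= A * q.
  by move=> h; have : (i + 1) * q <= A * q by [apply: mulq_le; move: h; clear; lia]; clear; lia.
case: hx => -[t0 tq ev ew]; case: hy => -[s0 sq ev' ew']; subst v w v' w'; rewrite /= in S *.
- have [s00|s00] := ltP 0 s.
    have B1' := Bc1 i s00; have B3' : 0 < s + 1 by move: s00; clear; lia.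
    by apply: S; constructor 1; move: tq B1' (Bc1 i B3'); clear; lia.
  have es : s = 0 by apply/eqP; rewrite eq_le s0 s00.
  have [t00|t00] := ltP 0 t.
    have L1' := Lc1 b t00; have L3' : 0 < t + 1 by move: t00; clear; lia.
    by apply: S; constructor 3; move: es L1' (Lc1 b L3'); clear; lia.
  have et : t = 0 by apply/eqP; rewrite eq_le t0 t00.
  have Ll : 1 <= Lc b (t + 1) /\ Lc b (t + 1) <= q by apply: Lc1; rewrite et.
  have Bl : q <= Bc i (s + 1) /\ Bc i (s + 1) <= 2 * q - 1 by apply: Bc1; rewrite es.
  subst s t; rewrite (@Lc0 b 0) // (@Bc0 i 0) // !add0r in S Vv Ll Bl *.
  set l1 := Lc b 1 in S Ll *; set b1 := Bc i 1 in S Bl *; clearbody l1 b1.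
  have [b00|b00] := ltP 0 b; first by apply: S; constructor 3; move: (bP b00) q1 Ll; clear; lia.
  have [i00|i00] := ltP 0 i; first by apply: S; constructor 1; move: (iP i00) q1 Bl; clear; lia.
  have eb : b = 0 by apply/eqP; rewrite eq_le b0 b00.
  have ei : i = 0 by apply/eqP; rewrite eq_le i0 i00.
  subst b i; rewrite !mul0r in Vv *.
  have := @meets_corner R L (A * q) (B * q) (0, 0) 1 1 b1 l1 Vv; rewrite !mul1r !add0r.
  by apply=> //; move: Ll Bl q1; clear; lia.
- have [t00|t00] := ltP 0 t.
    have L1' := Lc1 b t00; have L3' : 0 < t + 1 by move: t00; clear; lia.
    by apply: S; constructor 4; move: s0 L1' (Lc1 b L3'); clear; lia.
  have et : t = 0 by apply/eqP; rewrite eq_le t0 t00.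
  have sB : s < B * q by move: sq; clear; lia.
  have [s00|s00] := ltP (s + 1) (B * q).
    by apply: S; constructor 1; move: et (Tc1 i sB) (Tc1 i s00); clear; lia.
  have es : s + 1 = B * q by apply/eqP; rewrite eq_le sq s00.
  have Ll : 1 <= Lc b (t + 1) /\ Lc b (t + 1) <= q by apply: Lc1; rewrite et.
  have Tl := Tc1 i sB.
  subst t; rewrite (@Lc0 b 0) // (@TcB i (s + 1)) // !add0r in S Vv Vw' Ll *.
  set l1 := Lc b 1 in S Ll *; set b1 := Tc i s in S Tl *; clearbody l1 b1.
  have [i00|i00] := ltP 0 i; first by apply: S; constructor 1; move: (iP i00) q1 Tl; clear; lia.
  have [b00|b00] := ltP b B; first by apply: S; constructor 4; move: (bM b00) q1 Ll es Bq; clear; lia.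
  have eb : b = B by apply/eqP; rewrite eq_le bB b00.
  have ei : i = 0 by apply/eqP; rewrite eq_le i0 i00.
  subst b i; rewrite mul0r es in Vw' *; apply: meets_sym; apply: meets_swap; apply: meets_sym.
  have := @meets_corner R L (A * q) (B * q) (0, B * q) 1 (-1) b1 (l1 - B * q) Vv.
  rewrite !mul1r /= !add0r [B * q + (l1 - _)]addrC subrK mulN1r (_ : B * q - 1 = s); last by rewrite -es addrK.
  by apply=> //; move: Ll Tl q1 Bq; clear; lia.
- have tA : t < A * q by move: tq; clear; lia.
  have [t00|t00] := ltP (t + 1) (A * q).
    by apply: S; constructor 3; move: sq (Rc1 b tA) (Rc1 b t00); clear; lia.
  have et : t + 1 = A * q by apply/eqP; rewrite eq_le tq t00.
  have [s00|s00] := ltP 0 s.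
    have B1' := Bc1 i s00; have B3' : 0 < s + 1 by move: s00; clear; lia.
    by apply: S; constructor 2; move: et B1' (Bc1 i B3') Aq; clear; lia.
  have es : s = 0 by apply/eqP; rewrite eq_le s0 s00.
  have Bl : q <= Bc i (s + 1) /\ Bc i (s + 1) <= 2 * q - 1 by apply: Bc1; rewrite es.
  have Rl := Rc1 b tA.
  subst s; rewrite (@RcA b (t + 1)) // (@Bc0 i 0) // !add0r in S Vw Vv' Bl *.
  set l1 := Rc b t in S Rl *; set b1 := Bc i 1 in S Bl *; clearbody l1 b1.
  have [i00|i00] := ltP i A; first by apply: S; constructor 2; move: (iM i00) et Bl Aq q1; clear; lia.
  have [b00|b00] := ltP 0 b; first by apply: S; constructor 3; move: (bP b00) q1 Rl; clear; lia.
  have eb : b = 0 by apply/eqP; rewrite eq_le b0 b00.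
  have ei : i = A by apply/eqP; rewrite eq_le iA i00.
  subst b i; rewrite mul0r et in Vw *; apply: meets_swap.
  have := @meets_corner R L (A * q) (B * q) (A * q, 0) (-1) 1 (b1 - A * q) l1 Vv'.
  rewrite !mul1r /= !add0r [A * q + (_ - _)]addrC subrK mulN1r (_ : A * q - 1 = t); last by rewrite -et addrK.
  by apply=> //; move: Rl Bl q1 Aq; clear; lia.
have tA : t < A * q by move: tq; clear; lia.
have sB : s < B * q by move: sq; clear; lia.
have [s00|s00] := ltP (s + 1) (B * q).
  by apply: S; constructor 2; move: t0 (Tc1 i sB) (Tc1 i s00); clear; lia.
have es : s + 1 = B * q by apply/eqP; rewrite eq_le sq s00.
have [t00|t00] := ltP (t + 1) (A * q).
  by apply: S; constructor 4; move: es (Rc1 b tA) (Rc1 b t00) Bq; clear; lia.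
have et : t + 1 = A * q by apply/eqP; rewrite eq_le tq t00.
rewrite (@RcA b (t + 1)) // (@TcB i (s + 1)) // in S Vw Vw' *.
have Rl := Rc1 b tA; have Tl := Tc1 i sB.
set l1 := Rc b t in S Rl *; set b1 := Tc i s in S Tl *; clearbody l1 b1.
have [b00|b00] := ltP b B; first by apply: S; constructor 4; move: (bM b00) q1 Rl es Bq; clear; lia.
have [i00|i00] := ltP i A; first by apply: S; constructor 2; move: (iM i00) et Tl Aq q1; clear; lia.
have eb : b = B by apply/eqP; rewrite eq_le bB b00.
have ei : i = A by apply/eqP; rewrite eq_le iA i00.
subst b i; rewrite et es in Vw Vw' *; apply: meets_swap; apply: meets_sym; apply: meets_swap; apply: meets_sym.
have := @meets_corner R L (A * q) (B * q) (A * q, B * q) (-1) (-1) (b1 - A * q) (l1 - B * q) Vw'.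
rewrite !mulN1r /= [A * q + (_ - _)]addrC subrK [B * q + (_ - _)]addrC subrK (_ : A * q - 1 = t); last by rewrite -et addrK.
rewrite (_ : B * q - 1 = s); last by rewrite -es addrK.
by apply=> //; move: Rl Tl q1 Aq Bq; clear; lia.
Qed.

Theorem splane_exists : exists E, splane E.
Proof.
have A1 : 1 <= A by move: A2; clear; lia.
have B1 : 1 <= B by move: B2; clear; lia.
have A0 : 0 <= A by move: A2; clear; lia.
have B0 : 0 <= B by move: B2; clear; lia.
have SX : steps L (A * q) (B * q) armx.
  split; first exact: armx_V.
  move=> v w v' w' [b [t [_ _ hx]]] [b' [t' [_ _ hx']]].
  case: hx => -[t0 tq -> ->]; case: hx' => -[t0' tq' -> ->] /= et.
  - by subst t'; case: (leP b b') => h; [left|right; have {}h := ltW h]; split; apply: Lc_le.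
  - by move: tq t0' et; clear; lia.
  - by move: tq' t0 et; clear; lia.
  - by subst t'; case: (leP b b') => h; [left|right; have {}h := ltW h]; split; apply: Rc_le.
have SY : steps (fun x y => L y x) (B * q) (A * q) (fun v w => army (flip v) (flip w)).
  split.
    move=> v w /army_V[[h1 h2 h3 h4 h5] [h6 h7 h8 h9 h10] h]; split=> //; split=> //.
  move=> [v1 v2] [w1 w2] [v1' v2'] [w1' w2'] [b [t [_ _ hx]]] [b' [t' [_ _ hx']]].
  case: hx => -[t0 tq [-> ->] [-> ->]]; case: hx' => -[t0' tq' [-> ->] [-> ->]] /= et.
  - by subst t'; case: (leP b b') => h; [left|right; have {}h := ltW h]; split; apply: Bc_le.
  - by move: tq t0' et; clear; lia.
  - by move: tq' t0 et; clear; lia.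
  - by subst t'; case: (leP b b') => h; [left|right; have {}h := ltW h]; split; apply: Tc_le.
pose va a : Prop := a = 0 \/ a = A. pose hb b : Prop := b = 0 \/ b = B.
have hva a : va a -> [/\ 0 <= a, a <= A & avoids q (fun v w => army (flip v) (flip w)) a].
  move=> ha; split; try by case: ha => ->.
  move=> v w /army_V[[_ /= h1 h2 _ _] [_ /= h3 h4 _ _] _].
  by case: ha => ->; rewrite ?mul0r; [right|left].
have hhb b : hb b -> [/\ 0 <= b, b <= B & avoids q armx b].
  move=> ha; split; try by case: ha => ->.
  move=> v w /armx_V[[_ /= _ _ h1 h2] [_ /= _ _ h3 h4] _].
  by case: ha => ->; rewrite ?mul0r; [right|left].
have [E [PE HE]] := config_plane Lq A1 B1 SX SY arm_meets hva hhb
  (or_introl erefl) (or_intror erefl) (or_introl erefl) (or_intror erefl).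
exists E; split=> //.
- by move=> b t b0 bB t0 tq; apply: HE; left; exists b, t; split=> //; left.
- by move=> b t b0 bB t0 tq; apply: HE; left; exists b, t; split=> //; right.
- by move=> b t b0 bB t0 tq; apply: HE; right; left; exists b, t; split=> //; left.
- by move=> b t b0 bB t0 tq; apply: HE; right; left; exists b, t; split=> //; right.
Qed.

End Special.

Section Pin.
Variable R : realType.

Record pin (q A B : int) (l r bt tt : int -> R -> R) : Prop := Pin {
  pn_q : 0 < q;
  pn_A : 2 <= A;
  pn_B : 2 <= B;
  l_mono : forall i j x, i <= j -> l i x <= l j x;
  l_zero : forall i, l i 0 = i%:~R * q%:~R;
  l_range : forall i x, 0 <= i -> i <= B -> 0 <= x -> x <= A%:~R * q%:~R -> 0 <= l i x /\ l i x <= B%:~R * q%:~R;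
  l_one : forall i j x, 1 <= x -> x <= A%:~R * q%:~R -> l i x <= q%:~R /\ l i x = l j x;
  l_low : forall x, 0 <= x -> x <= A%:~R * q%:~R -> l 0 x <= q%:~R;
  l_q : forall i x, q%:~R <= x -> x <= A%:~R * q%:~R -> l i x = q%:~R;
  r_mono : forall i j x, i <= j -> r i x <= r j x;
  r_a : forall i, r i (A%:~R * q%:~R) = i%:~R * q%:~R;
  r_range : forall i x, 0 <= i -> i <= B -> 0 <= x -> x <= A%:~R * q%:~R -> 0 <= r i x /\ r i x <= B%:~R * q%:~R;
  r_one : forall i j x, 0 <= x -> x <= A%:~R * q%:~R - 1 ->
    [/\ q%:~R <= r i x, r i x <= 2 * q%:~R - 1 & r i x = r j x];
  r_high : forall x, 0 <= x -> x <= A%:~R * q%:~R -> q%:~R <= r B x;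
  r_q : forall i x, 0 <= x -> x <= q%:~R -> r i x = q%:~R;
  bt_mono : forall i j y, i <= j -> bt i y <= bt j y;
  bt_zero : forall i, bt i 0 = i%:~R * q%:~R;
  bt_one : forall i j y, 1 <= y -> y <= B%:~R * q%:~R -> bt i y = bt j y;
  bt_mid : forall i y, 1 <= i -> i <= A - 1 -> 0 <= y -> y <= B%:~R * q%:~R ->
    q%:~R <= bt i y /\ bt i y <= A%:~R * q%:~R - 1;
  bt_q : forall i y, q%:~R <= y -> y <= B%:~R * q%:~R -> bt i y = q%:~R;
  tt_mono : forall i j y, i <= j -> tt i y <= tt j y;
  tt_b : forall i, tt i (B%:~R * q%:~R) = i%:~R * q%:~R;
  tt_one : forall i j y, 0 <= y -> y <= B%:~R * q%:~R - 1 -> tt i y <= q%:~R /\ tt i y = tt j y;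
  tt_mid : forall i y, 1 <= i -> i <= A - 1 -> 0 <= y -> y <= B%:~R * q%:~R ->
    1 <= tt i y /\ tt i y <= A%:~R * q%:~R - q%:~R;
  tt_low : forall y, 0 <= y -> y <= B%:~R * q%:~R -> tt 1 y <= q%:~R;
  tt_q : forall i y, 0 <= y -> y <= q%:~R -> tt i y = q%:~R }.

Variables (q A B : int) (l r bt tt : int -> R -> R).
Hypothesis P : pin q A B l r bt tt.
Local Notation Q := (q%:~R : R).
Local Notation a := (A%:~R * Q).
Local Notation b := (B%:~R * Q).
Local Notation n1 := (a - Q).
Local Notation n2 := (b + Q).

Record srel (y1 y2 w1 w2 : R) : Prop := SRel {
  s_y1 : 0 <= y1 /\ y1 <= a;
  s_y2 : 0 <= y2 /\ y2 <= b;
  s_w1 : 0 <= w1 /\ w1 <= n1;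
  s_w2 : 0 <= w2 /\ w2 <= n2;
  s_g1 : w1 < n1 -> [\/ y1 <= Q, w2 = 0 | w2 = n2 /\ b - 1 < y2];
  s_g2 : 0 < w1 -> Q <= y1 \/ w2 = n2;
  s_g3 : w2 = 0 -> w1 < n1 -> y2 <= Q;
  s_g4 : 0 < w2 -> 0 < w1 -> Q <= y2 \/ (w1 = n1 /\ a - 1 < y1);
  s_g5 : w2 = 0 -> w1 < n1 -> y1 <= a - 1;
  s_g6 : w2 < n2 -> 0 < w1 -> y2 <= Q \/ (w1 = n1 /\ (b - 1 < y2 -> a - 1 <= y1));
  s_g7 : w2 = n2 -> w1 < n1 -> y1 <= a - 1;
  s_g8 : w2 = n2 -> 0 < w1 -> Q <= y2 /\ 1 <= y1;
  s_g9 : w2 < n2 -> w1 < n1 -> y2 <= Q \/ (w1 = 0 /\ y1 < 1);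
  s_ql : w1 = 0 -> stair q (B + 1) (l^~ y1) y2 w2;
  s_qr : w1 = n1 -> stair q (B + 1) (r^~ y1) y2 w2;
  s_qb : w2 = 0 -> stair q (A - 1) (fun i => bt (i + 1) y2) y1 w1;
  s_qt : w2 = n2 -> stair q (A - 1) (fun i => tt (i + 1) y2) y1 w1 }.

Let q0 : 0 < q. Proof. exact: pn_q P. Qed.
Let Q1 : 1 <= Q. Proof. by rewrite -[1]/(1%:~R) ler_int; move: q0; clear -P; lia. Qed.
Let Q0 : 0 < Q. Proof. exact: lt_le_trans ltr01 Q1. Qed.
Let a2 : 2 * Q <= a.
Proof. by rewrite ler_pM2r // -[2]/(2%:~R) ler_int (pn_A P). Qed.
Let b2 : 2 * Q <= b.
Proof. by rewrite ler_pM2r // -[2]/(2%:~R) ler_int (pn_B P). Qed.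

Lemma srel_mono1 y1 y2 w1 w2 y1' y2' w1' w2' : srel y1 y2 w1 w2 -> srel y1' y2' w1' w2' ->
  y1' < y1 -> w1 < w1' ->
  [\/ y2 < y2' /\ w2' < w2, y2 = y2' /\ w2 = w2' | y2' < y2 /\ w2 < w2'] -> False.
Proof.
move=> S S' y11 w11 tri.
have [w10 w1n] := s_w1 S; have [w10' w1n'] := s_w1 S'.
have [w20 w2n] := s_w2 S; have [w20' w2n'] := s_w2 S'.
have w1l : w1 < n1 by apply: lt_le_trans w1n'.
have w1p : 0 < w1' by apply: le_lt_trans w11.
have QB : w2 = 0 -> w2' = 0 -> y2 = y2' -> False.
  move=> e e' ey; have s := s_qb S e; have s' := s_qb S' e'; rewrite ey in s.
  by have := stair_mono q0 s' s y11; rewrite leNgt w11.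
have QT : w2 = n2 -> w2' = n2 -> y2 = y2' -> False.
  move=> e e' ey; have s := s_qt S e; have s' := s_qt S' e'; rewrite ey in s.
  by have := stair_mono q0 s' s y11; rewrite leNgt w11.
have G2' := s_g2 S' w1p.
have gam : w2' = n2 -> y1' < Q -> y1 <= Q -> False.
  move=> e2 yq yq1; have [yq2 y1p] := s_g8 S' e2 w1p.
  have [z|z] := eqVneq w2 n2.
    by apply: QT => //; case: tri => -[h1 h2] //; move: h2; rewrite z e2 ltxx.
  have {}z : w2 < n2 by rewrite lt_neqAle z.
  have y22 : y2' < y2 by case: tri => -[h1 h2] //; move: h2 z; rewrite e2; [rewrite ltNge w2n|move=> ->; rewrite ltxx].
  case: (s_g9 S z w1l) => [h|[h h']].
    by have := le_lt_trans yq2 (lt_le_trans y22 h); rewrite ltxx.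
  by have := lt_trans (le_lt_trans y1p y11) h'; rewrite ltxx.
case: (s_g1 S w1l) => [yq|e2|[e2 yb]].
- case: G2' => [yq'|e2]; first by have := lt_le_trans y11 (le_trans yq yq'); rewrite ltxx.
  by have [h|h] := ltP y1' Q; [exact: gam|have := lt_le_trans y11 (le_trans yq h); rewrite ltxx].
- have yq2 := s_g3 S e2 w1l; have ya := s_g5 S e2 w1l.
  have [z|z] := eqVneq w2' 0.
    by apply: QB => //; case: tri => -[h1 h2] //; move: h2; rewrite z e2 ltxx.
  have {}z : 0 < w2' by rewrite lt_neqAle eq_sym z.
  have y22 : y2' < y2 by case: tri => -[h1 h2] //; move: h2 z; rewrite e2; [rewrite ltNge w20'|move=> <-; rewrite ltxx].
  case: (s_g4 S' z w1p) => [h|[h h']].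
    by have := lt_le_trans y22 (le_trans yq2 h); rewrite ltxx.
  by have := lt_trans (lt_le_trans y11 ya) h'; rewrite ltxx.
have ya := s_g7 S e2 w1l.
have [z|z] := eqVneq w2' n2.
  by apply: QT => //; case: tri => -[h1 h2] //; move: h2; rewrite z e2 ltxx.
have {}z : w2' < n2 by rewrite lt_neqAle z.
have y22 : y2 < y2' by case: tri => -[h1 h2] //; move: h2 z; rewrite e2; [move=> <-; rewrite ltxx|rewrite ltNge w2n'].
case: (s_g6 S' z w1p) => [h|[h h']].
  by move: h y22 yb b2 Q1; clear -P q0 Q1 Q0 a2 b2; lra.
have := h' (lt_trans yb y22); move: ya y11; clear -P q0 Q1 Q0 a2 b2; lra.
Qed.

Lemma srel_mono2 y1 y2 w1 w2 y2' w2' : srel y1 y2 w1 w2 -> srel y1 y2' w1 w2' ->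
  y2' < y2 -> w2 < w2' -> False.
Proof.
move=> S S' y22 w22.
have [w10 w1n] := s_w1 S.
have [w20 w2n] := s_w2 S; have [w20' w2n'] := s_w2 S'.
have w2l : w2 < n2 by apply: lt_le_trans w2n'.
have w2p : 0 < w2' by apply: le_lt_trans w22.
have [z|z] := eqVneq w1 0.
  by have := stair_mono q0 (s_ql S' z) (s_ql S z) y22; rewrite leNgt w22.
have [z'|z'] := eqVneq w1 n1.
  by have := stair_mono q0 (s_qr S' z') (s_qr S z') y22; rewrite leNgt w22.
have w1p : 0 < w1 by rewrite lt_neqAle eq_sym z.
have w1l : w1 < n1 by rewrite lt_neqAle z'.
case: (s_g9 S w2l w1l) => [h|[h _]]; last by rewrite h eqxx in z.
case: (s_g4 S' w2p w1p) => [h'|[h' _]]; last by rewrite h' eqxx in z'.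
by have := lt_le_trans y22 (le_trans h h'); rewrite ltxx.
Qed.

Lemma srel_uniq (u y1 y2 w1 w2 y1' y2' w1' w2' : R) : 0 < u -> u < 1 ->
  srel y1 y2 w1 w2 -> srel y1' y2' w1' w2' ->
  (1 - u) * y1 + u * w1 = (1 - u) * y1' + u * w1' ->
  (1 - u) * y2 + u * w2 = (1 - u) * y2' + u * w2' -> y1 = y1' /\ y2 = y2'.
Proof.
move=> u0 u1; have u1' : 0 < 1 - u by rewrite subr_gt0.
have key (y w y' w' : R) : (1 - u) * y + u * w = (1 - u) * y' + u * w' ->
   [\/ y < y' /\ w' < w, y = y' /\ w = w' | y' < y /\ w < w'].
  move=> e; have e' : (1 - u) * (y - y') = u * (w' - w) by move: e; clear -P q0 Q1 Q0 a2 b2; lra.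
  case: (ltgtP y y') => [h|h|h].
  - constructor 1; split=> //; rewrite -subr_lt0 -(pmulr_rlt0 _ u0) -e' pmulr_rlt0 // subr_lt0 //.
  - constructor 3; split=> //; rewrite -subr_gt0 -(pmulr_rgt0 _ u0) -e' pmulr_rgt0 // subr_gt0 //.
  constructor 2; split=> //; move: e'; rewrite h subrr mulr0 => /esym/eqP.
  by rewrite mulf_eq0 (negbTE (lt0r_neq0 u0)) /= subr_eq0 => /eqP.
move=> S S' /key e1 /key e2.
case: e1 => -[h1 h2].
- exfalso; apply: (srel_mono1 S' S h1 h2); case: e2 => -[h3 h4]; [constructor 3|constructor 2|constructor 1]; split=> //.
- subst y1' w1'; case: e2 => -[h3 h4] //.
  + by case: (srel_mono2 S' S h3 h4).
  + by case: (srel_mono2 S S' h3 h4).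
- by case: (srel_mono1 S S' h1 h2 e2).
Qed.

End Pin.

Section StairEnds.
Variable R : realType.
Lemma stair_const (q n : int) (f : int -> R) p r : (forall b, f b = p) -> 0 <= r -> r <= n%:~R * q%:~R -> stair q n f p r.
Proof. by move=> e r0 rn; split=> // b _ _; rewrite e ltxx. Qed.

Lemma stair_bot (q n : int) (f : int -> R) p : 0 < q -> 0 <= n -> (forall b, 0 <= b -> b < n -> p <= f b) -> stair q n f p 0.
Proof.
move=> q0 n0 h; split=> //; first by apply: mulr_ge0; rewrite ler0z // ltW.
move=> b b0 bn; split=> h'; first by apply: mulr_ge0; rewrite ler0z // ltW.
by move: h'; rewrite ltNge h.
Qed.

Lemma stair_top (q n : int) (f : int -> R) p : 0 < q -> 0 <= n -> (forall b, 0 <= b -> b < n -> f b <= p) ->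
  stair q n f p (n%:~R * q%:~R).
Proof.
move=> q0 n0 h; have q0' : 0 < q%:~R :> R by rewrite ltr0z.
split=> //; first by apply: mulr_ge0; rewrite ler0z // ltW.
move=> b b0 bn; split=> h'; first by move: h'; rewrite ltNge h.
rewrite ler_pM2r // -[1]/(1%:~R) -rmorphD ler_int.
by move: bn; clear; lia.
Qed.
End StairEnds.

Section Types.
Variable R : realType.
Variables (q A B : int) (l r bt tt : int -> R -> R).
Hypothesis P : pin q A B l r bt tt.
Local Notation Q := (q%:~R : R).
Local Notation a := (A%:~R * Q).
Local Notation b := (B%:~R * Q).
Local Notation n1 := (a - Q).
Local Notation n2 := (b + Q).
Local Notation srel := (@srel R q A B l r bt tt).

Let q0 : 0 < q. Proof. exact: pn_q P. Qed.
Let Q1 : 1 <= Q. Proof. by rewrite -[1]/(1%:~R) ler_int; move: q0; clear -P; lia. Qed.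
Let a2 : 2 * Q <= a.
Proof. by rewrite ler_pM2r ?ltr0z // -[2]/(2%:~R) ler_int (pn_A P). Qed.
Let b2 : 2 * Q <= b.
Proof. by rewrite ler_pM2r ?ltr0z // -[2]/(2%:~R) ler_int (pn_B P). Qed.
Lemma EA : (A - 1)%:~R * Q = n1. Proof. by rewrite rmorphB /= mulrBl mul1r. Qed.
Lemma EB : (B + 1)%:~R * Q = n2. Proof. by rewrite rmorphD /= mulrDl mul1r. Qed.
Let A1 : 1 <= A - 1. Proof. by have := pn_A P; clear -P; lia. Qed.
Let B1 : 1 <= B - 1. Proof. by have := pn_B P; clear -P; lia. Qed.
Let A0 : 0 <= A - 1. Proof. exact: le_trans A1. Qed.
Let B0 : 0 <= B + 1. Proof. by move: B1; clear -P q0 Q1 a2 b2 A1 A0; lia. Qed.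

Lemma n1_gt0 : 0 < n1. Proof. by rewrite subr_gt0; move: a2 Q1; clear -P q0 Q1 a2 b2 A1 B1 A0 B0; lra. Qed.
Lemma n2_gt0 : 0 < n2. Proof. by move: b2 Q1; clear -P q0 Q1 a2 b2 A1 B1 A0 B0; lra. Qed.
Lemma qa1 : Q <= a - 1. Proof. by move: a2 Q1; clear -P q0 Q1 a2 b2 A1 B1 A0 B0; lra. Qed.
Lemma qb1 : Q <= b - 1. Proof. by move: b2 Q1; clear -P q0 Q1 a2 b2 A1 B1 A0 B0; lra. Qed.
Lemma qa : Q <= a. Proof. by apply: le_trans qa1 _; rewrite gerBl. Qed.
Lemma qb : Q <= b. Proof. by apply: le_trans qb1 _; rewrite gerBl. Qed.
Lemma rb1 : 2 * Q - 1 <= b - 1. Proof. by rewrite lerD2r. Qed.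
Lemma naa : n1 <= a - 1. Proof. by rewrite lerD2l lerN2. Qed.
Let Q0 : 0 <= Q. Proof. exact: le_trans ler01 Q1. Qed.

Lemma srel_left x y w2 : 0 <= x -> x <= a -> 0 <= y -> y <= b ->
  [\/ x <= Q, w2 = 0 | w2 = n2 /\ b - 1 < y] -> (w2 = 0 -> y <= Q /\ x <= a - 1) ->
  (w2 = n2 -> x <= a - 1) -> (w2 < n2 -> y <= Q \/ x < 1) ->
  stair q (B + 1) (l^~ x) y w2 -> (w2 = 0 -> x <= bt 1 y) -> (w2 = n2 -> x <= tt 1 y) ->
  srel x y 0 w2.
Proof.
have n0 := n1_gt0; move=> x0 xa y0 yb c1 c3 c7 c9 S cb ct.
have nA : 0 <= n1 by apply: ltW.
have [w0 wn _] := S; rewrite EB in wn.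
have ltx (z : R) : z < z -> False by rewrite ltxx.
split=> //.
- by move=> /ltx.
- by move=> /c3[].
- by move=> _ /ltx.
- by move=> /c3[].
- by move=> _ /ltx.
- by move=> /c7.
- by move=> _ /ltx.
- by move=> /c9 h _; case: h; [left|right].
- by move=> e; rewrite -e ltxx in n0.
- move=> e; apply: stair_bot => // i i0 iA; apply: le_trans (cb e) _; apply: (bt_mono P).
  by rewrite lerDr.
- move=> e; apply: stair_bot => // i i0 iA; apply: le_trans (ct e) _; apply: (tt_mono P).
  by rewrite lerDr.
Qed.

Lemma srel_right x y w2 : 0 <= x -> x <= a -> 0 <= y -> y <= b ->
  (Q <= x) \/ w2 = n2 -> (0 < w2 -> Q <= y \/ a - 1 < x) ->
  (w2 < n2 -> b - 1 < y -> a - 1 <= x) -> (w2 = n2 -> Q <= y /\ 1 <= x) ->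
  stair q (B + 1) (r^~ x) y w2 -> (w2 = 0 -> bt (A - 1) y <= x) -> (w2 = n2 -> tt (A - 1) y <= x) ->
  srel x y n1 w2.
Proof.
have n0 := n1_gt0; move=> x0 xa y0 yb c2 c4 c6 c8 S cb ct.
have nA : 0 <= n1 by apply: ltW.
have [w0 wn _] := S; rewrite EB in wn.
have ltx (z : R) : z < z -> False by rewrite ltxx.
split=> //.
- by move=> /ltx.
- by move=> _ /ltx.
- by move=> /c4 h _; case: h; [left|right].
- by move=> _ /ltx.
- by move=> h _; right; split=> //; apply: c6.
- by move=> _ /ltx.
- by move=> /c8.
- by move=> _ /ltx.
- by move=> e; rewrite e ltxx in n0.
- move=> e; rewrite -EA; apply: stair_top => // i i0 iA; apply: le_trans (cb e); apply: (bt_mono P).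
  by move: iA; clear -P q0 Q1 a2 b2 A1 B1 A0 B0; lia.
- move=> e; rewrite -EA; apply: stair_top => // i i0 iA; apply: le_trans (ct e); apply: (tt_mono P).
  by move: iA; clear -P q0 Q1 a2 b2 A1 B1 A0 B0; lia.
Qed.

Lemma srel_bottom x y w1 : Q <= x -> x <= a - 1 -> 0 <= y -> y <= Q ->
  stair q (A - 1) (fun i => bt (i + 1) y) x w1 -> srel x y w1 0.
Proof.
have n0 := n2_gt0; move=> x0 xa y0 yb S.
have [w0 wn _] := S; rewrite EA in wn.
have xa' : x <= a by apply: le_trans xa _; rewrite gerBl.
have yb' : y <= b by apply: le_trans yb qb.
have nB : 0 <= n2 by apply: ltW.
have x00 : 0 <= x by apply: le_trans x0.
split=> //.
- by constructor 2.
- by left.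
- by rewrite ltxx.
- by left.
- by move=> e; rewrite -e ltxx in n0.
- by left.
- by move=> e; apply: stair_bot => // i i0 iA; rewrite (l_q P).
- move=> e; apply: stair_bot => // i i0 iA.
  by have [h _ _] := r_one P i i x00 xa; apply: le_trans h.
- by move=> e; rewrite -e ltxx in n0.
Qed.

Lemma srel_top x y w1 : 1 <= x -> x <= n1 -> Q <= y -> y <= b -> x <= Q \/ b - 1 < y ->
  stair q (A - 1) (fun i => tt (i + 1) y) x w1 -> srel x y w1 n2.
Proof.
have n0 := n2_gt0; move=> x1 xn y0 yb c1 S.
have [w0 wn _] := S; rewrite EA in wn.
have xa1 : x <= a - 1 by apply: le_trans xn naa.
have xa : x <= a by apply: le_trans xa1 _; rewrite gerBl.
have x0 : 0 <= x by apply: le_trans x1.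
have y00 : 0 <= y by apply: le_trans y0.
have nB : 0 <= n2 by apply: ltW.
have ltx (z : R) : z < z -> False by rewrite ltxx.
split=> //.
- by move=> _; case: c1; [constructor 1|constructor 3].
- by right.
- by move=> e; rewrite e ltxx in n0.
- by left.
- by move=> /ltx.
- by move=> /ltx.
- move=> e; rewrite -EB; apply: stair_top => // i i0 iA; apply: le_trans y0.
  by have [] := l_one P i i x1 xa.
- move=> e; rewrite -EB; apply: stair_top => // i i0 iA.
  case: c1 => h; first by rewrite (r_q P).
  have [_ h2 _] := r_one P i i x0 xa1.
  by apply: le_trans h2 _; apply: le_trans rb1 (ltW h).
- by move=> e; rewrite e ltxx in n0.
Qed.

Lemma rel_C w1 w2 : 0 <= w1 -> w1 <= n1 -> 0 <= w2 -> w2 <= n2 -> srel Q Q w1 w2.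
Proof.
move=> h1 h2 h3 h4; have := qa; have := qb; have := qa1 => ha hb hc.
split=> //.
- by constructor 1.
- by left.
- by left.
- by left.
- by left.
- by move=> _; apply: stair_const; rewrite ?EB // => i; rewrite (l_q P).
- by move=> _; apply: stair_const; rewrite ?EB // => i; rewrite (r_q P).
- by move=> _; apply: stair_const; rewrite ?EA // => i; rewrite (bt_q P).
- by move=> _; apply: stair_const; rewrite ?EA // => i; rewrite (tt_q P).
Qed.

Lemma stair0 (n : int) (p : R) f : 0 <= n -> (forall i j, 0 <= i -> i <= j -> j < n -> f i <= f j) -> (0 < n -> p <= f 0) -> stair q n f p 0.
Proof.
move=> n0 fm h; apply: stair_bot => // c c0 cn; have n0' := le_lt_trans c0 cn.
by apply: le_trans (h n0') _; apply: fm.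
Qed.

Lemma lm x : forall i j, 0 <= i -> i <= j -> j < B + 1 -> l i x <= l j x.
Proof. by move=> i j _ ij _; apply: (l_mono P). Qed.
Lemma rm x : forall i j, 0 <= i -> i <= j -> j < B + 1 -> r i x <= r j x.
Proof. by move=> i j _ ij _; apply: (r_mono P). Qed.
Lemma bm y : forall i j, 0 <= i -> i <= j -> j < A - 1 -> bt (i + 1) y <= bt (j + 1) y.
Proof. by move=> i j _ ij _; apply: (bt_mono P); rewrite lerD2r. Qed.
Lemma tm y : forall i j, 0 <= i -> i <= j -> j < A - 1 -> tt (i + 1) y <= tt (j + 1) y.
Proof. by move=> i j _ ij _; apply: (tt_mono P); rewrite lerD2r. Qed.

Lemma n2_neq0 : n2 <> 0.
Proof. by move=> e; have := n2_gt0; rewrite e ltxx. Qed.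

Lemma rel_LL x y : 0 <= x -> x <= a -> 0 <= y -> y <= b -> y <= l 0 x -> x <= bt 1 y -> srel x y 0 0.
Proof.
move=> x0 xa y0 yb h1 h2.
have yq : y <= Q by apply: le_trans h1 (l_low P x0 xa).
have [_ h3] := bt_mid P (lexx 1) A1 y0 yb.
apply: srel_left => //.
- by constructor 2.
- by move=> _; split=> //; apply: le_trans h3.
- by move=> /esym/n2_neq0.
- by left.
- by apply: stair0 => //; exact: lm.
- by move=> /esym/n2_neq0.
Qed.

Lemma rel_UL x y : 0 <= x -> x <= a -> 0 <= y -> y <= b -> l B x <= y -> x <= tt 1 y -> srel x y 0 n2.
Proof.
move=> x0 xa y0 yb h1 h2.
have xq : x <= Q by apply: le_trans h2 (tt_low P y0 yb).
apply: srel_left => //.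
- by constructor 1.
- by move=> /n2_neq0.
- by move=> _; apply: le_trans xq qa1.
- by rewrite ltxx.
- rewrite -EB; apply: stair_level => //; first exact: lm.
  + by move=> _; rewrite addrK.
  + by rewrite ltxx.
- by move=> /n2_neq0.
Qed.

Lemma rel_LR x y : 0 <= x -> x <= a -> 0 <= y -> y <= b -> y <= r 0 x -> bt (A - 1) y <= x -> srel x y n1 0.
Proof.
move=> x0 xa y0 yb h1 h2.
have [h3 _] := bt_mid P A1 (lexx _) y0 yb.
apply: srel_right => //.
- by left; apply: le_trans h2.
- by rewrite ltxx.
- move=> _ h; rewrite leNgt; apply/negP => /ltW h'; have [_ h4 _] := r_one P 0 0 x0 h'.
  have := lt_le_trans h (le_trans h1 (le_trans h4 rb1)); by rewrite ltxx.
- by move=> /esym/n2_neq0.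
- by apply: stair0 => //; exact: rm.
- by move=> /esym/n2_neq0.
Qed.

Lemma rel_UR x y : 0 <= x -> x <= a -> 0 <= y -> y <= b -> r B x <= y -> tt (A - 1) y <= x -> srel x y n1 n2.
Proof.
move=> x0 xa y0 yb h1 h2.
have [h3 _] := tt_mid P A1 (lexx _) y0 yb.
have yq : Q <= y by apply: le_trans h1; apply: (r_high P).
apply: srel_right => //.
- by right.
- by left.
- by rewrite ltxx.
- by move=> _; split=> //; apply: le_trans h2.
- rewrite -EB; apply: stair_level => //; first exact: rm.
  + by move=> _; rewrite addrK.
  + by rewrite ltxx.
- by move=> /n2_neq0.
Qed.

Lemma rise_zero (i : int) (w : R) : 0 <= i -> i%:~R * Q <= w -> w = 0 -> i = 0.
Proof.
move=> i0 h e; apply/eqP; rewrite eq_le i0 andbT -(ler_int R) -(@ler_pM2r _ Q) ?ltr0z //.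
by rewrite mul0r -e.
Qed.

Lemma rise_top (i : int) (w : R) : i <= B -> w <= (i%:~R + 1) * Q -> w = n2 -> i = B.
Proof.
move=> iB h e; apply/eqP; rewrite eq_le iB /= -(lerD2r 1) -(ler_int R) -(@ler_pM2r _ Q) ?ltr0z //.
by rewrite EB -e rmorphD.
Qed.

Lemma rel_L1 (i : int) (x w2 : R) : 0 <= i -> i <= B -> 0 <= x -> x <= Q ->
  i%:~R * Q <= w2 -> w2 <= (i%:~R + 1) * Q -> srel x (l i x) 0 w2.
Proof.
move=> i0 iB x0 xq w1 w2'.
have xa : x <= a by apply: le_trans xq qa.
have xa1 : x <= a - 1 by apply: le_trans xq qa1.
have [y0 yb] := l_range P i0 iB x0 xa.
apply: srel_left => //.
- by constructor 1.
- by move=> e; split=> //; rewrite (rise_zero i0 w1 e); apply: (l_low P).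
- by move=> _; have [h|h] := ltP x 1; [right|left; have [] := l_one P i i h xa].
- apply: (stair_rise (f := l^~ x)) => //; first exact: lm.
  by apply: le_lt_trans iB _; rewrite ltrDl.
- by move=> _; apply: le_trans xq _; have [] := bt_mid P (lexx 1) A1 y0 yb.
- move=> _; have [h|h] := ltP x 1.
    by have [h' _] := tt_mid P (lexx 1) A1 y0 yb; apply: le_trans (ltW h) h'.
  by have [h' _] := l_one P i i h xa; rewrite (tt_q P).
Qed.

Lemma rel_R1 (i : int) (x w2 : R) : 0 <= i -> i <= B -> Q <= x -> x <= a ->
  i%:~R * Q <= w2 -> w2 <= (i%:~R + 1) * Q -> srel x (r i x) n1 w2.
Proof.
move=> i0 iB xq xa w1 w2'.
have x0 : 0 <= x by apply: le_trans xq.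
have [y0 yb] := r_range P i0 iB x0 xa.
apply: srel_right => //.
- by left.
- move=> _; have [h|h] := leP x (a - 1); last by right.
  by left; have [] := r_one P i i x0 h.
- move=> _ h1; rewrite leNgt; apply/negP => /ltW h'; have [_ h4 _] := r_one P i i x0 h'.
  by have := lt_le_trans h1 (le_trans h4 rb1); rewrite ltxx.
- move=> e; rewrite (rise_top iB w2' e); split; first exact: (r_high P).
  exact: le_trans xq.
- apply: (stair_rise (f := r^~ x)) => //; first exact: rm.
  by apply: le_lt_trans iB _; rewrite ltrDl.
- move=> _; have [h|h] := leP x (a - 1).
    by have [h' _ _] := r_one P i i x0 h; rewrite (bt_q P).
  by have [_ h'] := bt_mid P A1 (lexx _) y0 yb; apply: le_trans h' (ltW h).
move=> _; have [h|h] := leP x (a - 1).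
  have [_ h' _] := r_one P i i x0 h; have h2 := le_trans h' rb1.
  by have [h3 _] := tt_one P (A - 1) 0 y0 h2; apply: le_trans h3 xq.
have [_ h'] := tt_mid P A1 (lexx _) y0 yb; apply: le_trans h' _; apply: le_trans naa (ltW h).
Qed.

Lemma rel_L2 (i : int) (x y : R) : 1 <= i -> i <= B -> 0 <= x -> x <= 1 -> 0 <= y -> y <= b ->
  l (i - 1) x <= y -> y <= l i x -> srel x y 0 (i%:~R * Q).
Proof.
move=> i1 iB x0 x1 y0 yb h1 h2.
have i0 : 0 <= i by apply: le_trans i1.
have xq : x <= Q by apply: le_trans x1 Q1.
have xa : x <= a by apply: le_trans xq qa.
have Q00 : 0 < Q by apply: lt_le_trans Q1.
have w0 : i%:~R * Q <> 0.
  by move=> e; have := rise_zero i0 (lexx _) e; move=> e'; rewrite e' in i1.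
have wn : i%:~R * Q <> n2.
  move=> e; have := iB; rewrite -(ler_int R) -(ler_pM2r Q00) e gerDl leNgt Q00 //.
apply: srel_left => //.
- by constructor 1.
- move=> _; have [h|h] := ltP x 1; first by right.
  by left; apply: le_trans h2 _; have [] := l_one P i i h xa.
- apply: stair_level => //; first exact: lm.
  by apply: le_trans iB _; rewrite lerDl.
Qed.

Lemma rel_R2 (i : int) (x y : R) : 1 <= i -> i <= B -> a - 1 <= x -> x <= a -> 0 <= y -> y <= b ->
  r (i - 1) x <= y -> y <= r i x -> srel x y n1 (i%:~R * Q).
Proof.
move=> i1 iB x1 xa y0 yb h1 h2.
have i0 : 0 <= i by apply: le_trans i1.
have xq : Q <= x by apply: le_trans qa1 x1.
have x0 : 0 <= x by apply: le_trans xq.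
have Q00 : 0 < Q by apply: lt_le_trans Q1.
have w0 : i%:~R * Q <> 0.
  by move=> e; have := rise_zero i0 (lexx _) e; move=> e'; rewrite e' in i1.
have wn : i%:~R * Q <> n2.
  move=> e; have := iB; rewrite -(ler_int R) -(ler_pM2r Q00) e gerDl leNgt Q00 //.
apply: srel_right => //.
- by left.
- move=> _; have [h|h] := ltP (a - 1) x; first by right.
  by left; apply: le_trans h1; have [] := r_one P (i - 1) 0 x0 h.
- apply: stair_level => //; first exact: rm.
  by apply: le_trans iB _; rewrite lerDl.
Qed.

Lemma rel_B1 (i : int) (y w1 : R) : 0 <= i -> i + 1 <= A - 1 -> 0 <= y -> y <= Q ->
  i%:~R * Q <= w1 -> w1 <= (i%:~R + 1) * Q -> srel (bt (i + 1) y) y w1 0.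
Proof.
move=> i0 iA y0 yq h1 h2.
have i1 : 1 <= i + 1 by rewrite lerDr.
have [h3 h4] := bt_mid P i1 iA y0 (le_trans yq qb).
apply: srel_bottom => //; apply: (stair_rise (f := fun i => bt (i + 1) y)) => //; first exact: bm.
by apply: lt_le_trans iA; rewrite ltrDl.
Qed.

Lemma rel_B2 (i : int) (x y : R) : 1 <= i -> i + 1 <= A - 1 -> 0 <= y -> y <= 1 ->
  bt i y <= x -> x <= bt (i + 1) y -> srel x y (i%:~R * Q) 0.
Proof.
move=> i1 iA y0 y1 h1 h2.
have yq : y <= Q by apply: le_trans y1 Q1.
have i0 : 0 <= i by apply: le_trans i1.
have iA' : i <= A - 1 by apply: le_trans iA; rewrite lerDl.
have [h3 _] := bt_mid P i1 iA' y0 (le_trans yq qb).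
have i1' : 1 <= i + 1 by rewrite lerDr.
have [_ h4] := bt_mid P i1' iA y0 (le_trans yq qb).
apply: srel_bottom => //; [exact: le_trans h1|exact: le_trans h2 h4|].
apply: (stair_level (f := fun i => bt (i + 1) y)) => //; first exact: bm.
by rewrite subrK.
Qed.

Lemma rel_T1 (i : int) (y w1 : R) : 0 <= i -> i + 1 <= A - 1 -> Q <= y -> y <= b ->
  i%:~R * Q <= w1 -> w1 <= (i%:~R + 1) * Q -> srel (tt (i + 1) y) y w1 n2.
Proof.
move=> i0 iA y0 yq h1 h2.
have y00 : 0 <= y by apply: le_trans y0.
have i1 : 1 <= i + 1 by rewrite lerDr.
have [h3 h4] := tt_mid P i1 iA y00 yq.
apply: srel_top => //.
  by have [h|h] := leP y (b - 1); [left; have [] := tt_one P (i + 1) 0 y00 h|right].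
apply: (stair_rise (f := fun i => tt (i + 1) y)) => //; first exact: tm.
by apply: lt_le_trans iA; rewrite ltrDl.
Qed.

Lemma rel_T2 (i : int) (x y : R) : 1 <= i -> i + 1 <= A - 1 -> b - 1 <= y -> y <= b ->
  tt i y <= x -> x <= tt (i + 1) y -> srel x y (i%:~R * Q) n2.
Proof.
move=> i1 iA y1 yb h1 h2.
have yq : Q <= y by apply: le_trans qb1 y1.
have y0 : 0 <= y by apply: le_trans yq.
have i0 : 0 <= i by apply: le_trans i1.
have iA' : i <= A - 1 by apply: le_trans iA; rewrite lerDl.
have [h3 _] := tt_mid P i1 iA' y0 yb.
have i1' : 1 <= i + 1 by rewrite lerDr.
have [_ h4] := tt_mid P i1' iA y0 yb.
apply: srel_top => //; [exact: le_trans h1|exact: le_trans h2 h4| |].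
  have [h|h] := leP y (b - 1); last by right.
  by left; apply: le_trans h2 _; have [] := tt_one P (i + 1) 0 y0 h.
apply: (stair_level (f := fun i => tt (i + 1) y)) => //; first exact: tm.
by rewrite subrK.
Qed.

End Types.

Section PlRange.
Variable R : realType.
Local Notation rx := (@rx R).
Local Notation ry := (@ry R).
Local Notation wsum := (@wsum R).
Local Notation wt := (@wt R).

Lemma pl_range (phi : int -> int) N (lo hi c1 c2 : int) (x : R) : 0 <= lo -> lo < hi -> hi <= N%:Z ->
  (forall t, lo <= t -> t <= hi -> c1 <= phi t /\ phi t <= c2) -> lo%:~R <= x -> x <= hi%:~R ->
  c1%:~R <= pl phi N x /\ pl phi N x <= c2%:~R.
Proof.
move=> lo0 lohi hiN H lox xhi.
have [t [s [t0 t1 [s0 s1] ex ->]]] := chain_cell phi lo0 lohi hiN lox xhi.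
have [|h1 h2] := H t t0; first by apply: le_trans t1; rewrite lerDl.
have [|h3 h4] := H (t + 1) _ t1; first by apply: le_trans t0 _; rewrite lerDl.
by split; [apply: mix_ge|apply: mix_le]; rewrite // /ry /= ler_int.
Qed.

Lemma pl_eq (phi psi : int -> int) N (lo hi : int) (x : R) : 0 <= lo -> lo < hi -> hi <= N%:Z ->
  (forall t, lo <= t -> t <= hi -> phi t = psi t) -> lo%:~R <= x -> x <= hi%:~R ->
  pl phi N x = pl psi N x.
Proof.
move=> lo0 lohi hiN H lox xhi; have [t [t0 t1 tx xt]] := unit_cell lohi lox xhi.
have t0' := le_trans lo0 t0; have t1' := le_trans t1 hiN.
rewrite (plE phi t0' t1' tx xt) (plE psi t0' t1' tx xt) !H //.
- by apply: le_trans t0 _; rewrite lerDl.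
- by apply: le_trans t1; rewrite lerDl.
Qed.

Lemma wt_ystep phi N (t : int) l : 0 <= t -> t + 1 <= N%:Z ->
  wt [:: (phi t, t); (phi (t + 1), t + 1)] l ->
  let x := wsum [:: (phi t, t); (phi (t + 1), t + 1)] l ry in
  [/\ t%:~R <= x, x <= t%:~R + 1 & wsum [:: (phi t, t); (phi (t + 1), t + 1)] l rx = pl phi N x].
Proof.
move=> t0 tN wl; have [s [s0 s1 H]] := wt2 wl; rewrite /= !H.
have ex : (1 - s) * ry (phi t, t) + s * ry (phi (t + 1), t + 1) = t%:~R + s.
  by rewrite /ry /= rmorphD /=; ring.
rewrite ex lerDl lerD2l; split=> //.
rewrite (plE phi (t := t)) ?lerDl ?lerD2l //.
by rewrite /rx /=; ring.
Qed.

Lemma wt_hori q (a b : int) l : wt [:: (a * q, b * q); ((a + 1) * q, b * q)] l -> 0 < q ->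
  [/\ wsum [:: (a * q, b * q); ((a + 1) * q, b * q)] l ry = b%:~R * q%:~R,
      a%:~R * q%:~R <= wsum [:: (a * q, b * q); ((a + 1) * q, b * q)] l rx &
      wsum [:: (a * q, b * q); ((a + 1) * q, b * q)] l rx <= (a%:~R + 1) * q%:~R].
Proof.
move=> wl q0; have [s [s0 s1 H]] := wt2 wl; rewrite !H /rx /ry /= !rmorphM /= rmorphD /=.
have q0' : 0 < q%:~R :> R by rewrite ltr0z.
have -> : (1 - s) * (a%:~R * q%:~R) + s * ((a%:~R + 1) * q%:~R) = (a%:~R + s) * q%:~R :> R by ring.
by rewrite !ler_pM2r // lerDl lerD2l; split=> //; ring.
Qed.

Lemma chain_wt (phi : int -> int) N (lo hi : int) (x : R) : 0 <= lo -> lo < hi -> hi <= N%:Z ->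
  lo%:~R <= x -> x <= hi%:~R -> exists t l, [/\ lo <= t, t + 1 <= hi,
    wt [:: (t, phi t); (t + 1, phi (t + 1))] l, wsum [:: (t, phi t); (t + 1, phi (t + 1))] l rx = x &
    wsum [:: (t, phi t); (t + 1, phi (t + 1))] l ry = pl phi N x].
Proof.
move=> lo0 lohi hiN lox xhi.
have [t [s [t0 t1 [s0 s1] ex ey]]] := chain_cell phi lo0 lohi hiN lox xhi.
have [l [wl H]] := wt_mix (t, phi t) (t + 1, phi (t + 1)) s0 s1.
by exists t, l; split=> //; rewrite H; [rewrite [RHS]ex|rewrite ey].
Qed.

Lemma chain_ywt (phi : int -> int) N (lo hi : int) (x : R) : 0 <= lo -> lo < hi -> hi <= N%:Z ->
  lo%:~R <= x -> x <= hi%:~R -> exists t l, [/\ lo <= t, t + 1 <= hi,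
    wt [:: (phi t, t); (phi (t + 1), t + 1)] l, wsum [:: (phi t, t); (phi (t + 1), t + 1)] l ry = x &
    wsum [:: (phi t, t); (phi (t + 1), t + 1)] l rx = pl phi N x].
Proof.
move=> lo0 lohi hiN lox xhi.
have [t [s [t0 t1 [s0 s1] ex ey]]] := chain_cell phi lo0 lohi hiN lox xhi.
have [l [wl H]] := wt_mix (phi t, t) (phi (t + 1), t + 1) s0 s1.
by exists t, l; split=> //; rewrite H; [rewrite [RHS]ex|rewrite ey].
Qed.

Lemma chain_yon (E : pt2 -> pt2 -> Prop) phi N (lo hi : int) (x : R) : 0 <= lo -> lo < hi -> hi <= N%:Z ->
  (forall t, lo <= t -> t + 1 <= hi -> E (phi t, t) (phi (t + 1), t + 1)) ->
  lo%:~R <= x -> x <= hi%:~R -> on E (pl phi N x) x.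
Proof.
move=> lo0 lohi hN H lox xhi; have [t [s [t0 t1 [s0 s1] e1 e2]]] := chain_cell phi lo0 lohi hN lox xhi.
by exists (phi t, t), (phi (t + 1), t + 1), s; split=> //; apply: H.
Qed.

Lemma hori_wt q a b (y : R) : 0 < q -> a%:~R * q%:~R <= y -> y <= (a%:~R + 1) * q%:~R ->
  exists l, [/\ wt [:: (a * q, b * q); ((a + 1) * q, b * q)] l,
    wsum [:: (a * q, b * q); ((a + 1) * q, b * q)] l rx = y &
    wsum [:: (a * q, b * q); ((a + 1) * q, b * q)] l ry = b%:~R * q%:~R].
Proof.
move=> q0 h1 h2; have q0' : 0 < q%:~R :> R by rewrite ltr0z.
have s0 : 0 <= y / q%:~R - a%:~R by rewrite subr_ge0 ler_pdivlMr.
have s1 : y / q%:~R - a%:~R <= 1 by rewrite lerBlDl ler_pdivrMr.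
have [l [wl H]] := wt_mix (a * q, b * q) ((a + 1) * q, b * q) s0 s1.
exists l; split=> //; rewrite H /rx /ry /= !rmorphM ?rmorphD /=; last by ring.
by transitivity (y / q%:~R * q%:~R); [ring|rewrite mulfVK // lt0r_neq0].
Qed.

End PlRange.

Section Pinwheel.
Variable R : realType.
Local Notation rx := (@rx R).
Local Notation ry := (@ry R).
Local Notation wsum := (@wsum R).
Local Notation wt := (@wt R).
Variables (q : int) (L : int -> int -> Prop) (Y X : int -> int).
Hypothesis Lq : lattice q L.
Hypothesis HY : forall t, [/\ L t (Y t), 0 <= Y t & Y t < q].
Hypothesis HX : forall t, [/\ L (X t) t, 0 <= X t & X t < q].
Variables (A B : int).
Hypotheses (A2 : 2 <= A) (B2 : 2 <= B).
Local Notation Q := (q%:~R : R).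
Local Notation a := (A%:~R * Q).
Local Notation b := (B%:~R * Q).
Local Notation NA := (absz (A * q)).
Local Notation NB := (absz (B * q)).
Local Notation l := (fun i => @pl R (Lc q Y i) NA).
Local Notation r := (fun i => @pl R (Rc q Y A i) NA).
Local Notation bt := (fun i => @pl R (Bc q X i) NB).
Local Notation tt := (fun i => @pl R (Tc q X B i) NB).

Let q0 : 0 < q. Proof. exact: lat_q Lq. Qed.
Let q1 : 1 <= q. Proof. by move: q0; clear -Lq; lia. Qed.
Let Aq : 2 * q <= A * q. Proof. exact: (mulq_le Lq). Qed.
Let Bq : 2 * q <= B * q. Proof. exact: (mulq_le Lq). Qed.
Let NEA : NA%:Z = A * q.
Proof. by rewrite gez0_abs //; move: Aq q1; clear -Lq q0 q1 Aq Bq A2 B2; lia. Qed.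
Let NEB : NB%:Z = B * q.
Proof. by rewrite gez0_abs //; move: Bq q1; clear -Lq q0 q1 Aq Bq A2 B2 NEA; lia. Qed.
Let aE : a = (A * q)%:~R :> R. Proof. by rewrite rmorphM. Qed.
Let bE : b = (B * q)%:~R :> R. Proof. by rewrite rmorphM. Qed.
Let a1E : a - 1 = (A * q - 1)%:~R :> R. Proof. by rewrite rmorphB rmorphM. Qed.
Let b1E : b - 1 = (B * q - 1)%:~R :> R. Proof. by rewrite rmorphB rmorphM. Qed.
Let q2E : 2 * Q - 1 = (2 * q - 1)%:~R :> R. Proof. by rewrite rmorphB rmorphM. Qed.

Ltac slia := clear -Lq q0 q1 Aq Bq A2 B2 NEA NEB aE bE a1E b1E q2E; lia.

Lemma chains_pin : pin q A B l r bt tt.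
Proof.
have qA : q < A * q by move: q1 Aq; slia.
have qB : q < B * q by move: q1 Bq; slia.
have A0 : 0 < A * q by move: q1 Aq; slia.
have B0 : 0 < B * q by move: q1 Bq; slia.
have A1q : 1 < A * q by move: q1 Aq; slia.
have B1q : 1 < B * q by move: q1 Bq; slia.
have A10 : 0 < A * q - 1 by move: A1q; slia.
have B10 : 0 < B * q - 1 by move: B1q; slia.
have A1l : A * q - 1 <= NA%:Z by rewrite NEA; slia.
have B1l : B * q - 1 <= NB%:Z by rewrite NEB; slia.
have Al : A * q <= NA%:Z by rewrite NEA.
have Bl : B * q <= NB%:Z by rewrite NEB.
have ql : q <= NA%:Z by rewrite NEA ltW.
have ql' : q <= NB%:Z by rewrite NEB ltW.
have q00 := ltW q0.
have mid i : 1 <= i -> i <= A - 1 -> q <= i * q /\ i * q <= A * q - q.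
  move=> h1 h2; have h3 := mulq_le Lq h1; have h4 := mulq_le Lq h2.
  by move: h3 h4; slia.
split=> //.
- by move=> i j x ij; apply: pl_le => t _ _; apply: (Lc_le Y Lq).
- by move=> i; have := @pl_int R (Lc q Y i) NA 0 isT isT; rewrite Lc0 // => ->; rewrite rmorphM.
- move=> i x i0 iB x0 xa; rewrite aE in xa; rewrite bE.
  apply: (pl_range (lo := 0) (c1 := 0) _ A0 Al) => // t _ _; exact: (Lc_bd Lq HY B2).
- move=> i j x x1 xa; rewrite aE in xa; split; last first.
    by apply: (pl_eq (lo := 1) _ A1q Al) => // t t1 _; apply: Lc_indep; apply: lt_le_trans t1.
  have [] // := @pl_range R (Lc q Y i) NA 1 (A * q) 1 q x isT A1q Al _ x1 xa.
  by move=> t t1 _; apply: (Lc1 Lq HY); apply: lt_le_trans t1.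
- move=> x x0 xa; rewrite aE in xa.
  have [] // := @pl_range R (Lc q Y 0) NA 0 (A * q) 0 q x isT A0 Al _ x0 xa.
  move=> t _ _; have [h|h] := leP t 0; first by rewrite Lc0 // mul0r.
  by have := Lc1 Lq HY 0 h; slia.
- move=> i x x0 xa; rewrite aE in xa.
  have [|h1 h2] := @pl_range R (Lc q Y i) NA q (A * q) q q x q00 qA Al _ x0 xa.
    by move=> t t1 _; rewrite (Lcq Y Lq).
  by apply/eqP; rewrite eq_le h1 h2.
- by move=> i j x ij; apply: pl_le => t _ _; apply: (Rc_le Y Lq A).
- by move=> i; rewrite aE pl_int ?(ltW A0) // (RcA Y Lq A2) // rmorphM.
- move=> i x i0 iB x0 xa; rewrite aE in xa; rewrite bE.
  apply: (pl_range (lo := 0) (c1 := 0) _ A0 Al) => // t _ _; exact: (Rc_bd Lq HY A2 B2).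
- move=> i j x x1 xa; rewrite a1E in xa; rewrite q2E.
  have [|h1 h2] := @pl_range R (Rc q Y A i) NA 0 (A * q - 1) q (2 * q - 1) x isT A10 A1l _ x1 xa.
    by move=> t _ t1; apply: (Rc1 Lq HY); move: t1; slia.
  split=> //; apply: (pl_eq (lo := 0) _ A10 A1l) => // t _ t1; apply: Rc_indep; move: t1; slia.
- move=> x x0 xa; rewrite aE in xa.
  have [] // := @pl_range R (Rc q Y A B) NA 0 (A * q) q (B * q) x isT A0 Al _ x0 xa.
  move=> t _ _; have [h|h] := leP (A * q) t; first by rewrite (RcA Y Lq A2) //; split=> //; apply: ltW.
  by have := Rc1 Lq HY B h; move: Bq; slia.
- move=> i x x0 xa.
  have [|h1 h2] := @pl_range R (Rc q Y A i) NA 0 q q q x isT q0 ql _ x0 xa.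
    by move=> t _ t1; rewrite Rc0.
  by apply/eqP; rewrite eq_le h1 h2.
- by move=> i j x ij; apply: pl_le => t _ _; apply: (Bc_le X Lq).
- by move=> i; have := @pl_int R (Bc q X i) NB 0 isT isT; rewrite Bc0 // => ->; rewrite rmorphM.
- move=> i j x x1 xa; rewrite bE in xa.
  by apply: (pl_eq (lo := 1) _ B1q Bl) => // t t1 _; apply: Bc_indep; apply: lt_le_trans t1.
- move=> i x i1 iA x0 xa; rewrite bE in xa; rewrite a1E.
  apply: (pl_range (lo := 0) _ B0 Bl) => // t _ _; have [h|h] := leP t 0.
    by rewrite Bc0 //; have := mid i i1 iA; slia.
  by have := Bc1 Lq HX i h; move: Aq; slia.
- move=> i x x0 xa; rewrite bE in xa.
  have [|h1 h2] := @pl_range R (Bc q X i) NB q (B * q) q q x q00 qB Bl _ x0 xa.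
    by move=> t t1 _; rewrite (Bcq X Lq).
  by apply/eqP; rewrite eq_le h1 h2.
- by move=> i j x ij; apply: pl_le => t _ _; apply: (Tc_le X Lq B).
- by move=> i; rewrite bE pl_int ?(ltW B0) // (TcB X Lq B2) // rmorphM.
- move=> i j x x1 xa; rewrite b1E in xa; split; last first.
    by apply: (pl_eq (lo := 0) _ B10 B1l) => // t _ t1; apply: Tc_indep; move: t1; slia.
  have [] // := @pl_range R (Tc q X B i) NB 0 (B * q - 1) 1 q x isT B10 B1l _ x1 xa.
  by move=> t _ t1; apply: (Tc1 Lq HX); move: t1; slia.
- move=> i x i1 iA x0 xa; rewrite bE in xa; rewrite aE -rmorphB.
  apply: (pl_range (lo := 0) (c1 := 1) _ B0 Bl) => // t _ _; have [h|h] := leP (B * q) t.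
    by rewrite (TcB X Lq B2) //; have := mid i i1 iA; slia.
  by have := Tc1 Lq HX i h; move: Aq; slia.
- move=> x x0 xa; rewrite bE in xa.
  have [] // := @pl_range R (Tc q X B 1) NB 0 (B * q) 1 q x isT B0 Bl _ x0 xa.
  move=> t _ _; have [h|h] := leP (B * q) t; first by rewrite (TcB X Lq B2) // mul1r.
  exact: (Tc1 Lq HX 1 h).
- move=> i x x0 xa.
  have [|h1 h2] := @pl_range R (Tc q X B i) NB 0 q q q x isT q0 ql' _ x0 xa.
    by move=> t _ t1; rewrite Tc0.
  by apply/eqP; rewrite eq_le h1 h2.
Qed.

End Pinwheel.

Section Pinwheel.
Variable R : realType.
Local Notation rx := (@rx R).
Local Notation ry := (@ry R).
Local Notation wsum := (@wsum R).
Local Notation wt := (@wt R).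
Variables (q : int) (L : int -> int -> Prop) (Y X : int -> int).
Hypothesis Lq : lattice q L.
Hypothesis HY : forall t, [/\ L t (Y t), 0 <= Y t & Y t < q].
Hypothesis HX : forall t, [/\ L (X t) t, 0 <= X t & X t < q].
Variables (A B : int) (E E' : pt2 -> pt2 -> Prop).
Hypotheses (A2 : 2 <= A) (B2 : 2 <= B).
Hypothesis SE : splane R q L Y X A B E.
Hypothesis XE' : xplane R q L Y (A - 1) (B + 1) E'.
Local Notation Q := (q%:~R : R).
Local Notation a := (A%:~R * Q).
Local Notation b := (B%:~R * Q).
Local Notation n1 := (a - Q).
Local Notation n2 := (b + Q).
Local Notation NA := (absz (A * q)).
Local Notation NB := (absz (B * q)).
Local Notation l := (fun i => @pl R (Lc q Y i) NA).
Local Notation r := (fun i => @pl R (Rc q Y A i) NA).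
Local Notation bt := (fun i => @pl R (Bc q X i) NB).
Local Notation tt := (fun i => @pl R (Tc q X B i) NB).
Local Notation srel := (@srel R q A B l r bt tt).
Let P : pin q A B l r bt tt := @chains_pin R q L Y X Lq HY HX A B A2 B2.

Let q0 : 0 < q. Proof. exact: lat_q Lq. Qed.
Let q1 : 1 <= q. Proof. by move: q0; clear -Lq; lia. Qed.
Let Q0 : 0 < Q. Proof. by rewrite ltr0z. Qed.
Let A1 : 1 <= A - 1. Proof. by move: A2; clear -Lq; lia. Qed.
Let B1 : 1 <= B + 1. Proof. by move: B2; clear -Lq; lia. Qed.
Let B0 : 0 <= B. Proof. by move: B2; clear -Lq; lia. Qed.
Let A0 : 0 <= A. Proof. by move: A2; clear -Lq; lia. Qed.
Let Aq : q < A * q.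
Proof. by rewrite -[X in X < _]mul1r ltr_pM2r //; move: A2; clear -Lq; lia. Qed.
Let Bq : q < B * q.
Proof. by rewrite -[X in X < _]mul1r ltr_pM2r //; move: B2; clear -Lq; lia. Qed.
Let NEA : NA%:Z = A * q. Proof. by rewrite gez0_abs //; apply: ltW (lt_trans q0 Aq). Qed.
Let NEB : NB%:Z = B * q. Proof. by rewrite gez0_abs //; apply: ltW (lt_trans q0 Bq). Qed.
Let aE : a = (A * q)%:~R :> R. Proof. by rewrite rmorphM. Qed.
Let bE : b = (B * q)%:~R :> R. Proof. by rewrite rmorphM. Qed.
Let qNA : q <= NA%:Z. Proof. by rewrite NEA ltW. Qed.
Let qNB : q <= NB%:Z. Proof. by rewrite NEB ltW. Qed.
Let ANA : A * q <= NA%:Z. Proof. by rewrite NEA. Qed.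
Let BNB : B * q <= NB%:Z. Proof. by rewrite NEB. Qed.
Let n1E : (A - 1)%:~R * Q = n1 :> R. Proof. by rewrite rmorphB /= mulrBl mul1r. Qed.
Let n2E : (B + 1)%:~R * Q = n2 :> R. Proof. by rewrite rmorphD /= mulrDl mul1r. Qed.

Ltac slia := clear -Lq HY HX SE XE' A2 B2 q0 q1 A1 B1 B0 A0; lia.

Definition sslab (s t : seq pt2) :=
  [/\ spx L E s, spx L E' t, (size s + size t = 4)%N,
   forall a b c d, s = [:: a; b] -> t = [:: c; d] -> basis2 L (sub2 b a) (sub2 d c) &
   forall l k, wt s l -> wt t k -> srel (wsum s l rx) (wsum s l ry) (wsum t k rx) (wsum t k ry)].

Definition shit (y1 y2 w1 w2 : R) := exists s t l k, [/\ sslab s t, wt s l, wt t k,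
  wsum s l rx = y1 /\ wsum s l ry = y2 & wsum t k rx = w1 /\ wsum t k ry = w2].

Lemma xstep_basis (phi : int -> int) t c d : L t (phi t) -> L (t + 1) (phi (t + 1)) ->
  basis2 L (sub2 (t + 1, phi (t + 1)) (t, phi t)) (sub2 (c * q, (d + 1) * q) (c * q, d * q)).
Proof.
move=> h1 h2.
have -> : sub2 (c * q, (d + 1) * q) (c * q, d * q) = (0, q) by congr pair => /=; ring.
have Lt : L (t + 1 - t) (phi (t + 1) - phi t) by apply: (lat_B Lq).
have e1 : t + 1 - t = 1 by ring.
by rewrite e1 in Lt; rewrite /sub2 /= e1; apply: (basis2_x Lq).
Qed.

Lemma ystep_basis (phi : int -> int) t c d : L (phi t) t -> L (phi (t + 1)) (t + 1) ->
  basis2 L (sub2 (phi (t + 1), t + 1) (phi t, t)) (sub2 ((c + 1) * q, d * q) (c * q, d * q)).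
Proof.
move=> h1 h2.
have -> : sub2 ((c + 1) * q, d * q) (c * q, d * q) = (q, 0) by congr pair => /=; ring.
have Lt : L (phi (t + 1) - phi t) (t + 1 - t) by apply: (lat_B Lq).
have e1 : t + 1 - t = 1 by ring.
rewrite e1 in Lt; rewrite /sub2 /= e1.
exact: (basis2_flip (basis2_x (lattice_flip Lq) Lt)).
Qed.

Lemma shit_xstep (phi : int -> int) (lo hi c i : int) (x w2 : R) : 0 <= lo -> lo < hi -> hi <= A * q ->
  (forall t, lo <= t -> t <= hi -> L t (phi t)) ->
  (forall t, lo <= t -> t + 1 <= hi -> E (t, phi t) (t + 1, phi (t + 1))) ->
  (forall x w2, lo%:~R <= x -> x <= hi%:~R -> i%:~R * Q <= w2 -> w2 <= (i%:~R + 1) * Q ->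
     srel x (pl phi NA x) (c%:~R * Q) w2) ->
  E' (c * q, i * q) (c * q, (i + 1) * q) ->
  lo%:~R <= x -> x <= hi%:~R -> i%:~R * Q <= w2 -> w2 <= (i%:~R + 1) * Q ->
  shit x (pl phi NA x) (c%:~R * Q) w2.
Proof.
move=> lo0 lohi hiA HL HE HR Ec lox xhi w1 w2'.
have hiN : hi <= NA%:Z by rewrite NEA.
have [t [k [t0 t1 wk e1 e2]]] := chain_wt phi lo0 lohi hiN lox xhi.
have [m [wm e3 e4]] := @vert_wt R q L Lq c i w2 w1 w2'.
exists [:: (t, phi t); (t + 1, phi (t + 1))], [:: (c * q, i * q); (c * q, (i + 1) * q)], k, m.
split=> //.
split=> //; [by apply: Spx2; apply: HE|exact: Spx2| |].
  move=> ? ? ? ? [<- <-] [<- <-]; apply: xstep_basis; apply: HL => //.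
  - by apply: le_trans t1; rewrite lerDl.
  - by apply: le_trans t0 _; rewrite lerDl.
move=> k' m' wk' wm'.
have t0' : 0 <= t by apply: le_trans t0.
have t1' : t + 1 <= NA%:Z by apply: le_trans hiN.
have := @wt_step R phi NA t k' t0' t1' wk'; set z := wsum _ k' rx; move=> [h1 h2 ->].
have [-> h3 h4] := wt_vert wm' q0.
apply: HR => //.
- by apply: le_trans h1; rewrite ler_int.
- by apply: le_trans h2 _; rewrite intS ler_int.
Qed.

Lemma shit_ystep (phi : int -> int) (lo hi c i : int) (x w1 : R) : 0 <= lo -> lo < hi -> hi <= B * q ->
  (forall t, lo <= t -> t <= hi -> L (phi t) t) ->
  (forall t, lo <= t -> t + 1 <= hi -> E (phi t, t) (phi (t + 1), t + 1)) ->
  (forall x w1, lo%:~R <= x -> x <= hi%:~R -> i%:~R * Q <= w1 -> w1 <= (i%:~R + 1) * Q ->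
     srel (pl phi NB x) x w1 (c%:~R * Q)) ->
  E' (i * q, c * q) ((i + 1) * q, c * q) ->
  lo%:~R <= x -> x <= hi%:~R -> i%:~R * Q <= w1 -> w1 <= (i%:~R + 1) * Q ->
  shit (pl phi NB x) x w1 (c%:~R * Q).
Proof.
move=> lo0 lohi hiA HL HE HR Ec lox xhi w1l w1h.
have hiN : hi <= NB%:Z by rewrite NEB.
have [t [k [t0 t1 wk e1 e2]]] := chain_ywt phi lo0 lohi hiN lox xhi.
have [m [wm e3 e4]] := @hori_wt R q i c w1 q0 w1l w1h.
exists [:: (phi t, t); (phi (t + 1), t + 1)], [:: (i * q, c * q); ((i + 1) * q, c * q)], k, m.
split=> //.
split=> //; [by apply: Spx2; apply: HE|exact: Spx2| |].
  move=> ? ? ? ? [<- <-] [<- <-]; apply: ystep_basis; apply: HL => //.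
  - by apply: le_trans t1; rewrite lerDl.
  - by apply: le_trans t0 _; rewrite lerDl.
move=> k' m' wk' wm'.
have t0' : 0 <= t by apply: le_trans t0.
have t1' : t + 1 <= NB%:Z by apply: le_trans hiN.
have := @wt_ystep R phi NB t k' t0' t1' wk'; set z := wsum _ k' ry; move=> [h1 h2 ->].
have [-> h3 h4] := wt_hori wm' q0.
apply: HR => //.
- by apply: le_trans h1; rewrite ler_int.
- by apply: le_trans h2 _; rewrite intS ler_int.
Qed.

Lemma hit_L1 (i : int) (x w2 : R) : 0 <= i -> i <= B -> 0 <= x -> x <= Q ->
  i%:~R * Q <= w2 -> w2 <= (i%:~R + 1) * Q -> shit x (l i x) 0 w2.
Proof.
move=> i0 iB x0 xq w1 w2'.
have := @shit_xstep (Lc q Y i) 0 q 0 i x w2 (lexx 0) q0 (ltW Aq); rewrite mul0r; apply=> //.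
- by move=> t t0 tq; apply: (Lc_L Lq HY).
- by move=> t t0 tq; apply: (sp_L SE).
- by move=> x' w' h1 h2 h3 h4; apply: (rel_L1 P).
- by have := xp_vt XE' (lexx 0) (le_trans ler01 A1) i0 (_ : i + 1 <= B + 1); rewrite mul0r; apply; rewrite lerD2r.
Qed.

Lemma hit_R1 (i : int) (x w2 : R) : 0 <= i -> i <= B -> Q <= x -> x <= a ->
  i%:~R * Q <= w2 -> w2 <= (i%:~R + 1) * Q -> shit x (r i x) n1 w2.
Proof.
move=> i0 iB x0 xq w1 w2'; rewrite aE in xq.
have := @shit_xstep (Rc q Y A i) q (A * q) (A - 1) i x w2 (ltW q0) Aq (lexx _); rewrite n1E; apply=> //.
- by move=> t t0 tq; apply: (Rc_L Lq HY).
- by move=> t t0 tq; apply: (sp_R SE).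
- by move=> x' w' h1 h2 h3 h4; apply: (rel_R1 P) => //; rewrite aE.
- by apply: (xp_vt XE'); rewrite ?lerD2r // (le_trans ler01 A1).
Qed.

Lemma hit_B1 (i : int) (y w1 : R) : 0 <= i -> i + 1 <= A - 1 -> 0 <= y -> y <= Q ->
  i%:~R * Q <= w1 -> w1 <= (i%:~R + 1) * Q -> shit (bt (i + 1) y) y w1 0.
Proof.
move=> i0 iA y0 yq w1l w1h.
have i10 : 0 <= i + 1 by apply: addr_ge0.
have iA' : i + 1 <= A by apply: le_trans iA _; rewrite gerBl.
have := @shit_ystep (Bc q X (i + 1)) 0 q 0 i y w1 (lexx 0) q0 (ltW Bq); rewrite mul0r; apply=> //.
- by move=> t t0 tq; apply: (Bc_L Lq HX).
- by move=> t t0 tq; apply: (sp_B SE).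
- by move=> x' w' h1 h2 h3 h4; apply: (rel_B1 P).
- by have := xp_hz XE' (or_introl erefl) i0 iA; rewrite mul0r.
Qed.

Lemma hit_T1 (i : int) (y w1 : R) : 0 <= i -> i + 1 <= A - 1 -> Q <= y -> y <= b ->
  i%:~R * Q <= w1 -> w1 <= (i%:~R + 1) * Q -> shit (tt (i + 1) y) y w1 n2.
Proof.
move=> i0 iA y0 yq w1l w1h; rewrite bE in yq.
have i10 : 0 <= i + 1 by apply: addr_ge0.
have iA' : i + 1 <= A by apply: le_trans iA _; rewrite gerBl.
have := @shit_ystep (Tc q X B (i + 1)) q (B * q) (B + 1) i y w1 (ltW q0) Bq (lexx _); rewrite n2E; apply=> //.
- by move=> t t0 tq; apply: (Tc_L Lq HX).
- by move=> t t0 tq; apply: (sp_T SE).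
- by move=> x' w' h1 h2 h3 h4; apply: (rel_T1 P) => //; rewrite bE.
- exact: (xp_hz XE' (or_intror erefl)).
Qed.

Lemma shit_zone (h : R -> R -> R) (x y : R) (c d : int) : 0 <= x -> x <= a -> 0 <= y -> y <= b ->
  0 <= c -> c <= A - 1 -> 0 <= d -> d <= B + 1 -> lip2 h ->
  (forall u v, 0 <= u -> u <= a -> 0 <= v -> v <= b -> h u v = 0 -> on E u v) -> 0 < h x y ->
  (forall u v, 0 <= u -> u <= a -> 0 <= v -> v <= b -> 0 <= h u v -> srel u v (c%:~R * Q) (d%:~R * Q)) ->
  shit x y (c%:~R * Q) (d%:~R * Q).
Proof.
rewrite aE bE; move=> x0 xa y0 yb c0 cA d0 dB hl hz h0 HR.
have [|s [k [Es ss wk e H]]] := zone_cover (K := fun h' => h' = h) (sp_pl SE) x0 xa y0 yb.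
  by move=> _ ->.
have [m [wm em]] := wt_unit R (mem_head (c * q, d * q) [::]).
exists s, [:: (c * q, d * q)], k, m; split=> //; last by rewrite !em /rx /ry /= !rmorphM.
have Vcd : Vbox L ((A - 1) * q) ((B + 1) * q) (c * q, d * q) by apply: grid_V.
split=> //; [by apply: Spx1; apply: (pl_refl (xp_pl XE'))|by rewrite ss|].
move=> k' m' wk' wm'; have [-> ->] := wt_sing wm'; rewrite /rx /ry /= !rmorphM.
have [r1 r2 r3 r4] := spx_range (sp_pl SE) Es wk'.
by apply: HR => //; apply: H.
Qed.

Lemma on_L i x : 0 <= i -> i <= B -> 0 <= x -> x <= Q -> on E x (l i x).
Proof. by move=> i0 iB x0 xq; apply: (chain_on (lo := 0) _ q0 qNA) => // t t0 t1; apply: (sp_L SE). Qed.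

Lemma on_R i x : 0 <= i -> i <= B -> Q <= x -> x <= a -> on E x (r i x).
Proof.
move=> i0 iB x0 xq; rewrite aE in xq.
by apply: (chain_on (lo := q) (ltW q0) Aq ANA) => // t t0 t1; apply: (sp_R SE).
Qed.

Lemma on_B i y : 0 <= i -> i <= A -> 0 <= y -> y <= Q -> on E (bt i y) y.
Proof. by move=> i0 iB x0 xq; apply: (chain_yon (lo := 0) _ q0 qNB) => // t t0 t1; apply: (sp_B SE). Qed.

Lemma on_T i y : 0 <= i -> i <= A -> Q <= y -> y <= b -> on E (tt i y) y.
Proof.
move=> i0 iB x0 xq; rewrite bE in xq.
by apply: (chain_yon (lo := q) (ltW q0) Bq BNB) => // t t0 t1; apply: (sp_T SE).
Qed.

Lemma min_eq0 (u v : R) : Num.min u v = 0 -> (u = 0 /\ 0 <= v) \/ (v = 0 /\ 0 <= u).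
Proof.
by case: (leP u v) => [uv|vu] e; [left; rewrite -{2}e|right; rewrite -{2}e ltW].
Qed.

Let Qa : Q <= a. Proof. by rewrite aE ler_int ltW. Qed.
Let Qb : Q <= b. Proof. by rewrite bE ler_int ltW. Qed.
Let Q00 : 0 <= Q. Proof. exact: ltW. Qed.
Let A00 : 0 <= A - 1. Proof. exact: le_trans A1. Qed.
Let A1' : 1 <= A. Proof. by move: A2; slia. Qed.
Let A1A : A - 1 <= A. Proof. by rewrite gerBl. Qed.
Let B00 : 0 <= B + 1. Proof. exact: le_trans B1. Qed.

Lemma hit_LL x y : 0 <= x -> x <= a -> 0 <= y -> y <= b -> y <= l 0 x -> x <= bt 1 y -> shit x y 0 0.
Proof.
move=> x0 xa y0 yb h1 h2.
have cL u v : 0 <= u -> u <= a -> v = l 0 u -> u <= bt 1 v -> u <= Q.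
  move=> u0 ua ev; have [//|h] := leP u Q; rewrite (l_q P) in ev; [|exact: ltW|done].
  by rewrite ev (bt_q P) // leNgt h.
have cB u v : 0 <= v -> v <= b -> u = bt 1 v -> v <= l 0 u -> v <= Q.
  move=> v0 vb eu; have [//|h] := leP v Q; rewrite (bt_q P) in eu; [|exact: ltW|done].
  by rewrite eu (l_q P) // leNgt h.
have [e|n1'] := eqVneq y (l 0 x).
  have xq := cL _ _ x0 xa e h2.
  by rewrite e; apply: hit_L1; rewrite ?mul0r // add0r mul1r.
have [e|n2'] := eqVneq x (bt 1 y).
  have yq := cB _ _ y0 yb e h1.
  have := @hit_B1 0 y 0 (lexx _); rewrite !add0r -e mul1r mul0r; exact.
have := @shit_zone (fun x y => Num.min (l 0 x - y) (bt 1 y - x)) x y 0 0; rewrite !mul0r; apply=> //.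
- apply: lip2_min; apply: lip2B; [exact: lip2_pl (@lip2_x R)|exact: lip2_y|exact: lip2_pl (@lip2_y R)|exact: lip2_x].
- move=> u v u0 ua v0 vb /min_eq0[[]|[]] /eqP; rewrite !subr_eq0 !subr_ge0 => /eqP e h.
    by rewrite -e; apply: on_L => //; apply: cL (esym e) h.
  by rewrite -e; apply: on_B => //; apply: cB (esym e) h.
- by rewrite lt_min !subr_gt0 !lt_neqAle n1' n2' h1.
- move=> u v u0 ua v0 vb; rewrite le_min !subr_ge0 => /andP[k1 k2]; exact: (rel_LL P).
Qed.

Lemma hit_UL x y : 0 <= x -> x <= a -> 0 <= y -> y <= b -> l B x <= y -> x <= tt 1 y -> shit x y 0 n2.
Proof.
move=> x0 xa y0 yb h1 h2.
have cL u v : 0 <= u -> u <= a -> v = l B u -> u <= tt 1 v -> u <= Q.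
  move=> u0 ua ev; have [//|h] := leP u Q; rewrite (l_q P) in ev; [|exact: ltW|done].
  by rewrite ev (tt_q P) // leNgt h.
have cB u v : 0 <= v -> v <= b -> u = tt 1 v -> l B u <= v -> Q <= v.
  move=> v0 vb eu; have [//|h] := leP Q v; rewrite (tt_q P) in eu; [|done|exact: ltW].
  by rewrite eu (l_q P) // leNgt h.
have [e|n1'] := eqVneq y (l B x).
  have xq := cL _ _ x0 xa e h2.
  by rewrite e; apply: hit_L1; rewrite // ?lerDl // mulrDl mul1r.
have [e|n2'] := eqVneq x (tt 1 y).
  have yq := cB _ _ y0 yb e h1.
  have := @hit_T1 0 y 0 (lexx _); rewrite !add0r -e mul1r mul0r; exact.
have := @shit_zone (fun x y => Num.min (y - l B x) (tt 1 y - x)) x y 0 (B + 1); rewrite !mul0r n2E; apply=> //.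
- apply: lip2_min; apply: lip2B; [exact: lip2_y|exact: lip2_pl (@lip2_x R)|exact: lip2_pl (@lip2_y R)|exact: lip2_x].
- move=> u v u0 ua v0 vb /min_eq0[[]|[]] /eqP; rewrite !subr_eq0 !subr_ge0 => /eqP e h.
    by rewrite e; apply: on_L => //; apply: cL e h.
  by rewrite -e; apply: on_T => //; apply: cB (esym e) h.
- by rewrite lt_min !subr_gt0 !lt_neqAle n2' [_ == y]eq_sym n1' h1.
- move=> u v u0 ua v0 vb; rewrite le_min !subr_ge0 => /andP[k1 k2]; exact: (rel_UL P).
Qed.

Let A2E : A - 1 - 1 + 1 = A - 1. Proof. by rewrite subrK. Qed.
Let A20 : 0 <= A - 1 - 1. Proof. by rewrite subr_ge0. Qed.
Let n1l : (A - 1 - 1)%:~R * Q <= n1.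
Proof. by rewrite -n1E ler_pM2r // ler_int gerBl. Qed.
Let n1h : n1 <= ((A - 1 - 1)%:~R + 1) * Q.
Proof. by rewrite intS A2E -n1E. Qed.

Lemma hit_LR x y : 0 <= x -> x <= a -> 0 <= y -> y <= b -> y <= r 0 x -> bt (A - 1) y <= x -> shit x y n1 0.
Proof.
move=> x0 xa y0 yb h1 h2.
have cL u v : 0 <= u -> u <= a -> v = r 0 u -> bt (A - 1) v <= u -> Q <= u.
  move=> u0 ua ev; have [//|h] := leP Q u; rewrite (r_q P) in ev; [|done|exact: ltW].
  by rewrite ev (bt_q P) // leNgt h.
have cB u v : 0 <= v -> v <= b -> u = bt (A - 1) v -> v <= r 0 u -> v <= Q.
  move=> v0 vb eu; have [//|h] := leP v Q; rewrite (bt_q P) in eu; [|exact: ltW|done].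
  by rewrite eu (r_q P) // leNgt h.
have [e|n1'] := eqVneq y (r 0 x).
  have xq := cL _ _ x0 xa e h2.
  by rewrite e; apply: hit_R1; rewrite ?mul0r // add0r mul1r.
have [e|n2'] := eqVneq x (bt (A - 1) y).
  have yq := cB _ _ y0 yb e h1.
  by have := @hit_B1 (A - 1 - 1) y n1 A20; rewrite A2E -e; apply.
have := @shit_zone (fun x y => Num.min (r 0 x - y) (x - bt (A - 1) y)) x y (A - 1) 0; rewrite !mul0r n1E; apply=> //.
- apply: lip2_min; apply: lip2B; [exact: lip2_pl (@lip2_x R)|exact: lip2_y|exact: lip2_x|exact: lip2_pl (@lip2_y R)].
- move=> u v u0 ua v0 vb /min_eq0[[]|[]] /eqP; rewrite !subr_eq0 !subr_ge0 => /eqP e h.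
    by rewrite -e; apply: on_R => //; apply: cL (esym e) h.
  by rewrite e; apply: on_B => //; apply: cB e h.
- by rewrite lt_min !subr_gt0 !lt_neqAle n1' h1 [_ == x]eq_sym n2'.
- move=> u v u0 ua v0 vb; rewrite le_min !subr_ge0 => /andP[k1 k2]; exact: (rel_LR P).
Qed.

Lemma hit_UR x y : 0 <= x -> x <= a -> 0 <= y -> y <= b -> r B x <= y -> tt (A - 1) y <= x -> shit x y n1 n2.
Proof.
move=> x0 xa y0 yb h1 h2.
have cL u v : 0 <= u -> u <= a -> v = r B u -> tt (A - 1) v <= u -> Q <= u.
  move=> u0 ua ev; have [//|h] := leP Q u; rewrite (r_q P) in ev; [|done|exact: ltW].
  by rewrite ev (tt_q P) // leNgt h.
have cB u v : 0 <= v -> v <= b -> u = tt (A - 1) v -> r B u <= v -> Q <= v.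
  move=> v0 vb eu; have [//|h] := leP Q v; rewrite (tt_q P) in eu; [|done|exact: ltW].
  by rewrite eu (r_q P) // leNgt h.
have [e|n1'] := eqVneq y (r B x).
  have xq := cL _ _ x0 xa e h2.
  by rewrite e; apply: hit_R1; rewrite // ?lerDl // mulrDl mul1r.
have [e|n2'] := eqVneq x (tt (A - 1) y).
  have yq := cB _ _ y0 yb e h1.
  by have := @hit_T1 (A - 1 - 1) y n1 A20; rewrite A2E -e; apply.
have := @shit_zone (fun x y => Num.min (y - r B x) (x - tt (A - 1) y)) x y (A - 1) (B + 1).
rewrite n2E n1E; apply=> //.
- apply: lip2_min; apply: lip2B; [exact: lip2_y|exact: lip2_pl (@lip2_x R)|exact: lip2_x|exact: lip2_pl (@lip2_y R)].
- move=> u v u0 ua v0 vb /min_eq0[[]|[]] /eqP; rewrite !subr_eq0 !subr_ge0 => /eqP e h.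
    by rewrite e; apply: on_R => //; apply: cL e h.
  by rewrite e; apply: on_T => //; apply: cB e h.
- by rewrite lt_min !subr_gt0 !lt_neqAle [_ == y]eq_sym n1' h1 [_ == x]eq_sym n2'.
- move=> u v u0 ua v0 vb; rewrite le_min !subr_ge0 => /andP[k1 k2]; exact: (rel_UR P).
Qed.

Lemma hit_L2 (i : int) (x y : R) : 1 <= i -> i <= B -> 0 <= x -> x <= Q -> 0 <= y -> y <= b ->
  l (i - 1) x <= y -> y <= l i x -> shit x y 0 (i%:~R * Q).
Proof.
move=> i1 iB x0 xq y0 yb h1 h2.
have i0 : 0 <= i by apply: le_trans i1.
have i00 : 0 <= i - 1 by rewrite subr_ge0.
have iB' : i - 1 <= B by apply: le_trans iB; rewrite gerBl.
have i1E : (i - 1)%:~R + 1 = i%:~R :> R by rewrite intS subrK.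
have [e|n1'] := eqVneq y (l (i - 1) x).
  by rewrite e; apply: hit_L1; rewrite // ?i1E // ler_pM2r // ler_int gerBl.
have [e|n2'] := eqVneq y (l i x).
  by rewrite e; apply: hit_L1; rewrite // ler_pM2r // lerDl.
have l1 : l (i - 1) 1 = l i 1.
  by have [] := l_one P (i - 1) i (lexx 1) (le_trans (_ : 1 <= Q) Qa); rewrite // -[1]/(1%:~R) ler_int.
have Q1 : 1 <= Q by rewrite -[1]/(1%:~R) ler_int.
have x1 : x < 1.
  rewrite ltNge; apply/negP => x1; case/eqP: n2'; apply/eqP; rewrite eq_le h2.
  by have [_ <-] := l_one P (i - 1) i x1 (le_trans xq Qa).
have := @shit_zone (fun x y => Num.min (Num.min (l i x - y) (y - l (i - 1) x)) (1 - x)) x y 0 i; rewrite mul0r; apply=> //.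
- by apply: le_trans xq Qa.
- by apply: le_trans iB _; rewrite lerDl.
- apply: lip2_min; [apply: lip2_min|]; apply: lip2B;
   [exact: lip2_pl (@lip2_x R)|exact: lip2_y|exact: lip2_y|exact: lip2_pl (@lip2_x R)|exact: lip2_const|exact: lip2_x].
- move=> u v u0 ua v0 vb /min_eq0[[e h]|[/eqP e h]].
    have uq : u <= Q by apply: le_trans Q1; rewrite -subr_ge0.
    move: e => /min_eq0[[]|[]] /eqP; rewrite subr_eq0 => /eqP e _; first by rewrite -e; apply: on_L.
    by rewrite e; apply: on_L.
  rewrite subr_eq0 in e; move/eqP: e => e; subst u.
  move: h; rewrite le_min !subr_ge0 l1 => /andP[k1 k2].
  have -> : v = l i 1 by apply/eqP; rewrite eq_le k1 k2.
  exact: on_L.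
- by rewrite !lt_min !subr_gt0 !lt_neqAle n2' h2 [_ == y]eq_sym n1' h1 -lt_neqAle x1.
- move=> u v u0 ua v0 vb; rewrite !le_min !subr_ge0 => /andP[/andP[k1 k2] k3]; exact: (rel_L2 P).
Qed.

Lemma hit_R2 (i : int) (x y : R) : 1 <= i -> i <= B -> Q <= x -> x <= a -> 0 <= y -> y <= b ->
  r (i - 1) x <= y -> y <= r i x -> shit x y n1 (i%:~R * Q).
Proof.
move=> i1 iB xq xa y0 yb h1 h2.
have i0 : 0 <= i by apply: le_trans i1.
have i00 : 0 <= i - 1 by rewrite subr_ge0.
have iB' : i - 1 <= B by apply: le_trans iB; rewrite gerBl.
have i1E : (i - 1)%:~R + 1 = i%:~R :> R by rewrite intS subrK.
have [e|n1'] := eqVneq y (r (i - 1) x).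
  by rewrite e; apply: hit_R1; rewrite // ?i1E // ler_pM2r // ler_int gerBl.
have [e|n2'] := eqVneq y (r i x).
  by rewrite e; apply: hit_R1; rewrite // ler_pM2r // lerDl.
have Qa1 : Q <= a - 1 := qa1 P.
have a10 : 0 <= a - 1 by apply: le_trans Qa1.
have x0 : 0 <= x by apply: le_trans xq.
have r1 : r (i - 1) (a - 1) = r i (a - 1) by have [] := r_one P (i - 1) i a10 (lexx _).
have x1 : a - 1 < x.
  rewrite ltNge; apply/negP => x1; case/eqP: n2'; apply/eqP; rewrite eq_le h2.
  by have [_ _ <-] := r_one P (i - 1) i x0 x1.
have := @shit_zone (fun x y => Num.min (Num.min (r i x - y) (y - r (i - 1) x)) (x - (a - 1))) x y (A - 1) i; rewrite n1E; apply=> //.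
- by apply: le_trans iB _; rewrite lerDl.
- apply: lip2_min; [apply: lip2_min|]; apply: lip2B;
   [exact: lip2_pl (@lip2_x R)|exact: lip2_y|exact: lip2_y|exact: lip2_pl (@lip2_x R)|exact: lip2_x|exact: lip2_const].
- move=> u v u0 ua v0 vb /min_eq0[[e h]|[/eqP e h]].
    have uq : Q <= u by apply: le_trans Qa1 _; rewrite -subr_ge0.
    move: e => /min_eq0[[]|[]] /eqP; rewrite subr_eq0 => /eqP e _; first by rewrite -e; apply: on_R.
    by rewrite e; apply: on_R.
  rewrite subr_eq0 in e; move/eqP: e => e; subst u.
  move: h; rewrite le_min !subr_ge0 r1 => /andP[k1 k2].
  have -> : v = r i (a - 1) by apply/eqP; rewrite eq_le k1 k2.
  exact: on_R.
- by rewrite !lt_min !subr_gt0 [y < _]lt_neqAle [_ < y]lt_neqAle n2' h2 [_ == y]eq_sym n1' h1 x1.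
- move=> u v u0 ua v0 vb; rewrite !le_min !subr_ge0 => /andP[/andP[k1 k2] k3]; exact: (rel_R2 P).
Qed.

Lemma hit_B2 (i : int) (x y : R) : 1 <= i -> i + 1 <= A - 1 -> 0 <= x -> x <= a -> 0 <= y -> y <= Q ->
  bt i y <= x -> x <= bt (i + 1) y -> shit x y (i%:~R * Q) 0.
Proof.
move=> i1 iA x0 xa y0 yq h1 h2.
have yb : y <= b by apply: le_trans yq Qb.
have i0 : 0 <= i by apply: le_trans i1.
have iA1 : i <= A - 1 by apply: le_trans iA; rewrite lerDl.
have iA0 : i <= A by apply: le_trans iA1 A1A.
have iA2 : i + 1 <= A by apply: le_trans iA A1A.
have i10 : 0 <= i + 1 by apply: addr_ge0.
have i00 : 0 <= i - 1 by rewrite subr_ge0.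
have i1E : (i - 1)%:~R + 1 = i%:~R :> R by rewrite intS subrK.
have [e|n1'] := eqVneq x (bt i y).
  have := @hit_B1 (i - 1) y (i%:~R * Q) i00; rewrite subrK -e i1E; apply=> //.
  by rewrite ler_pM2r // ler_int gerBl.
have [e|n2'] := eqVneq x (bt (i + 1) y).
  by have := @hit_B1 i y (i%:~R * Q) i0; rewrite -e; apply=> //; rewrite ler_pM2r // lerDl.
have Q1 : 1 <= Q by rewrite -[1]/(1%:~R) ler_int.
have l1 : bt i 1 = bt (i + 1) 1 by apply: (bt_one P) => //; apply: le_trans Q1 Qb.
have y1 : y < 1.
  rewrite ltNge; apply/negP => y1; case/eqP: n2'; apply/eqP; rewrite eq_le h2.
  by rewrite -(bt_one P i (i + 1) y1).
have := @shit_zone (fun x y => Num.min (Num.min (bt (i + 1) y - x) (x - bt i y)) (1 - y)) x y i 0; rewrite mul0r; apply=> //.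
- apply: lip2_min; [apply: lip2_min|]; apply: lip2B;
   [exact: lip2_pl (@lip2_y R)|exact: lip2_x|exact: lip2_x|exact: lip2_pl (@lip2_y R)|exact: lip2_const|exact: lip2_y].
- move=> u v u0 ua v0 vb /min_eq0[[e h]|[/eqP e h]].
    have uq : v <= Q by apply: le_trans Q1; rewrite -subr_ge0.
    move: e => /min_eq0[[]|[]] /eqP; rewrite subr_eq0 => /eqP e _; first by rewrite -e; apply: on_B.
    by rewrite e; apply: on_B.
  rewrite subr_eq0 in e; move/eqP: e => e; subst v.
  move: h; rewrite le_min !subr_ge0 -l1 => /andP[k1 k2].
  have -> : u = bt i 1 by apply/eqP; rewrite eq_le k1 k2.
  exact: on_B.
- by rewrite !lt_min !subr_gt0 [x < _]lt_neqAle [_ < x]lt_neqAle n2' h2 [_ == x]eq_sym n1' h1 y1.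
- move=> u v u0 ua v0 vb; rewrite !le_min !subr_ge0 => /andP[/andP[k1 k2] k3]; exact: (rel_B2 P).
Qed.

Lemma hit_T2 (i : int) (x y : R) : 1 <= i -> i + 1 <= A - 1 -> 0 <= x -> x <= a -> Q <= y -> y <= b ->
  tt i y <= x -> x <= tt (i + 1) y -> shit x y (i%:~R * Q) n2.
Proof.
move=> i1 iA x0 xa yq yb h1 h2.
have y0 : 0 <= y by apply: le_trans yq.
have i0 : 0 <= i by apply: le_trans i1.
have iA1 : i <= A - 1 by apply: le_trans iA; rewrite lerDl.
have iA0 : i <= A by apply: le_trans iA1 A1A.
have iA2 : i + 1 <= A by apply: le_trans iA A1A.
have i10 : 0 <= i + 1 by apply: addr_ge0.
have i00 : 0 <= i - 1 by rewrite subr_ge0.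
have i1E : (i - 1)%:~R + 1 = i%:~R :> R by rewrite intS subrK.
have [e|n1'] := eqVneq x (tt i y).
  have := @hit_T1 (i - 1) y (i%:~R * Q) i00; rewrite subrK -e i1E; apply=> //.
  by rewrite ler_pM2r // ler_int gerBl.
have [e|n2'] := eqVneq x (tt (i + 1) y).
  by have := @hit_T1 i y (i%:~R * Q) i0; rewrite -e; apply=> //; rewrite ler_pM2r // lerDl.
have Qb1 : Q <= b - 1 := qb1 P.
have b10 : 0 <= b - 1 by apply: le_trans Qb1.
have l1 : tt i (b - 1) = tt (i + 1) (b - 1) by have [] := tt_one P i (i + 1) b10 (lexx _).
have y1 : b - 1 < y.
  rewrite ltNge; apply/negP => y1; case/eqP: n2'; apply/eqP; rewrite eq_le h2.
  by have [_ <-] := tt_one P i (i + 1) y0 y1.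
have := @shit_zone (fun x y => Num.min (Num.min (tt (i + 1) y - x) (x - tt i y)) (y - (b - 1))) x y i (B + 1); rewrite n2E; apply=> //.
- apply: lip2_min; [apply: lip2_min|]; apply: lip2B;
   [exact: lip2_pl (@lip2_y R)|exact: lip2_x|exact: lip2_x|exact: lip2_pl (@lip2_y R)|exact: lip2_y|exact: lip2_const].
- move=> u v u0 ua v0 vb /min_eq0[[e h]|[/eqP e h]].
    have uq : Q <= v by apply: le_trans Qb1 _; rewrite -subr_ge0.
    move: e => /min_eq0[[]|[]] /eqP; rewrite subr_eq0 => /eqP e _; first by rewrite -e; apply: on_T.
    by rewrite e; apply: on_T.
  rewrite subr_eq0 in e; move/eqP: e => e; subst v.
  move: h; rewrite le_min !subr_ge0 -l1 => /andP[k1 k2].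
  have -> : u = tt i (b - 1) by apply/eqP; rewrite eq_le k1 k2.
  exact: on_T.
- by rewrite !lt_min !subr_gt0 [x < _]lt_neqAle [_ < x]lt_neqAle n2' h2 [_ == x]eq_sym n1' h1 y1.
- move=> u v u0 ua v0 vb; rewrite !le_min !subr_ge0 => /andP[/andP[k1 k2] k3]; exact: (rel_T2 P).
Qed.

Lemma hit_C w1 w2 : 0 <= w1 -> w1 <= n1 -> 0 <= w2 -> w2 <= n2 -> shit Q Q w1 w2.
Proof.
rewrite -n1E -n2E -!rmorphM /= => h1 h2 h3 h4.
have [c1 [c2 [c3 [T it]]]] := pl_cov (xp_pl XE') h1 h2 h3 h4.
have [k [wk e1 e2]] := in_tri_wt it.
have [m [wm em]] := wt_unit R (mem_head (q, q) [::]).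
exists [:: (q, q)], [:: c1; c2; c3], m, k; split=> //.
have Vq : Vbox L (A * q) (B * q) (q, q).
  by have := grid_V Lq ler01 A1' ler01 (_ : 1 <= B); rewrite !mul1r; apply; move: B2; slia.
split=> //; [by apply: Spx1; apply: (pl_refl (sp_pl SE))|exact: Spx3|].
move=> k' m' wk' wm'; have [-> ->] := wt_sing wk'.
have [] := spx_range (xp_pl XE') (Spx3 T) wm'; rewrite !rmorphM /= n1E n2E.
exact: (rel_C P).
Qed.

Let nA : exists n : nat, n%:Z = A - 1.
Proof. by exists (absz (A - 1)); rewrite gez0_abs. Qed.
Let nB : exists n : nat, n%:Z = B + 1.
Proof. by exists (absz (B + 1)); rewrite gez0_abs. Qed.

Lemma cover_bottom (u v x y2 : R) : 0 <= u -> 0 <= v -> 0 <= y2 -> y2 <= Q -> 0 <= x -> x <= v * a + u * n1 ->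
  (forall y1, v * y1 = x -> 0 <= y1 -> y1 <= bt 1 y2 -> y2 <= l 0 y1) ->
  (forall y1, v * y1 + u * n1 = x -> 0 <= y1 -> bt (A - 1) y2 <= y1 -> y2 <= r 0 y1) ->
  exists y1 w1, shit y1 y2 w1 0 /\ v * y1 + u * w1 = x.
Proof.
move=> u0 v0 y0 yq x0 xa H1 H2; have yb : y2 <= b by apply: le_trans yq Qb.
have [n en] := nA; have nR : n%:R * Q = n1 :> R by rewrite -n1E -en.
have a0 : 0 <= a by apply: le_trans Qa.
have [] := @stair_cover R q n (fun i => bt (i + 1) y2) v u x a q0 v0 u0 a0 _ _ x0.
- move=> i i0 iA; rewrite en in iA.
  have iA' : i + 1 <= A - 1 by rewrite lezD1.
  have i1 : 1 <= i + 1 by rewrite lerDr.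
  have [h1 h2] := bt_mid P i1 iA' y0 yb.
  by split; [apply: le_trans h1|apply: le_trans h2 _; rewrite gerBl].
- by move=> i j _ ij _; apply: (bt_mono P); rewrite lerD2r.
- by rewrite nR.
move=> y1 [w1 [y10 y1a e cs]]; exists y1, w1; split=> //.
case: cs => [[j [j0 jn ew h1 h2]]|[j [j0 jn ey h1 h2]]]; rewrite en in jn.
  rewrite en in h2.
  have [ej|nj] := eqVneq j 0.
    move: ew h2; rewrite ej mul0r add0r => ew h2; rewrite ew; have {}h2 := h2 (lt_le_trans ltr01 A1).
    by apply: hit_LL => //; apply: H1 => //; rewrite -e ew mulr0 addr0.
  have jp : 0 < j by rewrite lt_neqAle eq_sym nj.
  have {}h1 := h1 jp; rewrite subrK in h1.
  have [ej|nj'] := eqVneq j (A - 1).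
    move: ew h1; rewrite ej n1E => ew h1; rewrite ew.
    by apply: hit_LR => //; apply: H2 => //; rewrite -e ew.
  have jl : j < A - 1 by rewrite lt_neqAle nj'.
  by rewrite ew; apply: hit_B2 => //; [rewrite lezD1|apply: h2].
by rewrite ey; apply: hit_B1 => //; rewrite lezD1.
Qed.

Lemma cover_top (u v x y2 : R) : 0 <= u -> 0 <= v -> Q <= y2 -> y2 <= b -> 0 <= x -> x <= v * a + u * n1 ->
  (forall y1, v * y1 = x -> 0 <= y1 -> y1 <= tt 1 y2 -> l B y1 <= y2) ->
  (forall y1, v * y1 + u * n1 = x -> 0 <= y1 -> tt (A - 1) y2 <= y1 -> r B y1 <= y2) ->
  exists y1 w1, shit y1 y2 w1 n2 /\ v * y1 + u * w1 = x.
Proof.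
move=> u0 v0 yq yb x0 xa H1 H2; have y0 : 0 <= y2 by apply: le_trans yq.
have [n en] := nA; have nR : n%:R * Q = n1 :> R by rewrite -n1E -en.
have a0 : 0 <= a by apply: le_trans Qa.
have [] := @stair_cover R q n (fun i => tt (i + 1) y2) v u x a q0 v0 u0 a0 _ _ x0.
- move=> i i0 iA; rewrite en in iA.
  have iA' : i + 1 <= A - 1 by rewrite lezD1.
  have i1 : 1 <= i + 1 by rewrite lerDr.
  have [h1 h2] := tt_mid P i1 iA' y0 yb.
  by split; [apply: le_trans h1|apply: le_trans h2 _; rewrite gerBl].
- by move=> i j _ ij _; apply: (tt_mono P); rewrite lerD2r.
- by rewrite nR.
move=> y1 [w1 [y10 y1a e cs]]; exists y1, w1; split=> //.
case: cs => [[j [j0 jn ew h1 h2]]|[j [j0 jn ey h1 h2]]]; rewrite en in jn.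
  rewrite en in h2.
  have [ej|nj] := eqVneq j 0.
    move: ew h2; rewrite ej mul0r add0r => ew h2; rewrite ew; have {}h2 := h2 (lt_le_trans ltr01 A1).
    by apply: hit_UL => //; apply: H1 => //; rewrite -e ew mulr0 addr0.
  have jp : 0 < j by rewrite lt_neqAle eq_sym nj.
  have {}h1 := h1 jp; rewrite subrK in h1.
  have [ej|nj'] := eqVneq j (A - 1).
    move: ew h1; rewrite ej n1E => ew h1; rewrite ew.
    by apply: hit_UR => //; apply: H2 => //; rewrite -e ew.
  have jl : j < A - 1 by rewrite lt_neqAle nj'.
  by rewrite ew; apply: hit_T2 => //; [rewrite lezD1|apply: h2].
by rewrite ey; apply: hit_T1 => //; rewrite lezD1.
Qed.

Lemma cover_left (u v y y1 : R) : 0 <= u -> 0 <= v -> 0 <= y1 -> y1 <= Q -> 0 <= y -> y <= v * b + u * n2 ->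
  exists y2 w2, [/\ v * y2 + u * w2 = y, 0 <= y2, y2 <= b &
   shit y1 y2 0 w2 \/ [/\ w2 = n2, l B y1 <= y2 & tt 1 y2 < y1]].
Proof.
move=> u0 v0 x0 xq y0 yb; have xa : y1 <= a by apply: le_trans xq Qa.
have [n en] := nB; have nR : n%:R * Q = n2 :> R by rewrite -n2E -en.
have b0 : 0 <= b by apply: le_trans Qb.
have [] := @stair_cover R q n (l^~ y1) v u y b q0 v0 u0 b0 _ _ y0.
- by move=> i i0 iA; rewrite en in iA; apply: (l_range P) => //; rewrite -(ltzD1 _ B).
- by move=> i j _ ij _; apply: (l_mono P).
- by rewrite nR.
move=> y2 [w2 [y20 y2b e cs]]; exists y2, w2; split=> //.
case: cs => [[j [j0 jn ew h1 h2]]|[j [j0 jn ey h1 h2]]]; rewrite en in jn.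
  rewrite en in h2.
  have [ej|nj] := eqVneq j 0.
    move: ew h2; rewrite ej mul0r => ew h2; rewrite ew; have {}h2 := h2 (lt_le_trans ltr01 B1).
    left; apply: hit_LL => //; apply: le_trans xq _.
    by have [] := bt_mid P (lexx 1) A1 y20 y2b.
  have jp : 0 < j by rewrite lt_neqAle eq_sym nj.
  have {}h1 := h1 jp.
  have [ej|nj'] := eqVneq j (B + 1).
    move: ew h1; rewrite ej n2E addrK => ew h1; rewrite ew.
    by have [h|h] := leP y1 (tt 1 y2); [left; apply: hit_UL|right].
  have jl : j < B + 1 by rewrite lt_neqAle nj'.
  by rewrite ew; left; apply: hit_L2 => //; [rewrite -ltzD1|apply: h2].
by rewrite ey; left; apply: hit_L1 => //; rewrite -ltzD1.
Qed.

Lemma cover_right (u v y y1 : R) : 0 <= u -> 0 <= v -> Q <= y1 -> y1 <= a -> 0 <= y -> y <= v * b + u * n2 ->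
  exists y2 w2, [/\ v * y2 + u * w2 = y, 0 <= y2, y2 <= b &
   [\/ shit y1 y2 n1 w2, [/\ w2 = n2, r B y1 <= y2 & y1 < tt (A - 1) y2] |
      [/\ w2 = 0, y2 <= r 0 y1 & y1 < bt (A - 1) y2]]].
Proof.
move=> u0 v0 xq xa y0 yb; have x0 : 0 <= y1 by apply: le_trans xq.
have [n en] := nB; have nR : n%:R * Q = n2 :> R by rewrite -n2E -en.
have b0 : 0 <= b by apply: le_trans Qb.
have [] := @stair_cover R q n (r^~ y1) v u y b q0 v0 u0 b0 _ _ y0.
- by move=> i i0 iA; rewrite en in iA; apply: (r_range P) => //; rewrite -(ltzD1 _ B).
- by move=> i j _ ij _; apply: (r_mono P).
- by rewrite nR.
move=> y2 [w2 [y20 y2b e cs]]; exists y2, w2; split=> //.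
case: cs => [[j [j0 jn ew h1 h2]]|[j [j0 jn ey h1 h2]]]; rewrite en in jn.
  rewrite en in h2.
  have [ej|nj] := eqVneq j 0.
    move: ew h2; rewrite ej mul0r => ew h2; rewrite ew; have {}h2 := h2 (lt_le_trans ltr01 B1).
    by have [h|h] := leP (bt (A - 1) y2) y1; [constructor 1; apply: hit_LR|constructor 3].
  have jp : 0 < j by rewrite lt_neqAle eq_sym nj.
  have {}h1 := h1 jp.
  have [ej|nj'] := eqVneq j (B + 1).
    move: ew h1; rewrite ej n2E addrK => ew h1; rewrite ew.
    by have [h|h] := leP (tt (A - 1) y2) y1; [constructor 1; apply: hit_UR|constructor 2].
  have jl : j < B + 1 by rewrite lt_neqAle nj'.
  by rewrite ew; constructor 1; apply: hit_R2 => //; [rewrite -ltzD1|apply: h2].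
by rewrite ey; constructor 1; apply: hit_R1 => //; rewrite -ltzD1.
Qed.

Lemma sslab_cov (u x y : R) : 0 <= u -> u < 1 -> 0 <= x -> x <= (A%:~R - u) * Q ->
  0 <= y -> y <= (B%:~R + u) * Q ->
  exists y1 y2 w1 w2, [/\ shit y1 y2 w1 w2, x = (1 - u) * y1 + u * w1 & y = (1 - u) * y2 + u * w2].
Proof.
move=> u0 u1 x0 xA y0 yB; have v0 : 0 < 1 - u by rewrite subr_gt0.
have xa : x <= (1 - u) * a + u * n1 by apply: le_trans xA _; rewrite le_eqVlt; apply/orP; left; apply/eqP; ring.
have yb : y <= (1 - u) * b + u * n2 by apply: le_trans yB _; rewrite le_eqVlt; apply/orP; left; apply/eqP; ring.
have [v ev] : exists v, v = 1 - u by exists (1 - u).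
rewrite -!ev in v0 xa yb *; have v0' := ltW v0.
have uv : v + u = 1 by rewrite ev subrK.
have vcan z : v * (z / v) = z by rewrite mulrC mulfVK // lt0r_neq0.
have vinj y1 y2 : v * y1 = v * y2 -> y1 = y2 by apply: mulfI; rewrite lt0r_neq0.
have un1 : 0 <= u * n1 by apply: mulr_ge0 => //; apply: ltW (n1_gt0 P).
have un2 : 0 <= u * n2 by apply: mulr_ge0 => //; apply: ltW (n2_gt0 P).
have [xl|xl] := ltP x (v * Q).
  pose y1 := x / v; have e1 : v * y1 = x by apply: vcan.
  have y10 : 0 <= y1 by apply: divr_ge0.
  have y1q : y1 < Q by rewrite -(ltr_pM2l v0) e1.
  have [y2 [w2 [e2 y20 y2b [h|[ew h1 h2]]]]] := cover_left u0 v0' y10 (ltW y1q) y0 yb.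
    by exists y1, y2, 0, w2; rewrite e1 e2 mulr0 addr0.
  have yq : Q <= y2.
    rewrite leNgt; apply/negP => h; move: h2; rewrite (tt_q P) //; last exact: ltW.
    by rewrite ltNge (ltW y1q).
  have [||y1' [w1 [h e]]] := cover_top u0 v0' yq y2b x0 xa.
  - move=> z ez z0 zt; have zy : z = y1 by apply: vinj; rewrite ez e1.
    by move: h2; rewrite -zy ltNge zt.
  - move=> z ez z0 zt; have zy : z <= Q.
      by apply: le_trans (ltW y1q); rewrite -(ler_pM2l v0) e1 -ez lerDl.
    by rewrite (r_q P).
  by exists y1', y2, w1, n2; rewrite -e2 ew e.
have [xr|xr] := ltP (v * Q + u * n1) x.
  pose y1 := (x - u * n1) / v; have e1 : v * y1 + u * n1 = x by rewrite vcan subrK.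
  have y1q : Q < y1 by rewrite -(ltr_pM2l v0) -(ltrD2r (u * n1)) e1.
  have y1a : y1 <= a by rewrite -(ler_pM2l v0) -(lerD2r (u * n1)) e1.
  have y10 : 0 <= y1 by apply: le_trans (ltW y1q).
  have ge z : v * z = x -> y1 <= z by move=> ez; rewrite -(ler_pM2l v0) ez -e1 lerDl.
  have eq z : v * z + u * n1 = x -> z = y1 by rewrite -e1 => /addIr/vinj.
  have [y2 [w2 [e2 y20 y2b [h|[ew h1 h2]|[ew h1 h2]]]]] := cover_right u0 v0' (ltW y1q) y1a y0 yb.
  - by exists y1, y2, n1, w2; rewrite e1 e2.
  - have yq : Q <= y2 by apply: le_trans h1; apply: (r_high P).
    have [||y1' [w1 [h e]]] := cover_top u0 v0' yq y2b x0 xa.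
    + move=> z /ge zy z0 zt; exfalso.
      by have := lt_le_trans y1q (le_trans zy (le_trans zt (tt_low P y20 y2b))); rewrite ltxx.
    + by move=> z /eq -> _ h; move: h2; rewrite ltNge h.
    by exists y1', y2, w1, n2; rewrite -e2 ew e.
  have yq : y2 <= Q.
    rewrite leNgt; apply/negP => h; move: h2; rewrite (bt_q P) //; last exact: ltW.
    by rewrite ltNge (ltW y1q).
  have [||y1' [w1 [h e]]] := cover_bottom u0 v0' y20 yq x0 xa.
  - move=> z /ge zy z0 zt; rewrite (l_q P) //; first exact: ltW (lt_le_trans y1q zy).
    apply: le_trans zt _; have [_ h] := bt_mid P (lexx 1) A1 y20 y2b.
    by apply: le_trans h _; rewrite gerBl.
  - by move=> z /eq -> _ h; move: h2; rewrite ltNge h.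
  by exists y1', y2, w1, 0; rewrite -e2 ew e.
have le z : v * z + u * n1 = x -> z <= Q by move=> ez; rewrite -(ler_pM2l v0) -(lerD2r (u * n1)) ez.
have ge z : v * z = x -> Q <= z by move=> ez; rewrite -(ler_pM2l v0) ez.
have [yl|yl] := ltP y (v * Q).
  pose y2 := y / v; have e2 : v * y2 = y by apply: vcan.
  have y20 : 0 <= y2 by apply: divr_ge0.
  have yq : y2 <= Q by apply: ltW; rewrite -(ltr_pM2l v0) e2.
  have y2b := le_trans yq Qb.
  have [||y1' [w1 [h e]]] := cover_bottom u0 v0' y20 yq x0 xa.
  - move=> z /ge zy z0 zt; rewrite (l_q P) //.
    apply: le_trans zt _; have [_ h] := bt_mid P (lexx 1) A1 y20 y2b.
    by apply: le_trans h _; rewrite gerBl.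
  - by move=> z /le zy z0 zt; rewrite (r_q P).
  by exists y1', y2, w1, 0; rewrite e e2 mulr0 addr0.
have [yr|yr] := ltP (v * Q + u * n2) y.
  pose y2 := (y - u * n2) / v; have e2 : v * y2 + u * n2 = y by rewrite vcan subrK.
  have yq : Q <= y2 by apply: ltW; rewrite -(ltr_pM2l v0) -(ltrD2r (u * n2)) e2.
  have y2b : y2 <= b by rewrite -(ler_pM2l v0) -(lerD2r (u * n2)) e2.
  have [||y1' [w1 [h e]]] := cover_top u0 v0' yq y2b x0 xa.
  - move=> z /ge zy z0 zt; rewrite (l_q P) //.
    by apply: le_trans zt _; apply: le_trans (tt_low P (le_trans Q00 yq) y2b) Qa.
  - by move=> z /le zy z0 zt; rewrite (r_q P).
  by exists y1', y2, w1, n2; rewrite e e2.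
have [eu|nu] := eqVneq u 0.

  exists Q, Q, 0, 0; split.
  - by apply: hit_C; rewrite // ltW // ?(n1_gt0 P) ?(n2_gt0 P).
  - by apply/eqP; rewrite eq_le mulr0 addr0 xl; move: xr; rewrite eu mul0r addr0 => ->.
  - by apply/eqP; rewrite eq_le mulr0 addr0 yl; move: yr; rewrite eu mul0r addr0 => ->.
have up : 0 < u by rewrite lt_neqAle eq_sym nu.
have ucan z : u * (z / u) = z by rewrite mulrC mulfVK.
exists Q, Q, ((x - v * Q) / u), ((y - v * Q) / u); split.
- apply: hit_C.
  + by apply: divr_ge0 => //; rewrite subr_ge0.
  + by rewrite ler_pdivrMr // [_ * u]mulrC lerBlDl.
  + by apply: divr_ge0 => //; rewrite subr_ge0.
  + by rewrite ler_pdivrMr // [_ * u]mulrC lerBlDl.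
- by rewrite ucan addrC subrK.
- by rewrite ucan addrC subrK.
Qed.

Lemma sslab_vertex s t v w : sslab s t -> v \in s -> w \in t -> srel (rx v) (ry v) (rx w) (ry w).
Proof.
move=> [_ _ _ _ H] vs wt'; have [k [wk ek]] := wt_unit R vs; have [m [wm em]] := wt_unit R wt'.
by have := H k m wk wm; rewrite !ek !em.
Qed.

Lemma sslab_slab : slab R q L A B E E' sslab.
Proof.
have low s t v : sslab s t -> v \in s -> Vbox L (A * q) (B * q) v.
  by move=> [Es _ _ _ _] vs; have [] := pl_V (sp_pl SE) (spx_edge (sp_pl SE) Es vs vs).
have high s t w : sslab s t -> w \in t -> Vbox L ((A - 1) * q) ((B + 1) * q) w.
  by move=> [_ Et _ _ _] vs; have [] := pl_V (xp_pl XE') (spx_edge (xp_pl XE') Et vs vs).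
split.
- by move=> s t [].
- by move=> s t [].
- by move=> s t [].
- by move=> s t v M vs; have [h1 h2 h3 h4 h5] := low _ _ _ M vs.
- by move=> s t w M wt'; have [h1 h2 h3 h4 h5] := high _ _ _ M wt'.
- by move=> c1 c2 d1 d2 [_ _ _ H _]; apply: H.
- move=> s t s' t' k m k' m' u [_ _ _ _ H] [_ _ _ _ H'] wk wm wk' wm' u0 u1.
  exact: (srel_uniq P u0 u1 (H _ _ wk wm) (H' _ _ wk' wm')).
- move=> x y u u0 u1 x0 xA y0 yB.
  have [y1 [y2 [w1 [w2 [[s [t [k [m [M wk wm [<- <-] [<- <-]]]]]] ex ey]]]]] := sslab_cov u0 u1 x0 xA y0 yB.
  by exists s, t, k, m.
- by move=> eA; exfalso; move: A2; rewrite eA.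
move=> s t v w M vs wt'.
have [Lv v1 v2 v3 v4] := low _ _ _ M vs; have [Lw w1 w2 w3 w4] := high _ _ _ M wt'.
have S := sslab_vertex M vs wt'.
have col a' i : v.1 = a' * q -> w.1 = i * q ->
    stair q (B + 1) (fun b => b%:~R * Q) (ry v) (ry w) -> w.2 = v.2 \/ w.2 = v.2 + q.
  move=> ev ew st; rewrite ev in Lv; rewrite ew in Lw.
  have [j ej] := lat_ymult Lq Lv; have [k ek] := lat_ymult Lq Lw.
  move: st => /(stair_swap q0); rewrite /ry ej ek !rmorphM /=.
  have j0 : 0 <= j by rewrite -(pmulr_lge0 _ q0) -ej.
  have jB : j <= B by rewrite -(ler_pM2r q0) -ej.
  have k0 : 0 <= k by rewrite -(pmulr_lge0 _ q0) -ek.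
  have kB : k <= B + 1 by rewrite -(ler_pM2r q0) -ek.
  have h1 : 0 <= j%:~R * Q by apply: mulr_ge0; rewrite // ler0z.
  have h2 : j%:~R * Q <= b by rewrite ler_pM2r // ler_int.
  move=> /(_ h1 h2)/(stair_grid q0 k0 kB)[->|->]; [by left|right].
  by rewrite mulrDl mul1r.
have row b' d : v.2 = b' * q -> w.2 = d * q ->
    stair q (A - 1) (fun b => (b%:~R + 1) * Q) (rx v) (rx w) -> w.1 = v.1 \/ w.1 = v.1 - q.
  move=> ev ew st; rewrite ev in Lv; rewrite ew in Lw.
  have [j ej] := lat_xmult Lq Lv; have [k ek] := lat_xmult Lq Lw.
  move: st; rewrite /rx ej ek !rmorphM /=.
  have j0 : 0 <= j by rewrite -(pmulr_lge0 _ q0) -ej.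
  have jA : j <= A - 1 + 1 by rewrite subrK -(ler_pM2r q0) -ej.
  move=> /(stair_grid q0 j0 jA)[->|->]; [by left|right].
  by rewrite mulrDl mul1r addrK.
split=> e1 e2.
- apply: (col 0 0); rewrite ?mul0r //.
  have := s_ql S; rewrite /rx e1 e2 => /(_ erefl); apply: stair_ext => i _ _; exact: (l_zero P).
- apply: (row 0 0); rewrite ?mul0r //.
  have := s_qb S; rewrite /ry e1 e2 => /(_ erefl); apply: stair_ext => i _ _.
  by rewrite (bt_zero P) -intS.
- apply: (col A (A - 1)) => //.
  have := s_qr S; rewrite /rx e1 e2 !rmorphM n1E => /(_ erefl); apply: stair_ext => i _ _; exact: (r_a P).
- apply: (row B (B + 1)) => //.
  have := s_qt S; rewrite /ry e1 e2 !rmorphM n2E => /(_ erefl); apply: stair_ext => i _ _.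
  by rewrite (tt_b P) -intS.
Qed.

End Pinwheel.

Theorem splane_half (R : realType) q L Y X A B E : lattice q L ->
  (forall t, [/\ L t (Y t), 0 <= Y t & Y t < q]) -> (forall t, [/\ L (X t) t, 0 <= X t & X t < q]) ->
  2 <= A -> 2 <= B -> splane R q L Y X A B E -> exists P, half R q L A B E P.
Proof.
move=> Lq HY HX A2 B2 SE.
have A1 : 1 <= A - 1 by move: A2; clear; lia.
have B1 : 1 <= B + 1 by move: B2; clear; lia.
have [E' XE'] := xplane_exists R Lq HY A1 B1.
have [P HP] := xplane_half Lq HY (le_trans ler01 A1) B1 (fun _ => XE').
exists (stack (@sslab R q L Y X A B E E') P).
have A1' : 1 <= A by move: A2; clear; lia.
exact: (half_glue Lq A1' (sp_pl SE) (xp_pl XE') (sslab_slab Lq HY HX A2 B2 SE XE') HP).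
Qed.

Definition rotL (L : int -> int -> Prop) (x y : int) := L y (- x).

Lemma lattice_rot q L : lattice q L -> lattice q (rotL L).
Proof.
move=> Lq; have L0 : L 0 0 by have := lat_B Lq (lat_x Lq) (lat_x Lq); rewrite !subrr.
have LN u v : L u v -> L (- u) (- v) by move=> h; have := lat_B Lq L0 h; rewrite !sub0r.
rewrite /rotL; split.
- exact: lat_q Lq.
- move=> a b c d h1 h2; have := lat_B Lq h1 h2.
  by rewrite (_ : - (a - c) = - a - - c) //; ring.
- by have := LN _ _ (lat_y Lq); rewrite oppr0.
- by rewrite oppr0; apply: (lat_x Lq).
- move=> a /LN; rewrite oppr0 opprK; exact: lat_y0 Lq _.
- move=> b; rewrite oppr0; exact: lat_x0 Lq _.
- by move=> a; apply: (lat_exx Lq).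
- by move=> b; have [c h] := lat_exy Lq b; exists (- c); rewrite opprK.
Qed.

(* The inverse of the quarter turn (x, y) |-> (n - y, x) of [0, m] x [0, n]. *)
Definition unrot (n : int) (v : pt2) : pt2 := (v.2, n - v.1).

(** * Joining the two halves *)

Section Rot.
Variable R : realType.
Local Notation rx := (@rx R).
Local Notation ry := (@ry R).
Local Notation wsum := (@wsum R).
Local Notation wt := (@wt R).
Variables (L : int -> int -> Prop) (m n : int) (E : pt2 -> pt2 -> Prop).

Definition rotE (a b : pt2) := E (unrot n a) (unrot n b).

Lemma basis2_unrot a b c : basis2 (rotL L) (sub2 b a) (sub2 c a) ->
  basis2 L (sub2 (unrot n b) (unrot n a)) (sub2 (unrot n c) (unrot n a)).
Proof.
have e u : sub2 (unrot n u) (unrot n a) = ((sub2 u a).2, - (sub2 u a).1).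
  by rewrite /sub2 /unrot /=; congr pair; ring.
rewrite !e; move: (sub2 b a) (sub2 c a) => u v [D0 H]; split=> /=.
  by rewrite (_ : _ - _ = u.1 * v.2 - u.2 * v.1) //; ring.
move=> x y Lxy; have [|i [j [e1 e2]]] := H (- y) x; first by rewrite /rotL opprK.
exists i, j; split=> //; rewrite -[LHS]opprK e1; ring.
Qed.

Lemma basis2_rot a b c : basis2 L (sub2 (unrot n b) (unrot n a)) (sub2 (unrot n c) (unrot n a)) ->
  basis2 (rotL L) (sub2 b a) (sub2 c a).
Proof.
have e u : sub2 (unrot n u) (unrot n a) = ((sub2 u a).2, - (sub2 u a).1).
  by rewrite /sub2 /unrot /=; congr pair; ring.
rewrite !e; move: (sub2 b a) (sub2 c a) => u v [/= D0 H]; split=> /=.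
  by move: D0; rewrite (_ : _ - _ = u.1 * v.2 - u.2 * v.1) //; ring.
move=> x y Lxy; have [i [j [e1 e2]]] := H y (- x) Lxy.
exists i, j; split=> //; rewrite -[LHS]opprK e2; ring.
Qed.

Lemma spx_unrot s : spx (rotL L) rotE s -> spx L E (map (unrot n) s).
Proof.
case=> [a Ea|a b Eab|a b c [Eab Ebc Eac bas]] /=; constructor => //.
by split=> //; apply: basis2_unrot.
Qed.

Lemma wsum_unrot s l : wt s l -> wsum (map (unrot n) s) l rx = wsum s l ry /\
  wsum (map (unrot n) s) l ry = n%:~R - wsum s l rx.
Proof.
move=> [_ _ e]; rewrite !wsum_map; split=> //.
rewrite (wsum_ext _ _ (h := fun v => n%:~R + -1 * rx v)); last first.
  by move=> v; rewrite /ry /rx /unrot /= rmorphB mulN1r.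
rewrite wsumD wsum_const e mulr1; congr (_ + _).
by rewrite /wsum -sumrN; apply: eq_bigr => i _; rewrite mulN1r mulrN.
Qed.

Hypothesis Ln : forall x y, L x (n + y) <-> L x y.
Hypothesis PL : plane R L m n E.

Definition rot (v : pt2) : pt2 := (n - v.2, v.1).

Lemma rotK : cancel rot (unrot n).
Proof. by case=> x y; rewrite /rot /unrot /= subKr. Qed.

Lemma plane_rot : plane R (rotL L) n m rotE.
Proof.
have VV v : Vbox L m n (unrot n v) -> Vbox (rotL L) n m v.
  move=> [/= /Ln h1 h2 h3 h4 h5]; split=> //.
  - by rewrite -oppr_le0 -(lerD2l n) addr0.
  - by rewrite -subr_ge0.
have VV' v : Vbox (rotL L) n m v -> Vbox L m n (unrot n v).
  move=> [h1 h2 h3 h4 h5]; split=> //=; first exact/Ln.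
  - by rewrite subr_ge0.
  - by rewrite gerBl.
split.
- by move=> a b /(pl_V PL)[/VV h1 /VV h2].
- by move=> a /VV' /(pl_refl PL).
- by move=> a b /(pl_sym PL).
- move=> s t l k Ks Kt ws wk e1 e2 g.
  have [a1 a2] := wsum_unrot ws; have [b1 b2] := wsum_unrot wk.
  have := pl_FF PL (spx_unrot Ks) (spx_unrot Kt) (wt_map (unrot n) ws) (wt_map (unrot n) wk) _ _ (fun v => g (rot v)).
  rewrite a1 a2 b1 b2 e1 e2 !wsum_map => /(_ erefl erefl).
  have K s' l' : wsum s' l' (fun v => g (rot (unrot n v))) = wsum s' l' g.
    by apply: wsum_ext => v; case: v => x y; rewrite /rot /unrot /= subKr.
  by rewrite !K.
move=> x y x0 xn y0 ym.
have h1 : 0 <= n%:~R - x by rewrite subr_ge0.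
have h2 : n%:~R - x <= n%:~R by rewrite gerBl.
have [a [b [c [[Eab Ebc Eac bas] it]]]] := pl_cov PL y0 ym h1 h2.
exists (rot a), (rot b), (rot c); split.
  split; rewrite /rotE ?rotK //; apply: basis2_rot; rewrite !rotK //.
have [l1 [l2 [l3 [p ls ex ey]]]] := it; exists l1, l2, l3; split=> //.
rewrite /rx /rot /= !rmorphB /= !mulrBr.
have -> : x = n%:~R * (l1 + l2 + l3) - (n%:~R - x) by rewrite ls; ring.
by rewrite ey /ry; ring.
Qed.

End Rot.

Section RotSpecial.
Variable R : realType.
Variables (q : int) (L : int -> int -> Prop) (Y X : int -> int).
Hypothesis Lq : lattice q L.
Hypothesis HY : forall t, [/\ L t (Y t), 0 <= Y t & Y t < q].
Hypothesis HX : forall t, [/\ L (X t) t, 0 <= X t & X t < q].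

Lemma rep_uniq y y' t : L t y -> L t y' -> 0 <= y -> y < q -> 0 <= y' -> y' < q -> y = y'.
Proof.
move=> h1 h2 y0 yq y0' yq'; have := lat_B Lq h1 h2; rewrite subrr => /(lat_y0 Lq)[i ei].
have q0 := lat_q Lq.
have i1 : i < 1 by rewrite -(ltr_pM2r q0) -ei mul1r; move: yq y0'; clear -Lq HY HX; lia.
have i2 : -1 < i by rewrite -(ltr_pM2r q0) -ei mulN1r; move: yq' y0; clear -Lq HY HX; lia.
have i0 : i = 0 by move: i1 i2; clear -Lq HY HX; lia.
by move: ei; rewrite i0 mul0r => /eqP; rewrite subr_eq0 => /eqP.
Qed.

Lemma rep_uniqx x x' t : L x t -> L x' t -> 0 <= x -> x < q -> 0 <= x' -> x' < q -> x = x'.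
Proof.
move=> h1 h2 y0 yq y0' yq'; have := lat_B Lq h1 h2; rewrite subrr => /(lat_x0 Lq)[i ei].
have q0 := lat_q Lq.
have i1 : i < 1 by rewrite -(ltr_pM2r q0) -ei mul1r; move: yq y0'; clear -Lq HY HX; lia.
have i2 : -1 < i by rewrite -(ltr_pM2r q0) -ei mulN1r; move: yq' y0; clear -Lq HY HX; lia.
have i0 : i = 0 by move: i1 i2; clear -Lq HY HX; lia.
by move: ei; rewrite i0 mul0r => /eqP; rewrite subr_eq0 => /eqP.
Qed.

Definition rotY (t : int) := X (- t).
Definition rotX (t : int) := if Y t == 0 then 0 else q - Y t.

Lemma rotY_ok t : [/\ rotL L t (rotY t), 0 <= rotY t & rotY t < q].
Proof. by have [h1 h2 h3] := HX (- t). Qed.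

Lemma rotX_ok t : [/\ rotL L (rotX t) t, 0 <= rotX t & rotX t < q].
Proof.
have q0 := lat_q Lq; have [h1 h2 h3] := HY t; rewrite /rotX /rotL; case: eqP => e.
  by rewrite oppr0; split=> //; rewrite -e.
split.
- by have := lat_B Lq h1 (lat_y Lq); rewrite subr0 opprB.
- by rewrite subr_ge0 ltW.
- by move: h2 h3 q0 e; clear -Lq HY HX; lia.
Qed.

Lemma X_period t : X (2 * q - t) = X (- t).
Proof.
have [h1 h2 h3] := HX (2 * q - t); have [h4 h5 h6] := HX (- t).
apply: (@rep_uniqx _ _ (- t)) => //.
have := lat_B Lq h1 (lat_yq 2 Lq); rewrite subr0 (_ : 2 * q - t - 2 * q = - t) //; ring.
Qed.

Variables (A : int) (E : pt2 -> pt2 -> Prop).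
Hypothesis A2 : 2 <= A.
Hypothesis SE : splane R q L Y X A 2 E.
Let q0 : 0 < q. Proof. exact: lat_q Lq. Qed.
Let Aq : 2 * q <= A * q. Proof. exact: (mulq_le Lq A2). Qed.

Ltac slia := clear -Lq HY HX A2 SE q0 Aq; lia.

Lemma dvd_sub t : (q %| 2 * q - t)%Z = (q %| t)%Z.
Proof. by rewrite rpredBl // dvdz_mull. Qed.

Lemma rotL_L i t : 0 <= t -> t <= q -> Lc q rotY i t = Tc q X 2 i (2 * q - t).
Proof.
move=> t0 tq; rewrite /Lc /Tc.
have -> : (2 * q - t < 2 * q) = (0 < t) by rewrite gtrBl.
have [h|h] := leP t 0.
  by have -> : 2 * q - t <= q = false by move: h q0; slia.
have [h'|h'] := ltP t q; last by have -> : 2 * q - t <= q by move: h' q0; slia.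
have -> : 2 * q - t <= q = false by move: h' q0; slia.
rewrite dvd_sub (ndvd Lq h h').
by rewrite X_period.
Qed.

Lemma rotL_R b t : q <= t -> t <= 2 * q -> Rc q rotY 2 b t = Bc q X b (2 * q - t).
Proof.
move=> t0 tq; rewrite /Rc /Bc subr_le0.
have [h|h] := leP t q.
  have et : t = q by apply/eqP; rewrite eq_le h t0.
  have -> : 2 * q <= t = false by rewrite et; move: q0; slia.
  by have -> : 2 * q - t < q = false by rewrite et; move: q0; slia.
have -> : 2 * q - t < q by move: h; slia.
by rewrite ltNge; case: (2 * q <= t) => //=; rewrite X_period.
Qed.

Lemma rotX_pos t : (q %| t)%Z = false -> rotX t = q - Y t.
Proof. by move=> h; have := Y_pos Lq HY h; rewrite /rotX; case: eqP => // ->. Qed.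

Lemma rotX_zero t : (q %| t)%Z -> rotX t = 0 /\ Y t = 0.
Proof.
move=> /dvdzP[i ei]; suff e : Y t = 0 by rewrite /rotX e eqxx.
have [h1 h2 h3] := HY t; apply: (@rep_uniq _ _ t) => //.
by rewrite ei; apply: lat_xq.
Qed.

Lemma rotL_B i s : 0 <= s -> s <= q -> 2 * q - Bc q rotX i s = Lc q Y (2 - i) s.
Proof.
move=> s0 sq; rewrite /Bc /Lc; have [h|h] := leP s 0; first by ring.
have [h'|h'] := ltP s q; last by ring.
by rewrite rotX_pos ?(ndvd Lq h h') //; ring.
Qed.

Lemma rotL_T i s : q <= s -> s <= A * q -> 2 * q - Tc q rotX A i s = Rc q Y A (2 - i) s.
Proof.
move=> s0 sq; rewrite /Tc /Rc; have [h|h] := leP s q; first by ring.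
have [h'|h'] := ltP s (A * q); last by ring.
case: ifP => d; first by have [_ ->] := rotX_zero d; ring.
by rewrite rotX_pos //; ring.
Qed.

Lemma splane_rot : splane R q (rotL L) rotY rotX 2 A (rotE (2 * q) E).
Proof.
have Ln x y : L x (2 * q + y) <-> L x y.
  split=> h.
    have := lat_B Lq h (lat_yq 2 Lq); rewrite subr0 (_ : 2 * q + y - 2 * q = y) //; ring.
  by have := lat_D Lq h (lat_yq 2 Lq); rewrite addr0 addrC.
have S2 t : 2 * q - t = 2 * q - (t + 1) + 1 by ring.
split.
- exact: plane_rot Ln (sp_pl SE).
- move=> b t b0 bA t0 tq; rewrite /rotE /unrot /=.
  have t1q : t <= q by move: tq; slia.
  have t10 : 0 <= t + 1 by move: t0; slia.
  rewrite !rotL_L //; apply: (pl_sym (sp_pl SE)).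
  have := @sp_T _ _ _ _ _ _ _ _ SE b (2 * q - (t + 1)) b0 bA; rewrite -S2; apply.
  - by move: tq; slia.
  - by move: t0; slia.
- move=> b t b0 bA t0 tq; rewrite /rotE /unrot /=.
  have t1q : t <= 2 * q by move: tq; slia.
  have t10 : q <= t + 1 by move: t0; slia.
  rewrite !rotL_R //; apply: (pl_sym (sp_pl SE)).
  have := @sp_B _ _ _ _ _ _ _ _ SE b (2 * q - (t + 1)) b0 bA; rewrite -S2; apply.
  - by move: tq; slia.
  - by move: t0; slia.
- move=> i s i0 i2 s0 sq; rewrite /rotE /unrot /=.
  have t1q : s <= q by move: sq; slia.
  have t10 : 0 <= s + 1 by move: s0; slia.
  rewrite !rotL_B //; apply: (sp_L SE) => //; first by rewrite subr_ge0.
  by rewrite gerBl.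
- move=> i s i0 i2 s0 sq; rewrite /rotE /unrot /=.
  have t1q : s <= A * q by move: sq; slia.
  have t10 : q <= s + 1 by move: s0; slia.
  rewrite !rotL_T //; apply: (sp_R SE) => //; first by rewrite subr_ge0.
  by rewrite gerBl.
Qed.

End RotSpecial.

Section Full.
Variable R : realType.
Local Notation wsum := (@wsum R).
Local Notation wt := (@wt R).
Local Notation tx := (@tx R).
Local Notation ty := (@ty R).
Local Notation tz := (@tz R).
Variables (q : int) (L : int -> int -> Prop).
Hypothesis Lq : lattice q L.
Local Notation Q := (q%:~R : R).

Record full (k : int) (P : seq pt3 -> Prop) : Prop := Full {
  fl_size : forall T, P T -> size T = 4;
  fl_in : forall T v, P T -> v \in T -> [/\ L v.1.1 v.1.2, 0 <= v.2 /\ v.2 <= k,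
     0 <= v.1.1 /\ v.1.1 <= (k - v.2) * q & 0 <= v.1.2 /\ v.1.2 <= v.2 * q];
  fl_uni : forall T, P T -> uni3 L T;
  fl_cov : forall x y z : R, 0 <= z -> z <= k%:~R -> 0 <= x -> x <= (k%:~R - z) * Q ->
     0 <= y -> y <= z * Q -> covers P x y z;
  fl_FF : FF3 R P;
  fl_std : forall T v w, P T -> v \in T -> w \in T ->
    [\/ v.1.1 = 0 /\ w.1.1 = 0, v.1.2 = 0 /\ w.1.2 = 0,
      v.1.1 = (k - v.2) * q /\ w.1.1 = (k - w.2) * q |
      v.1.2 = v.2 * q /\ w.1.2 = w.2 * q] -> stdir q v w }.

(* Exchanges the two halves of the dilated tetrahedron below and above the level z = 2. *)
Definition turn (v : pt3) : pt3 := (v.1.2, (2 - v.2) * q - v.1.1, 2 - v.2).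

Lemma uni3_turn T : uni3 (rotL L) T -> uni3 L (map turn T).
Proof.
move=> [ind gen].
have e2 c : zsum T c (fun v => (2 - v.2) * q - v.1.1) =
    2 * q * zsum T c (fun=> 1) + (- q) * zsum T c (fun v => v.2) + (-1) * zsum T c (fun v => v.1.1).
  by rewrite -!zsumZ -!zsumD; apply: eq_bigr => i _; ring.
have e3 c : zsum T c (fun v => 2 - v.2) = 2 * zsum T c (fun=> 1) + (-1) * zsum T c (fun v => v.2).
  by rewrite -!zsumZ -!zsumD; apply: eq_bigr => i _; ring.
split; rewrite ?size_map.
  move=> c sc; rewrite !zsum_map /turn /= e2 e3 => h1; rewrite h1 !mulr0 !add0r => h2 h3 h4.
  have h5 : zsum T c (fun v => v.2) = 0 by move: h4; rewrite mulN1r => /eqP; rewrite oppr_eq0 => /eqP.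
  move: h3; rewrite h5 mulr0 add0r mulN1r => /eqP; rewrite oppr_eq0 => /eqP h3.
  exact: ind.
move=> x y z Lxy; have [|c [sc h1 h2 h3 h4]] := gen (z * q - y) x (2 - z).
  rewrite /rotL opprB; by have := lat_B Lq Lxy (lat_yq z Lq); rewrite subr0.
exists c; split=> //; rewrite ?zsum_map ?size_map //.
  by rewrite /turn /= e2 h1 h2 h4; ring.
by rewrite /turn /= e3 h1 h4; ring.
Qed.

Lemma wsum_turn T l : wt T l -> [/\ wsum (map turn T) l tx = wsum T l ty,
  wsum (map turn T) l ty = (2 - wsum T l tz) * Q - wsum T l tx & wsum (map turn T) l tz = 2 - wsum T l tz].
Proof.
move=> [_ _ e]; rewrite !wsum_map; split=> //.
  transitivity (2 * Q * wsum T l (fun=> 1) + (- Q) * wsum T l tz + (-1) * wsum T l tx); last by rewrite e; ring.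
  rewrite /wsum !mulr_sumr -!big_split; apply: eq_bigr => i _ /=.
  by rewrite /turn /ty /tx /tz /= rmorphB rmorphM rmorphB /=; ring.
transitivity (2 * wsum T l (fun=> 1) + (-1) * wsum T l tz); last by rewrite e; ring.
rewrite /wsum !mulr_sumr -!big_split; apply: eq_bigr => i _ /=.
by rewrite /turn /tz /= rmorphB /=; ring.
Qed.

Lemma wsum_up T l z : wt T l -> [/\ wsum (map (up z) T) l tx = wsum T l tx,
  wsum (map (up z) T) l ty = wsum T l ty & wsum (map (up z) T) l tz = wsum T l tz + z%:~R].
Proof.
move=> [_ _ e]; rewrite !wsum_map; split=> //.
have -> : z%:~R = wsum T l (fun=> z%:~R) by rewrite wsum_const e mulr1.
rewrite -wsumD; apply: wsum_ext => v; by rewrite /tz /up /= rmorphD.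
Qed.

Lemma wt_unmap P P' (f : P -> P') T l : wt (map f T) l -> wt T l.
Proof. by move=> [h1 h2]; rewrite wsum_map => h3; split=> //; rewrite h1 size_map. Qed.

Lemma stdir_turn v w : stdir q v w -> stdir q (turn v) (turn w).
Proof.
move=> [e [s [he h1 h2 h3]]].
have T1 : (turn w).1.1 - (turn v).1.1 = s * e.1.2 by [].
have T2 : (turn w).1.2 - (turn v).1.2 = s * (- (e.2 * q) - e.1.1).
  by rewrite /turn /= mulrBr -h1 mulrN mulrA -h3; ring.
have T3 : (turn w).2 - (turn v).2 = s * - e.2 by rewrite mulrN -h3 /turn /=; ring.
move: he T1 T2 T3; rewrite !inE => /or4P[|||/or3P[]] /eqP -> /= T1 T2 T3.
- exists (0, q, 0), (- s); rewrite T1 T2 T3 /= !inE eqxx ?orbT; split=> //; ring.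
- exists (q, 0, 0), s; rewrite T1 T2 T3 /= !inE eqxx ?orbT; split=> //; ring.
- exists (0, q, 1), (- s); rewrite T1 T2 T3 /= !inE eqxx ?orbT; split=> //; ring.
- exists (- q, q, 1), (- s); rewrite T1 T2 T3 /= !inE eqxx ?orbT; split=> //; ring.
- exists (0, 0, 1), (- s); rewrite T1 T2 T3 /= !inE eqxx ?orbT; split=> //; ring.
- exists (- q, 0, 1), (- s); rewrite T1 T2 T3 /= !inE eqxx ?orbT; split=> //; ring.
Qed.

Section Join.
Variables (k : int) (m n : int) (E : pt2 -> pt2 -> Prop) (P P' : seq pt3 -> Prop).
Hypotheses (k4 : 4 <= k).
Hypothesis PE : plane R L m n E.
Hypothesis HU : half R q L (k - 2) 2 E P.
Hypothesis HL : half R q (rotL L) 2 (k - 2) (rotE (2 * q) E) P'.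

Definition both (T : seq pt3) := (exists T', P T' /\ T = map (up 2) T') \/ (exists T', P' T' /\ T = map turn T').

Let q0 : 0 < q. Proof. exact: lat_q Lq. Qed.

Lemma mixed_FF S T l m' : P S -> P' T -> wt S l -> wt T m' ->
  wsum (map (up 2) S) l tx = wsum (map turn T) m' tx ->
  wsum (map (up 2) S) l ty = wsum (map turn T) m' ty ->
  wsum (map (up 2) S) l tz = wsum (map turn T) m' tz ->
  forall g, wsum (map (up 2) S) l g = wsum (map turn T) m' g.
Proof.
move=> PS PT w1 w2; have [-> -> ->] := wsum_up 2 w1; have [-> -> ->] := wsum_turn w2 => ex ey ez g.
have z1 := half_tz HU PS w1; have z2 := half_tz HL PT w2.
have z1' : wsum S l tz = 0 by move: z1 z2 ez; set x1 := wsum _ _ _; set x2 := wsum _ _ _; rewrite -[2%:~R]/(2 : R); clear -Lq k4 PE HU HL; lra.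
have z2' : wsum T m' tz = 0 by move: z1' ez; set x1 := wsum _ _ _; set x2 := wsum _ _ _; rewrite -[2%:~R]/(2 : R); clear -Lq k4 PE HU HL; lra.
have [s [c [Es wc Hs]]] := hf_trace HU PS w1 z1'.
have [t [d [Et wd Ht]]] := hf_trace HL PT w2 z2'.
have [a1 a2] := wsum_unrot (2 * q) wd.
rewrite !wsum_map Hs Ht.
have := pl_FF PE Es (spx_unrot Et) wc (wt_map (unrot (2 * q)) wd) _ _ (fun v => g (v, 2)).
rewrite a1 a2 wsum_map.
have -> : wsum s c (fun v => g (up 2 (v, 0))) = wsum s c (fun v => g (v, 2)) by [].
have -> : wsum t d (fun v => g (turn (v, 0))) = wsum t d (fun v => g (unrot (2 * q) v, 2)).
  by apply: wsum_ext => v; rewrite /turn /unrot /= subr0.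
apply.
- by have := ex; rewrite Hs Ht.
by have := ey; rewrite z2' Hs Ht subr0 rmorphM.
Qed.

Lemma both_full : full k both.
Proof.
have k2 : 0 <= k - 2 by move: k4; clear -Lq; lia.
have k2' : 0 < k - 2 by move: k4; clear -Lq; lia.
have kR : (k - 2)%:~R = k%:~R - 2 :> R by rewrite rmorphB.
split.
- by move=> T [[T' [PT ->]]|[T' [PT ->]]]; rewrite size_map; [apply: (hf_size HU)|apply: (hf_size HL)].
- move=> T v [[T' [PT ->]]|[T' [PT ->]]] /mapP[[[x y] z] wT ->].
    have [/= h1 [h2 h3] [h4 h5] [h6 h7]] := hf_in HU PT wT.
    split=> //; split=> //.
    + by apply: addr_ge0.
    + by rewrite -lerBrDr.
    + by apply: le_trans h5 _; rewrite (_ : k - 2 - z = k - (z + 2)) //; ring.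
    + by rewrite addrC.
  have [/= h1 [h2 h3] [h4 h5] [h6 h7]] := hf_in HL PT wT.
  split; rewrite /turn /=.
  + have := lat_D Lq h1 (lat_yq (2 - z) Lq); by rewrite addr0 addrC.
  + by split; [rewrite subr_ge0|apply: le_trans (_ : 2 <= k); rewrite ?gerBl // (le_trans _ k4)].
  + by split=> //; apply: le_trans h7 _; rewrite (_ : k - 2 + z = k - (2 - z)) //; ring.
  + by split; [rewrite subr_ge0|rewrite gerBl].
- move=> T [[T' [PT ->]]|[T' [PT ->]]]; first exact: uni3_up (hf_uni HU PT).
  exact: uni3_turn (hf_uni HL PT).
- move=> x y z z0 zk x0 xk y0 yz; have [z2|z2] := leP 2 z.
    have [T [l [PT wl e1 e2 e3]]] : covers P x y (z - 2).
      have z20 : 0 <= z - 2 by rewrite subr_ge0.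
      have [e|n0] := eqVneq z k%:~R.
        have x00 : x = 0 by apply/eqP; rewrite eq_le x0 andbT; apply: le_trans xk _; rewrite e subrr mul0r.
        have := @hf_top _ _ _ _ _ _ _ HU k2' y y0.
        by rewrite subrK e kR x00 -e; apply.
      apply: (hf_cov HU) => //.
      + by rewrite kR ltrD2r lt_neqAle n0.
      + by rewrite kR opprB addrA subrK.
      + by rewrite -[2%:~R]/(2 : R) addrC subrK.
    have [f1 f2 f3] := wsum_up 2 wl.
    exists (map (up 2) T), l; split; [by left; exists T|exact: wt_map|by rewrite f1|by rewrite f2|].
    by rewrite f3 e3 subrK.
  have [T [l [PT wl e1 e2 e3]]] : covers P' (z * Q - y) x (2 - z).
    have z20 : 0 <= 2 - z by rewrite subr_ge0 ltW.
    have [e|n0] := eqVneq z 0.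
      have y00 : y = 0 by apply/eqP; rewrite eq_le y0 andbT; apply: le_trans yz _; rewrite e mul0r.
      have := @hf_top _ _ _ _ _ _ _ HL isT x x0.
      rewrite e y00 mul0r !subr0 addrC subrK; apply.
      by apply: le_trans xk _; rewrite e subr0.
    apply: (hf_cov HL) => //.
    + by rewrite gtrBl lt_neqAle eq_sym n0.
    + by rewrite subr_ge0.
    + by rewrite subKr gerBl.
    + by rewrite kR addrA subrK.
  have [f1 f2 f3] := wsum_turn wl.
  exists (map turn T), l; split; [by right; exists T|exact: wt_map|by rewrite f1| |].
    by rewrite f2 e1 e3 !subKr.
  by rewrite f3 e3 subKr.
- move=> S T l m' [[S' [PS ->]]|[S' [PS ->]]] [[T' [PT ->]]|[T' [PT ->]]] /wt_unmap w1 /wt_unmap w2 ex ey ez g.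
  + move: ex ey ez; have [-> -> ->] := wsum_up 2 w1; have [-> -> ->] := wsum_up 2 w2.
    by move=> ex ey /addIr ez; rewrite !wsum_map; apply: (hf_FF HU).
  + exact: mixed_FF.
  + by symmetry; apply: mixed_FF.
  + move: ex ey ez; have [-> -> ->] := wsum_turn w1; have [-> -> ->] := wsum_turn w2.
    move=> ex ey /addrI/oppr_inj ez; move: ey; rewrite ez => /addrI/oppr_inj ey.
    by rewrite !wsum_map; apply: (hf_FF HL).
move=> T v w [[T' [PT ->]]|[T' [PT ->]]] /mapP[v' vT ->] /mapP[w' wT ->] sf.
  suff [e [s [he h1 h2 h3]]] : stdir q v' w'.
    by exists e, s; split=> //; rewrite -h3 /up /= opprD addrACA subrr addr0.
  apply: (hf_std HU PT vT wT); move: sf; rewrite /same_facet /up /=.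
  have eA x : k - (x + 2) = k - 2 - x by ring.
  by rewrite !eA ![_ + 2]addrC.
apply: stdir_turn; apply: (hf_std HL PT vT wT); move: sf; rewrite /same_facet /turn /=.
have eA x : k - (2 - x) = k - 2 + x by ring.
rewrite !eA; case=> -[h1 h2]; [constructor 2|constructor 3|constructor 4|constructor 1] => //.
- by split; [move/eqP: h1|move/eqP: h2]; rewrite subr_eq0 => /eqP.
- split; [move: h1|move: h2] => /eqP; rewrite -subr_eq0 addrC addKr oppr_eq0 => /eqP //.
Qed.
End Join.

Lemma rep_exists : exists Y, forall t, [/\ L t (Y t), 0 <= Y t & Y t < q].
Proof.
have q0 := lat_q Lq.
have H t : exists y, [/\ L t y, 0 <= y & y < q].
  have [y h] := lat_exy Lq t; exists (y %% q)%Z; split.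
  - have := lat_B Lq h (lat_yq (y %/ q)%Z Lq); rewrite subr0 /modz; exact.
  - by rewrite modz_ge0 // lt0r_neq0.
  - by rewrite ltz_pmod.
by have [Y HY] := choice H; exists Y.
Qed.

End Full.

Theorem full_exists (R : realType) q L (k : int) : lattice q L -> 4 <= k -> exists P, full R q L k P.
Proof.
move=> Lq k4; have [Y HY] := rep_exists Lq.
have [X HX] := rep_exists (lattice_flip Lq).
have k2 : 2 <= k - 2 by move: k4; clear; lia.
have [E SE] := splane_exists R Lq HY HX k2 (lexx 2).
have [P HP] := splane_half Lq HY HX k2 (lexx 2) SE.
have SE' := splane_rot Lq HY HX k2 SE.
have [P' HP'] := splane_half (lattice_rot Lq) (rotY_ok HX) (rotX_ok Lq HY) (lexx 2) k2 SE'.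
exists (both q P P'); exact: (both_full Lq k4 (sp_pl SE) HP HP').
Qed.

(** * The dilated tetrahedron *)

Definition Lam (p q a b : int) := exists x y t, a = q * x + t * pprime p q /\ b = q * y + t.

Lemma in_LambdaE p q a b c : in_Lambda p q (mkpt a b c) <-> Lam p q a b.
Proof.
split=> [[x [y [z [t /rowP e]]]]|[x [y [t [-> ->]]]]]; last by exists x, y, c, t.
have := e (@Ordinal 3 0 isT); have := e (@Ordinal 3 1 isT); rewrite !mxE /= => e1 e2.
by exists x, y, t.
Qed.

Lemma Lam_lattice p q : 1 <= q -> coprimez p q -> lattice q (Lam p q).
Proof.
move=> q1 /coprimezP[[u v] /= e]; have q0 : 0 < q by apply: lt_le_trans q1.
set m := ((- p) %/ q)%Z.
have ep : pprime p q = - p - m * q by rewrite /pprime [X in _ = X - _](divz_eq (- p) q) addrC addKr.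
have e1 : pprime p q * - u + (v - u * m) * q = 1 by rewrite ep -e; ring.
split=> //.
- move=> a b c d [x [y [t [-> ->]]]] [x' [y' [t' [-> ->]]]].
  by exists (x - x'), (y - y'), (t - t'); split; ring.
- by exists 1, 0, 0; split; ring.
- by exists 0, 1, 0; split; ring.
- move=> a [x [y [t [-> /esym/eqP]]]]; rewrite addrC addr_eq0 => /eqP ->.
  by exists (x - y * pprime p q); ring.
- move=> b [x [y [t [/esym/eqP]]]]; rewrite addr_eq0 => /eqP h ->.
  exists (y + (x * u + t * (v - u * m))).
  have et : t = (- (t * pprime p q)) * u + t * (v - u * m) * q.
    by rewrite -[LHS]mulr1 -e1; ring.
  by rewrite [X in _ + X]et -h; ring.
- move=> a; exists (- (u * a)), ((v - u * m) * a), 0, (- (u * a)); split; last by ring.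
  by rewrite -[LHS]mul1r -e1; ring.
- by move=> b; exists (b * pprime p q), 0, 0, b; split; ring.
Qed.

Section Translation.
Variable R : realType.
Local Notation wsum := (@wsum R).
Local Notation wt := (@wt R).
Local Notation tx := (@tx R).
Local Notation ty := (@ty R).
Local Notation tz := (@tz R).

Lemma conv_map (I : finType) (i0 : I) (f : I -> 'rV[R]_3) (s : seq I) x : uniq s ->
  conv R [seq f i | i <- s] x <-> exists c : I -> R,
    [/\ forall i, 0 <= c i, \sum_(i <- s) c i = 1 & x = \sum_(i <- s) c i *: f i].
Proof.
move=> us; split=> [[l [l0 [ls ->]]]|[c [c0 cs ->]]].
  pose F (n : nat) : R := if insub n is Some j then l j else 0.
  have FE (j : 'I_(size (map f s))) : F j = l j by rewrite /F valK.
  exists (fun i => F (index i s)); split.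
  - by move=> i; rewrite /F; case: insub.
  - rewrite (big_nth i0) -ls; under [RHS]eq_bigr => j _ do rewrite -FE.
    rewrite -(big_mkord xpredT F) size_map; apply: eq_big_nat => j /andP[_ js].
    by rewrite index_uniq.
  rewrite [RHS](big_nth i0).
  transitivity (\sum_(j < size (map f s)) F j *: (map f s)`_j).
    by apply: eq_bigr => j _; rewrite FE.
  rewrite -(big_mkord xpredT (fun j => F j *: (map f s)`_j)) size_map; apply: eq_big_nat => j /andP[_ js].
  by rewrite index_uniq // (nth_map i0).
exists (fun j => c (nth i0 s j)); split=> //; split.
  by rewrite -[RHS]cs (big_nth i0) -(big_mkord xpredT (fun j => c (nth i0 s j))) size_map.
rewrite (big_nth i0) -(big_mkord xpredT (fun j => c (nth i0 s j) *: (map f s)`_j)) size_map.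
by apply: eq_big_nat => j /andP[_ js]; rewrite (nth_map i0).
Qed.

Lemma faceE (v : 'I_4 -> ipt) S x : face R v S x <-> exists c : 'I_4 -> R,
  [/\ forall i, 0 <= c i, forall i, i \notin S -> c i = 0, \sum_i c i = 1 &
    x = \sum_i c i *: toR R (v i)].
Proof.
rewrite /face (conv_map ord0) ?enum_uniq //; split=> [[c [c0 cs ->]]|[c [c0 cz cs ->]]].
  exists (fun i => if i \in S then c i else 0); split.
  - by move=> i; case: ifP.
  - by move=> i /negbTE->.
  - by rewrite -big_mkcond -cs big_enum.
  rewrite big_enum /= big_mkcond; apply: eq_bigr => i _; case: ifP => // _; by rewrite scale0r.
exists c; split=> //.
  by rewrite big_enum /= big_mkcond -cs; apply: eq_bigr => i _; case: ifP => // /negbT/cz.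
by rewrite big_enum /= [RHS]big_mkcond; apply: eq_bigr => i _; case: ifP => // /negbT/cz ->; rewrite scale0r.
Qed.

Definition o0 : 'I_3 := @Ordinal 3 0 isT.
Definition o1 : 'I_3 := @Ordinal 3 1 isT.
Definition o2 : 'I_3 := @Ordinal 3 2 isT.

Lemma ord3 (i : 'I_3) : [\/ i = o0, i = o1 | i = o2].
Proof.
by case: i => [[|[|[|?]]] h] //; [constructor 1|constructor 2|constructor 3]; apply: val_inj.
Qed.

Lemma row3P (K : Type) (x y : 'rV[K]_3) : x 0 o0 = y 0 o0 -> x 0 o1 = y 0 o1 -> x 0 o2 = y 0 o2 -> x = y.
Proof. by move=> h0 h1 h2; apply/rowP => j; case: (ord3 j) => ->. Qed.

Definition mk3 (v : pt3) : ipt := mkpt v.1.1 v.1.2 v.2.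

Lemma mk30 v : mk3 v 0 o0 = v.1.1. Proof. by rewrite mxE. Qed.
Lemma mk31 v : mk3 v 0 o1 = v.1.2. Proof. by rewrite mxE. Qed.
Lemma mk32 v : mk3 v 0 o2 = v.2. Proof. by rewrite mxE. Qed.

Definition tet (T : seq pt3) : tetra := [ffun i : 'I_4 => mk3 (nth (0, 0, 0) T i)].

Lemma wsum_ord (P : Type) (x0 : P) (T : seq P) l g : size l = size T -> size T = 4 ->
  wsum T l g = \sum_(i < 4) l`_i * g (nth x0 T i).
Proof.
move=> sl sT; rewrite /wsum (big_nth (x0, 0)) size_zip sl minnn sT big_mkord.
by apply: eq_bigr => i _; rewrite nth_zip.
Qed.

Lemma zsum_ord (P : Type) (x0 : P) (T : seq P) c g : size c = size T -> size T = 4 ->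
  zsum T c g = \sum_(i < 4) c`_i * g (nth x0 T i).
Proof.
move=> sl sT; rewrite /zsum (big_nth (x0, 0)) size_zip sl minnn sT big_mkord.
by apply: eq_bigr => i _; rewrite nth_zip.
Qed.

Lemma mkseq_ord (K : zmodType) (c : 'I_4 -> K) (i : 'I_4) : (mkseq (fun j => c (inord j)) 4)`_i = c i.
Proof. by rewrite nth_mkseq ?inord_val. Qed.

Lemma sum_row (K : nzRingType) (c : 'I_4 -> K) (f : 'I_4 -> 'rV[K]_3) j :
  (\sum_i c i *: f i) 0 j = \sum_i c i * f i 0 j.
Proof. by rewrite summxE; apply: eq_bigr => i _; rewrite mxE. Qed.

Lemma face_tet T S x : size T = 4 -> face R (tet T) S x <-> exists l,
  [/\ wt T l, forall i : 'I_4, i \notin S -> l`_i = 0 &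
      [/\ wsum T l tx = x 0 o0, wsum T l ty = x 0 o1 & wsum T l tz = x 0 o2]].
Proof.
move=> sT; rewrite faceE; split=> [[c [c0 cz cs ->]]|[l [[sl l0 ls] lz [e0 e1 e2]]]].
  pose l := mkseq (fun j => c (inord j)) 4.
  have sl : size l = size T by rewrite size_mkseq sT.
  exists l; split.
  - split=> //; first by move=> y /mapP[j _ ->].
    by rewrite (wsum_ord (0, 0, 0)) // -[RHS]cs; apply: eq_bigr => i _; rewrite mkseq_ord mulr1.
  - by move=> i /cz; rewrite mkseq_ord.
  split; rewrite (wsum_ord (0, 0, 0)) // sum_row; apply: eq_bigr => i _; rewrite mkseq_ord !mxE ffunE.
  + by rewrite mk30.
  + by rewrite mk31.
  + by rewrite mk32.
have lE i : l`_i = l`_i by [].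
exists (fun i => l`_i); split=> //.
- move=> i; apply: l0; apply: mem_nth; by rewrite sl sT.
- by rewrite -ls (wsum_ord (0, 0, 0)) //; apply: eq_bigr => i _; rewrite mulr1.
by apply: row3P; rewrite sum_row -?e0 -?e1 -?e2 (wsum_ord (0, 0, 0)) //; apply: eq_bigr => i _;
  rewrite !mxE ffunE ?mk30 ?mk31 ?mk32.
Qed.

Lemma poly_tet T x : size T = 4 -> polytope R (tet T) x <-> exists l,
  wt T l /\ [/\ wsum T l tx = x 0 o0, wsum T l ty = x 0 o1 & wsum T l tz = x 0 o2].
Proof.
move=> sT; rewrite /polytope (face_tet _ _ sT); split=> [[l [h1 _ h2]]|[l [h1 h2]]]; exists l; split=> //.
by move=> i; rewrite inE.
Qed.

Lemma weights_add (P : Type) (T : seq P) (m u : seq R) (x : R) : 0 <= x -> size m = size T -> size u = size T ->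
  (forall y, y \in m -> 0 <= y) -> (forall y, y \in u -> 0 <= y) ->
  exists k, [/\ size k = size T, forall y, y \in k -> 0 <= y & forall g, wsum T k g = wsum T m g + x * wsum T u g].
Proof.
move=> x0; elim: T m u => [|b T IH] [|m1 m] [|u1 u] // sm su m0 u0.
  by exists [::]; split=> // g; rewrite !wsumE mulr0 addr0.
case: sm su => sm [su]; have [||k [sk k0 Hk]] := IH m u sm su.
- by move=> y ym; apply: m0; rewrite inE ym orbT.
- by move=> y yu; apply: u0; rewrite inE yu orbT.
exists (m1 + x * u1 :: k); split; first by rewrite /= sk.
  move=> y; rewrite inE => /orP[/eqP->|/k0 //].
  by apply: addr_ge0; [apply: m0|apply: mulr_ge0 => //; apply: u0]; rewrite inE eqxx.
by move=> g; rewrite !wsumE Hk; ring.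
Qed.

Lemma wsum_transport (P : eqType) (S T : seq P) l : size l = size S -> (forall x, x \in l -> 0 <= x) ->
  (forall i, (i < size S)%N -> l`_i != 0 -> forall v0, nth v0 S i \in T) ->
  exists m, [/\ size m = size T, forall x, x \in m -> 0 <= x & forall g, wsum S l g = wsum T m g].
Proof.
elim: S l => [|a S IH] [|x l] //.
  move=> _ _ _; exists (nseq (size T) 0); split; first by rewrite size_nseq.
    by move=> x /nseqP[->].
  move=> g; rewrite wsumE; elim: T => [|b T IH]; rewrite /= ?wsumE // mul0r add0r; exact: IH.
move=> [sl] l0 H; have [||m [sm m0 Hm]] := IH l sl.
- by move=> y yl; apply: l0; rewrite inE yl orbT.
- by move=> i iS li v0; apply: (H i.+1).
have [x0|nx] := eqVneq x 0.
  by exists m; split=> // g; rewrite wsumE x0 mul0r add0r.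
have aT : a \in T by apply: (H 0%N _ nx a).
have [u [[su u0 us] Hu]] := wt_unit R aT.
have x0 : 0 <= x by apply: l0; rewrite inE eqxx.
have [k [sk k0 Hk]] := weights_add x0 sm su m0 u0.
by exists k; split=> // g; rewrite wsumE Hk Hm Hu addrC.
Qed.

End Translation.

Definition i0 : 'I_4 := @Ordinal 4 0 isT.
Definition i1 : 'I_4 := @Ordinal 4 1 isT.
Definition i2 : 'I_4 := @Ordinal 4 2 isT.
Definition i3 : 'I_4 := @Ordinal 4 3 isT.

Lemma sum4 (K : zmodType) (f : 'I_4 -> K) : \sum_i f i = f i0 + f i1 + f i2 + f i3.
Proof.
rewrite !big_ord_recl big_ord0 addr0 !addrA.
by congr (f _ + f _ + f _ + f _); apply: val_inj.
Qed.

Lemma ord4 (i : 'I_4) : [\/ i = i0, i = i1, i = i2 | i = i3].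
Proof.
by case: i => [[|[|[|[|?]]]] h] //; [constructor 1|constructor 2|constructor 3|constructor 4]; apply: val_inj.
Qed.

Section Main.
Variable R : realType.
Local Notation wsum := (@wsum R).
Local Notation wt := (@wt R).
Local Notation tx := (@tx R).
Local Notation ty := (@ty R).
Local Notation tz := (@tz R).
Variables (p q : int) (k : nat).
Hypotheses (q1 : 1 <= q) (k0 : (0 < k)%N).
Local Notation Q := (q%:~R : R).
Local Notation K := (k%:R : R).

Let Q0 : 0 < Q. Proof. by rewrite ltr0z (lt_le_trans ltr01 q1). Qed.
Let K0 : 0 < K. Proof. by rewrite ltr0n. Qed.
Let KZ : (k%:Z)%:~R = K. Proof. by []. Qed.

Definition inside (x y z : R) := [/\ 0 <= z /\ z <= K, 0 <= x /\ x <= (K - z) * Q & 0 <= y /\ y <= z * Q].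

Lemma kDeltaE i j : toR R (kDelta' p q k i) 0 j = K * (Delta' p q i 0 j)%:~R.
Proof. by rewrite /toR mxE /kDelta' mxE rmorphM. Qed.

Lemma kDelta_coord (c : 'I_4 -> R) :
  [/\ (\sum_i c i *: toR R (kDelta' p q k i)) 0 o0 = c i1 * (K * Q),
      (\sum_i c i *: toR R (kDelta' p q k i)) 0 o1 = c i3 * (K * Q) &
      (\sum_i c i *: toR R (kDelta' p q k i)) 0 o2 = (c i2 + c i3) * K].
Proof.
by rewrite !sum_row !sum4 !kDeltaE /Delta' /= !mxE /=; split; ring.
Qed.

Lemma poly_kDelta x : polytope R (kDelta' p q k) x <-> inside (x 0 o0) (x 0 o1) (x 0 o2).
Proof.
rewrite /polytope faceE; split=> [[c [c0 _ cs ->]]|[[z0 zK] [x0 xK] [y0 yK]]].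
  have [-> -> ->] := kDelta_coord c; move: cs; rewrite sum4 => cs.
  have g (i : 'I_4) (r : R) : 0 <= r -> 0 <= c i * r by move=> h; apply: mulr_ge0.
  have K0' := ltW K0; have KQ : 0 <= K * Q by apply: mulr_ge0 => //; apply: ltW.
  split; split.
  - by apply: mulr_ge0 => //; apply: addr_ge0.
  - rewrite -subr_ge0 (_ : _ - _ = (c i0 + c i1) * K); first by apply: mulr_ge0 => //; apply: addr_ge0.
    by transitivity ((c i0 + c i1 + c i2 + c i3) * K - (c i2 + c i3) * K); [rewrite cs mul1r|ring].
  - exact: g.
  - rewrite -subr_ge0 (_ : _ - _ = c i0 * (K * Q)); first exact: g.
    transitivity (((c i0 + c i1 + c i2 + c i3) * K - (c i2 + c i3) * K) * Q - c i1 * (K * Q)); [by rewrite cs mul1r|ring].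
  - exact: g.
  - by rewrite -subr_ge0 (_ : _ - _ = c i2 * (K * Q)); [exact: g|ring].
have KQ : 0 < K * Q by apply: mulr_gt0.
pose c3 := x 0 o1 / (K * Q); pose c1 := x 0 o0 / (K * Q); pose c2 := x 0 o2 / K - c3.
have e3 : c3 * (K * Q) = x 0 o1 by rewrite mulfVK // lt0r_neq0.
have e1 : c1 * (K * Q) = x 0 o0 by rewrite mulfVK // lt0r_neq0.
have e2 : (c2 + c3) * K = x 0 o2 by rewrite subrK mulfVK // lt0r_neq0.
have h3 : 0 <= c3 by apply: divr_ge0 => //; apply: ltW.
have h1 : 0 <= c1 by apply: divr_ge0 => //; apply: ltW.
have h2 : 0 <= c2.
  by rewrite subr_ge0 -(ler_pM2r KQ) e3 mulrA mulfVK // lt0r_neq0.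
have h0 : 0 <= 1 - c1 - c2 - c3.
  have E : (1 - c1 - c2 - c3) * (K * Q) = (K - (c2 + c3) * K) * Q - c1 * (K * Q) by ring.
  by rewrite -(pmulr_lge0 _ KQ) E e1 e2 subr_ge0.
exists (fun i => [:: 1 - c1 - c2 - c3; c1; c2; c3]`_i); split.
- by move=> i; case: (ord4 i) => ->.
- by move=> i; rewrite inE.
- by rewrite sum4 /=; ring.
have [a1 a2 a3] := kDelta_coord (fun i => [:: 1 - c1 - c2 - c3; c1; c2; c3]`_i).
by apply: row3P; rewrite ?a1 ?a2 ?a3 /= ?e1 ?e2 ?e3.
Qed.

Lemma not_interior x : polytope R (kDelta' p q k) x -> ~ interior3 R (polytope R (kDelta' p q k)) x ->
  [\/ x 0 o0 = 0, x 0 o1 = 0, x 0 o0 = (K - x 0 o2) * Q | x 0 o1 = x 0 o2 * Q].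
Proof.
move=> /poly_kDelta[[z0 zK] [x0 xK] [y0 yK]] nint; apply: contrapT => H; apply: nint.
have lt a b : a <= b -> a <> b -> a < b :> R by move=> h n; rewrite lt_neqAle h andbT; apply/eqP.
have {}x0 : 0 < x 0 o0 by apply: lt => // e; apply: H; constructor 1.
have {}y0 : 0 < x 0 o1 by apply: lt => // e; apply: H; constructor 2.
have {}xK : x 0 o0 < (K - x 0 o2) * Q by apply: lt => // e; apply: H; constructor 3.
have {}yK : x 0 o1 < x 0 o2 * Q by apply: lt => // e; apply: H; constructor 4.
have Q1 : 0 < Q + 1 by apply: addr_gt0.
pose e := Num.min (Num.min (x 0 o0) (x 0 o1))
   (Num.min (((K - x 0 o2) * Q - x 0 o0) / (Q + 1)) ((x 0 o2 * Q - x 0 o1) / (Q + 1))).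
have : e <= e by [].
rewrite {2}/e !le_min => /andP[/andP[ex ey] /andP[]]; rewrite !ler_pdivlMr // => es et.
exists e.
  by rewrite /e !lt_min x0 y0 !divr_gt0 // subr_gt0.
move=> y hy; apply/poly_kDelta.
have sl j : x 0 j - e < y 0 j /\ y 0 j < x 0 j + e.
  by have := hy j; rewrite ltr_norml => /andP[]; clear; move=> h1 h2; split; lra.
have [a1 a2] := sl o0; have [b1 b2] := sl o1; have [c1 c2] := sl o2.
have y00 : 0 <= y 0 o0 by apply: ltW; apply: le_lt_trans a1; rewrite subr_ge0.
have y10 : 0 <= y 0 o1 by apply: ltW; apply: le_lt_trans b1; rewrite subr_ge0.
have d1 : (y 0 o2 - x 0 o2) * Q <= e * Q by rewrite ler_pM2r // lerBlDl ltW.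
have d2 : (x 0 o2 - y 0 o2) * Q <= e * Q by rewrite ler_pM2r // lerBlDr -lerBlDl ltW.
have hx : y 0 o0 <= (K - y 0 o2) * Q.
  by move: es a2 d1; clear -p q1 k0; move=> es a2 d1; lra.
have hz : y 0 o1 <= y 0 o2 * Q.
  by move: et b2 d2; clear -p q1 k0; move=> es a2 d1; lra.
split; split=> //.
- by rewrite -(pmulr_lge0 _ Q0); apply: le_trans hz.
- by rewrite -subr_ge0 -(pmulr_lge0 _ Q0); apply: le_trans hx.
Qed.

Variable P : seq pt3 -> Prop.
Hypothesis HF : full R q (Lam p q) k%:Z P.

Let Lq := Lam p q.

Lemma full_lin T l (f : pt3 -> R) : wt T l -> (forall v, v \in T -> 0 <= f v) -> 0 <= wsum T l f.
Proof. exact: wsum_ge0'. Qed.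

Lemma full_inside T l : P T -> wt T l -> inside (wsum T l tx) (wsum T l ty) (wsum T l tz).
Proof.
move=> PT wl; have [_ _ e] := wl.
have lin (a b c d : R) : (forall v, v \in T -> 0 <= a + b * tx v + c * ty v + d * tz v) ->
   0 <= a + b * wsum T l tx + c * wsum T l ty + d * wsum T l tz.
  move=> h; rewrite (_ : _ + _ = wsum T l (fun v => a + b * tx v + c * ty v + d * tz v)); first exact: full_lin.
  rewrite !wsumD wsum_const e mulr1.
  by congr (_ + _ + _ + _); rewrite /wsum mulr_sumr; apply: eq_bigr => i _; ring.
have V v : v \in T -> [/\ 0 <= tz v /\ tz v <= K, 0 <= tx v /\ tx v <= (K - tz v) * Q & 0 <= ty v /\ ty v <= tz v * Q].
  move=> vT; have [_ [h1 h2] [h3 h4] [h5 h6]] := fl_in HF PT vT.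
  rewrite /tx /ty /tz !ler0z -KZ -rmorphB -!rmorphM !ler_int; by split.
have L1 : 0 <= wsum T l tz.
  by have := lin 0 0 0 1; rewrite !mul0r !add0r !mul1r; apply=> v /V[[h _] _ _]; rewrite !mul0r !add0r mul1r.
have L2 : 0 <= K + 0 * wsum T l tx + 0 * wsum T l ty + (-1) * wsum T l tz.
  by apply: lin => v /V[[_ h] _ _]; rewrite !mul0r !addr0 mulN1r subr_ge0.
have L3 : 0 <= wsum T l tx.
  by have := lin 0 1 0 0; rewrite !mul0r !add0r !addr0 !mul1r; apply=> v /V[_ [h _] _]; rewrite !mul0r !addr0 mul1r add0r.
have L4 : 0 <= K * Q + (-1) * wsum T l tx + 0 * wsum T l ty + (- Q) * wsum T l tz.
  apply: lin => v /V[_ [_ h] _]; rewrite -subr_ge0 in h.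
  by rewrite (_ : _ + _ = (K - tz v) * Q - tx v) //; ring.
have L5 : 0 <= wsum T l ty.
  by have := lin 0 0 1 0; rewrite !mul0r !add0r !addr0 !mul1r; apply=> v /V[_ _ [h _]]; rewrite !mul0r !addr0 mul1r !add0r.
have L6 : 0 <= 0 + 0 * wsum T l tx + (-1) * wsum T l ty + Q * wsum T l tz.
  apply: lin => v /V[_ _ [_ h]]; rewrite -subr_ge0 in h.
  by rewrite (_ : _ + _ = tz v * Q - ty v) //; ring.
split; split=> //; rewrite -subr_ge0.
- by move: L2; rewrite !mul0r !addr0 mulN1r.
- by rewrite (_ : _ - _ = K * Q + (-1) * wsum T l tx + 0 * wsum T l ty + (- Q) * wsum T l tz) //; ring.
by rewrite (_ : _ - _ = 0 + 0 * wsum T l tx + (-1) * wsum T l ty + Q * wsum T l tz) //; ring.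
Qed.

End Main.

Section Final.
Variable R : realType.
Local Notation wsum := (@wsum R).
Local Notation wt := (@wt R).
Local Notation tx := (@tx R).
Local Notation ty := (@ty R).
Local Notation tz := (@tz R).
Variables (p q : int) (k : nat).
Hypotheses (q1 : 1 <= q) (k0 : (0 < k)%N).
Local Notation Q := (q%:~R : R).
Local Notation K := (k%:R : R).
Variable P : seq pt3 -> Prop.
Hypothesis HF : full R q (Lam p q) k%:Z P.

Local Notation cell := ('I_(k * `|q|).+1 * 'I_(k * `|q|).+1 * 'I_(k * `|q|).+1)%type.
Let io (g : cell) : pt3 := (g.1.1%:Z, g.1.2%:Z, g.2%:Z).
Let oi (v : pt3) : cell := (inord `|v.1.1|, inord `|v.1.2|, inord `|v.2|).

Let oiK T v : P T -> v \in T -> io (oi v) = v.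
Proof.
move=> PT vT; have [_ [z0 zk] [x0 xk] [y0 yk]] := fl_in HF PT vT.
have a : v.2 <= k%:Z * q by rewrite -[v.2]mulr1; apply: ler_pM.
have b : v.2 * q <= k%:Z * q by apply: ler_wpM2r => //; apply: le_trans q1.
have c : (k%:Z - v.2) * q <= k%:Z * q.
  by apply: ler_wpM2r; [apply: le_trans q1|rewrite gerBl].
have e : (k * `|q|)%:Z = k%:Z * q by rewrite PoszM gez0_abs // (le_trans _ q1).
have F (x : int) : 0 <= x -> x <= k%:Z * q -> (inord `|x| : 'I_(k * `|q|).+1)%:Z = x.
  move=> h0 h1; rewrite inordK ?gez0_abs // ltnS -lez_nat gez0_abs //.
  by rewrite e.
case: v {vT} x0 y0 z0 xk yk zk a b c => [[x y] z] /= x0 y0 z0 xk yk zk a b c.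
by rewrite /io /oi /= !F //; [apply: le_trans yk b|apply: le_trans xk c].
Qed.

Definition cells : seq tetra :=
  [seq tet (map io t) | t : 4.-tuple cell <- enum {: 4.-tuple cell} & `[< P (map io t) >]].

Lemma cellsP T : T \in cells <-> exists T', P T' /\ T = tet T'.
Proof.
split=> [/mapP[t]|[T' [PT ->]]].
  by rewrite mem_filter => /andP[/asboolP Pt _] ->; exists (map io t).
have s4 : size (map oi T') == 4 by rewrite size_map (fl_size HF PT).
have E : map io (Tuple s4) = T'.
  by rewrite -map_comp -[RHS]map_id; apply/eq_in_map => v vT; apply: oiK vT.
apply/mapP; exists (Tuple s4); last by rewrite E.
by rewrite mem_filter mem_enum andbT E; apply/asboolP.
Qed.

Lemma inter_face S T x : P S -> P T ->
  (polytope R (tet S) x /\ polytope R (tet T) x) <->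
  face R (tet S) [set i : 'I_4 | nth (0, 0, 0) S i \in T] x.
Proof.
move=> PS PT; have sS := fl_size HF PS; have sT := fl_size HF PT.
rewrite !poly_tet // face_tet //; split=> [[[l [wl [x1 y1 z1]]] [m [wm [x2 y2 z2]]]]|[l [wl lz [x1 y1 z1]]]].
  have H : forall g, wsum S l g = wsum T m g.
    by apply: (fl_FF HF) => //; rewrite ?x2 ?y2 ?z2.
  exists l; split=> // i; rewrite inE => ni; have [sl l0 _] := wl.
  have := H (fun v => (v == nth (0, 0, 0) S i)%:R).
  have sm : size m = size T by case: wm.
  rewrite (wsum_ord (0, 0, 0) _ sm sT) [RHS]big1 => [|j _]; last first.
    case: eqP => [e|_]; last by rewrite mulr0.
    by rewrite -e mem_nth ?sT // in ni.
  rewrite (wsum_ord (0, 0, 0) _ sl sS) => /psumr_eq0P/(_ i isT); rewrite eqxx mulr1; apply=> j _.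
  by apply: mulr_ge0; [apply: l0; rewrite mem_nth // sl sS|case: eqP].
have [sl l0 ls] := wl.
split; first by exists l.
have [|m [sm m0 Hm]] := @wsum_transport R _ S T l sl l0.
  move=> i iS li v0; rewrite sS in iS.
  have := lz (Ordinal iS); rewrite inE /= => h.
  rewrite (set_nth_default (0, 0, 0)) ?sS //; apply/negPn/negP => /h e.
  by rewrite e eqxx in li.
by exists m; split; [split=> //; rewrite -Hm|rewrite -!Hm].
Qed.

Lemma tet_aff T : P T -> aff_indep (tet T).
Proof.
move=> PT c c0 cv i; have [ui _] := fl_uni HF PT; have sT := fl_size HF PT.
have sc : size (mkseq (fun j => c (inord j)) 4) = size T by rewrite size_mkseq sT.
have E g : zsum T (mkseq (fun j => c (inord j)) 4) g = \sum_i c i * g (nth (0, 0, 0) T i).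
  by rewrite (zsum_ord (0, 0, 0)) //; apply: eq_bigr => j _; rewrite mkseq_ord.
have Z o : \sum_i c i * tet T i 0 o = 0 by rewrite -sum_row cv mxE.
rewrite -(mkseq_ord c i); apply: (ui _ sc); last by rewrite mem_nth // sc sT.
- by rewrite E -[RHS]c0; apply: eq_bigr => j _; rewrite mulr1.
- by rewrite E -[RHS](Z o0); apply: eq_bigr => j _; rewrite ffunE mk30.
- by rewrite E -[RHS](Z o1); apply: eq_bigr => j _; rewrite ffunE mk31.
- by rewrite E -[RHS](Z o2); apply: eq_bigr => j _; rewrite ffunE mk32.
Qed.

Lemma tet_in T i : P T -> in_Lambda p q (tet T i).
Proof.
move=> PT; rewrite ffunE; apply/in_LambdaE.
by have [] := fl_in HF PT (mem_nth (0, 0, 0) (_ : (i < size T)%N)); rewrite // (fl_size HF PT).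
Qed.

Lemma cells_unimodular T : T \in cells -> unimodular (in_Lambda p q) T.
Proof.
move=> /cellsP[T' [PT ->]]; split; [by move=> i; apply: tet_in|split; first exact: tet_aff].
move=> w [x [y [z [t ->]]]]; have [_ ug] := fl_uni HF PT; have sT := fl_size HF PT.
have [|c [sc c1 cx cy cz]] := ug (q * x + t * pprime p q) (q * y + t) z; first by exists x, y, t.
exists (fun i : 'I_4 => c`_i); split.
  by rewrite -c1 (zsum_ord (0, 0, 0)) //; apply: eq_bigr => i _; rewrite mulr1.
apply: row3P; rewrite sum_row !mxE /=; [rewrite -cx|rewrite -cy|rewrite -cz];
  rewrite (zsum_ord (0, 0, 0)) //; apply: eq_bigr => i _; rewrite ffunE ?mk30 ?mk31 ?mk32 //.
Qed.

Lemma cells_triangulation : triangulation R (in_Lambda p q) (kDelta' p q k) cells.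
Proof.
split; [|split].
- by move=> T /cellsP[T' [PT ->]]; split; [move=> i; apply: tet_in|apply: tet_aff].
- move=> x; rewrite (poly_kDelta p q1 k0); split=> [[[z0 zK] [x0 xK] [y0 yK]]|[T /cellsP[T' [PT ->]]]].
    have [T [l [PT wl ex ey ez]]] := fl_cov HF z0 zK x0 xK y0 yK.
    exists (tet T); first by apply/cellsP; exists T.
    by apply/poly_tet; [exact: fl_size HF _ PT|exists l].
  rewrite poly_tet; last exact: (fl_size HF).
  move=> [l [wl [<- <- <-]]]; exact: full_inside HF _ _ PT wl.
- move=> T1 T2 /cellsP[S [PS ->]] /cellsP[T [PT ->]].
  exists [set i : 'I_4 | nth (0, 0, 0) S i \in T], [set i : 'I_4 | nth (0, 0, 0) T i \in S].
  split=> x; first exact: inter_face.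
  by rewrite -(inter_face _ PT PS); split=> -[].
Qed.

Lemma cells_standard : standard_boundary R (Delta' p q) (kDelta' p q k) cells.
Proof.
move=> T /cellsP[T' [PT ->]] i j nij H; have sT := fl_size HF PT.
have iT : nth (0, 0, 0) T' i \in T' by rewrite mem_nth // sT.
have jT : nth (0, 0, 0) T' j \in T' by rewrite mem_nth // sT.
set v := nth (0, 0, 0) T' i in iT; set w := nth (0, 0, 0) T' j in jT.
have [_ [vz0 vzk] [vx0 vxk] [vy0 vyk]] := fl_in HF PT iT.
have [_ [wz0 wzk] [wx0 wxk] [wy0 wyk]] := fl_in HF PT jT.
have half : conv R [:: toR R (tet T' i); toR R (tet T' j)] (2^-1 *: (toR R (tet T' i) + toR R (tet T' j))).
  exists (fun=> 2^-1); split; first by move=> _; rewrite invr_ge0.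
  by rewrite !big_ord_recl !big_ord0 !addr0 /= scalerDr; split=> //; lra.
have [M1 M2] := H _ half; have := not_interior q1 k0 M1 M2.
have e0 : (2^-1 *: (toR R (tet T' i) + toR R (tet T' j))) 0 o0 = 2^-1 * (v.1.1%:~R + w.1.1%:~R).
  by rewrite !mxE !ffunE !mk30.
have e1 : (2^-1 *: (toR R (tet T' i) + toR R (tet T' j))) 0 o1 = 2^-1 * (v.1.2%:~R + w.1.2%:~R).
  by rewrite !mxE !ffunE !mk31.
have e2 : (2^-1 *: (toR R (tet T' i) + toR R (tet T' j))) 0 o2 = 2^-1 * (v.2%:~R + w.2%:~R).
  by rewrite !mxE !ffunE !mk32.
rewrite e0 e1 e2 => facet.
have Z (a b : int) : 0 <= a -> 0 <= b -> (a + b)%:~R = 0 :> R -> a = 0 /\ b = 0.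
  by move=> a0 b0 /eqP; rewrite intr_eq0 paddr_eq0 // => /andP[/eqP-> /eqP->].
have std : stdir q v w.
  apply: (fl_std HF PT iT jT); case: facet => h.
  - by constructor 1; apply: Z => //; rewrite rmorphD /=; lra.
  - by constructor 2; apply: Z => //; rewrite rmorphD /=; lra.
  - constructor 3; have [|||a b] := Z ((k%:Z - v.2) * q - v.1.1) ((k%:Z - w.2) * q - w.1.1).
    + by rewrite subr_ge0.
    + by rewrite subr_ge0.
    + rewrite rmorphD !rmorphB !rmorphM !rmorphB /= -[k%:~R]/K; move: h; clear -HF q1 k0; lra.
    + by split; apply/esym/eqP; rewrite -subr_eq0 ?a ?b.
  - constructor 4; have [|||a b] := Z (v.2 * q - v.1.2) (w.2 * q - w.1.2).
    + by rewrite subr_ge0.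
    + by rewrite subr_ge0.
    + rewrite rmorphD !rmorphB !rmorphM /=; move: h; clear -HF q1 k0; lra.
    + by split; apply/esym/eqP; rewrite -subr_eq0 ?a ?b.
have [e [s [eE d0 d1 d2]]] := std.
have G (a b : 'I_4) : a != b -> Delta' p q b - Delta' p q a = mk3 e ->
  exists a b : 'I_4, a != b /\ exists lam : R,
    toR R (tet T' j) - toR R (tet T' i) = lam *: (toR R (Delta' p q b) - toR R (Delta' p q a)).
  move=> ab E; exists a, b; split=> //; exists s%:~R.
  have -> : toR R (Delta' p q b) - toR R (Delta' p q a) = toR R (mk3 e).
    by rewrite -E /toR map_mxB.
  have F (o : 'I_3) : mk3 w 0 o - mk3 v 0 o = s * mk3 e 0 o ->
     (toR R (tet T' j) - toR R (tet T' i)) 0 o = (s%:~R *: toR R (mk3 e)) 0 o.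
    by move=> h; rewrite !mxE !ffunE -rmorphM /= -rmorphB /=; congr (_%:~R); move: h; rewrite !mxE.
  by apply: row3P; apply: F; rewrite ?mk30 ?mk31 ?mk32.
move: eE; rewrite !inE => /or4P[|||/or3P[]] /eqP ee; rewrite ee in G.
- by apply: (G i0 i1) => //; apply: row3P; rewrite !mxE /= ?subr0.
- by apply: (G i2 i3) => //; apply: row3P; rewrite !mxE /= ?subr0 ?subrr.
- by apply: (G i0 i2) => //; apply: row3P; rewrite !mxE /= ?subr0 ?subrr.
- by apply: (G i0 i3) => //; apply: row3P; rewrite !mxE /= ?subr0 ?subrr.
- by apply: (G i1 i2) => //; apply: row3P; rewrite !mxE /= ?subr0 ?sub0r ?subrr.
- by apply: (G i1 i3) => //; apply: row3P; rewrite !mxE /= ?subr0 ?sub0r ?subrr.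
Qed.

End Final.

Theorem theorem5p1 (R : realType) (p q : int) (k : nat) :
  1 <= q -> coprimez p q -> (0 < k)%N -> k \notin [:: 1; 2; 3; 5; 7; 11]%N ->
  exists ts : seq tetra,
    triangulation R (in_Lambda p q) (kDelta' p q k) ts /\
    (forall T, T \in ts -> unimodular (in_Lambda p q) T) /\
    standard_boundary R (Delta' p q) (kDelta' p q k) ts.
Proof.
move=> q1 cpq k0 kn.
have k4 : 4 <= k%:Z by case: k k0 kn => [|[|[|[|k]]]].
have [P HP] := full_exists R (Lam_lattice q1 cpq) k4.
exists (cells q k P); split; first exact: (cells_triangulation q1 k0 HP).
by split; [exact: (cells_unimodular q1 HP)|exact: (cells_standard q1 k0 HP)].
Qed.
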